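(* Let $m>2$, $n=2m$. The space $$\mathfrak A=\{A_{abc}\in\otimes^3\mathfrak V:A_{abc}=A_{a[bc]},\ A_{[abc]}=0,\ A^a{}_{ac}=0\}$$ of tensors with Cotton-York symmetries admits a filtration $$\{0\}=:\mathfrak A^{\frac52}\subset\mathfrak A^{\frac32}\subset\mathfrak A^{\frac12}\subset\mathfrak A^{-\frac12}\subset\mathfrak A^{-\frac32}=\mathfrak A$$ of $\mathfrak p$-modules $\mathfrak A^i=\{A_{abc}\in\mathfrak A:{}^{\mathfrak A}_\xi\Pi^k_{i-1}(A)=0\text{ for all }k\}$, $i=-\frac12,\frac12,\frac32$, where $${}^{\mathfrak A}_\xi\Pi^0_{-\frac32}(A):=\xi^{aA}\xi^{bB}\xi^{cC}A_{abc},\qquad {}^{\mathfrak A}_\xi\Pi^0_{-\frac12}(A):=\xi^{aA}A_{abc}\xi^{bcC'},$$ $${}^{\mathfrak A}_\xi\Pi^1_{-\frac12}(A):=\xi^{bB}\xi^{cC}A_{abc}+\tfrac1{n-2}\gamma_{aD'}{}^{[B}\xi^{dC]}\xi^{bcD'}A_{dbc},$$ $${}^{\mathfrak A}_\xi\Pi^2_{-\frac12}(A):=\xi^{a(A}\xi^{bB)}A_{abc}+\tfrac3{2(n+2)}\gamma_{cD'}{}^{(A}\xi^{dB)}\xi^{baD'}A_{dba},$$ $${}^{\mathfrak A}_\xi\Pi^0_{\frac12}(A):=A_{abc}\xi^{bcA'},\qquad {}^{\mathfrak A}_\xi\Pi^1_{\frac12}(A):=\xi^{cA}A_{cab}-\tfrac1{n-2}\gamma_{[a|D'}{}^{A}A_{|b]cd}\xi^{cdD'},$$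 $${}^{\mathfrak A}_\xi\Pi^2_{\frac12}(A):=A_{(ab)c}\xi^{cA}-\tfrac3{2(n+2)}\gamma_{(a|D'}{}^{A}A_{|b)cd}\xi^{cdD'}.$$ The associated graded $\mathfrak p$-module $\mathrm{gr}(\mathfrak A)=\bigoplus_{i=-\frac32}^{\frac32}\mathrm{gr}_i(\mathfrak A)$, $\mathrm{gr}_i(\mathfrak A):=\mathfrak A^i/\mathfrak A^{i+1}$, splits into a direct sum $$\mathrm{gr}_{\pm\frac32}(\mathfrak A)\cong\mathfrak A^0_{\pm\frac32},\qquad \mathrm{gr}_{\pm\frac12}(\mathfrak A)\cong\mathfrak A^0_{\pm\frac12}\oplus\mathfrak A^1_{\pm\frac12}\oplus\mathfrak A^2_{\pm\frac12}$$ of irreducible $\mathfrak p$-modules isomorphic to the following $\mathfrak g_0$-modules, of the stated dimensions: - $\mathfrak A^0_{\pm\frac32}\cong\mathfrak V_{\pm\frac12}\circledcirc\mathfrak g_{\pm1}$, dimension $\frac13m(m^2-1)$; - $\mathfrak A^0_{\pm\frac12}\cong\mathfrak V_{\pm\frac12}\circledcirc\mathfrak z_0$, dimension $m$; - $\mathfrak A^1_{\pm\frac12}\cong\mathfrak V_{\mp\frac12}\circledcirc\mathfrak g_{\pm1}$, dimension $\frac12m(m-2)(m+1)$; - $\mathfrak A^2_{\pm\frac12}\cong\mathfrak V_{\pm\frac12}\circledcirc\mathfrak{sl}_0$, dimension $\frac12m(m+2)(m-1)$. Further, for $|i|=\frac12$, $$\mathfrak A_i^j=\{A_{abc}\in\mathfrak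 A^i:{}^{\mathfrak A}_\xi\Pi_i^k(A)=0\text{ for all }k\neq j\}/\mathfrak A^{i+1}.$$ Finally, the $\mathfrak p$-module $\mathrm{gr}(\mathfrak A)$ can be expressed by means of the directed graph with arrows $$\mathfrak A^0_{\frac32}\to\mathfrak A^0_{\frac12},\ \mathfrak A^1_{\frac12},\ \mathfrak A^2_{\frac12};\qquad \mathfrak A^2_{\frac12}\to\mathfrak A^2_{-\frac12},\ \mathfrak A^1_{-\frac12};\qquad \mathfrak A^1_{\frac12}\to\mathfrak A^2_{-\frac12},\ \mathfrak A^0_{-\frac12};$$ $$\mathfrak A^0_{\frac12}\to\mathfrak A^0_{-\frac12},\ \mathfrak A^1_{-\frac12};\qquad \mathfrak A^0_{-\frac12},\ \mathfrak A^1_{-\frac12},\ \mathfrak A^2_{-\frac12}\to\mathfrak A^0_{-\frac32},$$ where an arrow from $\mathfrak A_i^j$ to $\mathfrak A_{i-1}^k$ implies that $\breve{\mathfrak A}_i^j\subset\mathfrak g_1\cdot\breve{\mathfrak A}_{i-1}^k$ for any choice of irreducible $\mathfrak g_0$-modules $\breve{\mathfrak A}_i^j$, $\breve{\mathfrak A}_{i-1}^k$ isomorphic to $\mathfrak A_i^j$, $\mathfrak A_{i-1}^k$ respectively, or equivalently (when both maps involved are among the seven maps ${}^{\mathfrak A}_\xi\Pi^0_{-\frac32}$, ${}^{\mathfrak A}_\xi\Pi^0_{-\frac12}$, ${}^{\mathfrak A}_\xi\Pi^1_{-\frac12}$, ${}^{\mathfrak A}_\xi\Pi^2_{-\frac12}$,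 ${}^{\mathfrak A}_\xi\Pi^0_{\frac12}$, ${}^{\mathfrak A}_\xi\Pi^1_{\frac12}$, ${}^{\mathfrak A}_\xi\Pi^2_{\frac12}$) that $\ker{}^{\mathfrak A}_\xi\Pi_i^j\subset\ker{}^{\mathfrak A}_\xi\Pi_{i-1}^k$.
   Context: Let $\mathfrak V$ be a $2m$-dimensional oriented complex vector space ($m>2$) with non-degenerate symmetric bilinear form $g_{ab}$, used to raise and lower indices (and to identify $\mathfrak V\cong\mathfrak V^*$). Round/square brackets denote normalised (skew-)symmetrisation; vertical bars enclose indices excluded from it. $\mathfrak S^\pm$ are the chiral spinor spaces; elements of $\mathfrak S^+$ have primed upper indices, elements of $\mathfrak S^-$ unprimed upper indices. Clifford multiplication is given by $\gamma_{aA'}{}^B$, $\gamma_{aA}{}^{B'}$ with $\gamma_{(a|A'}{}^{C}\gamma_{|b)C}{}^{B'}=-g_{ab}\delta_{A'}^{B'}$, $\gamma_{(a|A}{}^{C'}\gamma_{|b)C'}{}^{B}=-g_{ab}\delta_A^B$; set $\gamma_{abA'}{}^{B'}:=\gamma_{[a|A'}{}^{C}\gamma_{|b]C}{}^{B'}$. Fix a pure spinor $\xi^{A'}\in\mathfrak S^+$, i.e. a non-zero spinor for which the kernel of $\xi_a{}^A:=\xi^{B'}\gamma_{aB'}{}^A:\mathfrak V\to\mathfrak S^-$ has dimension $m$ (it is then totally null), and put $\xi_{ab}{}^{A'}:=\xi^{B'}\gamma_{abB'}{}^{A'}$. Identify $\mathfrak g:=\mathfrak{so}(2m,\mathbb C)$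 with $\wedge^2\mathfrak V^*$. $\mathfrak p:=\{\phi_{ab}\in\mathfrak g:\xi^{aA}\xi^{bB}\phi_{ab}=0\}$ is the stabiliser of the line spanned by $\xi^{A'}$. Put $\mathfrak V_{\frac12}:=\ker(\xi_a{}^A:\mathfrak V\to\mathfrak S^-)$ and choose a totally null complement $\mathfrak V_{-\frac12}$ of it in $\mathfrak V$; this induces a grading $\mathfrak g=\mathfrak g_{-1}\oplus\mathfrak g_0\oplus\mathfrak g_1$ with $\mathfrak g_{\pm1}\cong\wedge^2\mathfrak V_{\pm\frac12}$, $\mathfrak g_0\cong\mathfrak V_{-\frac12}\otimes\mathfrak V_{\frac12}\cong\mathfrak{gl}(m,\mathbb C)$, $\mathfrak p=\mathfrak g_0\oplus\mathfrak g_1$, $\mathfrak g_1$ nilpotent; $\mathfrak g_0=\mathfrak z_0\oplus\mathfrak{sl}_0$ with $\mathfrak z_0$ the one-dimensional centre and $\mathfrak{sl}_0\cong\mathfrak{sl}(m,\mathbb C)$. ''Isomorphic to the $\mathfrak g_0$-module'' means isomorphic as a $\mathfrak g_0$-module. The splitting of $\mathfrak V$ induces a splitting of $\mathfrak A$ into graded $\mathfrak g_0$-submodules, in which the $\breve{\mathfrak A}_i^j$ live; $\mathfrak g_1\cdot$ denotes the algebraic action (linear span). $\mathfrak M\circledcirc\mathfrak M'$ denotes the Cartan product, the unique irreducible component of highest dimension in $\mathfrak M\otimes\mathfrak M'$. *)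

(* Defs.v *)
From mathcomp Require Import all_boot all_order all_algebra.
From mathcomp Require Import boolp classical_sets reals complex.

Set Implicit Arguments.
Unset Strict Implicit.
Unset Printing Implicit Defensive.

Import Order.TTheory GRing.Theory Num.Theory.
Local Open Scope ring_scope.

Section LinearSpan.
Variables (F : fieldType) (T : vectType F).

(* Smallest subspace containing every x with P x.  It is also used as set-builder
   notation for subspaces: if P is closed under linear combinations, then
   x \in lspan P is equivalent to P x, see mem_lspan. *)
Definition lspan (P : T -> Prop) : {vspace T} :=
  xget 0%VS [set U : {vspace T} | (forall x, P x -> x \in U) /\
    (forall W : {vspace T}, (forall x, P x -> x \in W) -> (U <= W)%VS)]%classic.

Lemma lspanP (P : T -> Prop) : (forall x, P x -> x \in lspan P) /\
  (forall W : {vspace T}, (forall x, P x -> x \in W) -> (lspan P <= W)%VS).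
Proof.
suff [U HU] : exists U : {vspace T}, (forall x, P x -> x \in U) /\
    (forall W : {vspace T}, (forall x, P x -> x \in W) -> (U <= W)%VS).
  by rewrite /lspan; case: xgetP => [V _ //|/(_ U)]; case.
pose good d := `[< exists2 U : {vspace T},
  (forall x, P x -> x \in U) & \dim U = d >].
have ex : exists d, good d.
  by exists (\dim (fullv : {vspace T})); apply/asboolP; exists fullv => // x _;
    rewrite memvf.
case: (ex_minnP ex) => d /asboolP[U PU dU] dmin; exists U; split=> // W PW.
have : good (\dim (U :&: W)%VS).
  by apply/asboolP; exists (U :&: W)%VS => // x Px; rewrite memv_cap PU ?PW.
move=> /dmin; rewrite -dU => le; apply/capv_idPl/eqP.
by rewrite eqEdim capvSl.
Qed.

Lemma mem_lspan (P : T -> Prop) : P 0 ->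
  (forall (a : F) x y, P x -> P y -> P (a *: x + y)) ->
  forall x, x \in lspan P <-> P x.
Proof.
move=> P0 PD x; split; last exact: (lspanP P).1.
pose good d := `[< exists2 U : {vspace T},
  (forall y, y \in U -> P y) & \dim U = d >].
have ex : exists d, good d.
  exists 0%N; apply/asboolP; exists 0%VS; rewrite ?dimv0 // => y.
  by rewrite memv0 => /eqP ->.
have ub d : good d -> (d <= \dim (fullv : {vspace T}))%N.
  by move=> /asboolP[U _ <-]; rewrite dimvS ?subvf.
case: (ex_maxnP ex ub) => d /asboolP[U UP dU] dmax xP; apply: (UP).
move: xP; apply/subvP; apply: (lspanP P).2 => y Py.
have : good (\dim (<[y]> + U)%VS).
  apply/asboolP; exists (<[y]> + U)%VS => // z /memv_addP[_ /vlineP[a ->]].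
  by case=> w wU ->; apply: PD => //; exact: UP.
move=> /dmax; rewrite -dU => le.
have /eqP -> : U == (<[y]> + U)%VS by rewrite eqEdim addvSr.
by apply: (subvP (addvSl _ _)); exact: memv_line.
Qed.

End LinearSpan.

Section CottonYork.
Variables (F : fieldType) (n sp sm : nat).

(* V = F^n, vectors v^a being row vectors, g_ab an arbitrary Gram matrix;
   chiral spinors are row vectors of length sp (primed upper indices, S^+) and
   sm (unprimed upper indices, S^-), so that x^{A'} gamma_{aA'}^B is
   x *m gam a. *)
Variable g : 'M[F]_n.
Variables (gam : 'I_n -> 'M[F]_(sp, sm)) (gam' : 'I_n -> 'M[F]_(sm, sp)).
Variable xi : 'rV[F]_sp.

Definition ginv : 'M[F]_n := invmx g.

Definition form (u v : 'rV[F]_n) : F := (u *m g *m v^T) 0 0.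

Definition nondegenerate_symmetric : Prop := g^T = g /\ g \in unitmx.

Definition clifford_relations : Prop := forall a b : 'I_n,
  2^-1 *: (gam a *m gam' b + gam b *m gam' a) = - (g a b *: 1%:M) /\
  2^-1 *: (gam' a *m gam b + gam' b *m gam a) = - (g a b *: 1%:M).

(* gamma_{abA'}^{B'} *)
Definition gam2 (a b : 'I_n) : 'M[F]_sp :=
  2^-1 *: (gam a *m gam' b - gam b *m gam' a).

(* Suffixes l and u: vector indices down and up. *)
Definition xi1l (a : 'I_n) (A : 'I_sm) : F := (xi *m gam a) 0 A.
Definition xi1u (a : 'I_n) (A : 'I_sm) : F := \sum_b ginv a b * xi1l b A.
Definition xi2l (a b : 'I_n) (A : 'I_sp) : F := (xi *m gam2 a b) 0 A.
Definition xi2u (a b : 'I_n) (A : 'I_sp) : F :=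
  \sum_c \sum_d ginv a c * ginv b d * xi2l c d A.

Definition Vplus : {vspace 'rV[F]_n} :=
  lspan (fun v : 'rV[F]_n => forall A : 'I_sm, \sum_a v 0 a * xi1l a A = 0).

Definition pure_spinor (m : nat) : Prop := xi != 0 /\ \dim Vplus = m.

(* X a b c is the component X_abc. *)
Local Notation tensor3 := {ffun 'I_n -> 'M[F]_n}.

Definition CY : {vspace tensor3} := lspan (fun X : tensor3 =>
  [/\ forall a b c, X a b c = 2^-1 * (X a b c - X a c b),
      forall a b c, 6^-1 * (X a b c + X b c a + X c a b
                            - X b a c - X a c b - X c b a) = 0
    & forall c, \sum_a \sum_d ginv a d * X d a c = 0]).

Definition Pi_m32_0 (X : tensor3) (A B C : 'I_sm) : F :=
  \sum_a \sum_b \sum_c xi1u a A * xi1u b B * xi1u c C * X a b c.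

Definition Pi_m12_0 (X : tensor3) (A : 'I_sm) (C : 'I_sp) : F :=
  \sum_a \sum_b \sum_c xi1u a A * X a b c * xi2u b c C.

Definition Pi_m12_1 (X : tensor3) (a : 'I_n) (B C : 'I_sm) : F :=
  \sum_b \sum_c xi1u b B * xi1u c C * X a b c
  + (n%:R - 2)^-1 * \sum_d \sum_b \sum_c \sum_D
      2^-1 * (gam a D B * xi1u d C - gam a D C * xi1u d B)
      * xi2u b c D * X d b c.

Definition Pi_m12_2 (X : tensor3) (c : 'I_n) (A B : 'I_sm) : F :=
  \sum_a \sum_b 2^-1 * (xi1u a A * xi1u b B + xi1u a B * xi1u b A) * X a b c
  + 3 / (2 * (n%:R + 2)) * \sum_d \sum_b \sum_a \sum_D
      2^-1 * (gam c D A * xi1u d B + gam c D B * xi1u d A)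
      * xi2u b a D * X d b a.

Definition Pi_p12_0 (X : tensor3) (a : 'I_n) (A : 'I_sp) : F :=
  \sum_b \sum_c X a b c * xi2u b c A.

(* gamma_{aD'}^A X_{bcd} xi^{cdD'} *)
Definition gamXxi (X : tensor3) (a b : 'I_n) (A : 'I_sm) : F :=
  \sum_c \sum_d \sum_D gam a D A * X b c d * xi2u c d D.

Definition Pi_p12_1 (X : tensor3) (a b : 'I_n) (A : 'I_sm) : F :=
  \sum_c xi1u c A * X c a b
  - (n%:R - 2)^-1 * (2^-1 * (gamXxi X a b A - gamXxi X b a A)).

Definition Pi_p12_2 (X : tensor3) (a b : 'I_n) (A : 'I_sm) : F :=
  \sum_c 2^-1 * (X a b c + X b a c) * xi1u c A
  - 3 / (2 * (n%:R + 2)) * (2^-1 * (gamXxi X a b A + gamXxi X b a A)).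

(* From here on a half-integer weight i is encoded by the natural number
   p = i + 3/2, so that -3/2, -1/2, 1/2, 3/2, 5/2 become 0, 1, 2, 3, 4. *)

(* The pairs (i, k) for which the map Pi^k_i exists. *)
Definition Pi_index : seq (nat * nat) :=
  [:: (0, 0); (1, 0); (1, 1); (1, 2); (2, 0); (2, 1); (2, 2)]%N.

Definition Pi_vanishes (p k : nat) (X : tensor3) : Prop :=
  match p, k with
  | 0, 0 => forall A B C, Pi_m32_0 X A B C = 0
  | 1, 0 => forall A C, Pi_m12_0 X A C = 0
  | 1, 1 => forall a B C, Pi_m12_1 X a B C = 0
  | 1, 2 => forall c A B, Pi_m12_2 X c A B = 0
  | 2, 0 => forall a A, Pi_p12_0 X a A = 0
  | 2, 1 => forall a b A, Pi_p12_1 X a b A = 0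
  | 2, 2 => forall a b A, Pi_p12_2 X a b A = 0
  | _, _ => True
  end.

Definition kerPi (p k : nat) : {vspace tensor3} :=
  lspan (fun X : tensor3 => X \in CY /\ Pi_vanishes p k X).

Definition filtr (p : nat) : {vspace tensor3} :=
  match p with
  | 0 => CY
  | q.+1 => if (q < 3)%N
            then lspan (fun X : tensor3 => X \in CY /\ forall k, Pi_vanishes q k X)
            else 0%VS
  end.

(* With p = i + 3/2, A^i is filtr p and A_i^j is the quotient of CYcomp p j by
   filtr p.+1; quotient modules are handled as pairs of nested subspaces. *)
Definition CYcomp (p j : nat) : {vspace tensor3} :=
  if (p == 1)%N || (p == 2)%N
  then lspan (fun X : tensor3 => X \in filtr p /\ forall k, k <> j -> Pi_vanishes p k X)
  else filtr p.

Definition lower (u : 'rV[F]_n) : 'rV[F]_n := u *m g.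

(* so(V), as skew-symmetric matrices phi_ab. *)
Definition so_alg : {vspace 'M[F]_n} := lspan (fun phi : 'M[F]_n => phi^T = - phi).

Definition lie (phi psi : 'M[F]_n) : 'M[F]_n :=
  phi *m ginv *m psi - psi *m ginv *m phi.

Definition tact (phi : 'M[F]_n) (X : tensor3) : tensor3 :=
  let phi' := phi *m ginv in (* phi_a^d *)
  [ffun a => \matrix_(b, c)
     (\sum_d (phi' a d * X d b c + phi' b d * X a d c + phi' c d * X a b d))].

Definition p_alg : {vspace 'M[F]_n} := lspan (fun phi : 'M[F]_n => phi \in so_alg /\
  forall A B : 'I_sm, \sum_a \sum_b xi1u a A * xi1u b B * phi a b = 0).

Section Grading.
Variable Vminus : {vspace 'rV[F]_n}.

Definition null_complement : Prop :=
  [/\ {in Vminus &, forall u v, form u v = 0},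
      (Vplus + Vminus)%VS = fullv
    & (Vplus :&: Vminus)%VS = 0%VS].

(* V_{1/2} for true, V_{-1/2} for false. *)
Definition Vhalf (s : bool) : {vspace 'rV[F]_n} := if s then Vplus else Vminus.

Definition wedge (U W : {vspace 'rV[F]_n}) : {vspace 'M[F]_n} :=
  lspan (fun phi : 'M[F]_n => exists u w, [/\ u \in U, w \in W
    & phi = (lower u)^T *m lower w - (lower w)^T *m lower u]).

(* g_1 for true, g_{-1} for false. *)
Definition g_pm1 (s : bool) : {vspace 'M[F]_n} := wedge (Vhalf s) (Vhalf s).

Definition g_0 : {vspace 'M[F]_n} := wedge Vminus Vplus.

Definition z_0 : {vspace 'M[F]_n} := lspan (fun phi : 'M[F]_n => phi \in g_0 /\
  forall psi, psi \in g_0 -> lie phi psi = 0).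

(* The semisimple part of the reductive algebra g_0. *)
Definition sl_0 : {vspace 'M[F]_n} := lspan (fun phi : 'M[F]_n => exists psi chi,
  [/\ psi \in g_0, chi \in g_0 & phi = lie psi chi]).

(* Tensors of weight p - 3/2: exactly p of the three factors in V_{1/2}. *)
Definition tensor_level (p : nat) : {vspace tensor3} :=
  lspan (fun X : tensor3 => exists (s t r : bool) (u v w : 'rV[F]_n),
    [/\ (s + t + r)%N = p,
        [/\ u \in Vhalf s, v \in Vhalf t & w \in Vhalf r]
      & X = [ffun a => lower u 0 a *: ((lower v)^T *m lower w)]]).

Definition CY_level (p : nat) : {vspace tensor3} := (CY :&: tensor_level p)%VS.

(* U tensor W, for U in V and W in g = wedge^2 V^*, inside the 3-tensors. *)
Definition tensor_Vg (U : {vspace 'rV[F]_n}) (W : {vspace 'M[F]_n}) :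
    {vspace tensor3} :=
  lspan (fun X : tensor3 => exists u phi, [/\ u \in U, phi \in W
    & X = [ffun a => lower u 0 a *: phi]]).

Definition stable (L : {vspace 'M[F]_n}) (U : {vspace tensor3}) : Prop :=
  forall phi X, phi \in L -> X \in U -> tact phi X \in U.

(* U / W is an irreducible L-module. *)
Definition irreducible_quot (L : {vspace 'M[F]_n}) (U W : {vspace tensor3}) :
    Prop :=
  [/\ stable L U, stable L W, (W <= U)%VS, U <> W
    & forall X : {vspace tensor3}, stable L X -> (W <= X)%VS -> (X <= U)%VS ->
        X = W \/ X = U].

(* U / W and K are isomorphic L-modules. *)
Definition isomorphic_quot (L : {vspace 'M[F]_n}) (U W K : {vspace tensor3}) :
    Prop :=
  [/\ stable L U, stable L W, stable L K, (W <= U)%VS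
    & exists f : 'Hom(tensor3, tensor3),
      [/\ (f @: U)%VS = K,
          forall X, X \in U -> (f X = 0 <-> X \in W)
        & forall phi X, phi \in L -> X \in U -> f (tact phi X) = tact phi (f X)]].

(* K is the Cartan product of the g_0-modules U and W. *)
Definition cartan_product (U : {vspace 'rV[F]_n}) (W : {vspace 'M[F]_n})
    (K : {vspace tensor3}) : Prop :=
  [/\ irreducible_quot g_0 K 0%VS, (K <= tensor_Vg U W)%VS
    & forall K' : {vspace tensor3}, irreducible_quot g_0 K' 0%VS ->
        (K' <= tensor_Vg U W)%VS -> K' <> K -> (\dim K' < \dim K)%N].

(* The quotient U / W is the direct sum of the quotients X j / W. *)
Definition direct_sum_quot (U W : {vspace tensor3})
    (X : 'I_3 -> {vspace tensor3}) : Prop :=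
  (\sum_j X j)%VS = U /\
  forall j, (X j :&: \sum_(k | k != j) X k)%VS = W.

Definition dim_quot (U W : {vspace tensor3}) : nat := (\dim U - \dim W)%N.

(* A_i^j is an irreducible p-module, isomorphic over g_0 to the Cartan product
   of U and W. *)
Definition comp_is (p j : nat) (U : {vspace 'rV[F]_n})
    (W : {vspace 'M[F]_n}) : Prop :=
  irreducible_quot p_alg (CYcomp p j) (filtr p.+1) /\
  exists K, cartan_product U W K /\
    isomorphic_quot g_0 (CYcomp p j) (filtr p.+1) K.

Definition dim_comp (p j : nat) : nat := dim_quot (CYcomp p j) (filtr p.+1).

(* The linear span of g_1 . Y *)
Definition g1_span (Y : {vspace tensor3}) : {vspace tensor3} :=
  lspan (fun X : tensor3 => exists phi Z, [/\ phi \in g_pm1 true, Z \in Y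
    & X = tact phi Z]).

(* Any copy of A_i^j in weight i lies in g_1 . (any copy of A_{i-1}^k in
   weight i - 1). *)
Definition g1_generates (p j k : nat) : Prop :=
  forall X Y : {vspace tensor3},
    (X <= CY_level p)%VS -> (Y <= CY_level p.-1)%VS ->
    irreducible_quot g_0 X 0%VS -> irreducible_quot g_0 Y 0%VS ->
    isomorphic_quot g_0 (CYcomp p j) (filtr p.+1) X ->
    isomorphic_quot g_0 (CYcomp p.-1 k) (filtr p) Y ->
    (X <= g1_span Y)%VS.

End Grading.

(* (p, j, k) stands for the arrow from A_i^j to A_{i-1}^k, where p = i + 3/2. *)
Definition arrows : seq (nat * nat * nat) :=
  [:: (3, 0, 0); (3, 0, 1); (3, 0, 2);
      (2, 2, 2); (2, 2, 1); (2, 1, 2); (2, 1, 0); (2, 0, 0); (2, 0, 1);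
      (1, 0, 0); (1, 1, 0); (1, 2, 0)]%N.

End CottonYork.

(* Main.v *)
From HB Require Import structures.
From mathcomp Require Import all_boot all_order all_algebra.
From mathcomp Require Import boolp ring zify.
From mathcomp Require Import reals complex.
Require Import Defs.

Set Implicit Arguments.
Unset Strict Implicit.
Unset Printing Implicit Defensive.

Import Order.TTheory GRing.Theory Num.Theory.
Local Open Scope ring_scope.

(** Everything is reduced to linear algebra over gl(m) in a frame adapted to the splitting. Take a
    basis [E true i] of $V_{1/2}$ and the dual basis [E false i] of $V_{-1/2}$
    ([dual_basis_exists]). A tensor has coordinates [coord3 X s t r i j k]; the number of [true]
    among the labels is its weight plus 3/2, and $g_0$ acts as gl(m) on $V_{1/2}$ and dually on
    $V_{-1/2}$. For a Cotton-York tensor the coordinates of weight 3/2 and -3/2 are tensors of hook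
    symmetry. Those of weight 1/2 and -1/2 are all determined by one tensor B in $V\otimes V\otimes
    V^*$, called [mixed s X], whose only constraint is that one trace is half the other ([cf_mid],
    [cf_first], [tr13_mixed], [lift_mixed]). Such a B is the sum of a pure trace, a skew traceless
    and a symmetric traceless tensor: these are the components 0, 1, 2.

    The pure spinor behaves as a Fock vacuum: Clifford multiplication by [E true i] kills it, and
    the spinors obtained from the [E false i] are linearly independent. Expanding the seven maps in
    these spinors ([vanishes00] to [vanishes22_high]) turns their vanishing into vanishing of
    coordinates and of parts of B. Hence the i-th filtration step consists of the Cotton-York
    tensors without coordinates of weight below i ([mem_filtr]), and a component keeps just one part
    of B ([mem_CYcomp]). Stability follows because $\mathfrak p$ has no part of degree -1.

    For irreducibility, matrix units move any tensor with a nonzero part of the given type to a unit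
    tensor, from which a whole model is generated ([hook_irreducible], [skew_traceless_irreducible],
    [sym_traceless_irreducible]). Dimensions are traces of projectors ([dim_projector]). Each model
    has more than half the dimension of the tensor product that contains it, so any other
    irreducible submodule meets it trivially and is smaller; this makes it the Cartan product
    ([realizes_cartan]).

    For the graph, the three components of one weight have different dimensions, so each has exactly
    one copy in its weight ([copy_unique]). An arrow then amounts to a single $\phi\in g_1$ and a
    single Z in the lower copy such that $\phi\cdot Z$ has nonzero part of the upper type
    ([generatesP]). The arrows get explicit witnesses. Between weights 1/2 and -1/2, the pairs (0,
    2) and (2, 0) fail by a direct computation, and the pair (1, 1), which is not among [arrows],
    holds exactly when m differs from 3. The kernel inclusions are decided independently and hold in
    exactly the same cases ([kernels_generate]). *)

Ltac split_eq i a :=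
  let e := fresh "e" in have [e|e] := eqVneq i a; [subst i|].

Ltac split_eq2 i a b := split_eq i a; [|split_eq i b].

Ltac split_eq3 i a b c := split_eq i a; [|split_eq2 i b c].

Ltac ring_delta :=
  repeat match goal with H : is_true (_ != _) |- _ =>
    rewrite ?(negPf H); clear H end;
  rewrite ?eqxx /=; ring.

(** * Three-index tensors under gl(m): matrix units and the hook module *)

Section Models.
Variables (F : numFieldType) (m : nat).
Local Notation tensor := {ffun 'I_m -> 'M[F]_m}.
Implicit Types (B : tensor) (S : {vspace tensor}) (M N : 'M[F]_m).

Definition unit3 (a b c : 'I_m) : tensor :=
  [ffun i => (i == a)%:R *: delta_mx b c].

Lemma unit3E a b c i j k :
  unit3 a b c i j k = (i == a)%:R * (j == b)%:R * (k == c)%:R.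
Proof. by rewrite ffunE !mxE -mulnb natrM mulrA. Qed.

Lemma tensorP B B' : (forall i j k, B i j k = B' i j k) -> B = B'.
Proof. by move=> e; apply/ffunP=> i; apply/matrixP=> j k; exact: e. Qed.

Lemma sum_tensorE (I : Type) (r : seq I) (P : pred I) (f : I -> tensor) i j k :
  (\sum_(x <- r | P x) f x) i j k = \sum_(x <- r | P x) f x i j k.
Proof.
by elim/big_rec2: _ => [|x y z _ <-]; rewrite ?ffunE ?mxE.
Qed.

Lemma tensor0 i j k : (0 : tensor) i j k = 0.
Proof. by rewrite ffunE mxE. Qed.

Lemma tensorD B B' i j k : (B + B') i j k = B i j k + B' i j k.
Proof. by rewrite ffunE mxE. Qed.

Lemma tensorN B i j k : (- B) i j k = - B i j k.
Proof. by rewrite ffunE mxE. Qed.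

Lemma tensorZ x B i j k : (x *: B) i j k = x * B i j k.
Proof. by rewrite ffunE mxE. Qed.

Definition tensorE := (tensor0, tensorD, tensorN, tensorZ, unit3E).

Lemma sum_delta (f : 'I_m -> F) a : \sum_i (i == a)%:R * f i = f a.
Proof.
rewrite (bigD1 a) //= eqxx mul1r big1 ?addr0 // => i /negPf ->.
by rewrite mul0r.
Qed.

Lemma sum_delta_sym (f : 'I_m -> F) a : \sum_i (a == i)%:R * f i = f a.
Proof. by under eq_bigr do rewrite eq_sym; rewrite sum_delta. Qed.

Lemma sum_delta3 (f : 'I_m -> 'I_m -> 'I_m -> F) a b c :
  \sum_i \sum_j \sum_k
    f i j k * ((i == a)%:R * (j == b)%:R * (k == c)%:R) = f a b c.
Proof.
rewrite -[RHS](sum_delta (fun i => f i b c)); apply: eq_bigr => i _.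
rewrite -[f i b c](sum_delta (fun j => f i j c)) mulr_sumr.
apply: eq_bigr => j _; rewrite -[f i j c](sum_delta (f i j)) !mulr_sumr.
by apply: eq_bigr => k _; rewrite mulrC -!mulrA.
Qed.

Lemma sum_unit3 B : B = \sum_i \sum_j \sum_k B i j k *: unit3 i j k.
Proof.
apply: tensorP => x y z; rewrite sum_tensorE -(sum_delta3 (fun i j k => B i j k)).
apply: eq_bigr => i _; rewrite sum_tensorE; apply: eq_bigr => j _.
rewrite sum_tensorE; apply: eq_bigr => k _.
by rewrite !tensorE (eq_sym x) (eq_sym y) (eq_sym z).
Qed.

Definition pairing (L : 'I_m -> 'I_m -> 'I_m -> F) B :=
  \sum_i \sum_j \sum_k L i j k * B i j k.

Lemma pairing_unit3 L a b c : pairing L (unit3 a b c) = L a b c.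
Proof.
rewrite -(sum_delta3 L); apply: eq_bigr => i _; apply: eq_bigr => j _.
by apply: eq_bigr => k _; rewrite unit3E.
Qed.

Lemma pairingD L B B' : pairing L (B + B') = pairing L B + pairing L B'.
Proof.
rewrite -big_split; apply: eq_bigr => i _; rewrite -big_split; apply: eq_bigr => j _.
by rewrite -big_split; apply: eq_bigr => k _; rewrite tensorD mulrDr.
Qed.

Lemma pairingN L B : pairing L (- B) = - pairing L B.
Proof.
rewrite /pairing -sumrN; apply: eq_bigr => i _; rewrite -sumrN; apply: eq_bigr => j _.
by rewrite -sumrN; apply: eq_bigr => k _; rewrite tensorN mulrN.
Qed.

(* A vector outside S is detected by one of the coordinates of 1 - projv S. *)
Lemma mem_by_pairing S B :
  (forall L, (forall B', B' \in S -> pairing L B' = 0) -> pairing L B = 0) ->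
  B \in S.
Proof.
move=> hB; pose D : 'End(tensor) := (\1 - projv S)%VF.
have DE B' : D B' = B' - projv S B' by rewrite !lfunE /= !lfunE.
suff : D B = 0 by rewrite DE => /subr0_eq ->; exact: memv_proj.
apply: tensorP => x y z; rewrite tensor0.
pose L i j k := D (unit3 i j k) x y z.
have LE B' : pairing L B' = D B' x y z.
  rewrite {2}[B']sum_unit3 linear_sum sum_tensorE; apply: eq_bigr => i _.
  rewrite linear_sum sum_tensorE; apply: eq_bigr => j _.
  rewrite linear_sum sum_tensorE; apply: eq_bigr => k _.
  by rewrite linearZ tensorZ mulrC.
by rewrite -LE; apply: hB => B' B'S; rewrite LE DE projv_id // subrr tensor0.
Qed.

(** The third slot gets its own matrix so that one formula serves both module structures in play:
    [N = M] for $V\otimes V\otimes V$ and [N = - M^T] for $V\otimes V\otimes V^*$. *)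
Definition rho M N B : tensor := [ffun i => \matrix_(j, k)
  (\sum_p M i p * B p j k + \sum_p M j p * B i p k + \sum_p N k p * B i j p)].

Lemma rhoE M N B i j k : rho M N B i j k =
  \sum_p M i p * B p j k + \sum_p M j p * B i p k + \sum_p N k p * B i j p.
Proof. by rewrite ffunE mxE. Qed.

Definition rho_mixed M B := rho M (- M^T) B.

Definition rho_cov M B := rho M M B.

Lemma sum_delta_mx (b a i : 'I_m) (f : 'I_m -> F) :
  \sum_p delta_mx b a i p * f p = (i == b)%:R * f a.
Proof.
rewrite -(sum_delta f) mulr_sumr; apply: eq_bigr => p _.
by rewrite mxE -mulnb natrM mulrA.
Qed.

Lemma sum_delta_mxT (b a k : 'I_m) (f : 'I_m -> F) :
  \sum_p (- (delta_mx b a)^T) k p * f p = - ((k == a)%:R * f b).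
Proof.
by rewrite -sum_delta_mx -sumrN; apply: eq_bigr => p _; rewrite !mxE mulNr andbC.
Qed.

(** A matrix unit acting: nilpotent on each slot when [a != b], a diagonal weight operator when
    [a = b] (see [shift_mixed_weight]). *)
Definition shift_mixed b a B := rho_mixed (delta_mx b a) B.

Lemma shift_mixedE b a B i j k : shift_mixed b a B i j k =
  (i == b)%:R * B a j k + (j == b)%:R * B i a k - (k == a)%:R * B i j b.
Proof. by rewrite rhoE !sum_delta_mx sum_delta_mxT. Qed.

Definition shift_cov b a B := rho_cov (delta_mx b a) B.

Lemma shift_covE b a B i j k : shift_cov b a B i j k =
  (i == b)%:R * B a j k + (j == b)%:R * B i a k + (k == b)%:R * B i j a.
Proof. by rewrite rhoE !sum_delta_mx. Qed.

Definition stable_mixed S := forall M B, B \in S -> rho_mixed M B \in S.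

Definition stable_cov S := forall M B, B \in S -> rho_cov M B \in S.

Hypothesis m_gt2 : (2 < m)%N.

Lemma exists_third (a b : 'I_m) : exists c, c != a /\ c != b.
Proof.
have /existsP[c] : [exists c, (c != a) && (c != b)].
  rewrite -negb_forall_in; apply/negP => /forall_inP h.
  have : (#|'I_m| <= #|[set a; b]|)%N.
    apply/subset_leq_card/subsetP => c _; rewrite !inE.
    by case: eqP => //= /eqP /h /eqP ->.
  by rewrite card_ord cards2; case: (_ != _); rewrite leqNgt ?m_gt2 ?(ltnW m_gt2).
by case/andP; exists c.
Qed.

(** Ordered pairs of distinct indices are connected by exchanging one entry at a time for a third
    index, which [m > 2] provides. *)
Lemma pair_closure (P : 'I_m -> 'I_m -> Prop) :
  (forall x y z, x != y -> z != x -> z != y -> P x y -> P z y) ->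
  (forall x y z, x != y -> z != x -> z != y -> P x y -> P x z) ->
  forall a b, a != b -> P a b -> forall p q, p != q -> P p q.
Proof.
move=> Pl Pr a b ab Pab p q pq.
have row x y z : x != y -> z != y -> P x y -> P z y.
  by move=> xy zy; have [-> //|zx] := eqVneq z x; exact: Pl.
have col x y z : x != y -> z != x -> P x y -> P x z.
  by move=> xy zx; have [-> //|zy] := eqVneq z y; exact: Pr.
have [pb|pb] := eqVneq p b; last first.
  by apply: (col p b) => //; rewrite 1?eq_sym //; apply: (row a).
(* Here the target starts with [b], so the first entry cannot be replaced directly; a detour through
   the third index [c] frees the value [b]. *)
have [c [ca cb]] := exists_third a b; subst p.
apply: (col b c); rewrite 1?eq_sym //.
apply: (row a c); rewrite 1?eq_sym //.
exact: (col a b).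
Qed.

(** Transpositions together with replacement of the first entry by a fourth index connect all
    triples. For [m = 3] the replacement move never occurs and permutations alone suffice. *)
Lemma triple_closure (P : 'I_m -> 'I_m -> 'I_m -> Prop) :
  (forall x y z, P x y z -> P y x z) ->
  (forall x y z, x != y -> x != z -> y != z -> P x y z -> P z y x) ->
  (forall x y z t, x != y -> x != z -> y != z ->
     t != x -> t != y -> t != z -> P x y z -> P t y z) ->
  forall a b c, a != b -> a != c -> b != c -> P a b c ->
  forall p q r, p != q -> p != r -> q != r -> P p q r.
Proof.
move=> sw12 sw13 rep a b c ab ac bc Pabc p q r pq pr qr.
have row x y z t : x != y -> x != z -> y != z -> t != y -> t != z ->
    P x y z -> P t y z.
  by move=> *; have [-> //|tx] := eqVneq t x; apply: (rep x).
have [y [z [py pz yz Ppyz]]] : exists y z, [/\ p != y, p != z, y != z & P p y z].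
  have [->|pa] := eqVneq p a; first by exists b, c.
  have [->|pb] := eqVneq p b.
    by exists a, c; split=> //; [rewrite eq_sym | apply: (sw12)].
  have [->|pc] := eqVneq p c.
    by exists b, a; split; [rewrite eq_sym..| exact: sw13].
  by exists b, c; split => //; apply: (row a).
have [z' [pz' qz' Ppqz]] : exists z', [/\ p != z', q != z' & P p q z'].
  have [->|qy] := eqVneq q y; first by exists z.
  have [->|qz] := eqVneq q z.
    exists y; split=> //; [by rewrite eq_sym | apply: (sw12)].
    by apply: (sw13 _ _ _ _ _ _ (sw12 _ _ _ Ppyz)) => //; rewrite eq_sym.
  exists z; split => //; apply: (sw12).
  by apply: (row y _ _ _ _ _ _ _ _ (sw12 _ _ _ Ppyz)) => //; rewrite eq_sym.
have Pz := sw13 p q z' pq pz' qz' Ppqz.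
apply: (sw13) => //; try by rewrite eq_sym.
by apply: (row z' _ _ _ _ _ _ _ _ Pz) => //; rewrite eq_sym.
Qed.

Lemma shift_mixed_mem S b a B : stable_mixed S -> B \in S ->
  shift_mixed b a B \in S.
Proof. by move=> st; exact: st. Qed.

Lemma shift_cov_mem S b a B : stable_cov S -> B \in S ->
  shift_cov b a B \in S.
Proof. by move=> st; exact: st. Qed.

Lemma mem_of_scaled S x B : x != 0 -> x *: B \in S -> B \in S.
Proof. by move=> x0 /(memvZ x^-1); rewrite scalerK. Qed.

(** Each slot is annihilated by two applications of the matrix unit, so its cube acts once on every
    slot. This leaves one entry of [B], with the factor 3! and the sign of the dual slot. *)
Lemma mixed_extract_sym S B a b : stable_mixed S -> B \in S -> a != b ->
  B a a b != 0 -> unit3 b b a \in S.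
Proof.
move=> st BS ab B0; have ba : b != a by rewrite eq_sym.
apply: (@mem_of_scaled S (- 6 * B a a b)).
  by rewrite mulf_neq0 // oppr_eq0 pnatr_eq0.
suff -> : (- 6 * B a a b) *: unit3 b b a =
  shift_mixed b a (shift_mixed b a (shift_mixed b a B)).
  by do 3 apply: shift_mixed_mem => //.
apply: tensorP => i j k; rewrite !(tensorE, shift_mixedE) ?eqxx ?(negPf ab) ?(negPf ba).
by case: (i == b); case: (j == b); case: (k == a) => /=; ring.
Qed.

Lemma shift_mixed_weight a B i j k : shift_mixed a a B i j k =
  ((i == a)%:R + (j == a)%:R - (k == a)%:R) * B i j k.
Proof.
rewrite shift_mixedE.
by case: (eqVneq i a) => [->|_]; case: (eqVneq j a) => [->|_];
  case: (eqVneq k a) => [->|_] /=; ring.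
Qed.

(** Raising twice and projecting to a weight leaves two unit tensors exchanged by swapping [b] and
    [c]; the sl(2) of these two indices then separates the skew combination. *)
Lemma mixed_extract_antisym S B a c b : stable_mixed S -> B \in S ->
  a != c -> a != b -> c != b -> B a c b != B c a b ->
  unit3 b c a - unit3 c b a \in S.
Proof.
move=> st BS ac ab cb B0.
have [ca ba bc] : [/\ c != a, b != a & b != c] by split; rewrite eq_sym.
apply: (@mem_of_scaled S (2 * (B a c b - B c a b))).
  by rewrite mulf_neq0 ?pnatr_eq0 // subr_eq0.
have [y [yS yE]] : exists y, y \in S /\ forall i j k,
    y i j k = 2 * B a c b * ((i == b)%:R * (j == c)%:R * (k == a)%:R)
    + 2 * B c a b * ((i == c)%:R * (j == b)%:R * (k == a)%:R).
  (* Two moves from [a] to [b] leave three kinds of terms; the weight operators of [c] and [a] kill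
     all of them except those with indices b, c, a and c, b, a. *)
  exists (shift_mixed a a (shift_mixed c c (shift_mixed b a (shift_mixed b a B)))).
  split=> [|i j k]; first by do 4 apply: shift_mixed_mem => //.
  rewrite !shift_mixed_weight.
  have -> : shift_mixed b a (shift_mixed b a B) i j k =
      2 * ((i == b)%:R * (j == b)%:R * B a a k
         - (i == b)%:R * (k == a)%:R * B a j b - (j == b)%:R * (k == a)%:R * B i a b).
    rewrite !shift_mixedE ?eqxx ?(negPf ab) ?(negPf ba).
    by case: (i == b); case: (j == b); case: (k == a) => /=; ring.
  case: (eqVneq k a) => [->|ka]; rewrite ?eqxx ?(negPf ac) ?(negPf ka) /=.
    case: (eqVneq i b) => [->|ib]; rewrite ?(negPf ba) ?(negPf bc) /=.
      case: (eqVneq j b) => [->|jb]; rewrite ?(negPf ba) ?(negPf bc) /=; first by ring.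
      by case: (eqVneq j c) => [->|jc]; rewrite ?(negPf ca) /=; [|case: (j == a)]; ring.
    case: (eqVneq j b) => [->|jb]; rewrite ?(negPf ba) ?(negPf bc) /=; last by ring.
    by case: (eqVneq i c) => [->|ic]; rewrite ?(negPf ca) /=; [|case: (i == a)]; ring.
  case: (eqVneq i b) => [->|ib]; rewrite ?(negPf ba) ?(negPf bc) /=; last by ring.
  case: (eqVneq j b) => [->|jb]; rewrite ?(negPf ba) ?(negPf bc) /=; last by ring.
  by ring.
(* Lowering and raising between [b] and [c] sends [y] to its symmetrisation in the first two slots,
   so subtracting it from twice [y] leaves the skew part. *)
suff -> : (2 * (B a c b - B c a b)) *: (unit3 b c a - unit3 c b a) =
  2 *: y - shift_mixed c b (shift_mixed b c y).
  by rewrite memvB ?memvZ //; do 2 apply: shift_mixed_mem => //.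
apply: tensorP => i j k; rewrite !(tensorE, shift_mixedE, yE) ?eqxx.
rewrite ?(negPf ac) ?(negPf ab) ?(negPf cb) ?(negPf ca) ?(negPf ba) ?(negPf bc).
case: (eqVneq i b) => [->|_]; rewrite ?(negPf bc) /=; last first.
  by case: (i == c); case: (j == b); case: (j == c); case: (k == a);
    case: (k == c) => /=; ring.
by case: (j == b); case: (j == c); case: (k == a);
    case: (k == c) => /=; ring.
Qed.

(** Young symmetry of shape (2,1), in the form skew in the last two slots with vanishing cyclic sum:
    the symmetry of a Cotton-York tensor without its trace condition. *)
Definition hook B : Prop := (forall i j k, B i j k = - B i k j) /\
  (forall i j k, B i j k + B j k i + B k i j = 0).

Definition skew_traceless B : Prop :=
  (forall i j k, B i j k = - B j i k) /\ (forall i, \sum_j B i j j = 0).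

Definition sym_traceless B : Prop :=
  (forall i j k, B i j k = B j i k) /\ (forall i, \sum_j B i j j = 0).

Lemma self_oppr0 (x : F) : x = - x -> x = 0.
Proof.
by move/eqP; rewrite -addr_eq0 -mulr2n mulrn_eq0 /= => /eqP.
Qed.

Lemma hook_first2 B p q : hook B -> B q p p = 0.
Proof. by case=> as_B _; apply: self_oppr0; exact: as_B. Qed.

(** After two moves from [p] to [c] the entries with a repeated last pair drop out by skewness, and
    the weight operator of [r] selects the wanted value of the remaining index. *)
Lemma cov_extract S B p c r : stable_cov S -> B \in S -> hook B ->
  p != c -> p != r -> c != r -> B p p r != 0 ->
  unit3 c c r - unit3 c r c \in S.
Proof.
move=> st BS hB pc pr cr B0.
have [cp rp rc] : [/\ c != p, r != p & r != c] by split; rewrite eq_sym.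
apply: (@mem_of_scaled S (2 * B p p r)); first by rewrite mulf_neq0 ?pnatr_eq0.
suff -> : (2 * B p p r) *: (unit3 c c r - unit3 c r c) =
    shift_cov r r (shift_cov c p (shift_cov c p B)).
  by do 3 apply: shift_cov_mem => //.
apply: tensorP => i j k.
have B2 x y z : shift_cov c p (shift_cov c p B) x y z =
    2 * ((x == c)%:R * (y == c)%:R * B p p z + (x == c)%:R * (z == c)%:R * B p y p).
  rewrite !shift_covE ?eqxx ?(negPf pc) !(hook_first2 _ _ hB).
  by case: (x == c); case: (y == c); case: (z == c) => /=; ring.
rewrite shift_covE !B2 !tensorE ?eqxx ?(negPf rc) (hB.1 p r p).
by case: (i == c); case: (i == r); case: (j == c); case: (j == r); case: (k == c);
  case: (k == r) => /=; ring.
Qed.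

(** Some element of [S] has an entry of the form [B p p q] nonzero, since otherwise all its elements
    would be totally skew, hence zero by the cyclic identity. Then [S] contains the basic hook
    tensors, and a functional killing these pairs to zero with every hook tensor. *)
Lemma hook_irreducible S : stable_cov S -> (forall B, B \in S -> hook B) ->
  S <> 0%VS -> forall B, hook B -> B \in S.
Proof.
move=> st Sh Sn0.
have [p [q [pq Ppq]]] : exists p q, p != q /\ unit3 p p q - unit3 p q p \in S.
  apply: contrapT => none; apply: Sn0; apply/eqP; rewrite -subv0; apply/subvP => B BS.
  have B0 B' p q : B' \in S -> p != q -> B' p p q = 0.
    move=> B'S pq; apply/eqP/contraT => nz; have [c [cp cq]] := exists_third p q.
    case: none; exists c, q; split => //.
    by apply: (cov_extract st B'S) nz => //; [exact: Sh | rewrite eq_sym].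
  have B1 B' p q : B' \in S -> B' p p q = 0.
    have [->|pq] := eqVneq p q; last by move/B0; apply.
    by move=> /Sh /hook_first2.
  (* Polarisation: the vanishing of all entries with equal first indices is applied to the shifted
     element of [S]. *)
  have B2 p q r : B q p r = - B p q r.
    have := B1 _ p r (shift_cov_mem p q st BS).
    rewrite shift_covE !eqxx !mul1r (B1 B) // mulr0 addr0 => /eqP.
    by rewrite addr_eq0 => /eqP.
  have [as_B cyc_B] := Sh _ BS.
  rewrite memv0; apply/eqP/tensorP => i j k; rewrite tensor0.
  have := cyc_B i j k.
  rewrite (as_B j k i) (B2 i j) opprK (B2 i k j) (as_B i k j) opprK.
  rewrite (_ : _ + _ + _ = B i j k *+ 3); last by ring.
  by move/eqP; rewrite mulrn_eq0 /= => /eqP.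
have Sall a b : a != b -> unit3 a a b - unit3 a b a \in S.
  move=> ab; pose P x y := unit3 x x y - unit3 x y x \in S.
  have Pl x y z : x != y -> z != x -> z != y -> P x y -> P z y.
    move=> xy zx zy Pxy; apply: (cov_extract st Pxy _ _ xy zy).
    - split=> i j k; rewrite !tensorE.
        by case: (i == x); case: (j == x); case: (j == y); case: (k == x);
          case: (k == y) => /=; ring.
      by case: (i == x); case: (j == x); case: (k == x); case: (i == y);
        case: (j == y); case: (k == y) => /=; ring.
    - by rewrite eq_sym.
    by rewrite !tensorE !eqxx (negPf xy) mulr0 mul0r subr0 !mulr1 oner_neq0.
  have Pr x y z : x != y -> z != x -> z != y -> P x y -> P x z.
    move=> xy zx zy Pxy; rewrite /P.
    suff -> : unit3 x x z - unit3 x z x = shift_cov z y (unit3 x x y - unit3 x y x).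
      exact: shift_cov_mem.
    have yx : y != x by rewrite eq_sym.
    apply: tensorP => i j k; rewrite shift_covE !tensorE ?eqxx ?(negPf xy) ?(negPf yx).
    by case: (i == x); case: (j == x); case: (k == x); case: (i == z);
      case: (j == z); case: (k == z) => /=; ring.
  exact: (pair_closure Pl Pr pq Ppq).
move=> B [as_B cyc_B]; apply: mem_by_pairing => L LS.
(* Only the part of [L] skew in the last two slots sees a hook tensor. Vanishing on [S] makes [A]
   totally skew, so cyclic permutations of [B] do not change its pairing with [A], and the cyclic
   identity makes it zero. *)
pose A i j k := L i j k - L i k j.
have A0 i j : A i i j = 0.
  have [->|ij] := eqVneq i j; first by rewrite /A subrr.
  by have := LS _ (Sall _ _ ij); rewrite pairingD pairingN !pairing_unit3.
have A0m i j : A i j i = 0 by rewrite -[LHS]opprK {1}/A opprB -/(A i i j) A0 oppr0.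
have A0r i j : A i j j = 0 by rewrite /A subrr.
have A12 i j k : A i j k = - A j i k.
  apply/eqP; rewrite -addr_eq0.
  have [->|ij] := eqVneq i j; first by rewrite A0 addr0.
  have [->|ik] := eqVneq i k; first by rewrite A0r A0m addr0.
  have [->|jk] := eqVneq j k; first by rewrite A0r A0m addr0.
  have := LS _ (shift_cov_mem j i st (Sall _ _ ik)).
  suff -> : shift_cov j i (unit3 i i k - unit3 i k i) =
      (unit3 i j k - unit3 i k j) + (unit3 j i k - unit3 j k i).
    by rewrite !(pairingD, pairingN) !pairing_unit3 => /eqP.
  apply: tensorP => x y z; rewrite shift_covE !tensorE !eqxx (negPf ik).
  by case: (x == i); case: (x == j); case: (y == i); case: (y == j); case: (y == k);
    case: (z == i); case: (z == j); case: (z == k) => /=; ring.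
have A23 i j k : A i j k = - A i k j by rewrite /A opprB.
have E : pairing L B *+ 2 = \sum_i \sum_j \sum_k A i j k * B i j k.
  rewrite mulr2n {2}/pairing; under [X in _ + X]eq_bigr => i _ do rewrite exchange_big.
  rewrite -big_split; apply: eq_bigr => i _; rewrite -big_split; apply: eq_bigr => j _.
  rewrite -big_split; apply: eq_bigr => k _; rewrite /A (as_B i k j) /=; ring.
have E1 : \sum_i \sum_j \sum_k A i j k * B j k i = \sum_i \sum_j \sum_k A i j k * B i j k.
  rewrite exchange_big; apply: eq_bigr => j _; rewrite exchange_big; apply: eq_bigr => k _.
  by apply: eq_bigr => i _; rewrite A12 A23 opprK.
have E2 : \sum_i \sum_j \sum_k A i j k * B k i j = \sum_i \sum_j \sum_k A i j k * B i j k.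
  under eq_bigr => i _ do rewrite exchange_big.
  rewrite exchange_big; apply: eq_bigr => k _; apply: eq_bigr => i _.
  by apply: eq_bigr => j _; rewrite A23 A12 opprK.
have : \sum_i \sum_j \sum_k A i j k * B i j k + \sum_i \sum_j \sum_k A i j k * B j k i
    + \sum_i \sum_j \sum_k A i j k * B k i j = 0.
  rewrite -!big_split big1 // => i _; rewrite -!big_split big1 // => j _.
  rewrite -!big_split big1 // => k _.
  by rewrite /= -!mulrDr cyc_B mulr0.
rewrite E1 E2 -E (_ : _ + _ + _ = pairing L B *+ 6); last by ring.
by move/eqP; rewrite mulrn_eq0 => /eqP.
Qed.

End Models.

Arguments unit3 {F m}.

(** * Submodules of $V\otimes V\otimes V^*$: symmetric and skew traceless tensors *)

Section MixedModels.
Variables (F : numFieldType) (m : nat).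
Hypothesis m_gt2 : (2 < m)%N.
Local Notation tensor := {ffun 'I_m -> 'M[F]_m}.
Implicit Types (B : tensor) (S : {vspace tensor}).
Local Notation e3 := (@unit3 F m).
Local Notation shift := (@shift_mixed F m).

(** Closes both dichotomies below, with [e = 1] and [e = -1]: a functional built from Kronecker
    deltas only sees the two traces. *)
Lemma sum_pure_trace (l : 'I_m -> F) (B : tensor) (e : F) :
  (forall i, \sum_j B i j j = 0) -> (forall i, \sum_j B j i j = 0) ->
  \sum_i \sum_j \sum_k ((j == k)%:R * l i + e * ((i == k)%:R * l j)) * B i j k = 0.
Proof.
move=> tr1 tr2.
under eq_bigr => i _ do under eq_bigr => j _ do
  under eq_bigr => k _ do rewrite mulrDl -mulrA -!(mulrA e) -mulrA.
under eq_bigr => i _ do under eq_bigr => j _ do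
  rewrite big_split /= sum_delta_sym -mulr_sumr sum_delta_sym.
under eq_bigr => i _ do rewrite big_split /= -!mulr_sumr tr1 mulr0 add0r.
rewrite -mulr_sumr exchange_big big1 ?mulr0 // => j _.
by rewrite -mulr_sumr tr2 mulr0.
Qed.

(** [S] is any stable subspace, not only one of symmetric traceless tensors; this stronger form
    later detects the component inside a sum of several components. If an entry [B a a b] with
    [a != b] is nonzero, unit tensors are extracted; if none is, polarisation leaves only deltas in
    the symmetric part. *)
Lemma sym_traceless_irreducible S : stable_mixed S ->
  (forall B, sym_traceless B -> B \in S) \/
  (forall B, B \in S -> forall i j k,
     B i j k + B j i k = (j == k)%:R * B i i i + (i == k)%:R * B j j j).
Proof.
move=> st.
have [[B [a [b [BS ab Bab]]]]|none] := pselect (exists B a b,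
    [/\ B \in S, a != b & B a a b != 0]); [left|right].
  have ba : b != a by rewrite eq_sym.
  have Sall p q : p != q -> e3 p p q \in S.
    apply: (pair_closure m_gt2 (P := fun p q => e3 p p q \in S)) ba
      (mixed_extract_sym st BS ab Bab) _ _.
      move=> x y z xy zx zy xS; apply: (@mem_of_scaled F m S 2); rewrite ?pnatr_eq0 //.
      suff -> : 2 *: e3 z z y = shift z x (shift z x (e3 x x y)).
        by do 2 apply: shift_mixed_mem => //.
      have xz : x != z by rewrite eq_sym.
      apply: tensorP => i j k; rewrite !(tensorE, shift_mixedE).
      rewrite ?eqxx ?(negPf xz) ?(negPf zx) ?(negPf zy).
      by case: (i == z); case: (j == z); case: (i == x); case: (j == x); case: (k == x); case: (k == y) => /=; ring.
    move=> x y z xy zx zy xS; rewrite -memvN.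
    suff -> : - e3 x x z = shift y z (e3 x x y) by exact: shift_mixed_mem.
    have xz : x != z by rewrite eq_sym.
    apply: tensorP => i j k; rewrite !(tensorE, shift_mixedE).
    rewrite ?eqxx ?(negPf xz) ?(negPf zx) ?(negPf zy).
    by case: (i == y); case: (j == y); case: (k == z); case: (k == y); case: (i == x); case: (j == x) => /=; ring.
  move=> B' [sB tB]; apply: mem_by_pairing => L LS.
  (* The symmetric part of a functional that kills [S]. Killing the unit tensors and their shifts
     forces it to be a combination of deltas, which annihilates traceless tensors. *)
  pose G i j k := L i j k + L j i k.
  have G0 i k : i != k -> G i i k = 0.
    by move=> ik; rewrite /G -pairing_unit3 LS ?addr0 // Sall.
  have G3 i j k : i != j -> i != k -> j != k -> G i j k = 0.
    move=> ij ik jk; have := LS _ (shift_mixed_mem j i st (Sall _ _ ik)).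
    suff -> : shift j i (e3 i i k) = e3 i j k + e3 j i k.
      by rewrite pairingD !pairing_unit3.
    apply: tensorP => x y z; rewrite shift_mixedE !tensorE !eqxx (negPf jk).
    by rewrite /=; ring.
  have Gk i k : i != k -> G i k k = L i i i.
    move=> ik; have := LS _ (shift_mixed_mem k i st (Sall _ _ ik)).
    suff -> : shift k i (e3 i i k) = e3 i k k + e3 k i k - e3 i i i.
      by rewrite !(pairingD, pairingN) !pairing_unit3 => /eqP; rewrite subr_eq0 => /eqP.
    by apply: tensorP => x y z; rewrite shift_mixedE !tensorE !eqxx /=; ring.
  have GE i j k : G i j k = (j == k)%:R * L i i i + 1 * ((i == k)%:R * L j j j).
    have [->|ij] := eqVneq i j.
      have [->|jk] := eqVneq j k; first by rewrite /G !mul1r.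
      by rewrite G0 // !mul0r mul1r addr0.
    have [eik|ik] := eqVneq i k.
      have jk : j != k by rewrite eq_sym -eik.
      by rewrite eik (negPf jk) mul0r add0r !mul1r -(Gk j k) // /G addrC.
    have [->|jk] := eqVneq j k; first by rewrite Gk // mul0r mulr0 addr0 mul1r.
    by rewrite G3 // !mul0r mulr0 addr0.
  have : pairing L B' *+ 2 = 0.
    have tB2 i : \sum_j B' j i j = 0 by under eq_bigr do rewrite sB; exact: tB.
    rewrite -[RHS](sum_pure_trace (fun i => L i i i) 1 tB tB2).
    rewrite mulr2n {2}/pairing exchange_big -big_split; apply: eq_bigr => i _.
    rewrite -big_split; apply: eq_bigr => j _; rewrite -big_split; apply: eq_bigr => k _.
    by rewrite -GE /G /= (sB j i) mulrDl.
  by move/eqP; rewrite mulrn_eq0 => /eqP.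
move=> B BS.
(* The vanishing holds for all elements of [S], hence for shifts of [B]; expanding these yields the
   entries with three distinct indices ([B3]) and those with a repeated upper index ([B2]). *)
have B0 B' a b : B' \in S -> a != b -> B' a a b = 0.
  move=> B'S ab; apply/eqP/contraT => nz; case: none.
  by exists B', a, b.
have B3 a b c : a != b -> c != b -> B c a b + B a c b = 0.
  move=> ab cb; have := B0 _ a b (shift_mixed_mem a c st BS) ab.
  have [->|ca] := eqVneq c a.
    by rewrite (B0 _ _ _ BS ab) addr0.
  rewrite shift_mixedE !eqxx eq_sym (negPf cb) !mul1r mul0r subr0 //.
have B2 a b : a != b -> B b a b + B a b b = B a a a.
  move=> ab; have := B0 _ a b (shift_mixed_mem a b st BS) ab.
  by rewrite shift_mixedE !eqxx !mul1r => /eqP; rewrite subr_eq0 => /eqP.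
move=> i j k.
have [->|ik] := eqVneq i k; have [->|jk] := eqVneq j k; rewrite ?mul1r ?mul0r ?addr0 ?add0r //.
- by rewrite addrC -(B2 j k) // addrC.
- by rewrite -(B2 i k) // addrC.
by rewrite addrC B3.
Qed.

(** Used twice in the skew dichotomy, once for the functional and once for the elements of [S]. The
    value [l i] is read off at an auxiliary index [o i] different from [i]; the third hypothesis
    makes the choice irrelevant. *)
Lemma skew_pure_trace_form (G : 'I_m -> 'I_m -> 'I_m -> F) :
  (forall i j k, G j i k = - G i j k) ->
  (forall i j k, i != j -> i != k -> j != k -> G i j k = 0) ->
  (forall i j k, i != j -> i != k -> j != k -> G i j j = G i k k) ->
  exists l : 'I_m -> F, forall i j k,
    G i j k = (j == k)%:R * l i - (i == k)%:R * l j.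
Proof.
move=> asG G3 Gk.
have [o oP] : exists o : 'I_m -> 'I_m, forall i, i != o i.
  pose h1 := ltnW m_gt2.
  exists (fun i => if i == Ordinal (ltnW h1) then Ordinal h1 else Ordinal (ltnW h1)).
  by move=> i; case: ifP => [/eqP ->|/negbT].
have Go i k : i != k -> G i k k = G i (o i) (o i).
  by move=> ik; have [<- //|ok] := eqVneq k (o i); exact: Gk.
exists (fun i => G i (o i) (o i)) => i j k.
have [->|ij] := eqVneq i j.
  by rewrite subrr; apply: self_oppr0; exact: asG.
have [eik|ik] := eqVneq i k.
  have jk : j != k by rewrite eq_sym -eik.
  by rewrite eik (negPf jk) mul0r sub0r mul1r -(Go j k) // asG.
have [ejk|jk] := eqVneq j k; first by rewrite ejk Go // mul0r subr0 mul1r.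
by rewrite G3 // !mul0r subr0.
Qed.

(** Same alternative as in the symmetric case, started from a skew entry with three distinct
    indices. Such entries cannot detect the pure trace tensors, which is why the second alternative
    allows them. *)
Lemma skew_traceless_irreducible S : stable_mixed S ->
  (forall B, skew_traceless B -> B \in S) \/
  (forall B, B \in S -> exists l : 'I_m -> F, forall i j k,
     B i j k - B j i k = (j == k)%:R * l i - (i == k)%:R * l j).
Proof.
move=> st.
have [[B [a [c [b [BS [ac ab cb] Bab]]]]]|none] := pselect (exists B a c b,
    [/\ B \in S, [/\ a != c, a != b & c != b] & B a c b != B c a b]); [left|right].
  have Sall p q r : p != q -> p != r -> q != r -> e3 p q r - e3 q p r \in S.
    pose P p q r := e3 p q r - e3 q p r \in S.
    have P12 x y z : P x y z -> P y x z by rewrite /P -memvN opprB.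
    have P13 x y z : x != y -> x != z -> y != z -> P x y z -> P z y x.
      move=> xy xz yz Pxyz; apply: (mixed_extract_antisym st Pxyz) => //.
      rewrite !tensorE !eqxx (negPf xy) -subr_eq0 /=.
      by rewrite (_ : _ - _ = 2%:R); [rewrite pnatr_eq0 | ring].
    have Prep x y z t : x != y -> x != z -> y != z -> t != x -> t != y -> t != z ->
        P x y z -> P t y z.
      move=> xy xz yz tx ty tz Pxyz; rewrite /P.
      suff -> : e3 t y z - e3 y t z = shift t x (e3 x y z - e3 y x z).
        exact: shift_mixed_mem.
      apply: tensorP => i j k; rewrite shift_mixedE !tensorE !eqxx.
      by rewrite (negPf xy) (negPf tz) /=; ring.
    have start : P b c a := mixed_extract_antisym st BS ac ab cb Bab.
    have [bc ba ca] : [/\ b != c, b != a & c != a] by split; rewrite eq_sym.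
    exact: (triple_closure P12 P13 Prep bc ba ca start).
  move=> B' [sB tB]; apply: mem_by_pairing => L LS.
  pose G i j k := L i j k - L j i k.
  have [l GE] : exists l : 'I_m -> F, forall i j k,
      G i j k = (j == k)%:R * l i - (i == k)%:R * l j.
    apply: skew_pure_trace_form => i j k; first by rewrite /G opprB.
      move=> ij ik jk; have := LS _ (Sall _ _ _ ij ik jk).
      by rewrite pairingD pairingN !pairing_unit3.
    move=> ij ik jk; have := LS _ (shift_mixed_mem k j st (Sall _ _ _ ij ik jk)).
    suff -> : shift k j (e3 i j k - e3 j i k) =
        e3 i k k - e3 k i k - (e3 i j j - e3 j i j).
      rewrite !(pairingD, pairingN) !pairing_unit3 => /eqP.
      by rewrite subr_eq0 => /eqP /esym.
    apply: tensorP => x y z; rewrite shift_mixedE !tensorE !eqxx.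
    by rewrite (eq_sym j i) (negPf ij) /=; ring.
  have : pairing L B' *+ 2 = 0.
    have tB2 i : \sum_j B' j i j = 0.
      by under eq_bigr do rewrite sB; rewrite sumrN tB oppr0.
    rewrite -[RHS](sum_pure_trace l (-1) tB tB2).
    rewrite mulr2n {2}/pairing exchange_big -big_split; apply: eq_bigr => i _.
    rewrite -big_split; apply: eq_bigr => j _; rewrite -big_split; apply: eq_bigr => k _.
    by rewrite mulN1r -GE /G /= (sB j i) mulrBl mulrN.
  by move/eqP; rewrite mulrn_eq0 => /eqP.
move=> B BS.
have B3 B' a c b : B' \in S -> a != c -> a != b -> c != b -> B' a c b = B' c a b.
  move=> B'S ac ab cb; apply/eqP/contraT => nz; case: none.
  by exists B', a, c, b.
apply: skew_pure_trace_form => i j k; first by rewrite opprB.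
  by move=> ij ik jk; rewrite (B3 B) // subrr.
move=> ij ik jk; have kj : k != j by rewrite eq_sym.
have := B3 _ i k j (shift_mixed_mem k j st BS) ik ij kj.
rewrite !shift_mixedE !eqxx (negPf ik) !mul1r !mul0r add0r addr0 => /eqP.
by move/eqP => h; rewrite -[B i j j](subrK (B i k k)) h; ring.
Qed.

End MixedModels.

Lemma exists_hom (F : fieldType) (U V : vectType F) (f : U -> V) :
  (forall a x y, f (a *: x + y) = a *: f x + f y) ->
  exists h : 'Hom(U, V), forall x, h x = f x.
Proof.
move=> lin_f.
pose L : {linear U -> V} := HB.pack f (GRing.isLinear.Build F U V *:%R f lin_f).
by exists (linfun L) => x; rewrite lfunE.
Qed.

(** * Dimensions of the models as traces of explicit projectors *)

Section Dimensions.
Variables (F : numFieldType) (m : nat).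
Hypothesis m_gt2 : (2 < m)%N.
Local Notation tensor := {ffun 'I_m -> 'M[F]_m}.
Local Notation e3 := (@unit3 F m).
Implicit Types (B : tensor) (K : {vspace tensor}) (S : {vspace 'rV[F]_m}).

Lemma vector_irreducible S : (forall M v, v \in S -> v *m M^T \in S) ->
  S <> 0%VS -> S = fullv.
Proof.
move=> st Sn0; apply/eqP; rewrite eqEsubv subvf /=.
have [v [vS [a va]]] : exists v, v \in S /\ exists a, v 0 a != 0.
  apply: contrapT => none; apply: Sn0; apply/eqP; rewrite -subv0; apply/subvP => v vS.
  rewrite memv0; apply/eqP/rowP => a; rewrite mxE; apply/eqP/contraT => nz.
  by case: none; exists v; split => //; exists a.
apply/subvP => w _; rewrite [w]row_sum_delta; apply: memv_suml => b _.
apply: memvZ; suff : v 0 a *: delta_mx 0 b \in S.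
  by move/(memvZ (v 0 a)^-1); rewrite scalerK.
suff -> : v 0 a *: delta_mx 0 b = v *m (delta_mx b a)^T by exact: st.
apply/rowP => c; rewrite !mxE /= (bigD1 a) //= big1 ?addr0.
  by rewrite !mxE eqxx andbT eq_sym.
by move=> d /negPf da; rewrite !mxE da andbF mulr0.
Qed.

(** A linear map with values in [K] and equal to the identity on [K] has trace $\dim K$; the trace
    is taken in the basis of unit tensors and compared with the coordinates in a basis of [K]. *)
Lemma dim_projector K (f : tensor -> tensor) :
  (forall a x y, f (a *: x + y) = a *: f x + f y) ->
  (forall B, f B \in K) -> (forall B, B \in K -> f B = B) ->
  (\dim K)%:R = \sum_i \sum_j \sum_k f (e3 i j k) i j k.
Proof.
move=> /exists_hom[h hE] fK f_id; pose b := vbasis K.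
have pE t : pairing (fun i j k => coord b t (h (e3 i j k))) b`_t = 1.
  transitivity (coord b t (h b`_t)); last first.
    rewrite hE f_id ?vbasis_mem ?mem_nth ?size_tuple //.
    by rewrite coord_free ?eqxx // (basis_free (vbasisP K)).
  rewrite {2}[b`_t]sum_unit3 !linear_sum; apply: eq_bigr => i _.
  rewrite !linear_sum; apply: eq_bigr => j _; rewrite !linear_sum.
  by apply: eq_bigr => k _; rewrite !linearZ /= mulrC.
transitivity (\sum_(t < \dim K) pairing (fun i j k => coord b t (h (e3 i j k))) b`_t).
  by under eq_bigr do rewrite pE; rewrite sumr_const card_ord.
rewrite exchange_big; apply: eq_bigr => i _.
rewrite exchange_big; apply: eq_bigr => j _.
rewrite exchange_big; apply: eq_bigr => k _.
rewrite [in RHS](coord_vbasis (fK (e3 i j k))) sum_tensorE.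
by apply: eq_bigr => t _; rewrite tensorZ hE.
Qed.

Definition tr23 B (i : 'I_m) := \sum_j B i j j.
Definition tr13 B (i : 'I_m) := \sum_j B j i j.

Lemma tr23_lin a B B' i : tr23 (a *: B + B') i = a * tr23 B i + tr23 B' i.
Proof.
by rewrite /tr23 mulr_sumr -big_split; apply: eq_bigr => j _; rewrite !tensorE.
Qed.

Lemma tr13_lin a B B' i : tr13 (a *: B + B') i = a * tr13 B i + tr13 B' i.
Proof.
by rewrite /tr13 mulr_sumr -big_split; apply: eq_bigr => j _; rewrite !tensorE.
Qed.

Lemma tr23_unit i j k x : tr23 (e3 i j k) x = (x == i)%:R * (j == k)%:R.
Proof.
rewrite /tr23; under eq_bigr => l _ do rewrite unit3E -mulrA mulrCA.
by rewrite sum_delta.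
Qed.

Lemma tr13_unit i j k x : tr13 (e3 i j k) x = (x == j)%:R * (i == k)%:R.
Proof.
rewrite /tr13; under eq_bigr => l _ do rewrite unit3E -mulrA.
by rewrite sum_delta.
Qed.

Lemma sum3_delta (c0 c1 c2 c3 c4 : F) :
  \sum_(i < m) \sum_(j < m) \sum_(k < m) (c0 + c1 * (i == j)%:R + c2 * (j == k)%:R
    + c3 * (i == k)%:R + c4 * ((i == j)%:R * (j == k)%:R))
  = c0 * m%:R ^+ 3 + (c1 + c2 + c3) * m%:R ^+ 2 + c4 * m%:R.
Proof.
have s1 (i : 'I_m) (c : F) : \sum_(k < m) c * (i == k)%:R = c.
  by under eq_bigr do rewrite mulrC; rewrite sum_delta_sym.
have s0 (c : F) : \sum_(k < m) c = c * m%:R by rewrite sumr_const card_ord mulr_natr.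
transitivity (\sum_(i < m) \sum_(j < m)
    ((c0 * m%:R + c2 + c3) + (c1 * m%:R + c4) * (i == j)%:R)).
  apply: eq_bigr => i _; apply: eq_bigr => j _.
  under eq_bigr => k _ do rewrite mulrA.
  by rewrite !big_split /= !s0 !s1; ring.
under eq_bigr => i _ do rewrite big_split /= s0 s1.
by rewrite s0; ring.
Qed.

(** The delta term has trace [m - 1] times the trace of the skew part, hence the factor
    [(m - 1)^-1]; in [sym_proj] the corresponding number is [m + 1]. *)
Definition skew_proj B : tensor := [ffun i => \matrix_(j, k)
  (2^-1 * (B i j k - B j i k - (m%:R - 1)^-1 *
    ((j == k)%:R * (tr23 B i - tr13 B i) - (i == k)%:R * (tr23 B j - tr13 B j))))].

Definition sym_proj B : tensor := [ffun i => \matrix_(j, k)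
  (2^-1 * (B i j k + B j i k - (m%:R + 1)^-1 *
    ((j == k)%:R * (tr23 B i + tr13 B i) + (i == k)%:R * (tr23 B j + tr13 B j))))].

(** Skew-symmetrise in the last two slots, then remove the totally skew part. *)
Definition hook_proj B : tensor := [ffun i => \matrix_(j, k)
  (2^-1 * (B i j k - B i k j) - 6^-1 *
     (B i j k + B j k i + B k i j - B j i k - B i k j - B k j i))].

Lemma skew_projE B i j k : skew_proj B i j k =
  2^-1 * (B i j k - B j i k - (m%:R - 1)^-1 *
    ((j == k)%:R * (tr23 B i - tr13 B i) - (i == k)%:R * (tr23 B j - tr13 B j))).
Proof. by rewrite ffunE mxE. Qed.

Lemma sym_projE B i j k : sym_proj B i j k =
  2^-1 * (B i j k + B j i k - (m%:R + 1)^-1 *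
    ((j == k)%:R * (tr23 B i + tr13 B i) + (i == k)%:R * (tr23 B j + tr13 B j))).
Proof. by rewrite ffunE mxE. Qed.

Lemma hook_projE B i j k : hook_proj B i j k =
  2^-1 * (B i j k - B i k j) - 6^-1 *
     (B i j k + B j k i + B k i j - B j i k - B i k j - B k j i).
Proof. by rewrite ffunE mxE. Qed.

Lemma mem_hook B : B \in lspan (@hook F m) <-> hook B.
Proof.
apply: mem_lspan => [|a x y [x1 x2] [y1 y2]].
  by split=> i j k; rewrite !tensorE ?oppr0 ?addr0.
split=> i j k; rewrite !tensorE; first by rewrite x1 y1; ring.
rewrite (_ : _ + _ = a * (x i j k + x j k i + x k i j) + (y i j k + y j k i + y k i j)).
  by rewrite x2 y2 mulr0 addr0.
by ring.
Qed.

Lemma mem_skew_traceless B : B \in lspan (@skew_traceless F m) <-> skew_traceless B.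
Proof.
apply: mem_lspan => [|a x y [x1 x2] [y1 y2]].
  by split=> [i j k|i]; [rewrite !tensorE oppr0 | rewrite big1 // => j _; rewrite tensor0].
split=> [i j k|i]; first by rewrite !tensorE x1 y1; ring.
by rewrite -[LHS]/(tr23 _ i) tr23_lin /tr23 x2 y2 mulr0 addr0.
Qed.

Lemma mem_sym_traceless B : B \in lspan (@sym_traceless F m) <-> sym_traceless B.
Proof.
apply: mem_lspan => [|a x y [x1 x2] [y1 y2]].
  by split=> [i j k|i]; [rewrite !tensorE | rewrite big1 // => j _; rewrite tensor0].
split=> [i j k|i]; first by rewrite !tensorE x1 y1.
by rewrite -[LHS]/(tr23 _ i) tr23_lin /tr23 x2 y2 mulr0 addr0.
Qed.

Lemma natr_neq0 k : k.+1%:R != 0 :> F. Proof. by rewrite pnatr_eq0. Qed.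

Lemma m_sub1_neq0 : m%:R - 1 != 0 :> F.
Proof. by rewrite subr_eq0 pnatr_eq1; case: m m_gt2 => [|[]]. Qed.

Lemma m_add1_neq0 : m%:R + 1 != 0 :> F.
Proof. by rewrite -mulrSr pnatr_eq0. Qed.

Lemma m_neq0 : m%:R != 0 :> F.
Proof. by rewrite pnatr_eq0 -lt0n (ltn_trans _ m_gt2). Qed.

Lemma sum_const (c : F) : \sum_(k < m) c = c * m%:R.
Proof. by rewrite sumr_const card_ord mulr_natr. Qed.

Lemma skew_proj_traceless B : skew_traceless (skew_proj B).
Proof.
split=> [i j k|i]; first by rewrite !skew_projE; ring.
under eq_bigr do rewrite skew_projE.
rewrite -mulr_sumr !sumrB -mulr_sumr sumrB sum_delta_sym.
rewrite -/(tr23 B i) -/(tr13 B i); under eq_bigr => j _ do rewrite eqxx mul1r.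
rewrite sum_const; have := m_sub1_neq0; set a := tr23 B i; set b := tr13 B i => h.
by field.
Qed.

Lemma sym_proj_traceless B : sym_traceless (sym_proj B).
Proof.
split=> [i j k|i]; first by rewrite !sym_projE; ring.
under eq_bigr do rewrite sym_projE.
rewrite -mulr_sumr sumrB big_split -mulr_sumr big_split /= sum_delta_sym.
rewrite -/(tr23 B i) -/(tr13 B i); under eq_bigr => j _ do rewrite eqxx mul1r.
rewrite sum_const; have := m_add1_neq0; set a := tr23 B i; set b := tr13 B i => h.
by field.
Qed.

Lemma skew_traceless_tr B i : skew_traceless B -> (tr23 B i = 0) * (tr13 B i = 0).
Proof.
case=> sB tB; split; first exact: tB.
by rewrite /tr13; under eq_bigr do rewrite sB; rewrite sumrN tB oppr0.
Qed.

Lemma sym_traceless_tr B i : sym_traceless B -> (tr23 B i = 0) * (tr13 B i = 0).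
Proof.
case=> sB tB; split; first exact: tB.
by rewrite /tr13; under eq_bigr do rewrite sB; rewrite tB.
Qed.

Lemma skew_proj_id B : skew_traceless B -> skew_proj B = B.
Proof.
move=> hB; apply: tensorP => i j k; rewrite skew_projE !(skew_traceless_tr _ hB).
by rewrite (hB.1 j i); have h := m_sub1_neq0; field.
Qed.

Lemma sym_proj_id B : sym_traceless B -> sym_proj B = B.
Proof.
move=> hB; apply: tensorP => i j k; rewrite sym_projE !(sym_traceless_tr _ hB).
by rewrite (hB.1 j i); have h := m_add1_neq0; field.
Qed.

Lemma hook_proj_hook B : hook (hook_proj B).
Proof. by split=> i j k; rewrite !hook_projE; field. Qed.

Lemma hook_proj_id B : hook B -> hook_proj B = B.
Proof.
move=> [as_B cyc_B]; apply: tensorP => i j k; rewrite hook_projE.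
rewrite (as_B i k j) (as_B j i k) (as_B k j i).
have := cyc_B i j k; rewrite -addrA => /eqP; rewrite addr_eq0 => /eqP ->.
by field.
Qed.

Lemma skew_proj_lin a B B' : skew_proj (a *: B + B') = a *: skew_proj B + skew_proj B'.
Proof.
by apply: tensorP => i j k; rewrite !(tensorE, skew_projE, tr23_lin, tr13_lin); ring.
Qed.

Lemma sym_proj_lin a B B' : sym_proj (a *: B + B') = a *: sym_proj B + sym_proj B'.
Proof.
by apply: tensorP => i j k; rewrite !(tensorE, sym_projE, tr23_lin, tr13_lin); ring.
Qed.

Lemma hook_proj_lin a B B' : hook_proj (a *: B + B') = a *: hook_proj B + hook_proj B'.
Proof. by apply: tensorP => i j k; rewrite !(tensorE, hook_projE); ring. Qed.

(** All projectors here are natural in the indices, so their diagonal entries depend only on which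
    indices coincide; the dimension becomes a polynomial in [m] with these coefficients. *)
Lemma dim_projector_unit K (f : tensor -> tensor) (c0 c1 c2 c3 c4 : F) :
  (forall a x y, f (a *: x + y) = a *: f x + f y) ->
  (forall B, f B \in K) -> (forall B, B \in K -> f B = B) ->
  (forall i j k, f (e3 i j k) i j k = c0 + c1 * (i == j)%:R + c2 * (j == k)%:R
    + c3 * (i == k)%:R + c4 * ((i == j)%:R * (j == k)%:R)) ->
  (\dim K)%:R = c0 * m%:R ^+ 3 + (c1 + c2 + c3) * m%:R ^+ 2 + c4 * m%:R.
Proof.
move=> fl fK f_id fE; rewrite (dim_projector fl fK f_id) -sum3_delta.
by apply: eq_bigr => i _; apply: eq_bigr => j _; apply: eq_bigr => k _.
Qed.

Ltac delta_cases i j k :=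
  rewrite ?(eq_sym j i) ?(eq_sym k j) ?(eq_sym k i) ?eqxx;
  let e := fresh "e" in let d := fresh "d" in let d' := fresh "d'" in
  have [e|d] := eqVneq i j;
    [subst i; have [e|d'] := eqVneq j k; [subst j|]
    | have [e|d'] := eqVneq j k; [subst j; rewrite (negPf d)|have [e|?] := eqVneq i k]];
  rewrite ?eqxx /=.

Lemma dim_hook : (3 * \dim (lspan (@hook F m)) = m * (m ^ 2 - 1))%N.
Proof.
have h : (\dim (lspan (@hook F m)))%:R =
    (3^-1) * m%:R ^+ 3 + (6^-1 + - 3^-1 + 6^-1) * m%:R ^+ 2 + (- 3^-1) * m%:R :> F.
  apply: (dim_projector_unit hook_proj_lin).
  - by move=> B; apply/mem_hook/hook_proj_hook.
  - by move=> B /mem_hook/hook_proj_id.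
  by move=> i j k; rewrite hook_projE !unit3E; delta_cases i j k; field.
apply/eqP; rewrite -(eqr_nat F) !natrM natrB ?expn_gt0 ?(ltn_trans _ m_gt2) //.
by rewrite natrX h; apply/eqP; field.
Qed.

Lemma dim_skew_traceless :
  (2 * \dim (lspan (@skew_traceless F m)) = m * (m - 2) * (m + 1))%N.
Proof.
have h0 := m_sub1_neq0.
pose c : F := (m%:R - 1)^-1 / 2.
have h : (\dim (lspan (@skew_traceless F m)))%:R =
    2^-1 * m%:R ^+ 3 + (- 2^-1 + - c + - c) * m%:R ^+ 2 + (2 * c) * m%:R :> F.
  apply: (dim_projector_unit skew_proj_lin).
  - by move=> B; apply/mem_skew_traceless/skew_proj_traceless.
  - by move=> B /mem_skew_traceless/skew_proj_id.
  move=> i j k; rewrite skew_projE !unit3E !tr23_unit !tr13_unit /c.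
  by delta_cases i j k; field.
apply/eqP; rewrite -(eqr_nat F) !natrM natrB ?(ltnW m_gt2) // natrD.
by rewrite h /c; apply/eqP; field.
Qed.

Lemma dim_sym_traceless :
  (2 * \dim (lspan (@sym_traceless F m)) = m * (m + 2) * (m - 1))%N.
Proof.
have h0 := m_add1_neq0.
pose c : F := (m%:R + 1)^-1 / 2.
have h : (\dim (lspan (@sym_traceless F m)))%:R =
    2^-1 * m%:R ^+ 3 + (2^-1 + - c + - c) * m%:R ^+ 2 + (- 2 * c) * m%:R :> F.
  apply: (dim_projector_unit sym_proj_lin).
  - by move=> B; apply/mem_sym_traceless/sym_proj_traceless.
  - by move=> B /mem_sym_traceless/sym_proj_id.
  move=> i j k; rewrite sym_projE !unit3E !tr23_unit !tr13_unit /c.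
  by delta_cases i j k; field.
apply/eqP; rewrite -(eqr_nat F) !natrM natrB ?(ltn_trans _ m_gt2) // natrD.
by rewrite h /c; apply/eqP; field.
Qed.

(** [skew23] and [traceless23] model the full tensor products $V\otimes\wedge^2V$ and $V\otimes
    sl(V)$, whose dimensions are compared with those of the irreducible models to recognise Cartan
    products. *)
Definition skew23 B : Prop := forall i j k, B i j k = - B i k j.

Definition traceless23 B : Prop := forall i, tr23 B i = 0.

Lemma mem_skew23 B : B \in lspan skew23 <-> skew23 B.
Proof.
apply: mem_lspan => [|a x y hx hy] i j k; rewrite !tensorE ?oppr0 //.
by rewrite hx hy; ring.
Qed.

Lemma mem_traceless23 B : B \in lspan traceless23 <-> traceless23 B.
Proof.
apply: mem_lspan => [i|a x y hx hy i].
  by rewrite /tr23 big1 // => j _; rewrite tensor0.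
by rewrite tr23_lin hx hy mulr0 addr0.
Qed.

Lemma dim_skew23 : (2 * \dim (lspan skew23) = m * (m * (m - 1)))%N.
Proof.
pose f B : tensor := [ffun i => \matrix_(j, k) (2^-1 * (B i j k - B i k j))].
have fE B i j k : f B i j k = 2^-1 * (B i j k - B i k j) by rewrite ffunE mxE.
have h : (\dim (lspan skew23))%:R =
    2^-1 * m%:R ^+ 3 + (0 + - 2^-1 + 0) * m%:R ^+ 2 + 0 * m%:R :> F.
  apply: (@dim_projector_unit _ f).
  - by move=> a x y; apply: tensorP => i j k; rewrite !(tensorE, fE); ring.
  - by move=> B; apply/mem_skew23 => i j k; rewrite !fE; ring.
  - move=> B /mem_skew23 hB; apply: tensorP => i j k; rewrite fE (hB i k j).
    by field.
  by move=> i j k; rewrite fE !unit3E; delta_cases i j k; field.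
apply/eqP; rewrite -(eqr_nat F) !natrM natrB ?(ltn_trans _ m_gt2) //.
by rewrite h; apply/eqP; field.
Qed.

Lemma dim_traceless23 : (\dim (lspan traceless23) = m * (m * m - 1))%N.
Proof.
have h0 := m_neq0.
pose f B : tensor := [ffun i => \matrix_(j, k)
  (B i j k - m%:R^-1 * ((j == k)%:R * tr23 B i))].
have fE B i j k : f B i j k = B i j k - m%:R^-1 * ((j == k)%:R * tr23 B i).
  by rewrite ffunE mxE.
have h : (\dim (lspan traceless23))%:R =
    1 * m%:R ^+ 3 + (0 + - m%:R^-1 + 0) * m%:R ^+ 2 + 0 * m%:R :> F.
  apply: (@dim_projector_unit _ f).
  - by move=> a x y; apply: tensorP => i j k; rewrite !(tensorE, fE, tr23_lin); ring.
  - move=> B; apply/mem_traceless23 => i; rewrite /tr23.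
    under eq_bigr do rewrite fE eqxx mul1r.
    by rewrite sumrB sum_const -/(tr23 B i); field.
  - move=> B /mem_traceless23 hB; apply: tensorP => i j k; rewrite fE hB.
    by rewrite !mulr0 subr0.
  by move=> i j k; rewrite fE !unit3E !tr23_unit; delta_cases i j k; field.
apply/eqP; rewrite -(eqr_nat F) !natrM natrB ?muln_gt0 ?(ltn_trans _ m_gt2) //.
by rewrite h natrM; apply/eqP; field.
Qed.
End Dimensions.

(** * Clifford multiplication and the frame adapted to the pure spinor *)

Section DualBasis.
Variables (F : numFieldType) (n sp sm : nat).
Variable g : 'M[F]_n.
Variables (gam : 'I_n -> 'M[F]_(sp, sm)) (gam' : 'I_n -> 'M[F]_(sm, sp)).
Variable xi : 'rV[F]_sp.
Hypothesis g_metric : nondegenerate_symmetric g.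
Hypothesis gam_clifford : clifford_relations g gam gam'.
Implicit Types (u v w : 'rV[F]_n).

Lemma formDl u v w : form g (u + v) w = form g u w + form g v w.
Proof. by rewrite /form !mulmxDl mxE. Qed.

Lemma formZl a u w : form g (a *: u) w = a * form g u w.
Proof. by rewrite /form -!scalemxAl mxE. Qed.

Lemma form_sym u v : form g u v = form g v u.
Proof.
rewrite /form -[in LHS](trmxK (u *m g *m v^T)) mxE.
by rewrite !trmx_mul trmxK g_metric.1 mulmxA.
Qed.

Lemma form_suml (I : finType) (x : I -> F) (e : I -> 'rV[F]_n) w :
  form g (\sum_i x i *: e i) w = \sum_i x i * form g (e i) w.
Proof.
rewrite /form !mulmx_suml summxE; apply: eq_bigr => i _.
by rewrite -!scalemxAl mxE.
Qed.

Lemma form_sumr (I : finType) (x : I -> F) (e : I -> 'rV[F]_n) w :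
  form g w (\sum_i x i *: e i) = \sum_i x i * form g w (e i).
Proof. by rewrite form_sym form_suml; under eq_bigr do rewrite form_sym. Qed.

Lemma form_nondegenerate u : (forall w, form g u w = 0) -> u = 0.
Proof.
move=> h; suff ug : u *m g = 0 by rewrite -(mulmxK g_metric.2 u) ug mul0mx.
apply/rowP => j; rewrite !mxE -[RHS](h (delta_mx 0 j)) /form trmx_delta.
by rewrite -colE !mxE.
Qed.

Definition slash p q (c : 'I_n -> 'M[F]_(p, q)) v : 'M[F]_(p, q) :=
  \sum_a v 0 a *: c a.

Lemma formE u v : form g u v = \sum_a \sum_b u 0 a * v 0 b * g a b.
Proof.
rewrite /form mxE exchange_big; apply: eq_bigr => b _; rewrite !mxE mulr_suml.
by apply: eq_bigr => a _; rewrite mulrAC.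
Qed.

Lemma slash_clifford p q (c : 'I_n -> 'M[F]_(p, q)) (c' : 'I_n -> 'M[F]_(q, p)) u v :
  (forall a b, 2^-1 *: (c a *m c' b + c b *m c' a) = - (g a b *: 1%:M)) ->
  slash c u *m slash c' v = - (slash c v *m slash c' u) - (2 * form g u v) *: 1%:M.
Proof.
move=> hc.
have E x y : slash c x *m slash c' y = \sum_a \sum_b (x 0 a * y 0 b) *: (c a *m c' b).
  rewrite /slash mulmx_suml; apply: eq_bigr => a _; rewrite mulmx_sumr.
  by apply: eq_bigr => b _; rewrite -scalemxAl -scalemxAr scalerA.
apply/eqP; rewrite -subr_eq0 opprD !opprK addrA; apply/eqP.
rewrite !E [X in _ + X + _]exchange_big formE mulr_sumr scaler_suml -!big_split big1 //= => a _.
rewrite mulr_sumr scaler_suml -!big_split big1 //= => b _.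
rewrite [v 0 b * _]mulrC -scalerDr -[X in _ *: X](scalerK (invr_neq0 _ : 2^-1 != 0)).
  by rewrite hc invrK scalerN scalerA scalerN scalerA mulrCA mulrA addNr.
by rewrite pnatr_eq0.
Qed.

Lemma slash_rowE p q (c : 'I_n -> 'M[F]_(p, q)) (x : 'rV[F]_p) v A :
  (x *m slash c v) 0 A = \sum_a v 0 a * (x *m c a) 0 A.
Proof.
rewrite /slash mulmx_sumr summxE; apply: eq_bigr => a _.
by rewrite -scalemxAr mxE.
Qed.

Lemma mem_Vplus v : v \in Vplus gam xi <-> xi *m slash gam v = 0.
Proof.
have -> : (xi *m slash gam v = 0) <-> (forall A, \sum_a v 0 a * xi1l gam xi a A = 0).
  split=> [h A|h]; first by rewrite -slash_rowE h mxE.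
  by apply/rowP => A; rewrite slash_rowE h mxE.
apply: mem_lspan => [A|a x y hx hy A]; first by rewrite big1 // => a _; rewrite mxE mul0r.
rewrite (eq_bigr (fun i => a * (x 0 i * xi1l gam xi i A) + y 0 i * xi1l gam xi i A)).
  by rewrite big_split -mulr_sumr /= hx hy mulr0 addr0.
by move=> i _; rewrite !mxE mulrDl mulrA.
Qed.

(** Apply the Clifford relation for [u] and [v] to [xi]: both products vanish, leaving a multiple of
    the nonzero spinor. *)
Lemma Vplus_null : xi != 0 -> {in Vplus gam xi &, forall u v, form g u v = 0}.
Proof.
move=> xi0 u v /mem_Vplus hu /mem_Vplus hv.
have := congr1 (mulmx xi) (@slash_clifford _ _ gam gam' u v (fun a b => (gam_clifford a b).1)).
rewrite mulmxA hu mul0mx mulmxBr mulmxN mulmxA hv mul0mx oppr0 sub0r.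
rewrite -scalemxAr mulmx1 => /esym/eqP; rewrite oppr_eq0 scaler_eq0 (negPf xi0) orbF.
by rewrite mulf_eq0 pnatr_eq0 /= => /eqP.
Qed.

Lemma vspace_coordinates (U : {vspace 'rV[F]_n}) d : \dim U = d ->
  exists e : 'I_d -> 'rV[F]_n, [/\ forall i, e i \in U,
    forall x : 'I_d -> F, \sum_i x i *: e i = 0 -> forall i, x i = 0
    & forall v, v \in U -> exists x : 'I_d -> F, v = \sum_i x i *: e i].
Proof.
move=> <-; exists (fun i => (vbasis U)`_i); split=> [i|x|v vU].
- by rewrite vbasis_mem ?mem_nth ?size_tuple.
- by apply/freeP; exact: basis_free (vbasisP U).
by exists (fun i => coord (vbasis U) i v); exact: coord_vbasis.
Qed.

Variables (m : nat) (Vm : {vspace 'rV[F]_n}).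
Hypothesis n_def : n = m.*2.
Hypothesis xi_pure : pure_spinor gam xi m.
Hypothesis Vm_compl : null_complement g gam xi Vm.
Local Notation V_ := (Vhalf gam xi Vm).

(** [E true] spans $V_{1/2}$ and [E false] spans $V_{-1/2}$. The first clause says that each of them
    is its own orthogonal space; the dual vector of [E s i] is [E (~~ s) i]. *)
Definition dual_basis (E : bool -> 'I_m -> 'rV[F]_n) : Prop :=
  [/\ forall s v, v \in V_ s <-> forall i, form g v (E s i) = 0,
      forall s t i j, form g (E s i) (E t j) = ((s != t) && (i == j))%:R
    & forall v, v = \sum_s \sum_i form g v (E (~~ s) i) *: E s i].

Lemma Vhalf_null s : {in V_ s &, forall u v, form g u v = 0}.
Proof.
by case: s => /=; [exact: Vplus_null xi_pure.1 | case: Vm_compl].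
Qed.

(** Two complementary null subspaces of dimension [m] are put in duality by a nondegenerate form, so
    any basis of one has a dual basis in the other. *)
Lemma dual_basis_exists : exists E, dual_basis E.
Proof.
have [xi0 dimp] := xi_pure; have [Vm0 Vsum Vcap] := Vm_compl.
have dimm : \dim Vm = m.
  have := dimv_disjoint_sum Vcap; rewrite Vsum dimvf /dim /= dimp mul1n => dim_sum.
  by apply: (@addnI m); rewrite -dim_sum addnn.
have [e [eV e_free e_span]] := vspace_coordinates dimp.
have [f [fV f_free f_span]] := vspace_coordinates dimm.
have null0 u : (forall w, w \in Vplus gam xi -> form g u w = 0) ->
    (forall w, w \in Vm -> form g u w = 0) -> u = 0.
  move=> hp hm; apply: form_nondegenerate => w.
  have /memv_addP[w1 w1p [w2 w2m ->]] : w \in (Vplus gam xi + Vm)%VS by rewrite Vsum memvf.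
  by rewrite form_sym formDl !(form_sym _ u) hp // hm // addr0.
pose P : 'M[F]_m := \matrix_(i, j) form g (e i) (f j).
(* A row vector killed by the Gram matrix gives a vector of $V_{1/2}$ orthogonal to $V_{-1/2}$, and
   to $V_{1/2}$ by nullity; hence it is zero. *)
have Pu : P \in unitmx.
  rewrite -row_free_unit -kermx_eq0; apply/rowV0P => x /sub_kermxP xP.
  apply/rowP => i; rewrite mxE; apply: (e_free (fun i => x 0 i)).
  apply: null0 => [w wV|w /f_span[y ->]].
    apply: (Vplus_null xi0) => //; apply: memv_suml => j _; exact: memvZ.
  rewrite form_sumr big1 // => j _; rewrite form_suml.
  have := congr1 (fun A : 'rV[F]_m => A 0 j) xP; rewrite !mxE => xPj.
  rewrite (eq_bigr (fun k => x 0 k * P k j)) ?xPj ?mulr0 // => k _.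
  by rewrite !mxE.
(* The inverse Gram matrix corrects [f] to the basis dual to [e]. *)
pose h j := \sum_k (invmx P) k j *: f k.
have hV j : h j \in Vm by apply: memv_suml => k _; exact: memvZ.
have eh i j : form g (e i) (h j) = (i == j)%:R.
  rewrite form_sumr; have := congr1 (fun A : 'M[F]_m => A i j) (mulmxV Pu); rewrite !mxE => <-.
  by apply: eq_bigr => k _; rewrite !mxE mulrC.
pose E (s : bool) := if s then e else h.
have EV s i : E s i \in V_ s by case: s => /=; [exact: eV | exact: hV].
have EE s t i j : form g (E s i) (E t j) = ((s != t) && (i == j))%:R.
  have [->|st] := eqVneq s t; first by rewrite (Vhalf_null (EV t i) (EV t j)).
  case: s t st => [] [] // _; last by rewrite /E form_sym eh eq_sym.
have dec v s : v \in V_ s -> v = \sum_i form g v (E (~~ s) i) *: E s i.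
  have aux t u : (forall i, form g (u - \sum_i form g u (E (~~ t) i) *: E t i) (E (~~ t) i) = 0).
    move=> i; rewrite formDl -scaleN1r formZl form_suml mulN1r.
    rewrite (eq_bigr (fun j => (j == i)%:R * form g u (E (~~ t) j))) ?sum_delta ?subrr //.
    by move=> j _; rewrite EE mulrC; case: (t).
  have hVd t u : u \in V_ t -> u - \sum_i form g u (E (~~ t) i) *: E t i \in V_ t.
    by move=> uV; rewrite memvB // memv_suml // => i _; rewrite memvZ.
  have decm u : u \in Vm -> u = \sum_i form g u (e i) *: h i.
    move=> uV; apply/eqP; rewrite -subr_eq0; apply/eqP; apply: null0.
      move=> w /e_span[x ->]; rewrite form_sumr big1 // => i _.
      by rewrite (aux false u i) mulr0.
    by move=> w; apply: (@Vhalf_null false) (hVd false u uV).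
  case: s => vV /=; last exact: decm.
  apply/eqP; rewrite -subr_eq0; apply/eqP; apply: null0.
    by move=> w; apply: (@Vhalf_null true) (hVd true v vV).
  move=> w /decm ->; rewrite form_sumr big1 // => i _.
  by rewrite (aux true v i) mulr0.
have full v : v = \sum_s \sum_i form g v (E (~~ s) i) *: E s i.
  have /memv_addP[w1 w1p [w2 w2m ->]] : v \in (Vplus gam xi + Vm)%VS by rewrite Vsum memvf.
  rewrite big_bool /= [in LHS](dec w1 true) // [in LHS](dec w2 false) //=.
  congr (_ + _); apply: eq_bigr => i _; rewrite formDl.
    by rewrite (@Vhalf_null false _ _ w2m (EV false i)) addr0.
  by rewrite (@Vhalf_null true _ _ w1p (EV true i)) add0r.
exists E; split => // s v; split=> [vV i|hv]; first exact: Vhalf_null vV (EV s i).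
rewrite (full v); apply: memv_suml => t _; apply: memv_suml => i _.
have [->|ts] := eqVneq t s; first exact: memvZ.
suff -> : ~~ t = s by rewrite hv scale0r mem0v.
by case: t s ts {hv} => [] [].
Qed.

End DualBasis.

(** * Coordinates of vectors, two-forms and three-tensors in the frame *)

Section Coordinates.
Variables (F : numFieldType) (n sp sm m : nat).
Variable g : 'M[F]_n.
Variables (gam : 'I_n -> 'M[F]_(sp, sm)) (gam' : 'I_n -> 'M[F]_(sm, sp)).
Variables (xi : 'rV[F]_sp) (Vm : {vspace 'rV[F]_n}).
Hypothesis g_metric : nondegenerate_symmetric g.
Variable E : bool -> 'I_m -> 'rV[F]_n.
Hypothesis E_dual : dual_basis g gam xi Vm E.
Local Notation V_ := (Vhalf gam xi Vm).
Local Notation tensor := {ffun 'I_n -> 'M[F]_n}.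
Local Notation low := (lower g).
Implicit Types (u v w : 'rV[F]_n) (M phi psi : 'M[F]_n) (X Y : tensor).

Lemma form_lin a M M' u v : form (a *: M + M') u v = a * form M u v + form M' u v.
Proof.
by rewrite /form mulmxDr mulmxDl -scalemxAr -scalemxAl !mxE.
Qed.

Lemma form0 u v : form 0 u v = 0.
Proof. by rewrite /form mulmx0 mul0mx mxE. Qed.

Lemma form_sum (I : Type) (r : seq I) (P : pred I) (f : I -> 'M[F]_n) u v :
  form (\sum_(x <- r | P x) f x) u v = \sum_(x <- r | P x) form (f x) u v.
Proof. by rewrite /form mulmx_sumr mulmx_suml summxE. Qed.

Lemma form_outer u v w w' :
  form ((low u)^T *m low v) w w' = form g u w * form g v w'.
Proof.
rewrite /form mulmxA -mulmxA mxE big_ord1; congr (_ * _).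
by rewrite -[w in w *m _]trmxK -trmx_mul mxE.
Qed.

Lemma E_form s t i j : form g (E s i) (E t j) = ((s != t) && (i == j))%:R.
Proof. by case: E_dual. Qed.

Lemma E_form' s t i j : form g (E s i) (E (~~ t) j) = (s == t)%:R * (i == j)%:R.
Proof. by rewrite E_form -natrM mulnb; case: s t => [] []. Qed.

Lemma E_mem s i : E s i \in V_ s.
Proof.
by have [hV _ _] := E_dual; apply/hV => j; rewrite E_form eqxx.
Qed.

Lemma sum_dual (f : bool -> 'I_m -> F) s i :
  \sum_t \sum_j (t == s)%:R * (j == i)%:R * f t j = f s i.
Proof.
rewrite (bigD1 s) //= eqxx [X in _ + X]big1 ?addr0.
  by under eq_bigr do rewrite mul1r; exact: sum_delta.
by move=> t /negPf ->; rewrite big1 // => j _; rewrite !mul0r.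
Qed.

Lemma E_decomp v : v = \sum_s \sum_i form g v (E (~~ s) i) *: E s i.
Proof. by case: E_dual. Qed.

Lemma delta_decomp a : delta_mx 0 a = \sum_s \sum_i low (E (~~ s) i) 0 a *: E s i.
Proof.
rewrite [LHS]E_decomp; apply: eq_bigr => s _; apply: eq_bigr => i _; congr (_ *: _).
by rewrite (form_sym g_metric) /form trmx_delta -colE mxE.
Qed.

(** The right-hand side is checked to be inverse to [g] row by row, from the expansion of the
    standard basis in the frame. It is the reason why index contraction flips the label [s]
    everywhere below. *)
Lemma ginv_decomp : ginv g = \sum_s \sum_i (E s i)^T *m E (~~ s) i.
Proof.
have h : g *m (\sum_s \sum_i (E s i)^T *m E (~~ s) i) = 1%:M.
  have gE u a : row a g *m u^T = (low u 0 a)%:M.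
    rewrite [LHS]mx11_scalar; congr _%:M; rewrite /lower !mxE; apply: eq_bigr => j _.
    by rewrite !mxE mulrC -[in LHS]g_metric.1 mxE.
  apply/row_matrixP => a; rewrite row_mul row1 delta_decomp mulmx_sumr !big_bool /= addrC.
  by congr (_ + _); rewrite mulmx_sumr; apply: eq_bigr => i _;
    rewrite mulmxA gE mul_scalar_mx.
by rewrite /ginv -[LHS]mulmx1 -h mulKmx // g_metric.2.
Qed.

Definition slice u X : 'M[F]_n := \sum_a u 0 a *: X a.

Definition tri X u v w : F := form (slice u X) v w.

(** Evaluating on the opposite labels extracts the coefficient of [E s i], [E t j], [E r k], so that
    the labels name the factors $V_{\pm1/2}$ in which the coordinate lives. *)
Definition coord3 X s t r i j k : F := tri X (E (~~ s) i) (E (~~ t) j) (E (~~ r) k).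
Local Notation cf := coord3.

Definition coord2 phi s t i j : F := form phi (E (~~ s) i) (E (~~ t) j).
Local Notation cP := coord2.

Lemma slice_lin u a X Y : slice u (a *: X + Y) = a *: slice u X + slice u Y.
Proof.
rewrite /slice scaler_sumr -big_split; apply: eq_bigr => b _.
by rewrite !ffunE scalerDr !scalerA mulrC.
Qed.

Lemma cf_lin a X Y s t r i j k :
  cf (a *: X + Y) s t r i j k = a * cf X s t r i j k + cf Y s t r i j k.
Proof. by rewrite /cf /tri slice_lin form_lin. Qed.

Lemma cf0 s t r i j k : cf 0 s t r i j k = 0.
Proof.
by rewrite /cf /tri /slice big1 ?form0 // => a _; rewrite ffunE scaler0.
Qed.

Lemma cfD X Y s t r i j k : cf (X + Y) s t r i j k = cf X s t r i j k + cf Y s t r i j k.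
Proof. by rewrite -[X]scale1r cf_lin mul1r scale1r. Qed.

Lemma cfZ a X s t r i j k : cf (a *: X) s t r i j k = a * cf X s t r i j k.
Proof. by rewrite -[a *: X]addr0 cf_lin cf0 addr0. Qed.

Lemma cfB X Y s t r i j k : cf (X - Y) s t r i j k = cf X s t r i j k - cf Y s t r i j k.
Proof. by rewrite cfD -scaleN1r cfZ mulN1r. Qed.

Lemma cf_sum (I : Type) (l : seq I) (P : pred I) (f : I -> tensor) s t r i j k :
  cf (\sum_(x <- l | P x) f x) s t r i j k = \sum_(x <- l | P x) cf (f x) s t r i j k.
Proof.
by elim/big_rec2: _ => [|x y z _ <-]; rewrite ?cf0 ?cfD.
Qed.

Lemma cP_lin a phi psi s t i j :
  cP (a *: phi + psi) s t i j = a * cP phi s t i j + cP psi s t i j.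
Proof. exact: form_lin. Qed.

Lemma cP0 s t i j : cP 0 s t i j = 0.
Proof. exact: form0. Qed.

Lemma cPZ a phi s t i j : cP (a *: phi) s t i j = a * cP phi s t i j.
Proof. by rewrite -[a *: phi]addr0 cP_lin cP0 addr0. Qed.

Lemma cPD phi psi s t i j : cP (phi + psi) s t i j = cP phi s t i j + cP psi s t i j.
Proof. by rewrite -[phi]scale1r cP_lin mul1r scale1r. Qed.

Lemma cPB phi psi s t i j : cP (phi - psi) s t i j = cP phi s t i j - cP psi s t i j.
Proof. by rewrite cPD -scaleN1r cPZ mulN1r. Qed.

Lemma form_mul_tr M M' u v : form (M *m M') u v = form M' (u *m M) v.
Proof. by rewrite /form !mulmxA. Qed.

Lemma form_trmx M u v : form M^T u v = form M v u.
Proof.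
by rewrite /form -{1}[u]trmxK -!trmx_mul mxE mulmxA.
Qed.

Lemma form_mulr_tr M M' u v : form (M' *m M^T) u v = form M' u (v *m M).
Proof. by rewrite /form trmx_mul !mulmxA. Qed.

Lemma mul_ginv phi u :
  u *m (phi *m ginv g) = \sum_s \sum_l form phi u (E s l) *: E (~~ s) l.
Proof.
rewrite ginv_decomp !mulmx_sumr; apply: eq_bigr => s _.
rewrite !mulmx_sumr; apply: eq_bigr => l _.
by rewrite !mulmxA [X in X *m _]mx11_scalar mul_scalar_mx.
Qed.

Lemma slice_tact phi X u (phi' := phi *m ginv g) :
  slice u (tact g phi X) = slice (u *m phi') X + phi' *m slice u X + slice u X *m phi'^T.
Proof.
rewrite /slice /tact -/phi'; clearbody phi'; rewrite mulmx_sumr mulmx_suml.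
have -> : \sum_a (u *m phi') 0 a *: X a = \sum_a u 0 a *: \sum_d phi' a d *: X d.
  under [RHS]eq_bigr do rewrite scaler_sumr; rewrite exchange_big; apply: eq_bigr => d _.
  by rewrite mxE scaler_suml; apply: eq_bigr => a _; rewrite scalerA.
rewrite -!big_split; apply: eq_bigr => a _ /=.
rewrite -scalemxAr -scalemxAl -!scalerDr; congr (_ *: _).
apply/matrixP => b c; rewrite ffunE !mxE !big_split /= summxE; congr (_ + _ + _).
- by apply: eq_bigr => d _; rewrite mxE.
by apply: eq_bigr => d _; rewrite mxE mulrC.
Qed.

Lemma slice_sum X (I : Type) (l : seq I) (x : I -> F) (e : I -> 'rV[F]_n) :
  slice (\sum_(i <- l) x i *: e i) X = \sum_(i <- l) x i *: slice (e i) X.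
Proof.
rewrite /slice; under [RHS]eq_bigr do rewrite scaler_sumr.
rewrite exchange_big; apply: eq_bigr => a _; rewrite summxE scaler_suml.
by apply: eq_bigr => i _; rewrite mxE scalerA.
Qed.

Lemma tri1_sum X (I : Type) (l : seq I) (x : I -> F) (e : I -> 'rV[F]_n) v w :
  tri X (\sum_(i <- l) x i *: e i) v w = \sum_(i <- l) x i * tri X (e i) v w.
Proof.
rewrite /tri slice_sum form_sum; apply: eq_bigr => i _.
by rewrite -[_ *: _]addr0 form_lin form0 addr0.
Qed.

Lemma form2_sum M (I : Type) (l : seq I) (x : I -> F) (e : I -> 'rV[F]_n) w :
  form M (\sum_(i <- l) x i *: e i) w = \sum_(i <- l) x i * form M (e i) w.
Proof.
rewrite /form !mulmx_suml summxE; apply: eq_bigr => i _.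
by rewrite -!scalemxAl mxE.
Qed.

Lemma form3_sum M (I : Type) (l : seq I) (x : I -> F) (e : I -> 'rV[F]_n) w :
  form M w (\sum_(i <- l) x i *: e i) = \sum_(i <- l) x i * form M w (e i).
Proof. by rewrite -form_trmx form2_sum; under eq_bigr do rewrite form_trmx. Qed.

Lemma double_sum (V : lmodType F) (x : bool -> 'I_m -> F) (e : bool -> 'I_m -> V) :
  \sum_s \sum_i x s i *: e s i = \sum_p x p.1 p.2 *: e p.1 p.2.
Proof. by rewrite pair_big. Qed.

Lemma tri1_sum2 X (x : bool -> 'I_m -> F) (e : bool -> 'I_m -> 'rV[F]_n) v w :
  tri X (\sum_s \sum_i x s i *: e s i) v w = \sum_s \sum_i x s i * tri X (e s i) v w.
Proof. by rewrite double_sum tri1_sum pair_big. Qed.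

Lemma form2_sum2 M (x : bool -> 'I_m -> F) (e : bool -> 'I_m -> 'rV[F]_n) w :
  form M (\sum_s \sum_i x s i *: e s i) w = \sum_s \sum_i x s i * form M (e s i) w.
Proof. by rewrite double_sum form2_sum pair_big. Qed.

Lemma form3_sum2 M (x : bool -> 'I_m -> F) (e : bool -> 'I_m -> 'rV[F]_n) w :
  form M w (\sum_s \sum_i x s i *: e s i) = \sum_s \sum_i x s i * form M w (e s i).
Proof.
rewrite -form_trmx form2_sum2; apply: eq_bigr => s _; apply: eq_bigr => i _.
by rewrite form_trmx.
Qed.

(** The index of [phi] contracted with [X] passes through the inverse metric, which flips its label:
    this is the [~~ u]. The change of weight under each block of [phi] can be read off. *)
Lemma cf_tact phi X s t r i j k : cf (tact g phi X) s t r i j k =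
  \sum_u \sum_l cP phi s (~~ u) i l * cf X u t r l j k +
  \sum_u \sum_l cP phi t (~~ u) j l * cf X s u r i l k +
  \sum_u \sum_l cP phi r (~~ u) k l * cf X s t u i j l.
Proof.
have formD M M' u v : form (M + M') u v = form M u v + form M' u v.
  by rewrite -[M]scale1r form_lin mul1r scale1r.
rewrite {1}/cf /tri slice_tact !formD form_mul_tr form_mulr_tr -/(tri _ _ _ _).
rewrite !mul_ginv tri1_sum2 form2_sum2 form3_sum2.
by congr (_ + _ + _); apply: eq_bigr => u _; apply: eq_bigr => l _;
  rewrite /cP negbK.
Qed.

Lemma cP_lie phi psi s t i j : cP (lie g phi psi) s t i j =
  \sum_u \sum_l cP phi s (~~ u) i l * cP psi u t l j
  - \sum_u \sum_l cP psi s (~~ u) i l * cP phi u t l j.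
Proof.
rewrite /lie cPB /cP !form_mul_tr !mul_ginv !form2_sum2.
by congr (_ - _); apply: eq_bigr => u _; apply: eq_bigr => l _; rewrite negbK.
Qed.

Lemma slice_decomp X : X = \sum_s \sum_i
  [ffun a => low (E s i) 0 a *: slice (E (~~ s) i) X].
Proof.
apply/ffunP => a; transitivity (slice (delta_mx 0 a) X).
  rewrite /slice (bigD1 a) //= big1 => [|b ba]; rewrite !mxE !eqxx ?scale1r ?addr0 //=.
  by rewrite (negPf ba) scale0r.
rewrite delta_decomp double_sum slice_sum -(pair_big xpredT xpredT
  (fun s i => low (E (~~ s) i) 0 a *: slice (E s i) X)) /=.
rewrite big_bool [in RHS]big_bool /= addrC ffunE !sum_ffunE.
by congr (_ + _); apply: eq_bigr => i _; rewrite ffunE.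
Qed.

Lemma sum_negb (f : bool -> F) : \sum_s f (~~ s) = \sum_s f s.
Proof. by rewrite !big_bool /= addrC. Qed.

Lemma mx_decomp M : M = \sum_s \sum_i \sum_t \sum_j
  form M (E (~~ s) i) (E (~~ t) j) *: ((low (E s i))^T *m low (E t j)).
Proof.
have formP M' : (forall u v, form M u v = form M' u v) -> M = M'.
  move=> h; apply/matrixP => a b; have := h (delta_mx 0 a) (delta_mx 0 b).
  by rewrite /form !trmx_delta -!rowE -!colE !mxE.
apply: formP => u v; rewrite form_sum {1}[u]E_decomp form2_sum2.
rewrite -[LHS]sum_negb; apply: eq_bigr => s _; rewrite form_sum; apply: eq_bigr => i _.
rewrite form_sum {1}[v]E_decomp form3_sum2 -[X in _ * X]sum_negb mulr_sumr.
apply: eq_bigr => t _; rewrite form_sum mulr_sumr; apply: eq_bigr => j _.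
rewrite -[_ *: _]addr0 form_lin form0 addr0 form_outer !negbK.
by rewrite (form_sym g_metric u) (form_sym g_metric v); ring.
Qed.

Definition unitT s t r i j k : tensor :=
  [ffun a => low (E s i) 0 a *: ((low (E t j))^T *m low (E r k))].

Lemma tensor_decomp X : X = \sum_s \sum_i \sum_t \sum_j \sum_r \sum_k
  cf X s t r i j k *: unitT s t r i j k.
Proof.
rewrite [LHS]slice_decomp; apply: eq_bigr => s _; apply: eq_bigr => i _.
apply/ffunP => a; rewrite ffunE [in LHS](mx_decomp (slice _ _)) scaler_sumr sum_ffunE.
apply: eq_bigr => t _; rewrite scaler_sumr sum_ffunE.
apply: eq_bigr => j _; rewrite scaler_sumr sum_ffunE.
apply: eq_bigr => r _; rewrite scaler_sumr sum_ffunE.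
by apply: eq_bigr => k _; rewrite !ffunE !scalerA mulrC.
Qed.

Lemma cf_inj X Y : (forall s t r i j k, cf X s t r i j k = cf Y s t r i j k) -> X = Y.
Proof.
move=> h; rewrite (tensor_decomp X) (tensor_decomp Y).
by do 6 (apply: eq_bigr => ? _); rewrite h.
Qed.

Lemma cP_inj M M' : (forall s t i j, cP M s t i j = cP M' s t i j) -> M = M'.
Proof.
move=> h; rewrite (mx_decomp M) (mx_decomp M').
by do 4 (apply: eq_bigr => ? _); rewrite -/(cP _ _ _ _ _) h.
Qed.

Lemma cP_sum (I : Type) (l : seq I) (P : pred I) (f : I -> 'M[F]_n) s t i j :
  cP (\sum_(x <- l | P x) f x) s t i j = \sum_(x <- l | P x) cP (f x) s t i j.
Proof. exact: form_sum. Qed.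

Lemma cP_outer s t i j s' t' i' j' :
  cP ((low (E s i))^T *m low (E t j)) s' t' i' j' =
  (s == s')%:R * (i == i')%:R * ((t == t')%:R * (j == j')%:R).
Proof. by rewrite /cP form_outer !E_form'. Qed.

Lemma cf_outer s i (f : 'M[F]_n) s' t' r' i' j' k' :
  cf [ffun a => low (E s i) 0 a *: f] s' t' r' i' j' k' =
  (s == s')%:R * (i == i')%:R * cP f t' r' j' k'.
Proof.
rewrite /cf /tri -E_form'; suff -> : slice (E (~~ s') i') [ffun a => low (E s i) 0 a *: f] =
    form g (E s i) (E (~~ s') i') *: f.
  by rewrite -[_ *: f]addr0 form_lin form0 addr0.
rewrite /slice; under eq_bigr do rewrite ffunE scalerA.
rewrite -scaler_suml; congr (_ *: _); rewrite /form mxE; apply: eq_bigr => a _.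
by rewrite !mxE mulrC.
Qed.

Lemma exists_mx (c : bool -> bool -> 'I_m -> 'I_m -> F) :
  exists M, forall s t i j, cP M s t i j = c s t i j.
Proof.
exists (\sum_s \sum_i \sum_t \sum_j c s t i j *: ((low (E s i))^T *m low (E t j))).
move=> s t i j; rewrite cP_sum -[RHS](sum_dual (fun s i => c s t i j)).
apply: eq_bigr => s' _; rewrite cP_sum; apply: eq_bigr => i' _; rewrite cP_sum.
rewrite -(sum_dual (fun t j => c s' t i' j)) mulr_sumr; apply: eq_bigr => t' _.
rewrite cP_sum mulr_sumr; apply: eq_bigr => j' _.
by rewrite cPZ cP_outer; ring.
Qed.

Lemma exists_tensor (c : bool -> bool -> bool -> 'I_m -> 'I_m -> 'I_m -> F) :
  exists X, forall s t r i j k, cf X s t r i j k = c s t r i j k.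
Proof.
have /cid[M hM] : exists M : bool -> 'I_m -> 'M[F]_n, forall s i t r j k,
    cP (M s i) t r j k = c s t r i j k.
  have h (si : bool * 'I_m) := cid (exists_mx (fun t r j k => c si.1 t r si.2 j k)).
  by exists (fun s i => sval (h (s, i))) => s i t r j k; case: (h (s, i)) => M /= ->.
exists (\sum_s \sum_i [ffun a => low (E s i) 0 a *: M s i]) => s t r i j k.
rewrite cf_sum -[RHS](sum_dual (fun s i => c s t r i j k)); apply: eq_bigr => s' _.
by rewrite cf_sum; apply: eq_bigr => i' _; rewrite cf_outer hM.
Qed.

End Coordinates.

(** * The subalgebras $\mathfrak p$, $g_0$, $g_{\pm1}$, $\mathfrak z_0$ and $\mathfrak{sl}_0$ in
    coordinates *)

Section Membership.
Variables (F : numFieldType) (n sp sm m : nat).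
Variable g : 'M[F]_n.
Variables (gam : 'I_n -> 'M[F]_(sp, sm)) (gam' : 'I_n -> 'M[F]_(sm, sp)).
Variables (xi : 'rV[F]_sp) (Vm : {vspace 'rV[F]_n}).
Hypothesis g_metric : nondegenerate_symmetric g.
Variable E : bool -> 'I_m -> 'rV[F]_n.
Hypothesis E_dual : dual_basis g gam xi Vm E.
Local Notation V_ := (Vhalf gam xi Vm).
Local Notation tensor := {ffun 'I_n -> 'M[F]_n}.
Local Notation low := (lower g).
Local Notation cf := (coord3 E).
Local Notation cP := (coord2 E).
Implicit Types (u v w : 'rV[F]_n) (M phi psi : 'M[F]_n) (X Y : tensor).

Lemma mem_so_tr phi : phi \in so_alg F n <-> phi^T = - phi.
Proof.
apply: mem_lspan => [|a x y hx hy]; first by rewrite trmx0 oppr0.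
by rewrite linearD linearZ /= hx hy scalerN opprD.
Qed.

Lemma mem_so phi : phi \in so_alg F n <-> forall s t i j, cP phi s t i j = - cP phi t s j i.
Proof.
rewrite mem_so_tr.
have E1 s t i j : cP phi^T s t i j = cP phi t s j i by rewrite /coord2 form_trmx.
have E2 s t i j : cP (- phi) s t i j = - cP phi s t i j.
  by rewrite -scaleN1r cPZ mulN1r.
split=> [h s t i j|h]; first by rewrite -E1 h E2.
by apply: (cP_inj g_metric E_dual) => s t i j; rewrite E1 E2 h.
Qed.

(** A relation puts a combination of the [E false i] into $V_{1/2}$; as this space is null, pairing
    with [E true i] shows that the coefficients vanish. *)
Lemma slash_E_free (x : 'I_m -> F) :
  (forall A, \sum_i x i * (xi *m slash gam (E false i)) 0 A = 0) -> forall i, x i = 0.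
Proof.
move=> h i; pose v := \sum_i x i *: E false i.
have vV : v \in V_ true.
  apply/mem_Vplus/rowP => A; rewrite [RHS]mxE -[RHS](h A) slash_rowE.
  under [RHS]eq_bigr do rewrite slash_rowE mulr_sumr.
  rewrite exchange_big; apply: eq_bigr => a _; rewrite /v summxE mulr_suml.
  by apply: eq_bigr => j _; rewrite mxE mulrA.
have [hV _ _] := E_dual; have /hV/(_ i) := vV.
rewrite form2_sum (eq_bigr (fun j => (j == i)%:R * x j)) ?sum_delta // => j _.
by rewrite (E_form E_dual) mulrC.
Qed.

Lemma slash_true i : xi *m slash gam (E true i) = 0.
Proof. by apply/mem_Vplus; exact: (E_mem E_dual true i). Qed.

(** In the expansion of the inverse metric the terms where [E true i] multiplies the spinor vanish,
    so the free vector index lies in $V_{1/2}$. *)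
Lemma xi1uE a A : xi1u g gam xi a A =
  \sum_i E true i 0 a * (xi *m slash gam (E false i)) 0 A.
Proof.
rewrite /xi1u (ginv_decomp g_metric E_dual) big_bool /=.
transitivity (\sum_i (E true i 0 a * (xi *m slash gam (E false i)) 0 A
   + E false i 0 a * (xi *m slash gam (E true i)) 0 A)); last first.
  by apply: eq_bigr => i _; rewrite slash_true [(0 : 'rV_sm) 0 A]mxE mulr0 addr0.
under [RHS]eq_bigr do rewrite !slash_rowE !mulr_sumr -big_split.
rewrite exchange_big; apply: eq_bigr => b _; rewrite mxE !summxE -big_split mulr_suml.
apply: eq_bigr => i _; rewrite /xi1l !mxE !big_ord1 !mxE /=; ring.
Qed.

(** Contracting [phi] twice with the spinor gives a combination of products of the free spinors of
    [slash_E_free], with the block of degree -1 as coefficients. *)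
Lemma mem_p_alg phi : phi \in p_alg g gam xi <->
  phi \in so_alg F n /\ forall i j, cP phi false false i j = 0.
Proof.
pose z i A := (xi *m slash gam (E false i)) 0 A.
have -> : phi \in p_alg g gam xi <-> phi \in so_alg F n /\ forall A B,
    \sum_a \sum_b xi1u g gam xi a A * xi1u g gam xi b B * phi a b = 0.
  apply: mem_lspan => [|a x y [x1 x2] [y1 y2]].
    split=> [|A B]; first exact: mem0v.
    by rewrite big1 // => a _; rewrite big1 // => b _; rewrite mxE mulr0.
  split=> [|A B]; first by rewrite memvD ?memvZ.
  transitivity (a * (\sum_a \sum_b xi1u g gam xi a A * xi1u g gam xi b B * x a b)
      + \sum_a \sum_b xi1u g gam xi a A * xi1u g gam xi b B * y a b).
    rewrite mulr_sumr -big_split; apply: eq_bigr => c _.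
    rewrite mulr_sumr -big_split; apply: eq_bigr => d _.
    by rewrite !mxE /=; ring.
  by rewrite x2 y2 mulr0 addr0.
have eqf A B : \sum_a \sum_b xi1u g gam xi a A * xi1u g gam xi b B * phi a b =
    \sum_i (\sum_j cP phi false false i j * z j B) * z i A.
  pose w A := \sum_i z i A *: E true i.
  have wE C a : xi1u g gam xi a C = w C 0 a.
    by rewrite xi1uE /w summxE; apply: eq_bigr => i _; rewrite [RHS]mxE mulrC.
  transitivity (form phi (w A) (w B)).
    by rewrite formE; apply: eq_bigr => a _; apply: eq_bigr => b _; rewrite !wE.
  rewrite /w form2_sum; apply: eq_bigr => i _; rewrite form3_sum mulrC; congr (_ * _).
  by apply: eq_bigr => j _; rewrite mulrC.
split=> -[h1 h2]; split=> //.
  move=> i j; apply: (slash_E_free (x := cP phi false false i)) => B.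
  move: i; apply: slash_E_free => A; rewrite -/(z _ _).
  by rewrite -eqf h2.
move=> A B; rewrite eqf big1 // => i _; rewrite big1 ?mul0r // => j _.
by rewrite h2 mul0r.
Qed.

Local Notation so := (so_alg F n).
Local Notation g0 := (g_0 g gam xi Vm).

Definition wedge_pair (s t s' t' : bool) :=
  ((s' == s) && (t' == t)) || ((s' == t) && (t' == s)).

Lemma negb_of_neq (r s : bool) : r != s -> ~~ r = s.
Proof. by case: r s => [] []. Qed.

Lemma mem_wedge s t phi : phi \in wedge g (V_ s) (V_ t) <->
  phi \in so /\ forall s' t' i j, ~~ wedge_pair s t s' t' -> cP phi s' t' i j = 0.
Proof.
have [hV _ _] := E_dual.
set P := fun phi => phi \in so /\ forall s' t' i j, ~~ wedge_pair s t s' t' -> cP phi s' t' i j = 0.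
have lP x : x \in lspan P <-> P x.
  apply: mem_lspan => [|a y z [y1 y2] [z1 z2]].
    by split=> [|s' t' i j _]; rewrite ?mem0v // cP0.
  split=> [|s' t' i j h]; first by rewrite memvD ?memvZ.
  by rewrite cP_lin y2 // z2 // mulr0 addr0.
split=> [|[/mem_so_tr as_tr phi0]].
  suff /subvP h : (wedge g (V_ s) (V_ t) <= lspan P)%VS by move/h/lP.
  apply: (lspanP _).2 => _ [u [w [us wt ->]]]; apply/lP; split=> [|s' t' i j].
    apply/mem_so => s' t' i j; rewrite !cPB /coord2 !form_outer //; ring.
  rewrite cPB /coord2 !form_outer // => nst.
  have u0 r k : r != s -> form g u (E (~~ r) k) = 0.
    by move=> rs; suff -> : ~~ r = s; [exact: (hV s u).1 | exact: negb_of_neq].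
  have w0 r k : r != t -> form g w (E (~~ r) k) = 0.
    by move=> rs; suff -> : ~~ r = t; [exact: (hV t w).1 | exact: negb_of_neq].
  move: nst; rewrite /wedge_pair negb_or !negb_and => /andP[h1 h2].
  have -> : form g u (E (~~ s') i) * form g w (E (~~ t') j) = 0.
    by case/orP: h1 => h; [rewrite (u0 s') // mul0r | rewrite (w0 t') // mulr0].
  by case/orP: h2 => h; [rewrite (w0 s') // mul0r | rewrite (u0 t') // mulr0]; rewrite subr0.
(* Skewness rewrites [phi] in wedge products of frame vectors; the hypothesis on the blocks discards
   every product not of the types [s], [t]. *)
have as2 : phi = 2^-1 *: \sum_s \sum_i \sum_t \sum_j cP phi s t i j *:
    ((low (E s i))^T *m low (E t j) - (low (E t j))^T *m low (E s i)).
  transitivity (2^-1 *: (phi - phi^T)).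
    by rewrite as_tr opprK -mulr2n -scaler_nat scalerA mulVf ?scale1r ?pnatr_eq0.
  congr (_ *: _); rewrite {1 2}(mx_decomp g_metric E_dual phi).
  rewrite linear_sum -sumrB.
  apply: eq_bigr => s1 _; rewrite linear_sum -sumrB; apply: eq_bigr => i1 _.
  rewrite linear_sum -sumrB; apply: eq_bigr => t1 _.
  rewrite linear_sum -sumrB; apply: eq_bigr => j1 _.
  by rewrite linearZ /= (trmx_mul (low (E s1 i1))^T) trmxK -scalerBr.
rewrite as2 memvZ //; apply: memv_suml => s1 _; apply: memv_suml => i1 _.
apply: memv_suml => t1 _; apply: memv_suml => j1 _.
have gen u w : u \in V_ s -> w \in V_ t ->
    (low u)^T *m low w - (low w)^T *m low u \in wedge g (V_ s) (V_ t).
  by move=> us wt; apply: (lspanP _).1; exists u, w.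
have [/orP[/andP[/eqP-> /eqP->]|/andP[/eqP-> /eqP->]]|/phi0 ->] :=
  boolP (wedge_pair s t s1 t1); last by rewrite scale0r mem0v.
  by apply/memvZ/gen; exact: (E_mem E_dual).
by rewrite -opprB scalerN memvN; apply/memvZ/gen; exact: (E_mem E_dual).
Qed.

(** One off-diagonal block determines an element of $g_0$, the other being minus its transpose; the
    bracket becomes the matrix commutator ([gl_mx_lie]). *)
Definition gl_mx phi : 'M[F]_m := \matrix_(i, j) cP phi true false i j.

Lemma gl_mxE phi i j : gl_mx phi i j = cP phi true false i j.
Proof. by rewrite mxE. Qed.

Lemma mem_g0 phi : phi \in g0 <->
  [/\ phi \in so, forall i j, cP phi true true i j = 0
    & forall i j, cP phi false false i j = 0].
Proof.
rewrite -[g0]/(wedge g (V_ false) (V_ true)) mem_wedge; split=> [[h1 h2]|[h1 h2 h3]].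
  by split=> // i j; apply: h2.
by split=> // [] [] [] i j.
Qed.

Lemma mem_g1 s phi : phi \in g_pm1 g gam xi Vm s <->
  phi \in so /\ forall s' t' i j, ~~ ((s' == s) && (t' == s)) -> cP phi s' t' i j = 0.
Proof.
rewrite mem_wedge; split=> -[h1 h2]; split=> // s' t' i j h.
  by apply: h2; rewrite /wedge_pair orbb.
by apply: h2; move: h; rewrite /wedge_pair orbb.
Qed.

Lemma cP_g0 phi s t i j : phi \in g0 -> cP phi s t i j =
  if s == t then 0 else if s then gl_mx phi i j else - gl_mx phi j i.
Proof.
by move=> /mem_g0[/mem_so as_phi h1 h2]; rewrite !mxE; case: s; case: t => //=.
Qed.

Lemma gl_mx_exists (M : 'M[F]_m) : exists2 phi, phi \in g0 & gl_mx phi = M.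
Proof.
have [phi hphi] := exists_mx E_dual (fun s t i j =>
  if s == t then 0 else if s then M i j else - M j i).
exists phi; last by apply/matrixP => i j; rewrite mxE hphi.
apply/mem_g0; split=> [|i j|i j]; rewrite ?hphi //.
by apply/mem_so => [] [] [] i j; rewrite !hphi /= ?oppr0 ?opprK.
Qed.

Lemma gl_mx_inj : {in g0 &, injective gl_mx}.
Proof.
move=> phi psi hphi hpsi e; apply: (cP_inj g_metric E_dual) => s t i j.
by rewrite !cP_g0 // e.
Qed.

Lemma gl_mx_lin a phi psi : gl_mx (a *: phi + psi) = a *: gl_mx phi + gl_mx psi.
Proof. by apply/matrixP => i j; rewrite !mxE cP_lin. Qed.

Lemma lie_g0 phi psi : phi \in g0 -> psi \in g0 -> lie g phi psi \in g0.
Proof.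
move=> hphi hpsi; have [h1 _ _] := (mem_g0 phi).1 hphi; have [h2 _ _] := (mem_g0 psi).1 hpsi.
apply/mem_g0; split=> [|i j|i j].
- have [e1 e2] := ((mem_so_tr phi).1 h1, (mem_so_tr psi).1 h2).
  apply/mem_so_tr; rewrite /lie /ginv linearB /= !trmx_mul !trmx_inv g_metric.1 e1 e2.
  by rewrite !mulNmx !mulmxN !opprK opprB !mulmxA.
- by rewrite (cP_lie g_metric E_dual) !big_bool /= !big1 ?subrr ?addr0 // => l _;
    rewrite !cP_g0 //= ?mulr0 ?mul0r.
by rewrite (cP_lie g_metric E_dual) !big_bool /= !big1 ?subrr ?addr0 // => l _;
  rewrite !cP_g0 //= ?mulr0 ?mul0r.
Qed.

Lemma gl_mx_lie phi psi : phi \in g0 -> psi \in g0 ->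
  gl_mx (lie g phi psi) = gl_mx phi *m gl_mx psi - gl_mx psi *m gl_mx phi.
Proof.
move=> hphi hpsi; apply/matrixP => i j; rewrite mxE (cP_lie g_metric E_dual).
have z a b : a \in g0 ->
    \sum_(l < m) cP a true true i l * cP b false false l j = 0.
  by move=> ha; rewrite big1 // => l _; rewrite (cP_g0 _ _ _ _ ha) mul0r.
rewrite !big_bool /= !z // !addr0 !mxE.
by congr (_ - _); apply: eq_bigr => l _; rewrite !mxE.
Qed.

Lemma lspan_gl (P : 'M[F]_n -> Prop) (Q : 'M[F]_m -> Prop) :
  (forall phi, P phi <-> phi \in g0 /\ Q (gl_mx phi)) -> Q 0 ->
  (forall a x y, Q x -> Q y -> Q (a *: x + y)) ->
  forall phi, phi \in lspan P <-> phi \in g0 /\ Q (gl_mx phi).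
Proof.
move=> PQ Q0 Qlin phi; rewrite -PQ; apply: mem_lspan.
  apply/PQ; split; first exact: mem0v.
  by have -> : gl_mx 0 = 0 by apply/matrixP => i j; rewrite !mxE cP0.
move=> a x y /PQ[x1 x2] /PQ[y1 y2]; apply/PQ; split; first by rewrite memvD ?memvZ.
by rewrite gl_mx_lin; apply: Qlin.
Qed.

Lemma gl_mx_sum (I : Type) (l : seq I) (P : pred I) (f : I -> 'M[F]_n) :
  gl_mx (\sum_(x <- l | P x) f x) = \sum_(x <- l | P x) gl_mx (f x).
Proof.
apply/matrixP => i j; rewrite mxE cP_sum summxE.
by apply: eq_bigr => x _; rewrite mxE.
Qed.

Lemma gl_mxZ a phi : gl_mx (a *: phi) = a *: gl_mx phi.
Proof. by apply/matrixP => i j; rewrite !mxE cPZ. Qed.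

(** A matrix that commutes with all matrix units is scalar. *)
Lemma mem_z0 phi : (0 < m)%N ->
  phi \in z_0 g gam xi Vm <-> phi \in g0 /\ exists c, gl_mx phi = c%:M.
Proof.
move=> m_gt0; rewrite /z_0; apply: (@lspan_gl _ (fun A : 'M[F]_m => exists c, A = c%:M)) => [{}phi||a x y [c ->] [d ->]]; last first.
- by exists (a * c + d); rewrite scale_scalar_mx -raddfD.
- by exists 0; rewrite raddf0.
have lie0 psi chi : psi \in g0 -> chi \in g0 ->
    lie g psi chi = 0 <-> gl_mx psi *m gl_mx chi = gl_mx chi *m gl_mx psi.
  move=> h1 h2; split=> [h|/eqP]; last rewrite -subr_eq0 -gl_mx_lie // => /eqP h.
    by apply/eqP; rewrite -subr_eq0 -gl_mx_lie // h; apply/eqP/matrixP => i j; rewrite !mxE cP0.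
  apply: gl_mx_inj; rewrite ?lie_g0 ?mem0v // h.
  by apply/matrixP => i j; rewrite !mxE cP0.
split=> -[h1 h2]; split=> //; last first.
  move=> psi hpsi; apply/lie0 => //; have [c ->] := h2.
  by rewrite scalar_mxC.
have e a b i j : gl_mx phi i a * (j == b)%:R = (i == a)%:R * gl_mx phi b j.
  have [psi hpsi psiE] := gl_mx_exists (delta_mx a b).
  have := (lie0 _ _ h1 hpsi).1 (h2 _ hpsi); rewrite psiE => /matrixP/(_ i j).
  rewrite [LHS]mxE [RHS]mxE sum_delta_mx => <-.
  transitivity (\sum_p delta_mx b a j p * gl_mx phi i p).
    by rewrite sum_delta_mx mulrC.
  by apply: eq_bigr => p _; rewrite [delta_mx b a _ _]mxE [delta_mx a b _ _]mxE mulrC andbC.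
exists (gl_mx phi (Ordinal m_gt0) (Ordinal m_gt0)); apply/matrixP => i j.
rewrite [RHS]mxE; have [->|ij] := eqVneq i j.
  by have := e j (Ordinal m_gt0) j (Ordinal m_gt0); rewrite !eqxx mulr1 mul1r.
by have := e j j i j; rewrite eqxx (negPf ij) mulr1 mul0r.
Qed.

(** Commutators have trace zero; conversely a trace-free matrix is a combination of matrix units
    that are each a single commutator. *)
Lemma mem_sl0 phi : (0 < m)%N ->
  phi \in sl_0 g gam xi Vm <-> phi \in g0 /\ \tr (gl_mx phi) = 0.
Proof.
move=> m_gt0; pose P phi := phi \in g0 /\ \tr (gl_mx phi) = 0.
have mP psi : psi \in lspan P <-> psi \in g0 /\ \tr (gl_mx psi) = 0.
  apply: (@lspan_gl _ (fun A : 'M[F]_m => \tr A = 0)) => [//||a x y hx hy]; first exact: mxtrace0.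
  by rewrite mxtraceD mxtraceZ hx hy mulr0 addr0.
split=> [|[h1 tr0]].
  suff /subvP h : (sl_0 g gam xi Vm <= lspan P)%VS by move=> /h /mP.
  apply: (lspanP _).2 => _ [psi [chi [h1 h2 ->]]]; apply/mP; split; first exact: lie_g0.
  by rewrite gl_mx_lie // linearB /= mxtrace_mulC subrr.
(* Diagonal units are corrected in the corner [o] so as to become traceless; the corrections add up
   to the trace of [gl_mx phi], which is zero. *)
pose o := Ordinal m_gt0; pose D a b : 'M[F]_m := delta_mx a b - (a == b)%:R *: delta_mx o o.
have emb (M : 'M[F]_m) : {psi | psi \in g0 & gl_mx psi = M}.
  by apply/cid2; exact: gl_mx_exists.
pose em (M : 'M[F]_m) := s2val (emb M).
have em0 (M : 'M[F]_m) : em M \in g0 by rewrite /em; case: (emb M).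
have emE (M : 'M[F]_m) : gl_mx (em M) = M by rewrite /em; case: (emb M).
have Dsl a b : em (D a b) \in sl_0 g gam xi Vm.
  have br (M N : 'M[F]_m) : em (M *m N - N *m M) \in sl_0 g gam xi Vm.
    apply: (lspanP _).1; exists (em M), (em N); split; rewrite ?em0 //.
    by apply: gl_mx_inj; rewrite ?em0 ?lie_g0 ?em0 // gl_mx_lie ?em0 // !emE.
  rewrite /D; have [->|ab] := eqVneq a b.
    by rewrite scale1r; have := br (delta_mx b o) (delta_mx o b); rewrite !mul_delta_mx.
  rewrite scale0r subr0; have := br (delta_mx a a) (delta_mx a b).
  by rewrite mul_delta_mx mul_delta_mx_0 ?subr0 // eq_sym.
suff -> : phi = \sum_a \sum_b gl_mx phi a b *: em (D a b).
  by do 2 (apply: memv_suml => ? _); apply: memvZ.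
apply: gl_mx_inj => //.
  by do 2 (apply: memv_suml => ? _); apply: memvZ; exact: em0.
rewrite gl_mx_sum; under eq_bigr do rewrite gl_mx_sum.
under eq_bigr => a _ do under eq_bigr => b _ do rewrite gl_mxZ emE /D scalerBr scalerA.
under eq_bigr do rewrite sumrB; rewrite sumrB -matrix_sum_delta.
under [X in _ - X]eq_bigr => a _ do rewrite -scaler_suml.
rewrite -scaler_suml (_ : \sum_a _ = 0) ?scale0r ?subr0 // -[RHS]tr0.
apply: eq_bigr => a _; under eq_bigr do rewrite mulrC.
by rewrite sum_delta_sym.
Qed.

End Membership.

(** * Cotton-York tensors, weight spaces and tensor products in coordinates *)

Section TensorMembership.
Variables (F : numFieldType) (n sp sm m : nat).
Variable g : 'M[F]_n.
Variables (gam : 'I_n -> 'M[F]_(sp, sm)) (gam' : 'I_n -> 'M[F]_(sm, sp)).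
Variables (xi : 'rV[F]_sp) (Vm : {vspace 'rV[F]_n}).
Hypothesis g_metric : nondegenerate_symmetric g.
Variable E : bool -> 'I_m -> 'rV[F]_n.
Hypothesis E_dual : dual_basis g gam xi Vm E.
Local Notation V_ := (Vhalf gam xi Vm).
Local Notation tensor := {ffun 'I_n -> 'M[F]_n}.
Local Notation low := (lower g).
Local Notation cf := (coord3 E).
Local Notation cP := (coord2 E).
Implicit Types (u v w : 'rV[F]_n) (phi psi : 'M[F]_n) (X Y : tensor).

Definition cotton_york X : Prop :=
  [/\ forall s t r i j k, cf X s t r i j k = - cf X s r t i k j,
      forall s t r i j k, cf X s t r i j k + cf X t r s j k i + cf X r s t k i j = 0
    & forall r k, \sum_s \sum_i cf X s (~~ s) r i i k = 0].

Lemma triE X u v w :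
  tri X u v w = \sum_a \sum_b \sum_c u 0 a * v 0 b * w 0 c * X a b c.
Proof.
rewrite /tri /slice form_sum; apply: eq_bigr => a _; rewrite -[_ *: _]addr0 form_lin form0 addr0.
rewrite formE mulr_sumr; apply: eq_bigr => b _; rewrite mulr_sumr.
by apply: eq_bigr => c _; rewrite !mulrA.
Qed.

Lemma covector_eq0 (f : 'I_n -> F) :
  (forall s i, \sum_c E (~~ s) i 0 c * f c = 0) -> forall c, f c = 0.
Proof.
move=> h c; transitivity (\sum_a (delta_mx 0 c : 'rV[F]_n) 0 a * f a).
  rewrite (bigD1 c) //= mxE !eqxx mul1r big1 ?addr0 // => a ac.
  by rewrite mxE eqxx (negPf ac) mul0r.
rewrite (delta_decomp g_metric E_dual).
under eq_bigr do rewrite summxE mulr_suml.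
rewrite exchange_big big1 // => s _; under eq_bigr do rewrite summxE mulr_suml.
rewrite exchange_big big1 // => i _; under eq_bigr do rewrite mxE -mulrA.
by rewrite -mulr_sumr -[s]negbK h mulr0.
Qed.

Lemma cf_transpose X s t r i j k :
  cf [ffun a => (X a)^T] s t r i j k = cf X s r t i k j.
Proof.
rewrite /coord3 /tri -form_trmx /slice; congr form.
by rewrite linear_sum; apply: eq_bigr => a _; rewrite ffunE linearZ /= trmxK.
Qed.

Lemma cf_rotate X s t r i j k :
  cf [ffun a => \matrix_(b, c) X b c a] s t r i j k = cf X t r s j k i.
Proof.
rewrite /coord3 !triE exchange_big; apply: eq_bigr => b _.
rewrite exchange_big; apply: eq_bigr => c _; apply: eq_bigr => a _.
by rewrite ffunE mxE; ring.
Qed.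

Lemma trace_cf X r k : \sum_c E (~~ r) k 0 c * (\sum_a \sum_d ginv g a d * X d a c)
  = \sum_s \sum_i cf X s (~~ s) r i i k.
Proof.
have E1 a d : ginv g a d = \sum_s \sum_i E s i 0 a * E (~~ s) i 0 d.
  rewrite (ginv_decomp g_metric E_dual) summxE; apply: eq_bigr => s _.
  by rewrite summxE; apply: eq_bigr => i _; rewrite mxE big_ord1 mxE.
transitivity (\sum_s \sum_i \sum_d \sum_a \sum_c
    E (~~ s) i 0 d * E (~~ ~~ s) i 0 a * E (~~ r) k 0 c * X d a c); last first.
  by apply: eq_bigr => s _; apply: eq_bigr => i _; rewrite /coord3 triE.
under eq_bigr => c _.
  rewrite mulr_sumr; under eq_bigr => a _.
    rewrite mulr_sumr; under eq_bigr => d _.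
      rewrite E1 mulr_suml mulr_sumr; under eq_bigr do rewrite mulr_suml mulr_sumr.
      over.
    rewrite exchange_big /=; under eq_bigr do rewrite exchange_big /=.
    over.
  rewrite exchange_big /=; under eq_bigr do rewrite exchange_big /=.
  over.
rewrite exchange_big; apply: eq_bigr => s _; rewrite exchange_big; apply: eq_bigr => i _.
rewrite exchange_big /= ; under eq_bigr do rewrite exchange_big /=.
rewrite exchange_big; apply: eq_bigr => d _; apply: eq_bigr => a _; apply: eq_bigr => c _.
by rewrite negbK; ring.
Qed.

Lemma mem_CY X : X \in CY g <-> cotton_york X.
Proof.
set P := (fun X : tensor =>
  [/\ forall a b c, X a b c = 2^-1 * (X a b c - X a c b),
      forall a b c, 6^-1 * (X a b c + X b c a + X c a b
                            - X b a c - X a c b - X c b a) = 0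
    & forall c, \sum_a \sum_d ginv g a d * X d a c = 0]).
have -> : X \in CY g <-> P X.
  apply: mem_lspan => [|a x y [x1 x2 x3] [y1 y2 y3]].
    split=> [a b c|a b c|c]; rewrite ?tensor0 ?tensorE; try ring.
    by rewrite big1 // => a _; rewrite big1 // => d _; rewrite tensor0 mulr0.
  split=> [b c d|b c d|c]; rewrite ?tensorD ?tensorZ.
  - by rewrite [in LHS](x1 b c d) [in LHS](y1 b c d); ring.
  - have := x2 b c d; have := y2 b c d.
    set p := _ * _ => hp; set q := _ * _ => hq.
    by transitivity (a * q + p); [rewrite /p /q; ring | rewrite hp hq mulr0 addr0].
  transitivity (a * (\sum_a \sum_d ginv g a d * x d a c) + \sum_a \sum_d ginv g a d * y d a c).
    rewrite mulr_sumr -big_split; apply: eq_bigr => b _.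
    rewrite mulr_sumr -big_split; apply: eq_bigr => d _.
    by rewrite tensorD tensorZ /=; ring.
  by rewrite x3 y3 mulr0 addr0.
have cond1 : (forall a b c, X a b c = - X a c b) <->
    (forall s t r i j k, cf X s t r i j k = - cf X s r t i k j).
  split=> [h s t r i j k|h].
    rewrite -[X in - X]cf_transpose -[RHS]mulN1r -cfZ scaleN1r; congr (coord3 E _ s t r i j k).
    by apply: tensorP => a b c; rewrite tensorN ffunE mxE h.
  suff e : X = - [ffun a => (X a)^T] by move=> a b c; rewrite [in LHS]e tensorN ffunE mxE.
  apply: (cf_inj g_metric E_dual) => s t r i j k.
  by rewrite -scaleN1r cfZ cf_transpose mulN1r.
have cond2 : (forall a b c, X a b c + X b c a + X c a b = 0) <->
    (forall s t r i j k, cf X s t r i j k + cf X t r s j k i + cf X r s t k i j = 0).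
  set Y := [ffun a => \matrix_(b, c) X b c a]; set Z := [ffun a => \matrix_(b, c) Y b c a].
  have eY s t r i j k : cf X s t r i j k + cf X t r s j k i + cf X r s t k i j =
      cf (X + Y + Z) s t r i j k.
    by rewrite !cfD /Z !cf_rotate /Y ?cf_rotate.
  have eT a b c : X a b c + X b c a + X c a b = (X + Y + Z) a b c.
    by rewrite !tensorD /Z /Y !ffunE !mxE !ffunE !mxE.
  split=> [h s t r i j k|h a b c].
    rewrite eY (_ : X + Y + Z = 0) ?cf0 //.
    by apply: tensorP => a b c; rewrite -eT h tensor0.
  rewrite eT (_ : X + Y + Z = 0) ?tensor0 //.
  by apply: (cf_inj g_metric E_dual) => s t r i j k; rewrite -eY h cf0.
have cond3 : (forall c, \sum_a \sum_d ginv g a d * X d a c = 0) <->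
    (forall r k, \sum_s \sum_i cf X s (~~ s) r i i k = 0).
  split=> [h r k|h].
    by rewrite -trace_cf big1 // => c _; rewrite h mulr0.
  by apply: covector_eq0 => r k; rewrite trace_cf.
split=> [[h1 h2 h3]|[/cond1 h1 /cond2 h2 /cond3 h3]].
  have h1' x y z : X x y z = - X x z y.
    have := h1 x y z; set p := X x y z; set q := X x z y => e.
    apply/eqP; rewrite -addr_eq0 (_ : p + q = 2 * p - (p - q)); last by ring.
    by rewrite {1}e; apply/eqP; field.
  split; [exact/cond1 | apply/cond2 => a b c | exact/cond3].
  (* Given skewness in the last two indices, the total skew-symmetrisation is a multiple of the
     cyclic sum. *)
  have := h2 a b c; rewrite (h1' b a c) (h1' a c b) (h1' c b a) => /eqP.
  rewrite mulf_eq0 invr_eq0 pnatr_eq0 /= => /eqP e.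
  have : (X a b c + X b c a + X c a b) *+ 2 = 0 by rewrite -[RHS]e; ring.
  by move/eqP; rewrite mulrn_eq0 => /eqP.
split=> // a b c; first by rewrite (h1 a c b); field.
rewrite (h1 b a c) (h1 a c b) (h1 c b a).
by rewrite (_ : _ - _ = 2 * (X a b c + X b c a + X c a b)); [rewrite h2 !mulr0 | ring].
Qed.

Lemma slice_outer u v phi : slice v [ffun a => low u 0 a *: phi] = form g u v *: phi.
Proof.
rewrite /slice; under eq_bigr do rewrite ffunE scalerA.
rewrite -scaler_suml; congr (_ *: _); rewrite /form mxE; apply: eq_bigr => a _.
by rewrite !mxE mulrC.
Qed.

Lemma cf_slice X s t r i j k : cf X s t r i j k = cP (slice (E (~~ s) i) X) t r j k.
Proof. by []. Qed.

Lemma mem_level p X : X \in tensor_level g gam xi Vm p <->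
  forall (s t r : bool) i j k, (s + t + r)%N != p -> cf X s t r i j k = 0.
Proof.
have [hV _ _] := E_dual.
pose P X := forall (s t r : bool) i j k, (s + t + r)%N != p -> cf X s t r i j k = 0.
have lP Y : Y \in lspan P <-> P Y.
  apply: mem_lspan => [|a x y hx hy] s t r i j k h; first exact: cf0.
  by rewrite cf_lin hx // hy // mulr0 addr0.
split=> [|h].
  suff /subvP h : (tensor_level g gam xi Vm p <= lspan P)%VS by move=> /h /lP.
  apply: (lspanP _).2 => _ [s [t [r [u [v [w [hp [us vt wr] ->]]]]]]].
  apply/lP => s' t' r' i j k h; rewrite cf_slice slice_outer cPZ /coord2 form_outer //.
  have z a b x : x \in V_ a -> b != a -> forall l, form g x (E (~~ b) l) = 0.
    by move=> xa ba l; rewrite (negb_of_neq ba); exact: (hV a x).1.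
  have [es|/z -> //] := eqVneq s' s; last by rewrite mul0r.
  have [et|/z -> //] := eqVneq t' t; last by rewrite mul0r mulr0.
  have [er|/z -> //] := eqVneq r' r; last by rewrite !mulr0.
  by move: h; rewrite es et er hp eqxx.
rewrite (tensor_decomp g_metric E_dual X).
apply: memv_suml => s _; apply: memv_suml => i _; apply: memv_suml => t _.
apply: memv_suml => j _; apply: memv_suml => r _; apply: memv_suml => k _.
have [hp|/h ->] := eqVneq (s + t + r)%N p; last by rewrite scale0r mem0v.
apply/memvZ/(lspanP _).1; exists s, t, r, (E s i), (E t j), (E r k); split=> //.
by split; apply: (E_mem E_dual).
Qed.

Lemma mem_Vg s (W : {vspace 'M[F]_n}) X : X \in tensor_Vg g (V_ s) W <->
  (forall i, slice (E s i) X = 0) /\ (forall i, slice (E (~~ s) i) X \in W).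
Proof.
have [hV _ _] := E_dual.
pose P X := (forall i, slice (E s i) X = 0) /\ (forall i, slice (E (~~ s) i) X \in W).
have lP Y : Y \in lspan P <-> P Y.
  have s0 u : slice u (0 : tensor) = 0.
    by rewrite /slice big1 // => a _; rewrite ffunE scaler0.
  apply: mem_lspan => [|a x y [x1 x2] [y1 y2]].
    by split=> i; rewrite s0 ?mem0v.
  split=> i; rewrite slice_lin; first by rewrite x1 y1 scaler0 addr0.
  by rewrite memvD ?memvZ.
split=> [|[h1 h2]].
  suff /subvP h : (tensor_Vg g (V_ s) W <= lspan P)%VS by move=> /h /lP.
  apply: (lspanP _).2 => _ [u [phi [us phiW ->]]]; apply/lP; split=> i.
    by rewrite slice_outer ((hV s u).1 us) scale0r.
  by rewrite slice_outer memvZ.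
rewrite (slice_decomp g_metric E_dual X); apply: memv_suml => t _; apply: memv_suml => i _.
have [->|ts] := eqVneq t s.
  apply: (lspanP _).1; exists (E s i), (slice (E (~~ s) i) X); split=> //.
  exact: (E_mem E_dual).
rewrite (negb_of_neq ts) h1 [X in X \in _](_ : _ = 0) ?mem0v //.
by apply/ffunP => a; rewrite !ffunE scaler0.
Qed.

End TensorMembership.

(** * The Fock space built on the pure spinor *)

Section Spinors.
Variables (F : numFieldType) (n sp sm m : nat).
Variable g : 'M[F]_n.
Variables (gam : 'I_n -> 'M[F]_(sp, sm)) (gam' : 'I_n -> 'M[F]_(sm, sp)).
Variables (xi : 'rV[F]_sp) (Vm : {vspace 'rV[F]_n}).
Hypothesis g_metric : nondegenerate_symmetric g.
Hypothesis gam_clifford : clifford_relations g gam gam'.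
Hypothesis xi_neq0 : xi != 0.
Variable E : bool -> 'I_m -> 'rV[F]_n.
Hypothesis E_dual : dual_basis g gam xi Vm E.
Hypothesis m_gt2 : (2 < m)%N.
Hypothesis n_def : n = m.*2.
Local Notation V_ := (Vhalf gam xi Vm).
Local Notation tensor := {ffun 'I_n -> 'M[F]_n}.
Local Notation cf := (coord3 E).
Local Notation cP := (coord2 E).
Implicit Types (u v w : 'rV[F]_n) (Y : 'M[F]_n) (X : tensor).

(** [xi] is the vacuum, the [E false i] act as creation operators and the [E true i] as annihilation
    operators; [spin1], [spin2] and [spin3] are the states with one, two and three particles. *)
Definition spin1 i : 'rV[F]_sm := xi *m slash gam (E false i).
Definition spin2 i j : 'rV[F]_sp := spin1 i *m slash gam' (E false j).
Definition spin3 i j k : 'rV[F]_sm := spin2 i j *m slash gam (E false k).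

Let clifford1 u v := @slash_clifford F n g sp sm gam gam' u v
  (fun a b => (gam_clifford a b).1).
Let clifford2 u v := @slash_clifford F n g sm sp gam' gam u v
  (fun a b => (gam_clifford a b).2).

Lemma xi_true i : xi *m slash gam (E true i) = 0.
Proof. exact: (slash_true E_dual). Qed.

Lemma spin1_true i j : spin1 i *m slash gam' (E true j) = - (2 * (i == j)%:R) *: xi.
Proof.
rewrite /spin1 -mulmxA clifford1 mulmxBr mulmxN mulmxA xi_true mul0mx oppr0 sub0r.
by rewrite -scalemxAr mulmx1 (E_form E_dual) scaleNr.
Qed.

Lemma spin2_skew i j : spin2 i j = - spin2 j i.
Proof.
rewrite /spin2 /spin1 -!mulmxA clifford1 mulmxBr mulmxN (E_form E_dual).
by rewrite mulr0 scale0r mulmx0 subr0.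
Qed.

(** Anticommute the annihilation operator past the last creation operator; each contraction with the
    metric removes one index with the Clifford factor 2. *)
Lemma spin2_true i j k : spin2 i j *m slash gam (E true k) =
  (2 * (i == k)%:R) *: spin1 j - (2 * (j == k)%:R) *: spin1 i.
Proof.
rewrite /spin2 -mulmxA clifford2 mulmxBr mulmxN mulmxA spin1_true -scalemxAl scaleNr opprK.
by rewrite -scalemxAr mulmx1 (E_form E_dual).
Qed.

Lemma spin3_skew i j k : spin3 i j k = - spin3 i k j.
Proof.
rewrite /spin3 /spin2 -!mulmxA clifford2 mulmxBr mulmxN (E_form E_dual).
by rewrite mulr0 scale0r mulmx0 subr0 ?mulmxN.
Qed.

Lemma spin3_skew12 i j k : spin3 i j k = - spin3 j i k.
Proof. by rewrite /spin3 spin2_skew mulNmx. Qed.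

Lemma spin1_free (x : 'I_m -> F) :
  \sum_i x i *: spin1 i = 0 -> forall i, x i = 0.
Proof.
move=> h; apply: (slash_E_free E_dual) => A.
have e : (\sum_i x i *: spin1 i) 0 A = 0 by rewrite h mxE.
by rewrite -[RHS]e summxE; apply: eq_bigr => i _; rewrite [RHS]mxE.
Qed.

Lemma spin1_free2 (x : 'I_m -> 'I_m -> F) :
  (forall A B, \sum_i \sum_j x i j * (spin1 i 0 A * spin1 j 0 B) = 0) ->
  forall i j, x i j = 0.
Proof.
move=> h i j; move: j; apply: (slash_E_free E_dual) => B.
move: i; apply: (slash_E_free E_dual) => A; rewrite -[RHS](h A B).
apply: eq_bigr => i _; rewrite mulr_suml; apply: eq_bigr => j _.
by rewrite -/(spin1 i) -/(spin1 j); ring.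
Qed.

(** The spinor $Y_{bc}\xi^{bcA'}$ of a skew [Y], expanded in Fock states (see [sum_xi2u]). The block
    of [Y] with both labels [true] is absent because its spinors vanish. *)
Definition spin_contract Y : 'rV[F]_sp :=
  \sum_i \sum_j cP Y false false i j *: spin2 i j
  - (2 * \sum_i cP Y false true i i) *: xi.
Local Notation contract2 := spin_contract.

Lemma contract2_true Y l : (forall i j, cP Y false false i j = - cP Y false false j i) ->
  contract2 Y *m slash gam (E true l) = \sum_j (4 * cP Y false false l j) *: spin1 j.
Proof.
move=> skewY; rewrite /contract2 mulmxBl -scalemxAl xi_true scaler0 subr0 mulmx_suml.
transitivity (\sum_i \sum_j ((2 * cP Y false false i j * (i == l)%:R) *: spin1 j
    - (2 * cP Y false false i j * (j == l)%:R) *: spin1 i)).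
  apply: eq_bigr => i _; rewrite mulmx_suml; apply: eq_bigr => j _.
  by rewrite -scalemxAl spin2_true scalerBr !scalerA; congr (_ *: _ - _ *: _); ring.
under eq_bigr do rewrite sumrB; rewrite sumrB exchange_big -sumrB; apply: eq_bigr => j _.
rewrite -!scaler_suml -scalerBl; congr (_ *: _).
have sum_deltar (f : 'I_m -> F) : \sum_i f i * (i == l)%:R = f l.
  by under eq_bigr do rewrite mulrC; exact: sum_delta.
by rewrite !sum_deltar (skewY j l); ring.
Qed.

Lemma contract2_false Y l : contract2 Y *m slash gam (E false l) =
  \sum_i \sum_j cP Y false false i j *: spin3 i j l
  - (2 * \sum_i cP Y false true i i) *: spin1 l.
Proof.
rewrite /contract2 mulmxBl -scalemxAl mulmx_suml; congr (_ - _).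
by apply: eq_bigr => i _; rewrite mulmx_suml; apply: eq_bigr => j _; rewrite -scalemxAl.
Qed.

(** Annihilation by [E true l] leaves row [l] of the lowest block as coefficients of the free
    one-particle states; once that block is zero only a multiple of the nonzero [xi] remains. *)
Lemma contract2_eq0 Y : (forall i j, cP Y false false i j = - cP Y false false j i) ->
  contract2 Y = 0 <->
  (forall i j, cP Y false false i j = 0) /\ \sum_i cP Y false true i i = 0.
Proof.
move=> skewY; split=> [h|[h1 h2]]; last first.
  rewrite /contract2 h2 mulr0 scale0r subr0 big1 // => i _.
  by rewrite big1 // => j _; rewrite h1 scale0r.
have h1 i j : cP Y false false i j = 0.
  have := contract2_true i skewY; rewrite h mul0mx => /esym/spin1_free/(_ j)/eqP.
  by rewrite mulf_eq0 pnatr_eq0 => /eqP.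
split=> //; move: h; rewrite /contract2 big1 => [|i _]; last first.
  by rewrite big1 // => j _; rewrite h1 scale0r.
by move/eqP; rewrite sub0r oppr_eq0 scaler_eq0 (negPf xi_neq0) orbF mulf_eq0 pnatr_eq0 => /eqP.
Qed.

Lemma sum_ginv2 (Y T : 'I_n -> 'I_n -> F) :
  \sum_b \sum_c Y b c * (\sum_d \sum_e ginv g b d * ginv g c e * T d e) =
  \sum_s \sum_i \sum_t \sum_j (\sum_b \sum_c E s i 0 b * E t j 0 c * Y b c)
    * (\sum_d \sum_e E (~~ s) i 0 d * E (~~ t) j 0 e * T d e).
Proof.
have gE a d : ginv g a d = \sum_p E p.1 p.2 0 a * E (~~ p.1) p.2 0 d.
  rewrite (ginv_decomp g_metric E_dual) summxE -(pair_bigA _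
    (fun s i => E s i 0 a * E (~~ s) i 0 d)); apply: eq_bigr => s _.
  by rewrite summxE; apply: eq_bigr => i _; rewrite mxE big_ord1 mxE.
transitivity (\sum_p \sum_q \sum_x \sum_y E p.1 p.2 0 x.1 * E q.1 q.2 0 x.2 * Y x.1 x.2
    * (E (~~ p.1) p.2 0 y.1 * E (~~ q.1) q.2 0 y.2 * T y.1 y.2)).
  rewrite pair_bigA [RHS]pair_bigA [RHS]exchange_big; apply: eq_bigr => x _.
  rewrite [RHS]exchange_big [in LHS]pair_bigA mulr_sumr; apply: eq_bigr => y _ /=.
  rewrite !gE mulr_suml mulr_suml mulr_sumr -(pair_bigA _ (fun p q =>
    E p.1 p.2 0 x.1 * E q.1 q.2 0 x.2 * Y x.1 x.2
    * (E (~~ p.1) p.2 0 y.1 * E (~~ q.1) q.2 0 y.2 * T y.1 y.2))) /=.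
  apply: eq_bigr => p _; rewrite mulr_sumr mulr_suml mulr_sumr.
  by apply: eq_bigr => q _; ring.
rewrite [RHS]pair_bigA; apply: eq_bigr => p _ /=; rewrite [RHS]pair_bigA.
apply: eq_bigr => q _ /=; rewrite [X in _ = X * _]pair_bigA mulr_suml.
apply: eq_bigr => x _ /=; rewrite [X in _ = _ * X]pair_bigA mulr_sumr.
by apply: eq_bigr.
Qed.

Lemma xi_gam2_sum u v A : \sum_d \sum_e u 0 d * v 0 e * xi2l gam gam' xi d e A =
  (2^-1 *: (xi *m slash gam u *m slash gam' v - xi *m slash gam v *m slash gam' u)) 0 A.
Proof.
have G x y : xi *m slash gam x *m slash gam' y =
    \sum_d \sum_e (x 0 d * y 0 e) *: (xi *m (gam d *m gam' e)).
  rewrite -mulmxA /slash mulmx_suml mulmx_sumr; apply: eq_bigr => d _.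
  rewrite mulmx_sumr mulmx_sumr; apply: eq_bigr => e _.
  by rewrite -scalemxAl -!scalemxAr scalerA.
rewrite !G [X in _ - X]exchange_big -sumrB scaler_sumr summxE; apply: eq_bigr => d _.
rewrite -sumrB scaler_sumr summxE; apply: eq_bigr => e _.
have sE a (r : 'rV[F]_sp) : (a *: r) 0 A = a * r 0 A by rewrite mxE.
rewrite /xi2l /gam2 [v 0 e * _]mulrC -scalerBr -mulmxBr -scalemxAr !sE; ring.
Qed.

Lemma sum_xi2u Y A : Y^T = - Y ->
  \sum_b \sum_c Y b c * xi2u g gam gam' xi b c A = contract2 Y 0 A.
Proof.
move=> skewY; rewrite /xi2u sum_ginv2.
have skY s t i j : cP Y s t i j = - cP Y t s j i.
  have [h _] := mem_so g_metric E_dual Y; apply: h.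
  by apply/(mem_so_tr Y).
(* The spinor-valued two-form in the frame: a two-particle state, plus or minus a delta times [xi],
   or zero, according to the labels. *)
pose K s t i j := 2^-1 *: (xi *m slash gam (E s i) *m slash gam' (E t j)
  - xi *m slash gam (E t j) *m slash gam' (E s i)).
transitivity ((\sum_s \sum_i \sum_t \sum_j cP Y s t i j *: K s t i j) 0 A).
  rewrite summxE -[RHS](@sum_negb F); apply: eq_bigr => s _.
  rewrite summxE; apply: eq_bigr => i _; rewrite summxE -[RHS](@sum_negb F).
  apply: eq_bigr => t _; rewrite summxE; apply: eq_bigr => j _.
  by rewrite [RHS]mxE /coord2 !negbK formE xi_gam2_sum.
have Kff i j : K false false i j = spin2 i j.
  rewrite /K -!/(spin1 _) -/(spin2 _ _) -/(spin2 _ _) (spin2_skew j i) opprK -mulr2n.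
  by rewrite -scaler_nat scalerA mulVf ?scale1r ?pnatr_eq0.
have Kft i j : K false true i j = - (i == j)%:R *: xi.
  rewrite /K -/(spin1 _) spin1_true xi_true mul0mx subr0 scalerA; congr (_ *: _).
  by field.
have Ktf i j : K true false i j = (i == j)%:R *: xi.
  by rewrite -[LHS]opprK -scalerN opprB -/(K false true j i) Kft scaleNr opprK eq_sym.
have Ktt i j : K true true i j = 0 by rewrite /K !xi_true !mul0mx subrr scaler0.
have sdelta (c : 'I_m -> F) i : \sum_j (c j * (i == j)%:R) *: xi = c i *: xi.
  rewrite -scaler_suml; congr (_ *: _); under eq_bigr do rewrite mulrC.
  exact: sum_delta_sym.
have e1 : \sum_i \sum_t \sum_j cP Y true t i j *: K true t i j =
    - (\sum_i cP Y false true i i) *: xi.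
  rewrite -sumrN scaler_suml; apply: eq_bigr => i _; rewrite big_bool /=.
  rewrite big1 ?add0r => [|j _]; last by rewrite Ktt scaler0.
  under eq_bigr do rewrite Ktf scalerA.
  by rewrite sdelta skY.
have e2 : \sum_i \sum_t \sum_j cP Y false t i j *: K false t i j =
    \sum_i \sum_j cP Y false false i j *: spin2 i j - (\sum_i cP Y false true i i) *: xi.
  rewrite scaler_suml -sumrB; apply: eq_bigr => i _; rewrite big_bool /= addrC.
  congr (_ + _); first by apply: eq_bigr => j _; rewrite Kff.
  under eq_bigr do rewrite Kft scalerA mulrN scaleNr.
  by rewrite sumrN sdelta.
rewrite big_bool /= e1 e2 /contract2 addrC -addrA scaleNr -opprD -scalerDl.
by rewrite (_ : _ + _ = 2 * \sum_i cP Y false true i i) //; ring.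
Qed.

End Spinors.

(** * The seven maps evaluated on frame vectors *)

Section Projections.
Variables (F : numFieldType) (n sp sm m : nat).
Variable g : 'M[F]_n.
Variables (gam : 'I_n -> 'M[F]_(sp, sm)) (gam' : 'I_n -> 'M[F]_(sm, sp)).
Variables (xi : 'rV[F]_sp) (Vm : {vspace 'rV[F]_n}).
Hypothesis g_metric : nondegenerate_symmetric g.
Hypothesis gam_clifford : clifford_relations g gam gam'.
Hypothesis xi_neq0 : xi != 0.
Variable E : bool -> 'I_m -> 'rV[F]_n.
Hypothesis E_dual : dual_basis g gam xi Vm E.
Hypothesis m_gt2 : (2 < m)%N.
Hypothesis n_def : n = m.*2.
Local Notation V_ := (Vhalf gam xi Vm).
Local Notation tensor := {ffun 'I_n -> 'M[F]_n}.
Local Notation cf := (coord3 E).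
Local Notation cP := (coord2 E).
Local Notation spin1 := (spin1 gam xi E).
Local Notation spin2 := (spin2 gam gam' xi E).
Local Notation spin3 := (spin3 gam gam' xi E).
Local Notation contract2 := (spin_contract gam gam' xi E).
Implicit Types (u v w : 'rV[F]_n) (Y : 'M[F]_n) (X : tensor).

Lemma cotton_york_slice X u : cotton_york E X -> slice u X \in so_alg F n.
Proof.
case=> skX _ _; have gen s i : slice (E s i) X \in so_alg F n.
  apply/(mem_so g_metric E_dual) => t r j k; rewrite -(negbK s).
  by rewrite -!cf_slice; exact: skX.
rewrite (E_decomp E_dual u) double_sum slice_sum; apply: memv_suml => p _.
exact: memvZ.
Qed.

Lemma scalemx_entry p q a (A : 'M[F]_(p, q)) i j : (a *: A) i j = a * A i j.
Proof. by rewrite mxE. Qed.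

Lemma mx0_entry p q i j : (0 : 'M[F]_(p, q)) i j = 0.
Proof. by rewrite mxE. Qed.

Lemma slice_delta a X : slice (delta_mx 0 a) X = X a.
Proof.
rewrite /slice (bigD1 a) //= big1 => [|b ba]; rewrite !mxE !eqxx ?scale1r ?addr0 //=.
by rewrite (negPf ba) scale0r.
Qed.

Lemma contract2_sum (I : finType) (x : I -> F) (f : I -> 'M[F]_n) :
  contract2 (\sum_i x i *: f i) = \sum_i x i *: contract2 (f i).
Proof.
have e (s t : bool) i j : cP (\sum_k x k *: f k) s t i j = \sum_k x k * cP (f k) s t i j.
  by rewrite cP_sum; apply: eq_bigr => k _; rewrite cPZ.
rewrite /spin_contract; under [RHS]eq_bigr do rewrite scalerBr; rewrite sumrB; congr (_ - _).
  under [RHS]eq_bigr do rewrite scaler_sumr; rewrite [RHS]exchange_big; apply: eq_bigr => i _.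
  under [RHS]eq_bigr do rewrite scaler_sumr; rewrite [RHS]exchange_big; apply: eq_bigr => j _.
  by rewrite e scaler_suml; apply: eq_bigr => k _; rewrite scalerA.
under [RHS]eq_bigr do rewrite scalerA; rewrite -scaler_suml; congr (_ *: _).
under eq_bigr do rewrite e; rewrite exchange_big [LHS]mulr_sumr; apply: eq_bigr => k _.
by rewrite -mulr_sumr mulrCA.
Qed.

Lemma sum_X_xi2u X a A : cotton_york E X ->
  \sum_b \sum_c X a b c * xi2u g gam gam' xi b c A = contract2 (X a) 0 A.
Proof.
move=> hX; apply: (sum_xi2u g_metric gam_clifford E_dual); apply/(mem_so_tr (X a)).
by rewrite -slice_delta; exact: cotton_york_slice.
Qed.

Lemma sum_xi1u (p : nat) X (M : 'M[F]_(sp, p)) A B :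
  \sum_d xi1u g gam xi d B * (contract2 (X d) *m M) 0 A =
  \sum_k spin1 k 0 B * (contract2 (slice (E true k) X) *m M) 0 A.
Proof.
under eq_bigr => d _ do rewrite (xi1uE g_metric E_dual) mulr_suml.
rewrite exchange_big; apply: eq_bigr => k _; rewrite /slice contract2_sum mulmx_suml summxE.
rewrite mulr_sumr; apply: eq_bigr => d _; rewrite -scalemxAl scalemx_entry.
rewrite -/(spin1 k); ring.
Qed.

(** The vector $\xi^{aA}$ for a fixed spinor index [A] (see [xi1u_null]). *)
Definition null_dir A : 'rV[F]_n := \sum_i spin1 i 0 A *: E true i.

Lemma xi1u_null a A : xi1u g gam xi a A = null_dir A 0 a.
Proof.
rewrite (xi1uE g_metric E_dual) summxE; apply: eq_bigr => i _.
by rewrite scalemx_entry mulrC.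
Qed.

Lemma Pi_m32_0E X A B C :
  Pi_m32_0 g gam xi X A B C = tri X (null_dir A) (null_dir B) (null_dir C).
Proof.
by rewrite triE; do 3 (apply: eq_bigr => ? _); rewrite !xi1u_null.
Qed.

Lemma Pi_m12_0E X A C : cotton_york E X -> Pi_m12_0 g gam gam' xi X A C =
  \sum_k spin1 k 0 A * contract2 (slice (E true k) X) 0 C.
Proof.
move=> hX; transitivity (\sum_d xi1u g gam xi d A * (contract2 (X d) *m 1%:M) 0 C).
  apply: eq_bigr => d _; rewrite mulmx1 -sum_X_xi2u // mulr_sumr; apply: eq_bigr => b _.
  by rewrite mulr_sumr; apply: eq_bigr => c _; rewrite mulrA.
by rewrite sum_xi1u; under eq_bigr do rewrite mulmx1.
Qed.

Lemma sum4_contract X a d A : cotton_york E X ->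
  \sum_b \sum_c \sum_D gam a D A * xi2u g gam gam' xi b c D * X d b c =
  (contract2 (X d) *m gam a) 0 A.
Proof.
move=> hX; rewrite mxE; under [RHS]eq_bigr => D _ do rewrite -sum_X_xi2u // mulr_suml.
rewrite [RHS]exchange_big; apply: eq_bigr => b _.
under [RHS]eq_bigr => D _ do rewrite mulr_suml.
rewrite [RHS]exchange_big; apply: eq_bigr => c _; apply: eq_bigr => D _.
by ring.
Qed.

Lemma gamXxiE X a b A : cotton_york E X ->
  gamXxi g gam gam' xi X a b A = (contract2 (X b) *m gam a) 0 A.
Proof.
move=> hX; rewrite -sum4_contract //; do 3 (apply: eq_bigr => ? _); ring.
Qed.

(** The free vector index is absorbed by a test vector [v], so that the map can later be tested on
    the frame, where [spin_contract] and [slash] have simple values. *)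
Lemma Pi_m12_1E X v B C : cotton_york E X ->
  \sum_a v 0 a * Pi_m12_1 g gam gam' xi X a B C =
  form (slice v X) (null_dir B) (null_dir C) + (n%:R - 2)^-1 * \sum_k 2^-1 *
   (spin1 k 0 C * (contract2 (slice (E true k) X) *m slash gam v) 0 B -
    spin1 k 0 B * (contract2 (slice (E true k) X) *m slash gam v) 0 C).
Proof.
move=> hX; rewrite /Pi_m12_1; under eq_bigr do rewrite mulrDr; rewrite big_split /=; congr (_ + _).
  rewrite -/(tri X v _ _) triE; apply: eq_bigr => a _; rewrite mulr_sumr.
  apply: eq_bigr => b _; rewrite mulr_sumr; apply: eq_bigr => c _.
  by rewrite !xi1u_null; ring.
under eq_bigr do rewrite mulrCA; rewrite -mulr_sumr; congr (_ * _).
transitivity (\sum_a v 0 a * (2^-1 * (\sum_d xi1u g gam xi d C * (contract2 (X d) *m gam a) 0 B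
   - \sum_d xi1u g gam xi d B * (contract2 (X d) *m gam a) 0 C))).
  apply: eq_bigr => a _; congr (_ * _); rewrite -sumrB mulr_sumr; apply: eq_bigr => d _.
  rewrite -!sum4_contract // !mulr_sumr -sumrB mulr_sumr; apply: eq_bigr => b _.
  rewrite !mulr_sumr -sumrB mulr_sumr; apply: eq_bigr => c _.
  rewrite !mulr_sumr -sumrB mulr_sumr; apply: eq_bigr => D _; ring.
transitivity (\sum_a \sum_k v 0 a * (2^-1 *
    (spin1 k 0 C * (contract2 (slice (E true k) X) *m gam a) 0 B -
     spin1 k 0 B * (contract2 (slice (E true k) X) *m gam a) 0 C))).
  by apply: eq_bigr => a _; rewrite !sum_xi1u -sumrB !mulr_sumr.
rewrite exchange_big; apply: eq_bigr => k _; rewrite !slash_rowE !mulr_sumr -sumrB mulr_sumr.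
by apply: eq_bigr => a _; ring.
Qed.

Lemma Pi_m12_2E X v A B : cotton_york E X ->
  \sum_c v 0 c * Pi_m12_2 g gam gam' xi X c A B =
  2^-1 * (tri X (null_dir A) (null_dir B) v + tri X (null_dir B) (null_dir A) v)
  + 3 / (2 * (n%:R + 2)) * \sum_k 2^-1 *
   (spin1 k 0 B * (contract2 (slice (E true k) X) *m slash gam v) 0 A +
    spin1 k 0 A * (contract2 (slice (E true k) X) *m slash gam v) 0 B).
Proof.
move=> hX; rewrite /Pi_m12_2; under eq_bigr do rewrite mulrDr; rewrite big_split /=; congr (_ + _).
  under eq_bigr do rewrite mulr_sumr; rewrite exchange_big !triE -big_split mulr_sumr.
  apply: eq_bigr => a _; under eq_bigr do rewrite mulr_sumr.
  rewrite [LHS]exchange_big /= -big_split mulr_sumr; apply: eq_bigr => b _ /=.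
  rewrite -[X in _ = _ * X]big_split [RHS]mulr_sumr; apply: eq_bigr => c _ /=.
  by rewrite !xi1u_null /=; ring.
under eq_bigr do rewrite mulrCA; rewrite -mulr_sumr; congr (_ * _).
transitivity (\sum_a v 0 a * (2^-1 * (\sum_d xi1u g gam xi d B * (contract2 (X d) *m gam a) 0 A
   + \sum_d xi1u g gam xi d A * (contract2 (X d) *m gam a) 0 B))).
  apply: eq_bigr => a _; congr (_ * _); rewrite -big_split mulr_sumr; apply: eq_bigr => d _.
  rewrite /= -!sum4_contract // !mulr_sumr -big_split mulr_sumr; apply: eq_bigr => b _.
  rewrite /= !mulr_sumr -big_split mulr_sumr; apply: eq_bigr => c _.
  rewrite /= !mulr_sumr -big_split mulr_sumr; apply: eq_bigr => D _ /=; ring.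
transitivity (\sum_a \sum_k v 0 a * (2^-1 *
    (spin1 k 0 B * (contract2 (slice (E true k) X) *m gam a) 0 A +
     spin1 k 0 A * (contract2 (slice (E true k) X) *m gam a) 0 B))).
  by apply: eq_bigr => a _; rewrite !sum_xi1u -big_split !mulr_sumr.
rewrite exchange_big; apply: eq_bigr => k _; rewrite !slash_rowE !mulr_sumr -big_split mulr_sumr.
by apply: eq_bigr => a _ /=; ring.
Qed.

Lemma Pi_p12_0E X v A : cotton_york E X ->
  \sum_a v 0 a * Pi_p12_0 g gam gam' xi X a A = contract2 (slice v X) 0 A.
Proof.
move=> hX; rewrite /slice contract2_sum summxE; apply: eq_bigr => a _.
by rewrite /Pi_p12_0 sum_X_xi2u // scalemx_entry.
Qed.

Lemma contract2_slash X u v A : \sum_a u 0 a * \sum_b v 0 b * (contract2 (X b) *m gam a) 0 A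
  = (contract2 (slice v X) *m slash gam u) 0 A.
Proof.
rewrite slash_rowE; apply: eq_bigr => a _; congr (_ * _).
rewrite /slice contract2_sum mulmx_suml summxE; apply: eq_bigr => b _.
by rewrite -scalemxAl scalemx_entry.
Qed.

Lemma contract2_slash' X u v A :
  \sum_a u 0 a * \sum_b v 0 b * (contract2 (X a) *m gam b) 0 A
  = (contract2 (slice u X) *m slash gam v) 0 A.
Proof.
rewrite -contract2_slash [RHS](eq_bigr (fun b => \sum_a u 0 a * (v 0 b * (contract2 (X a) *m gam b) 0 A))).
  by rewrite [RHS]exchange_big; apply: eq_bigr => a _; rewrite mulr_sumr.
by move=> b _; rewrite mulr_sumr; apply: eq_bigr => a _; ring.
Qed.

Lemma sum1_lin (u f1 f2 f3 : 'I_n -> F) (c d e : F) :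
  \sum_a u a * (f1 a + c * (d * (f2 a + e * f3 a))) =
  \sum_a u a * f1 a + c * (d * (\sum_a u a * f2 a + e * \sum_a u a * f3 a)).
Proof.
rewrite mulr_sumr -big_split mulr_sumr mulr_sumr -big_split; apply: eq_bigr => a _ /=.
by ring.
Qed.

Lemma sum2_lin (u v : 'rV[F]_n) (f1 f2 f3 : 'I_n -> 'I_n -> F) (c d e : F) :
  \sum_a u 0 a * \sum_b v 0 b * (f1 a b + c * (d * (f2 a b + e * f3 a b))) =
  \sum_a u 0 a * (\sum_b v 0 b * f1 a b) +
  c * (d * (\sum_a u 0 a * (\sum_b v 0 b * f2 a b) + e * \sum_a u 0 a * (\sum_b v 0 b * f3 a b))).
Proof.
by rewrite -sum1_lin; apply: eq_bigr => a _; rewrite sum1_lin.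
Qed.

Lemma tri_null1 X A u v : tri X (null_dir A) u v =
  \sum_a u 0 a * \sum_b v 0 b * \sum_c xi1u g gam xi c A * X c a b.
Proof.
rewrite triE exchange_big; apply: eq_bigr => a _; rewrite mulr_sumr exchange_big.
apply: eq_bigr => b _; rewrite !mulr_sumr; apply: eq_bigr => c _.
by rewrite xi1u_null; ring.
Qed.

Lemma Pi_p12_1E X u v A : cotton_york E X ->
  \sum_a u 0 a * \sum_b v 0 b * Pi_p12_1 g gam gam' xi X a b A =
  tri X (null_dir A) u v - (n%:R - 2)^-1 * (2^-1 *
    ((contract2 (slice v X) *m slash gam u) 0 A - (contract2 (slice u X) *m slash gam v) 0 A)).
Proof.
move=> hX; rewrite -contract2_slash -contract2_slash' tri_null1.
rewrite -mulNr -[X in _ + _ * (_ * (_ - X))]mul1r -[X in _ + _ * (_ * (_ + X))]mulNr -sum2_lin.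
apply: eq_bigr => a _; congr (_ * _); apply: eq_bigr => b _; congr (_ * _).
by rewrite /Pi_p12_1 !gamXxiE //; ring.
Qed.

Lemma tri_null3 X A u v : 2^-1 * (tri X u v (null_dir A) + tri X v u (null_dir A)) =
  \sum_a u 0 a * \sum_b v 0 b * \sum_c 2^-1 * (X a b c + X b a c) * xi1u g gam xi c A.
Proof.
rewrite !triE [X in _ + X]exchange_big -big_split mulr_sumr; apply: eq_bigr => a _ /=.
rewrite -big_split !mulr_sumr; apply: eq_bigr => b _ /=.
rewrite -big_split !mulr_sumr; apply: eq_bigr => c _ /=.
by rewrite xi1u_null; ring.
Qed.

Lemma Pi_p12_2E X u v A : cotton_york E X ->
  \sum_a u 0 a * \sum_b v 0 b * Pi_p12_2 g gam gam' xi X a b A =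
  2^-1 * (tri X u v (null_dir A) + tri X v u (null_dir A)) - 3 / (2 * (n%:R + 2)) * (2^-1 *
    ((contract2 (slice v X) *m slash gam u) 0 A + (contract2 (slice u X) *m slash gam v) 0 A)).
Proof.
move=> hX; rewrite -contract2_slash -contract2_slash' tri_null3.
rewrite -mulNr -[X in _ + _ * (_ * (_ + X))]mul1r -sum2_lin.
apply: eq_bigr => a _; congr (_ * _); apply: eq_bigr => b _; congr (_ * _).
by rewrite /Pi_p12_2 !gamXxiE //; ring.
Qed.
End Projections.

(** * Kernels of the seven maps in terms of the tensors [mixed s X] *)

Section Kernels.
Variables (F : numFieldType) (n sp sm m : nat).
Variable g : 'M[F]_n.
Variables (gam : 'I_n -> 'M[F]_(sp, sm)) (gam' : 'I_n -> 'M[F]_(sm, sp)).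
Variables (xi : 'rV[F]_sp) (Vm : {vspace 'rV[F]_n}).
Hypothesis g_metric : nondegenerate_symmetric g.
Hypothesis gam_clifford : clifford_relations g gam gam'.
Hypothesis xi_neq0 : xi != 0.
Variable E : bool -> 'I_m -> 'rV[F]_n.
Hypothesis E_dual : dual_basis g gam xi Vm E.
Hypothesis m_gt2 : (2 < m)%N.
Hypothesis n_def : n = m.*2.
Local Notation tensor := {ffun 'I_n -> 'M[F]_n}.
Local Notation cf := (coord3 E).
Local Notation cP := (coord2 E).
Local Notation spin1 := (spin1 gam xi E).
Local Notation spin2 := (spin2 gam gam' xi E).
Local Notation spin3 := (spin3 gam gam' xi E).
Local Notation contract2 := (spin_contract gam gam' xi E).
Local Notation vanishes := (Pi_vanishes g gam gam' xi).
Implicit Types (u v w : 'rV[F]_n) (Y : 'M[F]_n) (X : tensor).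
Implicit Types (B : {ffun 'I_m -> 'M[F]_m}).

(** For a Cotton-York tensor this block determines all coordinates with exactly two labels equal to
    [s] ([cf_mid], [cf_first]): weight -1/2 for [s = false], weight 1/2 for [s = true]. *)
Definition mixed (s : bool) X : {ffun 'I_m -> 'M[F]_m} :=
  [ffun i => \matrix_(j, k) cf X s s (~~ s) i j k].

Lemma mixedE s X i j k : mixed s X i j k = cf X s s (~~ s) i j k.
Proof. by rewrite ffunE mxE. Qed.

(** Vanishing of the trace, of the skew traceless part and of the symmetric traceless part. As the
    other trace is half of [tr23], the skew and symmetric parts have traces 1/2 and 3/2 times
    [tr23]; division by [m - 1] and [m + 1] gives the constants. *)
Definition comp_zero (k : nat) B : Prop :=
  match k with
  | 0%N => forall i, tr23 B i = 0
  | 1%N => forall i j l, B i j l - B j i l =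
      (2 * (m%:R - 1))^-1 * ((j == l)%:R * tr23 B i - (i == l)%:R * tr23 B j)
  | 2%N => forall i j l, B i j l + B j i l =
      3 / (2 * (m%:R + 1)) * ((j == l)%:R * tr23 B i + (i == l)%:R * tr23 B j)
  | _ => True
  end.

Section CottonYork.
Variable X : tensor.
Hypothesis hX : cotton_york E X.

Lemma cf_mid s i j k : cf X s (~~ s) s i j k = - mixed s X i k j.
Proof. by rewrite mixedE; case: hX => h _ _; rewrite h. Qed.

(** The cyclic identity expresses the coordinate with the odd label in front by the two other
    arrangements. *)
Lemma cf_first s i j k : cf X (~~ s) s s i j k = mixed s X k j i - mixed s X j k i.
Proof.
have [_ h _] := hX; have := h (~~ s) s s i j k.
by rewrite cf_mid !mixedE => /eqP; rewrite -addrA addr_eq0 => /eqP ->; ring.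
Qed.

(** The metric trace contracts opposite labels; by [cf_mid] and [cf_first] it equals [tr23] minus
    twice [tr13]. *)
Lemma tr13_mixed s i : tr13 (mixed s X) i = tr23 (mixed s X) i / 2.
Proof.
have [_ _ h] := hX; have := h s i; rewrite (bigD1 s) //= (bigD1 (~~ s)) /=; last by case: s.
rewrite negbK [X in _ + (_ + X)]big1 ?addr0; last by case: s => [] [].
under eq_bigr do rewrite cf_mid; under [X in _ + X]eq_bigr do rewrite cf_first.
rewrite sumrN sumrB -/(tr13 _ _) -/(tr23 _ _) => e.
have -> : tr23 (mixed s X) i = 2 * tr13 (mixed s X) i.
  by apply/eqP; rewrite -subr_eq0 -[X in _ == X]e; apply/eqP; ring.
by field.
Qed.

Lemma cf_hook s : hook [ffun i => \matrix_(j, k) cf X s s s i j k].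
Proof. by have [h1 h2 _] := hX; split=> i j k; rewrite !ffunE !mxE. Qed.

Lemma cP_slice_skew s t i j k : cP (slice (E s i) X) t t j k = - cP (slice (E s i) X) t t k j.
Proof. by have [h _ _] := hX; have := h (~~ s) t t i j k; rewrite !cf_slice !negbK. Qed.

Lemma nR : n%:R = 2 * m%:R :> F.
Proof. by rewrite n_def -muln2 natrM mulrC. Qed.

Lemma m_sub2 : m%:R - 2 != 0 :> F.
Proof. by rewrite subr_eq0 eqr_nat; case: eqP m_gt2 => // ->. Qed.

Lemma covector2_eq0 (f : 'I_n -> 'I_n -> F) :
  (forall s t i j, \sum_a E (~~ s) i 0 a * \sum_b E (~~ t) j 0 b * f a b = 0) ->
  forall a b, f a b = 0.
Proof.
move=> h a; apply: (covector_eq0 g_metric E_dual) => t j; move: a.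
by apply: (covector_eq0 g_metric E_dual) => s i; exact: h.
Qed.

Lemma vanishes00 : vanishes 0 0 X <-> forall i j k, cf X false false false i j k = 0.
Proof.
have e P Q C : Pi_m32_0 g gam xi X P Q C = \sum_i (\sum_j (\sum_k
    cf X false false false i j k * spin1 k 0 C) * spin1 j 0 Q) * spin1 i 0 P.
  rewrite (Pi_m32_0E g_metric E_dual) /null_dir tri1_sum; apply: eq_bigr => i _.
  rewrite mulrC /tri form2_sum; congr (_ * _); apply: eq_bigr => j _.
  rewrite mulrC form3_sum; congr (_ * _); apply: eq_bigr => k _.
  by rewrite mulrC.
split=> [h i j k|h P Q C]; last first.
  rewrite e big1 // => i _; rewrite big1 ?mul0r // => j _; rewrite big1 ?mul0r // => k _.
  by rewrite h mul0r.
move: k; apply: (slash_E_free E_dual) => C; move: j; apply: (slash_E_free E_dual) => Q.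
by move: i; apply: (slash_E_free E_dual) => P; rewrite -[RHS](h P Q C) e.
Qed.

Lemma vanishes10 : vanishes 1 0 X <->
  (forall i j k, cf X false false false i j k = 0) /\ comp_zero 0 (mixed false X).
Proof.
have e : vanishes 1 0 X <-> forall k, contract2 (slice (E true k) X) = 0.
  split=> [h k|h A C]; last first.
    rewrite (Pi_m12_0E g_metric gam_clifford E_dual) // big1 // => k _.
    by rewrite h mx0_entry mulr0.
  apply/rowP => C; rewrite [RHS]mx0_entry; move: k; apply: (slash_E_free E_dual) => A.
  rewrite -[RHS](h A C) (Pi_m12_0E g_metric gam_clifford E_dual) //.
  by apply: eq_bigr => k _; rewrite mulrC.
have c k := contract2_eq0 gam_clifford xi_neq0 E_dual (cP_slice_skew true false k).
split=> [/e h|[h1 h2]]; last first.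
  apply/e => k; apply/c; split=> [i j|]; first exact: h1.
  by rewrite -[RHS](h2 k); apply: eq_bigr => i _; rewrite mixedE.
split=> [i j k|k]; first exact: ((c i).1 (h i)).1.
rewrite -[RHS]((c k).1 (h k)).2; apply: eq_bigr => i _.
by rewrite mixedE.
Qed.

Lemma spin1_sum_eq0 (x : 'I_m -> F) :
  (forall A, \sum_i x i * spin1 i 0 A = 0) <-> forall i, x i = 0.
Proof.
split=> [|h A]; first exact: (slash_E_free E_dual).
by rewrite big1 // => i _; rewrite h mul0r.
Qed.

Lemma spin1_sum2_eq0 (x : 'I_m -> 'I_m -> F) :
  (forall A1 A2, \sum_i \sum_j x i j * (spin1 i 0 A1 * spin1 j 0 A2) = 0) <->
  forall i j, x i j = 0.
Proof.
split=> [|h A1 A2]; first exact: (spin1_free2 E_dual).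
by rewrite big1 // => i _; rewrite big1 // => j _; rewrite h mul0r.
Qed.

Lemma row_entry (q : 'I_m -> F) A : (\sum_j q j *: spin1 j) 0 A = \sum_j q j * spin1 j 0 A.
Proof. by rewrite summxE; apply: eq_bigr => j _; rewrite scalemx_entry. Qed.

Lemma spin1_collect (q : 'I_m -> 'I_m -> F) e A1 A2 :
  \sum_k 2^-1 * (spin1 k 0 A2 * (\sum_j q k j *: spin1 j) 0 A1 +
                 e * (spin1 k 0 A1 * (\sum_j q k j *: spin1 j) 0 A2)) =
  \sum_i \sum_j 2^-1 * (q j i + e * q i j) * (spin1 i 0 A1 * spin1 j 0 A2).
Proof.
transitivity (\sum_k \sum_j 2^-1 * q k j * (spin1 j 0 A1 * spin1 k 0 A2) +
              \sum_k \sum_j 2^-1 * (e * q k j) * (spin1 k 0 A1 * spin1 j 0 A2)).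
  rewrite -big_split; apply: eq_bigr => k _; rewrite !row_entry.
  rewrite !mulr_sumr -!big_split mulr_sumr; apply: eq_bigr => j _ /=; ring.
rewrite exchange_big -big_split; apply: eq_bigr => i _; rewrite -big_split.
by apply: eq_bigr => j _ /=; ring.
Qed.

Lemma tri_null12 v A1 A2 : tri X (null_dir gam xi E A1) (null_dir gam xi E A2) v =
  \sum_i \sum_j tri X (E true i) (E true j) v * (spin1 i 0 A1 * spin1 j 0 A2).
Proof.
rewrite /null_dir tri1_sum; apply: eq_bigr => i _; rewrite /tri form2_sum mulr_sumr.
by apply: eq_bigr => j _; ring.
Qed.

Lemma form_null v A1 A2 :
  form (slice v X) (null_dir gam xi E A1) (null_dir gam xi E A2) =
  \sum_i \sum_j cP (slice v X) false false i j * (spin1 i 0 A1 * spin1 j 0 A2).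
Proof.
rewrite /null_dir form2_sum; apply: eq_bigr => i _; rewrite form3_sum mulr_sumr.
by apply: eq_bigr => j _; rewrite /coord2 /=; ring.
Qed.

(** Once the contracted spinors are one-particle states, with coefficients [q], the map is a
    combination of products of two free spinors and vanishes exactly when all coefficients do. The
    three similar lemmas below serve the other maps. *)
Lemma Pi_m12_1_contract v (q : 'I_m -> 'I_m -> F) :
  (forall k, contract2 (slice (E true k) X) *m slash gam v = \sum_j q k j *: spin1 j) ->
  (forall A1 A2, \sum_a v 0 a * Pi_m12_1 g gam gam' xi X a A1 A2 = 0) <->
  forall i j, cP (slice v X) false false i j
    + (2 * (m%:R - 1))^-1 * (2^-1 * (q j i - q i j)) = 0.
Proof.
move=> hq; rewrite -spin1_sum2_eq0.
suff e A1 A2 : \sum_a v 0 a * Pi_m12_1 g gam gam' xi X a A1 A2 = \sum_i \sum_j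
    (cP (slice v X) false false i j + (2 * (m%:R - 1))^-1 * (2^-1 * (q j i - q i j)))
    * (spin1 i 0 A1 * spin1 j 0 A2).
  by split=> h A1 A2; have := h A1 A2; rewrite e.
rewrite (Pi_m12_1E g_metric gam_clifford E_dual) // form_null nR.
rewrite (_ : 2 * m%:R - 2 = 2 * (m%:R - 1)); last by ring.
rewrite [X in _ + _ * X](eq_bigr (fun k => 2^-1 *
    (spin1 k 0 A2 * (\sum_j q k j *: spin1 j) 0 A1 +
     -1 * (spin1 k 0 A1 * (\sum_j q k j *: spin1 j) 0 A2)))) => [|k _]; last first.
  by rewrite hq mulN1r.
rewrite spin1_collect mulr_sumr -big_split; apply: eq_bigr => i _.
rewrite mulr_sumr -big_split; apply: eq_bigr => j _ /=; ring.
Qed.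

Lemma Pi_m12_2_contract v (q : 'I_m -> 'I_m -> F) :
  (forall k, contract2 (slice (E true k) X) *m slash gam v = \sum_j q k j *: spin1 j) ->
  (forall A1 A2, \sum_a v 0 a * Pi_m12_2 g gam gam' xi X a A1 A2 = 0) <->
  forall i j, 2^-1 * (tri X (E true i) (E true j) v + tri X (E true j) (E true i) v)
    + 3 / (4 * (m%:R + 1)) * (2^-1 * (q j i + q i j)) = 0.
Proof.
move=> hq; rewrite -spin1_sum2_eq0.
suff e A1 A2 : \sum_a v 0 a * Pi_m12_2 g gam gam' xi X a A1 A2 = \sum_i \sum_j
    (2^-1 * (tri X (E true i) (E true j) v + tri X (E true j) (E true i) v)
    + 3 / (4 * (m%:R + 1)) * (2^-1 * (q j i + q i j)))
    * (spin1 i 0 A1 * spin1 j 0 A2).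
  by split=> h A1 A2; have := h A1 A2; rewrite e.
rewrite (Pi_m12_2E g_metric gam_clifford E_dual) // !tri_null12 nR.
rewrite (_ : 2 * (2 * m%:R + 2) = 4 * (m%:R + 1)); last by ring.
rewrite [X in _ + _ * X](eq_bigr (fun k => 2^-1 *
    (spin1 k 0 A2 * (\sum_j q k j *: spin1 j) 0 A1 +
     1 * (spin1 k 0 A1 * (\sum_j q k j *: spin1 j) 0 A2)))) => [|k _]; last first.
  by rewrite hq mul1r.
rewrite spin1_collect [X in _ * (_ + X)]exchange_big -big_split !mulr_sumr -big_split.
apply: eq_bigr => i _; rewrite /= -big_split !mulr_sumr -big_split.
by apply: eq_bigr => j _ /=; ring.
Qed.

Lemma Pi_p12_1_contract u v (q1 q2 : 'I_m -> F) :
  contract2 (slice v X) *m slash gam u = \sum_j q1 j *: spin1 j ->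
  contract2 (slice u X) *m slash gam v = \sum_j q2 j *: spin1 j ->
  (forall A, \sum_a u 0 a * \sum_b v 0 b * Pi_p12_1 g gam gam' xi X a b A = 0) <->
  forall k, tri X (E true k) u v - (2 * (m%:R - 1))^-1 * (2^-1 * (q1 k - q2 k)) = 0.
Proof.
move=> h1 h2; rewrite -spin1_sum_eq0.
suff e A : \sum_a u 0 a * \sum_b v 0 b * Pi_p12_1 g gam gam' xi X a b A = \sum_k
    (tri X (E true k) u v - (2 * (m%:R - 1))^-1 * (2^-1 * (q1 k - q2 k))) * spin1 k 0 A.
  by split=> h A; have := h A; rewrite e.
rewrite (Pi_p12_1E g_metric gam_clifford E_dual) // h1 h2 nR !row_entry /null_dir tri1_sum.
rewrite (_ : 2 * m%:R - 2 = 2 * (m%:R - 1)); last by ring.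
by rewrite -sumrB !mulr_sumr -sumrB; apply: eq_bigr => k _ /=; ring.
Qed.

Lemma Pi_p12_2_contract u v (q1 q2 : 'I_m -> F) :
  contract2 (slice v X) *m slash gam u = \sum_j q1 j *: spin1 j ->
  contract2 (slice u X) *m slash gam v = \sum_j q2 j *: spin1 j ->
  (forall A, \sum_a u 0 a * \sum_b v 0 b * Pi_p12_2 g gam gam' xi X a b A = 0) <->
  forall k, 2^-1 * (tri X u v (E true k) + tri X v u (E true k))
    - 3 / (4 * (m%:R + 1)) * (2^-1 * (q1 k + q2 k)) = 0.
Proof.
move=> h1 h2; rewrite -spin1_sum_eq0.
suff e A : \sum_a u 0 a * \sum_b v 0 b * Pi_p12_2 g gam gam' xi X a b A = \sum_k
    (2^-1 * (tri X u v (E true k) + tri X v u (E true k))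
    - 3 / (4 * (m%:R + 1)) * (2^-1 * (q1 k + q2 k))) * spin1 k 0 A.
  by split=> h A; have := h A; rewrite e.
rewrite (Pi_p12_2E g_metric gam_clifford E_dual) // h1 h2 nR !row_entry /null_dir /tri !form3_sum.
rewrite (_ : 2 * (2 * m%:R + 2) = 4 * (m%:R + 1)); last by ring.
rewrite -!big_split !mulr_sumr -sumrB; apply: eq_bigr => k _ /=; ring.
Qed.

Lemma contract2_ee k l : contract2 (slice (E true k) X) *m slash gam (E true l) =
  \sum_j (4 * cf X false false false k l j) *: spin1 j.
Proof. exact: (contract2_true gam_clifford E_dual _ (cP_slice_skew true false k)). Qed.

Lemma contract2_fe k l : contract2 (slice (E false k) X) *m slash gam (E true l) =
  \sum_j (4 * cf X true false false k l j) *: spin1 j.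
Proof. exact: (contract2_true gam_clifford E_dual _ (cP_slice_skew false false k)). Qed.

(** The three-particle states carry coordinates of lowest weight as coefficients, so only the trace
    term is left. *)
Lemma contract2_ef k l : (forall i j k, cf X false false false i j k = 0) ->
  contract2 (slice (E true k) X) *m slash gam (E false l) =
  \sum_j (- 2 * tr23 (mixed false X) k * (l == j)%:R) *: spin1 j.
Proof.
move=> h; rewrite contract2_false big1 => [|i _]; last first.
  by rewrite big1 // => j _; rewrite -[cP _ _ _ _ _]/(cf X false false false k i j) h scale0r.
rewrite sub0r -scaleNr [RHS](bigD1 l) //= eqxx mulr1 [X in _ + X]big1 ?addr0 => [|j /negPf lj].
  by rewrite mulNr; congr (- (_ * _) *: _); apply: eq_bigr => i _; rewrite mixedE.
by rewrite eq_sym lj mulr0 scale0r.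
Qed.

Lemma contract2_ff k l : (forall i j k, cf X true false false i j k = 0) ->
  contract2 (slice (E false k) X) *m slash gam (E false l) =
  \sum_j (2 * tr23 (mixed true X) k * (l == j)%:R) *: spin1 j.
Proof.
move=> h; rewrite contract2_false big1 => [|i _]; last first.
  by rewrite big1 // => j _; rewrite -[cP _ _ _ _ _]/(cf X true false false k i j) h scale0r.
rewrite sub0r -scaleNr [RHS](bigD1 l) //= eqxx mulr1 [X in _ + X]big1 ?addr0 => [|j /negPf lj].
  rewrite -mulrN -sumrN; congr (_ * _ *: _); apply: eq_bigr => i _.
  by rewrite -[cP _ _ _ _ _]/(cf X true false true k i i) (@cf_mid true) opprK.
by rewrite eq_sym lj mulr0 scale0r.
Qed.

Let m1 : m%:R - 1 != 0 :> F := m_sub1_neq0 F m_gt2.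
Let m2 : m%:R + 1 != 0 :> F := m_add1_neq0 F m.

Lemma free_index (T : Type) (f : 'I_n -> T -> F) :
  (forall a x, f a x = 0) <-> (forall s l x, \sum_a E s l 0 a * f a x = 0).
Proof.
split=> [h s l x|h a x]; first by rewrite big1 // => a _; rewrite h mulr0.
by move: a; apply: (covector_eq0 g_metric E_dual) => s i; exact: h.
Qed.

(** Skew in the first two and in the last two slots means totally skew, which the cyclic identity
    rules out. *)
Lemma cf_fff_eq0 (c : F) : c != 0 ->
  (forall i j k, c * (cf X false false false i j k + cf X false false false j i k) = 0) ->
  forall i j k, cf X false false false i j k = 0.
Proof.
move=> c0 h i j k; have [h1 h2 _] := hX.
have sw x y z : cf X false false false x y z = - cf X false false false y x z.
  by have /eqP := h x y z; rewrite mulf_eq0 (negPf c0) /= addr_eq0 => /eqP.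
have := h2 false false false i j k.
rewrite (h1 _ _ _ j k i) (sw j i k) opprK (sw k i j) (h1 _ _ _ i k j) opprK.
rewrite (_ : _ + _ + _ = cf X false false false i j k *+ 3); last by ring.
by move/eqP; rewrite mulrn_eq0 => /eqP.
Qed.

(** Testing with [E true l] involves only coordinates of lowest weight and forces them to vanish;
    testing with [E false l] then gives the condition on the skew part of [mixed false X]. *)
Lemma vanishes11 : vanishes 1 1 X <->
  (forall i j k, cf X false false false i j k = 0) /\ comp_zero 1 (mixed false X).
Proof.
have e : vanishes 1 1 X <-> forall s l A1 A2,
    \sum_a E s l 0 a * Pi_m12_1 g gam gam' xi X a A1 A2 = 0.
  have h := free_index (fun a x => Pi_m12_1 g gam gam' xi X a x.1 x.2).
  split=> [v s l A1 A2|v a A1 A2]; last by apply: (h.2 _ a (A1, A2)) => s l [].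
  by apply: (h.1 _ s l (A1, A2)) => a [].
have [h1 h2 _] := hX.
have kt l := Pi_m12_1_contract (fun k => contract2_ee k l).
have kf l (z : forall i j k, cf X false false false i j k = 0) :=
  Pi_m12_1_contract (fun k => contract2_ef k l z).
have kf' (z : forall i j k, cf X false false false i j k = 0) l :
  (forall A1 A2, \sum_a E false l 0 a * Pi_m12_1 g gam gam' xi X a A1 A2 = 0) <->
  forall i j, mixed false X i j l - mixed false X j i l = (2 * (m%:R - 1))^-1 *
   ((j == l)%:R * tr23 (mixed false X) i - (i == l)%:R * tr23 (mixed false X) j).
  rewrite kf //; split=> h i j.
    have := h i j; rewrite -[cP _ _ _ _ _]/(cf X true false false l i j) (@cf_first false).
    rewrite (eq_sym j l) (eq_sym i l) => /eqP; rewrite addr_eq0 => /eqP e0.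
    by rewrite -[LHS]opprB e0; field.
  rewrite -[cP _ _ _ _ _]/(cf X true false false l i j) (@cf_first false).
  by rewrite -[X in X + _]opprB h (eq_sym j l) (eq_sym i l); field.
have kt' (z : forall i j k, cf X false false false i j k = 0) l :
  forall A1 A2, \sum_a E true l 0 a * Pi_m12_1 g gam gam' xi X a A1 A2 = 0.
  apply/kt => i j; rewrite -[cP _ _ _ _ _]/(cf X false false false l i j) !z; ring.
split=> [/e v|[z hB]]; last first.
  by apply/e => -[] l; [exact: kt' | apply/kf' => // i j; exact: hB].
(* The test with [E true i] yields $(m-2)/(m-1)$ times the coordinate, nonzero because [m > 2]. *)
have z i j l : cf X false false false i j l = 0.
  have /kt/(_ j l) := v true i.
  rewrite -[cP _ _ _ _ _]/(cf X false false false i j l).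
  have := h2 false false false i j l; rewrite (h1 _ _ _ j l i).
  set x := cf _ _ _ _ i j l; set y := cf _ _ _ _ j i l; set w := cf _ _ _ _ l i j => e1 e2.
  have e3 : w - y = - x by apply/eqP; rewrite -addr_eq0 -e1; apply/eqP; ring.
  have : (m%:R - 2) / (m%:R - 1) * x = 0.
    transitivity (x + (2 * (m%:R - 1))^-1 * (2 * (w - y))); first by rewrite e3; field.
    by rewrite -[RHS]e2; field.
  by move/eqP; rewrite !mulf_eq0 invr_eq0 (negPf m1) (negPf m_sub2) /= => /eqP.
by split=> // i j l; exact: ((kf' z l).1 (v false l) i j).
Qed.

Lemma vanishes12 : vanishes 1 2 X <->
  (forall i j k, cf X false false false i j k = 0) /\ comp_zero 2 (mixed false X).
Proof.
have e : vanishes 1 2 X <-> forall s l A1 A2,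
    \sum_a E s l 0 a * Pi_m12_2 g gam gam' xi X a A1 A2 = 0.
  have h := free_index (fun a x => Pi_m12_2 g gam gam' xi X a x.1 x.2).
  split=> [v s l A1 A2|v a A1 A2]; last by apply: (h.2 _ a (A1, A2)) => s l [].
  by apply: (h.1 _ s l (A1, A2)) => a [].
have [h1 h2 _] := hX.
have kt l := Pi_m12_2_contract (fun k => contract2_ee k l).
have kf l (z : forall i j k, cf X false false false i j k = 0) :=
  Pi_m12_2_contract (fun k => contract2_ef k l z).
have kf' (z : forall i j k, cf X false false false i j k = 0) l :
  (forall A1 A2, \sum_a E false l 0 a * Pi_m12_2 g gam gam' xi X a A1 A2 = 0) <->
  forall i j, mixed false X i j l + mixed false X j i l = 3 / (2 * (m%:R + 1)) *
   ((j == l)%:R * tr23 (mixed false X) i + (i == l)%:R * tr23 (mixed false X) j).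
  rewrite kf //; split=> h i j; have := h i j;
    rewrite -![tri _ _ _ _]/(cf X false false true _ _ l) -!(@mixedE false).
    rewrite (eq_sym j l) (eq_sym i l) => /eqP; rewrite addr_eq0 => /eqP e0.
    have -> : mixed false X i j l + mixed false X j i l =
      2 * (2^-1 * (mixed false X i j l + mixed false X j i l)) by field.
    by rewrite e0; field.
  by move=> ->; rewrite (eq_sym j l) (eq_sym i l); field.
have kt' (z : forall i j k, cf X false false false i j k = 0) l :
  forall A1 A2, \sum_a E true l 0 a * Pi_m12_2 g gam gam' xi X a A1 A2 = 0.
  apply/kt => i j; rewrite -![tri _ _ _ _]/(cf X false false false _ _ l) !z; ring.
split=> [/e v|[z hB]]; last first.
  by apply/e => -[] l; [exact: kt' | apply/kf' => // i j; exact: hB].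
have z : forall i j k, cf X false false false i j k = 0.
  (* The factor is 1/2 from the symmetrisation minus $3/(2(m+1))$ from the correction term of the
     map. *)
  apply: (@cf_fff_eq0 ((m%:R - 2) / (2 * (m%:R + 1)))).
    by rewrite mulf_neq0 ?invr_eq0 ?mulf_neq0 ?m_sub2 ?pnatr_eq0.
  move=> i j l; have /kt/(_ i j) := v true l.
  rewrite -![tri _ _ _ _]/(cf X false false false _ _ l).
  rewrite (h1 _ _ _ j l i) (h1 _ _ _ i l j) => <-; field.
  done.
by split=> // i j l; exact: ((kf' z l).1 (v false l) i j).
Qed.

(** By [contract2_eq0]: slices along [E true] give the lowest weight and the trace of weight -1/2,
    slices along [E false] give the skew part of weight -1/2 and the trace of weight 1/2. *)
Lemma vanishes20 : vanishes 2 0 X <->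
  [/\ forall i j k, cf X false false false i j k = 0, comp_zero 0 (mixed false X),
      forall i j k, mixed false X i j k = mixed false X j i k
    & comp_zero 0 (mixed true X)].
Proof.
have e : vanishes 2 0 X <-> forall s l, contract2 (slice (E s l) X) = 0.
  have h := free_index (fun a A => Pi_p12_0 g gam gam' xi X a A).
  split=> [/h v s l|v]; last first.
    by apply/h => s l A; rewrite (Pi_p12_0E g_metric gam_clifford E_dual) // v mx0_entry.
  apply/rowP => A; rewrite [RHS]mx0_entry -[RHS](v s l A).
  by rewrite (Pi_p12_0E g_metric gam_clifford E_dual).
have c s k := contract2_eq0 gam_clifford xi_neq0 E_dual (cP_slice_skew s false k).
have tr k : \sum_i cf X true false true k i i = - tr23 (mixed true X) k.
  by rewrite -sumrN; apply: eq_bigr => i _; rewrite (@cf_mid true).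
have tr' k : \sum_i cf X false false true k i i = tr23 (mixed false X) k.
  by apply: eq_bigr => i _; rewrite mixedE.
split=> [/e v|[z h1 h2 h3]]; last first.
  apply/e => -[] l; apply/c; split=> [i j|].
  - exact: z.
  - by rewrite -[LHS]/(\sum_i cf X false false true l i i) tr'.
  - by rewrite -[LHS]/(cf X true false false l i j) (@cf_first false) h2 subrr.
  by rewrite -[LHS]/(\sum_i cf X true false true l i i) tr h3 oppr0.
split=> [i j k|k|i j k|k].
- exact: ((c true i).1 (v true i)).1.
- by rewrite -tr'; exact: ((c true k).1 (v true k)).2.
- have := ((c false k).1 (v false k)).1 j i; rewrite -[cP _ _ _ _ _]/(cf X true false false k j i).
  by rewrite (@cf_first false) => /eqP; rewrite subr_eq0 => /eqP.
apply/eqP; rewrite -oppr_eq0 -tr; apply/eqP; exact: ((c false k).1 (v false k)).2.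
Qed.

Lemma free_index2 (f : 'I_n -> 'I_n -> 'I_sm -> F) :
  (forall a b A, f a b A = 0) <->
  (forall s t l p A, \sum_a E s l 0 a * \sum_b E t p 0 b * f a b A = 0).
Proof.
split=> [h s t l p A|h a b A].
  by rewrite big1 // => a _; rewrite big1 ?mulr0 // => b _; rewrite h mulr0.
by apply: (covector2_eq0 (f := fun a b => f a b A)) => s t i j; exact: h.
Qed.

Lemma vanishes21_ee : vanishes 2 1 X -> forall i j k, cf X false false false i j k = 0.
Proof.
move/free_index2 => v i j k; have [h1 h2 _] := hX.
have /(Pi_p12_1_contract (contract2_ee k j) (contract2_ee j k))/(_ i) := v true true j k.
rewrite -[tri _ _ _ _]/(cf X false false false i j k).
have := h2 false false false i j k; rewrite (h1 _ _ _ k i j).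
set x := cf _ _ _ _ i j k; set y := cf _ _ _ _ j k i; set w := cf _ _ _ _ k j i => e1 e2.
have : (m%:R - 2) / (m%:R - 1) * x = 0.
  transitivity (x + (2 * (m%:R - 1))^-1 * (2 * (y - w))).
    by rewrite (_ : y - w = - x); [field | apply/eqP; rewrite -addr_eq0 -e1; apply/eqP; ring].
  by rewrite -[RHS]e2; field.
by move/eqP; rewrite !mulf_eq0 invr_eq0 (negPf m1) (negPf m_sub2) /= => /eqP.
Qed.

(** Testing with one vector of each type isolates a condition on weight -1/2 alone, because the
    lowest weight is assumed zero. *)
Lemma vanishes21_ef : (forall i j k, cf X false false false i j k = 0) -> forall l p,
  (forall A, \sum_a E true l 0 a * \sum_b E false p 0 b * Pi_p12_1 g gam gam' xi X a b A = 0)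
  <-> forall k, mixed false X k l p - (m%:R - 1)^-1 * (mixed false X k l p - mixed false X l k p)
    - (2 * (m%:R - 1))^-1 * ((k == p)%:R * tr23 (mixed false X) l) = 0.
Proof.
move=> z l p; rewrite (Pi_p12_1_contract (contract2_fe p l) (contract2_ef l p z)).
suff e k : tri X (E true k) (E true l) (E false p) - (2 * (m%:R - 1))^-1 *
     (2^-1 * (4 * cf X true false false p l k - - 2 * tr23 (mixed false X) l * (p == k)%:R)) =
   mixed false X k l p - (m%:R - 1)^-1 * (mixed false X k l p - mixed false X l k p)
    - (2 * (m%:R - 1))^-1 * ((k == p)%:R * tr23 (mixed false X) l).
  by split=> h k; have := h k; rewrite e.
rewrite -[tri _ _ _ _]/(cf X false false true k l p) (@cf_first false).
by rewrite -(@mixedE false) (eq_sym p k); field.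
Qed.

(** Tracing the condition of [vanishes21_ef] kills the trace, with factor $(m-2)/(m-1)$;
    symmetrising it kills the symmetric part. A skew B then satisfies $(m-3)/(m-1)\,B=0$, whence the
    exception for [m = 3]. *)
Lemma vanishes21_level1 : vanishes 2 1 X ->
  [/\ forall i j k, cf X false false false i j k = 0, comp_zero 0 (mixed false X),
      comp_zero 2 (mixed false X)
    & m <> 3 -> comp_zero 1 (mixed false X)].
Proof.
move=> v; have z := vanishes21_ee v; move/free_index2: v => v.
have e l p k := (vanishes21_ef z l p).1 (v true false l p) k.
have t0 k : tr23 (mixed false X) k = 0.
  have : \sum_l (mixed false X k l l
      - (m%:R - 1)^-1 * (mixed false X k l l - mixed false X l k l)
      - (2 * (m%:R - 1))^-1 * ((k == l)%:R * tr23 (mixed false X) l)) = 0.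
    by rewrite big1 // => l _; exact: e.
  rewrite sumrB -mulr_sumr sum_delta_sym sumrB -mulr_sumr sumrB -/(tr13 _ _) -/(tr23 _ _).
  rewrite tr13_mixed; set t := tr23 _ _ => ht.
  have : (m%:R - 2) / (m%:R - 1) * t = 0 by rewrite -[RHS]ht; field.
  by move/eqP; rewrite !mulf_eq0 invr_eq0 (negPf m1) (negPf m_sub2) /= => /eqP.
have e' k l p : mixed false X k l p
    - (m%:R - 1)^-1 * (mixed false X k l p - mixed false X l k p) = 0.
  by have := e l p k; rewrite t0 !mulr0 subr0.
have sk k l p : mixed false X k l p + mixed false X l k p = 0.
  rewrite -[RHS]addr0 -{1}(e' k l p) -(e' l k p); field.
  done.
split=> // [i j l|m3 i j l]; first by rewrite sk !t0 !mulr0 addr0 mulr0.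
suff b0 k p q : mixed false X k p q = 0 by rewrite !b0 !t0 !mulr0 !subr0 mulr0.
have := e' k p q; rewrite (_ : mixed false X p k q = - mixed false X k p q); last first.
  by apply/eqP; rewrite -addr_eq0 sk.
set x := mixed _ _ _ _ _ => ht; have : (m%:R - 3) / (m%:R - 1) * x = 0.
  by rewrite -[RHS]ht; field.
move/eqP; rewrite !mulf_eq0 invr_eq0 (negPf m1) orbF => /orP[|/eqP //].
by rewrite subr_eq0 eqr_nat => /eqP.
Qed.

Lemma vanishes21_fe l p :
  (forall A, \sum_a E true p 0 a * \sum_b E false l 0 b * Pi_p12_1 g gam gam' xi X a b A = 0) ->
  (forall A, \sum_a E false l 0 a * \sum_b E true p 0 b * Pi_p12_1 g gam gam' xi X a b A = 0).
Proof.
move=> h A; have := h A; rewrite !(Pi_p12_1E g_metric gam_clifford E_dual) // => e.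
have -> : tri X (null_dir gam xi E A) (E false l) (E true p) =
    - tri X (null_dir gam xi E A) (E true p) (E false l).
  have := cotton_york_slice g_metric E_dual (null_dir gam xi E A) hX.
  move/mem_so_tr => sk; rewrite /tri -form_trmx sk.
  by rewrite -scaleN1r -[_ *: _]addr0 form_lin form0 addr0 mulN1r.
by rewrite -[RHS]oppr0 -[in RHS]e; ring.
Qed.

(** With the two lowest weights gone, only tests with two vectors [E false] say anything, and they
    express the skew part at weight 1/2. *)
Lemma vanishes21_high : (forall i j k, cf X false false false i j k = 0) ->
  mixed false X = 0 -> vanishes 2 1 X <-> comp_zero 1 (mixed true X).
Proof.
move=> z z1; have z1' i j k : mixed false X i j k = 0 by rewrite z1 tensor0.
have z2 i j k : cf X true false false i j k = 0 by rewrite (@cf_first false) !z1' subr0.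
have kff l p := Pi_p12_1_contract (contract2_ff p l z2) (contract2_ff l p z2).
have e l p k : tri X (E true k) (E false l) (E false p) - (2 * (m%:R - 1))^-1 * (2^-1 *
    (2 * tr23 (mixed true X) p * (l == k)%:R - 2 * tr23 (mixed true X) l * (p == k)%:R)) =
    - (mixed true X l p k - mixed true X p l k - (2 * (m%:R - 1))^-1 *
      ((p == k)%:R * tr23 (mixed true X) l - (l == k)%:R * tr23 (mixed true X) p)).
  by rewrite -[tri _ _ _ _]/(cf X false true true k l p) (@cf_first true); field.
have kef l p : forall A, \sum_a E true l 0 a * \sum_b E false p 0 b *
    Pi_p12_1 g gam gam' xi X a b A = 0.
  apply/vanishes21_ef => // k; rewrite !z1' (_ : tr23 _ _ = 0); first by ring.
  by rewrite /tr23 big1.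
split=> [/free_index2 v l p k|h].
  have := (kff l p).1 (v false false l p) k; rewrite e => /eqP.
  by rewrite oppr_eq0 subr_eq0 => /eqP.
apply/free_index2 => -[] [] l p A; [| exact: kef | exact: vanishes21_fe (kef p l) A |].
  move: A; apply/(Pi_p12_1_contract (contract2_ee p l) (contract2_ee l p)) => k.
  by rewrite -[tri _ _ _ _]/(cf X false false false k l p) !z; ring.
by move: A; apply/kff => k; rewrite e h subrr oppr0.
Qed.

Lemma vanishes22_ee : vanishes 2 2 X -> forall i j k, cf X false false false i j k = 0.
Proof.
move/free_index2 => v; have [h1 h2 _] := hX.
apply: (@cf_fff_eq0 ((m%:R - 2) / (2 * (m%:R + 1)))).
  by rewrite mulf_neq0 ?invr_eq0 ?mulf_neq0 ?m_sub2 ?pnatr_eq0.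
move=> l p k.
have /(Pi_p12_2_contract (contract2_ee p l) (contract2_ee l p))/(_ k) := v true true l p.
rewrite -![tri _ _ _ _]/(cf X false false false _ _ k).
by rewrite (h1 _ _ _ l p k) (h1 _ _ _ p l k) => e; rewrite -[RHS]e; field.
Qed.

Lemma vanishes22_ef : (forall i j k, cf X false false false i j k = 0) -> forall l p,
  (forall A, \sum_a E true l 0 a * \sum_b E false p 0 b * Pi_p12_2 g gam gam' xi X a b A = 0)
  <-> forall k, 2^-1 * mixed false X k l p - mixed false X l k p
    - 3 / (2 * (m%:R + 1)) * (mixed false X k l p - mixed false X l k p)
    + 3 / (4 * (m%:R + 1)) * ((k == p)%:R * tr23 (mixed false X) l) = 0.
Proof.
move=> z l p; rewrite (Pi_p12_2_contract (contract2_fe p l) (contract2_ef l p z)).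
suff e k : 2^-1 * (tri X (E true l) (E false p) (E true k) +
    tri X (E false p) (E true l) (E true k)) - 3 / (4 * (m%:R + 1)) *
     (2^-1 * (4 * cf X true false false p l k + - 2 * tr23 (mixed false X) l * (p == k)%:R)) =
   2^-1 * mixed false X k l p - mixed false X l k p
    - 3 / (2 * (m%:R + 1)) * (mixed false X k l p - mixed false X l k p)
    + 3 / (4 * (m%:R + 1)) * ((k == p)%:R * tr23 (mixed false X) l).
  by split=> h k; have := h k; rewrite e.
rewrite -[tri X (E true _) _ _]/(cf X false true false l p k) (@cf_mid false).
rewrite -[tri X (E false _) _ _]/(cf X true false false p l k) (@cf_first false).
by rewrite (eq_sym p k); field.
Qed.

Lemma lin_comb_eq0 (a b r : F) c d : a = 0 -> b = 0 -> r = c * a + d * b -> r = 0.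
Proof. by move=> -> -> ->; rewrite !mulr0 addr0. Qed.

(** The condition of [vanishes22_ef] and the one with [i] and [j] exchanged: their difference
    governs the skew part, their sum the symmetric part. The trace stays free. *)
Lemma vanishes22_level1 : vanishes 2 2 X ->
  [/\ forall i j k, cf X false false false i j k = 0, comp_zero 1 (mixed false X)
    & comp_zero 2 (mixed false X)].
Proof.
move=> v; have z := vanishes22_ee v; move/free_index2: v => v.
have e l p k := (vanishes22_ef z l p).1 (v true false l p) k.
split=> // i j l; have := e j l i; have := e i l j.
  set x := mixed _ _ i j l; set y := mixed _ _ j i l; set ti := tr23 _ i; set tj := tr23 _ j.
  move=> e1 e2; apply/eqP; rewrite -subr_eq0; apply/eqP.
  (* Inverse of the coefficient $3/2-3/(m+1)$ of the skew part in the difference. *)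
  pose c : F := 2 * (m%:R + 1) / (3 * (m%:R - 1)).
  by apply: (lin_comb_eq0 (c := - c) (d := c) e1 e2); rewrite /c; field; rewrite m1 m2.
set x := mixed _ _ i j l; set y := mixed _ _ j i l; set ti := tr23 _ i; set tj := tr23 _ j.
move=> e1 e2; apply/eqP; rewrite -subr_eq0; apply/eqP.
by apply: (lin_comb_eq0 (c := - 2) (d := - 2) e1 e2); field.
Qed.

Lemma vanishes22_fe l p :
  (forall A, \sum_a E true p 0 a * \sum_b E false l 0 b * Pi_p12_2 g gam gam' xi X a b A = 0) ->
  (forall A, \sum_a E false l 0 a * \sum_b E true p 0 b * Pi_p12_2 g gam gam' xi X a b A = 0).
Proof.
move=> h A; have := h A; rewrite !(Pi_p12_2E g_metric gam_clifford E_dual) // => e.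
by rewrite -[RHS]e; ring.
Qed.

Lemma vanishes22_high : (forall i j k, cf X false false false i j k = 0) ->
  mixed false X = 0 -> vanishes 2 2 X <-> comp_zero 2 (mixed true X).
Proof.
move=> z z1; have z1' i j k : mixed false X i j k = 0 by rewrite z1 tensor0.
have z2 i j k : cf X true false false i j k = 0 by rewrite (@cf_first false) !z1' subr0.
have kff l p := Pi_p12_2_contract (contract2_ff p l z2) (contract2_ff l p z2).
have e l p k : 2^-1 * (tri X (E false l) (E false p) (E true k) +
    tri X (E false p) (E false l) (E true k)) - 3 / (4 * (m%:R + 1)) * (2^-1 *
    (2 * tr23 (mixed true X) p * (l == k)%:R + 2 * tr23 (mixed true X) l * (p == k)%:R)) =
    2^-1 * (mixed true X l p k + mixed true X p l k - 3 / (2 * (m%:R + 1)) *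
      ((p == k)%:R * tr23 (mixed true X) l + (l == k)%:R * tr23 (mixed true X) p)).
  by rewrite -![tri _ _ _ _]/(cf X true true false _ _ k) -!(@mixedE true); field.
have kef l p : forall A, \sum_a E true l 0 a * \sum_b E false p 0 b *
    Pi_p12_2 g gam gam' xi X a b A = 0.
  apply/vanishes22_ef => // k; rewrite !z1' (_ : tr23 _ _ = 0); first by ring.
  by rewrite /tr23 big1.
split=> [/free_index2 v l p k|h].
  have := (kff l p).1 (v false false l p) k; rewrite e => /eqP.
  by rewrite mulf_eq0 invr_eq0 pnatr_eq0 subr_eq0 => /eqP.
apply/free_index2 => -[] [] l p A; [| exact: kef | exact: vanishes22_fe (kef p l) A |].
  move: A; apply/(Pi_p12_2_contract (contract2_ee p l) (contract2_ee l p)) => k.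
  by rewrite -![tri _ _ _ _]/(cf X false false false _ _ k) !z; ring.
by move: A; apply/kff => k; rewrite e h subrr mulr0.
Qed.

(** The three-particle states that survive a test with two vectors of $V_{-1/2}$. A tensor of weight
    -1/2 can lie in the kernel of a map of index 1/2 when these cancel under the map's
    (skew-)symmetrisation in [p] and [l]. *)
Let ff_sum p l := \sum_i \sum_j cf X true false false p i j *: spin3 i j l.

Lemma contract2_ff_high p l : mixed true X = 0 ->
  contract2 (slice (E false p) X) *m slash gam (E false l) = ff_sum p l.
Proof.
move=> z; rewrite contract2_false (_ : 2 * _ = 0) ?scale0r ?subr0 //.
rewrite (eq_bigr (fun=> 0)) ?big1 ?mulr0 // => i _.
by rewrite -[LHS]/(cf X true false true p i i) (@cf_mid true) z tensor0 oppr0.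
Qed.

Lemma vanishes21_low : (forall i j k, cf X false false false i j k = 0) ->
  mixed true X = 0 ->
  (forall k l p, mixed false X k l p
    - (m%:R - 1)^-1 * (mixed false X k l p - mixed false X l k p)
    - (2 * (m%:R - 1))^-1 * ((k == p)%:R * tr23 (mixed false X) l) = 0) ->
  (forall p l, ff_sum p l = ff_sum l p) -> vanishes 2 1 X.
Proof.
move=> z z2 h1 h2; have kef l p := (vanishes21_ef z l p).2 (fun k => h1 k l p).
apply/free_index2 => -[] [] l p A; [| exact: kef | exact: vanishes21_fe (kef p l) A |].
  move: A; apply/(Pi_p12_1_contract (contract2_ee p l) (contract2_ee l p)) => k.
  by rewrite -[tri _ _ _ _]/(cf X false false false k l p) !z; ring.
rewrite (Pi_p12_1E g_metric gam_clifford E_dual) // !contract2_ff_high // h2 subrr !mulr0 subr0.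
rewrite /null_dir tri1_sum big1 // => k _.
by rewrite -[tri _ _ _ _]/(cf X false true true k l p) (@cf_first true) z2 !tensor0 subrr mulr0.
Qed.

Lemma vanishes22_low : (forall i j k, cf X false false false i j k = 0) ->
  mixed true X = 0 ->
  (forall k l p, 2^-1 * mixed false X k l p - mixed false X l k p
    - 3 / (2 * (m%:R + 1)) * (mixed false X k l p - mixed false X l k p)
    + 3 / (4 * (m%:R + 1)) * ((k == p)%:R * tr23 (mixed false X) l) = 0) ->
  (forall p l, ff_sum p l = - ff_sum l p) -> vanishes 2 2 X.
Proof.
move=> z z2 h1 h2; have kef l p := (vanishes22_ef z l p).2 (fun k => h1 k l p).
apply/free_index2 => -[] [] l p A; [| exact: kef | exact: vanishes22_fe (kef p l) A |].
  move: A; apply/(Pi_p12_2_contract (contract2_ee p l) (contract2_ee l p)) => k.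
  by rewrite -![tri _ _ _ _]/(cf X false false false _ _ k) !z; ring.
rewrite (Pi_p12_2E g_metric gam_clifford E_dual) // !contract2_ff_high // (h2 p l).
rewrite -scaleN1r scalemx_entry mulN1r addNr !mulr0 subr0.
rewrite /null_dir /tri !form3_sum !big1 ?addr0 ?mulr0 // => k _.
  by rewrite -[form _ _ _]/(cf X true true false p l k) -(@mixedE true) z2 tensor0 mulr0.
by rewrite -[form _ _ _]/(cf X true true false l p k) -(@mixedE true) z2 tensor0 mulr0.
Qed.

(** For a pure trace, [ff_sum p l] is a multiple of $\sum_j t_j$ times [spin3 p j l], skew in [p]
    and [l] because [spin3] is totally skew; the symmetric map does not see it. This shows that
    component 0 of weight -1/2 escapes. *)
Lemma vanishes22_trace (t : 'I_m -> F) :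
  (forall i j k, cf X false false false i j k = 0) -> mixed true X = 0 ->
  (forall i j k, mixed false X i j k =
     (m%:R - 2) * ((i == k)%:R * t j) + (2 * m%:R - 1) * ((j == k)%:R * t i)) ->
  vanishes 2 2 X.
Proof.
move=> z z2 hB; have tr i : tr23 (mixed false X) i = 2 * (m%:R + 1) * (m%:R - 1) * t i.
  rewrite /tr23; under eq_bigr do rewrite hB.
  rewrite big_split -!mulr_sumr /= sum_delta_sym; under eq_bigr do rewrite eqxx mul1r.
  by rewrite sum_const; ring.
apply: vanishes22_low => // [k l p|p l].
  by rewrite !hB tr; field; rewrite m2.
pose S p l := \sum_j t j *: spin3 p j l.
have ffE p' l' : ff_sum p' l' = (2 * (m%:R + 1)) *: S p' l'.
  transitivity (\sum_i \sum_j (((m%:R + 1) * t j) * (i == p')%:R) *: spin3 i j l' -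
                \sum_i \sum_j (((m%:R + 1) * t i) * (j == p')%:R) *: spin3 i j l').
    rewrite -sumrB; apply: eq_bigr => i _; rewrite -sumrB; apply: eq_bigr => j _.
    by rewrite (@cf_first false) !hB -scalerBl; congr (_ *: _); ring.
  rewrite [X in _ - X]exchange_big -sumrB (bigD1 p') //= [X in _ + X]big1 => [|i /negPf ip].
    rewrite addr0 -sumrB scaler_sumr; apply: eq_bigr => j _.
    rewrite eqxx (spin3_skew12 gam_clifford E_dual j) scalerN opprK !mulr1 -scalerDl scalerA.
    by congr (_ *: _); ring.
  by rewrite -sumrB big1 // => j _; rewrite ip !mulr0 !scale0r subr0.
rewrite !ffE -scalerN; congr (_ *: _); rewrite -sumrN; apply: eq_bigr => j _.
rewrite (spin3_skew12 gam_clifford E_dual l j) (spin3_skew gam_clifford E_dual j l).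
by rewrite (spin3_skew12 gam_clifford E_dual j p) !opprK scalerN opprK.
Qed.

(** For [m = 3] the obstruction factor [m - 3] disappears, and the only nonzero three-particle
    states with indices [a], [c] have third index [b]. Hence [ff_sum] is supported at [p = l = b]
    and the skew map kills it. *)
Lemma vanishes21_dim3 a c b : m = 3 -> a != c -> a != b -> c != b ->
  (forall i j k, cf X false false false i j k = 0) -> mixed true X = 0 ->
  mixed false X = unit3 a c b - unit3 c a b -> vanishes 2 1 X.
Proof.
move=> m3 ac ab cb z z2 hB.
have hBE i j k : mixed false X i j k = (i == a)%:R * (j == c)%:R * (k == b)%:R
    - (i == c)%:R * (j == a)%:R * (k == b)%:R by rewrite hB !tensorE.
have tr i : tr23 (mixed false X) i = 0.
  rewrite /tr23; under eq_bigr do rewrite hBE.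
  rewrite sumrB (eq_bigr (fun j => (j == c)%:R * ((i == a)%:R * (j == b)%:R))); last first.
    by move=> j _; ring.
  rewrite sum_delta (eq_bigr (fun j => (j == a)%:R * ((i == c)%:R * (j == b)%:R))); last first.
    by move=> j _; ring.
  by rewrite sum_delta (negPf ab) (negPf cb) !mulr0 subrr.
apply: vanishes21_low => // [k l p|p l].
  rewrite tr mulr0 mulr0 subr0 !hBE; have : m%:R = 3 :> F by rewrite m3.
  by move=> ->; field.
have ffE p' l' : ff_sum p' l' = (- 4 * (p' == b)%:R) *: spin3 a c l'.
  transitivity (\sum_i \sum_j ((2 * (p' == b)%:R) * ((i == c)%:R * (j == a)%:R)) *: spin3 i j l' -
                \sum_i \sum_j ((2 * (p' == b)%:R) * ((i == a)%:R * (j == c)%:R)) *: spin3 i j l').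
    rewrite -sumrB; apply: eq_bigr => i _; rewrite -sumrB; apply: eq_bigr => j _.
    by rewrite (@cf_first false) !hBE -scalerBl; congr (_ *: _); ring.
  have sd (x : F) c' a' : \sum_i \sum_j (x * ((i == c')%:R * (j == a')%:R)) *: spin3 i j l' =
      x *: spin3 c' a' l'.
    rewrite (bigD1 c') //= [X in _ + X]big1 => [|i /negPf ic]; last first.
      by rewrite big1 // => j _; rewrite ic mul0r mulr0 scale0r.
    rewrite addr0 (bigD1 a') //= big1 => [|j /negPf ja]; last first.
      by rewrite ja !mulr0 scale0r.
    by rewrite !eqxx !mulr1 addr0.
  rewrite !sd (spin3_skew12 gam_clifford E_dual c) scalerN -opprD -scalerDl -scaleNr.
  by congr (_ *: _); ring.
have s0 q : q != b -> spin3 a c q = 0.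
  have self0 (x : 'rV[F]_sm) : x = - x -> x = 0.
    move/eqP; rewrite -subr_eq0 opprK -mulr2n -scaler_nat scaler_eq0 pnatr_eq0 /=.
    by move/eqP.
  move=> qb; have : q \in [set a; c; b].
    suff -> : [set a; c; b] = setT by rewrite inE.
    apply/eqP; rewrite eqEcard subsetT cardsT card_ord /=.
    rewrite setUC cardsU1 cards2 ac !inE negb_or (eq_sym b a) ab (eq_sym b c) cb.
    by rewrite m3.
  rewrite !inE (negPf qb) orbF => /orP[/eqP->|/eqP->].
    rewrite (spin3_skew gam_clifford E_dual) (self0 (spin3 a a c)) ?oppr0 //.
    exact: (spin3_skew12 gam_clifford E_dual).
  by apply: self0; exact: (spin3_skew gam_clifford E_dual).
rewrite !ffE; have [->|pb] := eqVneq p b.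
  by have [->//|lb] := eqVneq l b; rewrite (s0 l) // scaler0 mulr0 scale0r.
have [->|lb] := eqVneq l b; last by rewrite mulr0 !scale0r.
by rewrite (s0 p) // scaler0 mulr0 scale0r.
Qed.

End CottonYork.
End Kernels.

(** * The filtration and its components are given by weights *)

Section Filtration.
Variables (F : numFieldType) (n sp sm m : nat).
Variable g : 'M[F]_n.
Variables (gam : 'I_n -> 'M[F]_(sp, sm)) (gam' : 'I_n -> 'M[F]_(sm, sp)).
Variables (xi : 'rV[F]_sp) (Vm : {vspace 'rV[F]_n}).
Hypothesis g_metric : nondegenerate_symmetric g.
Hypothesis gam_clifford : clifford_relations g gam gam'.
Hypothesis xi_neq0 : xi != 0.
Variable E : bool -> 'I_m -> 'rV[F]_n.
Hypothesis E_dual : dual_basis g gam xi Vm E.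
Hypothesis m_gt2 : (2 < m)%N.
Hypothesis n_def : n = m.*2.
Local Notation tensor := {ffun 'I_n -> 'M[F]_n}.
Local Notation cf := (coord3 E).
Local Notation cP := (coord2 E).
Local Notation mixed := (mixed E).
Local Notation vanishes := (Pi_vanishes g gam gam' xi).
Local Notation A_ := (filtr g gam gam' xi).
Local Notation Aj_ := (CYcomp g gam gam' xi).
Local Notation so := (so_alg F n).
Implicit Types (phi psi : 'M[F]_n) (X Y : tensor) (B : {ffun 'I_m -> 'M[F]_m}).

Lemma mixed_lin s a X Y : mixed s (a *: X + Y) = a *: mixed s X + mixed s Y.
Proof. by apply: tensorP => i j k; rewrite !(tensorE, mixedE) cf_lin. Qed.

Lemma mixed0 s : mixed s 0 = 0.
Proof. by apply: tensorP => i j k; rewrite mixedE tensor0 cf0. Qed.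

Lemma comp_zero0 k : comp_zero k (0 : {ffun 'I_m -> 'M[F]_m}).
Proof.
have t i : tr23 (0 : {ffun 'I_m -> 'M[F]_m}) i = 0.
  by rewrite /tr23 big1 // => j _; rewrite tensor0.
case: k => [|[|[|k]]] //= i j l; first by rewrite !t !tensor0 !mulr0 !subr0 mulr0.
by rewrite !t !tensor0 !mulr0 !addr0 mulr0.
Qed.

Lemma comp_zero_lin k a B B' : comp_zero k B -> comp_zero k B' -> comp_zero k (a *: B + B').
Proof.
case: k => [|[|[|k]]] //= h h' i; first by rewrite tr23_lin h h' mulr0 addr0.
  move=> j l; rewrite !tr23_lin !tensorE.
  transitivity (a * (B i j l - B j i l) + (B' i j l - B' j i l)); first by ring.
  by rewrite h h'; ring.
move=> j l; rewrite !tr23_lin !tensorE.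
transitivity (a * (B i j l + B j i l) + (B' i j l + B' j i l)); first by ring.
by rewrite h h'; ring.
Qed.

Lemma comp_zero_all B : (forall k, comp_zero k B) -> B = 0.
Proof.
move=> h; have t := h 0%N; apply: tensorP => i j l; rewrite tensor0.
have e1 : B i j l - B j i l = 0 by rewrite (h 1%N i j l) !t !mulr0 subr0 mulr0.
have e2 : B i j l + B j i l = 0 by rewrite (h 2%N i j l) !t !mulr0 addr0 mulr0.
by apply: (lin_comb_eq0 (c := 2^-1) (d := 2^-1) e1 e2); field.
Qed.

Lemma mixed_zero_level s X (s1 s2 s3 : bool) i j k : cotton_york E X -> mixed s X = 0 ->
  (s1 + s2 + s3)%N = s.+1 -> cf X s1 s2 s3 i j k = 0.
Proof.
move=> hX z; have := cf_mid hX s; have := cf_first hX s.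
have z' x y w : cf X s s (~~ s) x y w = 0 by rewrite -mixedE z tensor0.
rewrite z => h1 h2; move: z' h1 h2.
case: s {z} => z' h1 h2; case: s1; case: s2; case: s3 => //= _;
  by rewrite ?z' ?h1 ?h2 ?tensor0 ?subr0 ?oppr0.
Qed.

Definition high (p : nat) X := forall (s t r : bool) i j k,
  (s + t + r < p)%N -> cf X s t r i j k = 0.

Lemma high_lin p a X Y : high p X -> high p Y -> high p (a *: X + Y).
Proof. by move=> h h' s t r i j k l; rewrite cf_lin h // h' // mulr0 addr0. Qed.

(** Coordinates of the next weight are all controlled by the single block [mixed s X]. *)
Lemma high_step (s : bool) X : cotton_york E X ->
  high s.+2 X <-> high s.+1 X /\ mixed s X = 0.
Proof.
move=> hX; split=> [h|[h z] s1 s2 s3 i j k].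
  split=> [s1 s2 s3 i j k l|]; first by apply: h; rewrite ltnW // ltnS.
  by apply: tensorP => i j k; rewrite mixedE tensor0 h //; case: s {h}.
rewrite ltnS leq_eqVlt => /orP[/eqP|]; first exact: mixed_zero_level.
exact: h.
Qed.

Lemma high1 X : high 1 X <-> forall i j k, cf X false false false i j k = 0.
Proof. by split=> [h i j k|h [] [] [] i j k //]; apply: h. Qed.

Lemma vanishes_low X : cotton_york E X -> high 1 X -> forall k,
  vanishes 1 k X <-> comp_zero k (mixed false X).
Proof.
move=> hX /high1 z [|[|[|k]]] //.
- have := vanishes10 g_metric gam_clifford xi_neq0 E_dual hX.
  by move=> [h1 h2]; split=> [/h1[]|h] //; apply: h2.
- have := vanishes11 g_metric gam_clifford E_dual m_gt2 n_def hX.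
  by move=> [h1 h2]; split=> [/h1[]|h] //; apply: h2.
have := vanishes12 g_metric gam_clifford E_dual m_gt2 n_def hX.
by move=> [h1 h2]; split=> [/h1[]|h] //; apply: h2.
Qed.

Lemma vanishes_high X : cotton_york E X -> high 2 X -> forall k,
  vanishes 2 k X <-> comp_zero k (mixed true X).
Proof.
move=> hX /(high_step false hX)[/high1 z z1] [|[|[|k]]] //.
- have [h1 h2] := vanishes20 g_metric gam_clifford xi_neq0 E_dual hX.
  split=> [/h1[]|h] //; apply: h2; split=> //; rewrite z1; first exact: (comp_zero0 0).
  by move=> i j k; rewrite !tensor0.
- exact: (vanishes21_high g_metric gam_clifford E_dual m_gt2 n_def hX z z1).
exact: (vanishes22_high g_metric gam_clifford E_dual n_def hX z z1).
Qed.

Lemma lspan_CY (P : tensor -> Prop) (Q : tensor -> Prop) :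
  (forall X, P X <-> X \in CY g /\ Q X) -> Q 0 ->
  (forall a X Y, Q X -> Q Y -> Q (a *: X + Y)) ->
  forall X, X \in lspan P <-> X \in CY g /\ Q X.
Proof.
move=> PQ Q0 Qlin X; rewrite -PQ; apply: mem_lspan.
  by apply/PQ; rewrite mem0v.
by move=> a x y /PQ[x1 x2] /PQ[y1 y2]; apply/PQ; rewrite memvD ?memvZ //; split=> //; apply: Qlin.
Qed.

(** Vanishing of all maps of one index removes exactly the coordinates of the corresponding weight,
    since the three parts of [mixed] together are everything ([comp_zero_all]). *)
Lemma mem_filtr p X : (p <= 4)%N -> X \in A_ p <-> X \in CY g /\ high p X.
Proof.
have high0 q : high q 0 by move=> s t r i j k _; rewrite cf0.
have linQ q (P : tensor -> Prop) : (forall X, P X <-> X \in CY g /\ high q X) ->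
    forall X, X \in lspan P <-> X \in CY g /\ high q X.
  by move=> h; apply: lspan_CY => //; exact: high_lin.
have cyP Y : Y \in CY g <-> cotton_york E Y := mem_CY g_metric E_dual Y.
case: p => [|[|[|[|[|p]]]]] // _ /=.
- by split=> [h|[]//]; split=> // s t r i j k; rewrite ltn0.
- apply: linQ => Y; split=> -[h1 h2]; split=> //.
    by apply/high1/(vanishes00 gam' g_metric E_dual); exact: (h2 0%N).
  by case=> // ; apply/(vanishes00 gam' g_metric E_dual)/high1.
- apply: linQ => Y; split=> -[h1 h2]; split=> //; have hY := (cyP Y).1 h1.
    have z : high 1 Y.
      apply/high1.
      by have [] := (vanishes10 g_metric gam_clifford xi_neq0 E_dual hY).1 (h2 0%N).
    apply/(high_step false hY); split=> //; apply: comp_zero_all => k.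
    exact: (vanishes_low hY z k).1 (h2 k).
  move=> k; have [z z1] := (high_step false hY).1 h2.
  by apply: (vanishes_low hY z k).2; rewrite z1; exact: comp_zero0.
- apply: linQ => Y; split=> -[h1 h2]; split=> //; have hY := (cyP Y).1 h1.
    (* At weight -1/2 the map with index 0 supplies the trace and the map with index 2 the two other
       parts; this choice works for [m = 3] too, unlike the map with index 1. *)
    have [z c0 sym _] := (vanishes20 g_metric gam_clifford xi_neq0 E_dual hY).1 (h2 0%N).
    have [_ c1 c2] := vanishes22_level1 g_metric gam_clifford E_dual m_gt2 n_def hY (h2 2%N).
    have z2 : high 2 Y.
      apply/(high_step false hY); split; first exact/high1.
      by apply: comp_zero_all => -[|[|[|k]]].
    apply/(high_step true hY); split=> //; apply: comp_zero_all => k.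
    exact: (vanishes_high hY z2 k).1 (h2 k).
  move=> k; have [z z1] := (high_step true hY).1 h2.
  by apply: (vanishes_high hY z k).2; rewrite z1; exact: comp_zero0.
rewrite memv0; split=> [/eqP ->|[_ h]]; first by rewrite mem0v.
apply/eqP/(cf_inj g_metric E_dual) => s t r i j k; rewrite cf0 h //.
by case: s; case: t; case: r.
Qed.

Lemma mem_CYcomp (s : bool) j X : X \in Aj_ s.+1 j <->
  X \in CY g /\ (high s.+1 X /\ forall k, k <> j -> comp_zero k (mixed s X)).
Proof.
have cyP Y : Y \in CY g <-> cotton_york E Y := mem_CY g_metric E_dual Y.
have -> : Aj_ s.+1 j = lspan (fun X => X \in A_ s.+1 /\
    forall k, k <> j -> vanishes s.+1 k X) by case: s.
apply: (lspan_CY (Q := fun X => high s.+1 X /\ forall k, k <> j -> comp_zero k (mixed s X))).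
- have key Y k : Y \in CY g -> high s.+1 Y -> vanishes s.+1 k Y <-> comp_zero k (mixed s Y).
    by move=> /cyP hY h; case: s h => h; [exact: vanishes_high | exact: vanishes_low].
  move=> Y; have m4 : (s.+1 <= 4)%N by case: (s).
  split=> [[/(mem_filtr Y m4)[h1 h2] h3]|[h1 [h2 h3]]].
    by split=> //; split=> // k kj; apply/key => //; exact: h3.
  by split=> [|k kj]; [apply/(mem_filtr Y m4) | apply/key => //; exact: h3].
- split=> [s1 s2 s3 i l k _|k _]; first exact: cf0.
  by rewrite mixed0; exact: comp_zero0.
move=> a Y Z [h1 h2] [h3 h4]; split=> [|k kj]; first exact: high_lin.
by rewrite mixed_lin; apply: comp_zero_lin; [exact: h2 | exact: h4].
Qed.

End Filtration.

(** * How $\mathfrak p$ and $g_0$ act on the blocks of coordinates *)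

Section Actions.
Variables (F : numFieldType) (n sp sm m : nat).
Variable g : 'M[F]_n.
Variables (gam : 'I_n -> 'M[F]_(sp, sm)).
Variables (xi : 'rV[F]_sp) (Vm : {vspace 'rV[F]_n}).
Hypothesis g_metric : nondegenerate_symmetric g.
Variable E : bool -> 'I_m -> 'rV[F]_n.
Hypothesis E_dual : dual_basis g gam xi Vm E.
Local Notation tensor := {ffun 'I_n -> 'M[F]_n}.
Local Notation cf := (coord3 E).
Local Notation cP := (coord2 E).
Local Notation mixed := (mixed E).
Local Notation so := (so_alg F n).
Local Notation g0 := (g_0 g gam xi Vm).
Local Notation gl_mx := (gl_mx E).
Local Notation act := (tact g).
Implicit Types (phi psi : 'M[F]_n) (X Y : tensor) (B : {ffun 'I_m -> 'M[F]_m}).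

Lemma cotton_york_tact phi X : phi \in so -> cotton_york E X -> cotton_york E (act phi X).
Proof.
move=> /(mem_so g_metric E_dual) skphi [h1 h2 h3]; split=> [s t r i j k|s t r i j k|r k].
- rewrite !(cf_tact g_metric E_dual) !opprD -addrA [X in _ + X]addrC addrA -!sumrN.
  by congr (_ + _ + _); apply: eq_bigr => u _; rewrite -sumrN; apply: eq_bigr => l _;
    rewrite -mulrN -h1.
- rewrite !(cf_tact g_metric E_dual).
  transitivity (\sum_u \sum_l cP phi s (~~ u) i l *
      (cf X u t r l j k + cf X t r u j k l + cf X r u t k l j) +
    \sum_u \sum_l cP phi t (~~ u) j l *
      (cf X s u r i l k + cf X u r s l k i + cf X r s u k i l) +
    \sum_u \sum_l cP phi r (~~ u) k l *
      (cf X s t u i j l + cf X t u s j l i + cf X u s t l i j)); last first.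
    by rewrite !big1 ?addr0 // => u _; rewrite big1 // => l _; rewrite h2 mulr0.
  have dist (a : bool -> 'I_m -> F) (x y z : bool -> 'I_m -> F) :
      \sum_u \sum_l a u l * (x u l + y u l + z u l) = \sum_u \sum_l a u l * x u l +
      \sum_u \sum_l a u l * y u l + \sum_u \sum_l a u l * z u l.
    rewrite -!big_split; apply: eq_bigr => u _; rewrite -!big_split.
    by apply: eq_bigr => l _; rewrite /= !mulrDr.
  by rewrite !dist; ring.
under eq_bigr => s _ do under eq_bigr => i _ do rewrite (cf_tact g_metric E_dual).
under eq_bigr => s _ do rewrite !big_split /=.
rewrite !big_split /= [X in _ + X](_ : _ = 0) ?addr0; last first.
  under eq_bigr do rewrite exchange_big /=.
  rewrite exchange_big big1 // => u _; under eq_bigr do rewrite exchange_big /=.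
  rewrite exchange_big big1 // => l _; under eq_bigr do rewrite -mulr_sumr.
  by rewrite -mulr_sumr h3 mulr0.
(* What is left is [phi] acting on the two contracted slots; the two terms cancel because [phi] is
   skew. *)
apply/eqP; rewrite addr_eq0; apply/eqP.
transitivity (\sum_u \sum_l \sum_s \sum_i cP phi s (~~ u) i l * cf X u (~~ s) r l i k).
  under eq_bigr do rewrite exchange_big /=.
  rewrite exchange_big; apply: eq_bigr => u _; under eq_bigr do rewrite exchange_big /=.
  by rewrite exchange_big.
rewrite -sumrN; apply: eq_bigr => u _; rewrite -sumrN; apply: eq_bigr => l _.
rewrite -[LHS](@sum_negb F) -sumrN; apply: eq_bigr => s _; rewrite -sumrN.
by apply: eq_bigr => i _; rewrite negbK -mulNr -skphi.
Qed.

(** Every term either uses coordinates of the same or lower weight, which vanish, or the block of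
    [phi] of degree -1, which is zero on $\mathfrak p$. *)
Lemma high_tact p phi X : phi \in p_alg g gam xi -> high E p X -> high E p (act phi X).
Proof.
move=> /(mem_p_alg g_metric E_dual)[_ h0] h s t r i j k l.
rewrite (cf_tact g_metric E_dual).
rewrite !big1 ?addr0 // => u _; rewrite big1 // => q _.
- have [e|e] := boolP (u ==> r); first by rewrite h ?mulr0 //; case: u r l e => [] [] //=; lia.
  by move: e; case: u; case: (r) => // _; rewrite h0 mul0r.
- have [e|e] := boolP (u ==> t); first by rewrite h ?mulr0 //; case: u t l e => [] [] //=; lia.
  by move: e; case: u; case: (t) => // _; rewrite h0 mul0r.
have [e|e] := boolP (u ==> s); first by rewrite h ?mulr0 //; case: u s l e => [] [] //=; lia.
by move: e; case: u; case: (s) => // _; rewrite h0 mul0r.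
Qed.

(** The matrix of [phi] on the factor with label [s]: the representation of gl(m) for [true] and its
    dual for [false]. *)
Definition gl_part (s : bool) phi : 'M[F]_m := if s then gl_mx phi else - (gl_mx phi)^T.
Local Notation gl_sign := gl_part.

Lemma gl_signN s phi : gl_sign (~~ s) phi = - (gl_sign s phi)^T.
Proof. by case: s; rewrite /gl_sign //= linearN /= trmxK opprK. Qed.

Lemma gl_sign_exists s (M : 'M[F]_m) : exists2 phi, phi \in g0 & gl_sign s phi = M.
Proof.
have [phi h e] := gl_mx_exists g_metric E_dual (if s then M else - M^T).
by exists phi; rewrite // /gl_sign e; case: s {h e}; rewrite //= linearN /= trmxK opprK.
Qed.

Lemma cf_act0 phi X s t r i j k : phi \in g0 -> cf (act phi X) s t r i j k =
  \sum_l gl_sign s phi i l * cf X s t r l j k + \sum_l gl_sign t phi j l * cf X s t r i l k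
  + \sum_l gl_sign r phi k l * cf X s t r i j l.
Proof.
move=> hphi; rewrite (cf_tact g_metric E_dual).
have e s' i' (f : bool -> 'I_m -> F) : \sum_u \sum_l cP phi s' (~~ u) i' l * f u l =
    \sum_l gl_sign s' phi i' l * f s' l.
  rewrite (bigD1 s') //= [X in _ + X]big1 ?addr0 => [|u us].
    by apply: eq_bigr => l _; rewrite (cP_g0 g_metric E_dual) // /gl_sign;
      case: s'; rewrite //= !mxE.
  rewrite big1 // => l _; rewrite (cP_g0 g_metric E_dual) //.
  by rewrite (negb_of_neq us) eqxx mul0r.
by rewrite !e.
Qed.

Lemma mixed_act s phi X : phi \in g0 ->
  mixed s (act phi X) = rho_mixed (gl_sign s phi) (mixed s X).
Proof.
move=> hphi; apply: tensorP => i j k; rewrite mixedE cf_act0 // rhoE gl_signN.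
by congr (_ + _ + _); apply: eq_bigr => l _; rewrite mixedE.
Qed.

Definition extremal (s : bool) X : {ffun 'I_m -> 'M[F]_m} :=
  [ffun i => \matrix_(j, k) cf X s s s i j k].

Lemma extremalE s X i j k : extremal s X i j k = cf X s s s i j k.
Proof. by rewrite ffunE mxE. Qed.

Lemma extremal_lin s a X Y : extremal s (a *: X + Y) = a *: extremal s X + extremal s Y.
Proof. by apply: tensorP => i j k; rewrite !(tensorE, extremalE) cf_lin. Qed.

Lemma extremal_act s phi X : phi \in g0 ->
  extremal s (act phi X) = rho_cov (gl_sign s phi) (extremal s X).
Proof.
move=> hphi; apply: tensorP => i j k; rewrite extremalE cf_act0 // rhoE.
by congr (_ + _ + _); apply: eq_bigr => l _; rewrite extremalE.
Qed.

(** For tensors with the odd label in the first slot; the rotation moves that slot to the end so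
    that [rho_mixed] applies. It realises $V_{\mp1/2}\otimes g_{\pm1}$. *)
Definition cyclic_mixed (s : bool) X : {ffun 'I_m -> 'M[F]_m} :=
  [ffun i => \matrix_(j, k) cf X (~~ s) s s k i j].

Lemma cyclic_mixedE s X i j k : cyclic_mixed s X i j k = cf X (~~ s) s s k i j.
Proof. by rewrite ffunE mxE. Qed.

Lemma cyclic_mixed_lin s a X Y :
  cyclic_mixed s (a *: X + Y) = a *: cyclic_mixed s X + cyclic_mixed s Y.
Proof. by apply: tensorP => i j k; rewrite !(tensorE, cyclic_mixedE) cf_lin. Qed.

Lemma cyclic_mixed_act s phi X : phi \in g0 ->
  cyclic_mixed s (act phi X) = rho_mixed (gl_sign s phi) (cyclic_mixed s X).
Proof.
move=> hphi; apply: tensorP => i j k; rewrite cyclic_mixedE cf_act0 // rhoE gl_signN.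
rewrite -addrA addrC; congr (_ + _ + _);
  by apply: eq_bigr => l _; rewrite cyclic_mixedE.
Qed.

Definition trace_row (s : bool) X : 'rV[F]_m := \row_i tr23 (mixed s X) i.

Lemma trace_row_lin s a X Y : trace_row s (a *: X + Y) = a *: trace_row s X + trace_row s Y.
Proof. by apply/rowP => i; rewrite !mxE mixed_lin tr23_lin. Qed.

Lemma tr23_rho (M : 'M[F]_m) B i : tr23 (rho_mixed M B) i = \sum_l M i l * tr23 B l.
Proof.
rewrite /tr23; under eq_bigr do rewrite rhoE.
rewrite !big_split /= -addrA [X in _ + X](_ : _ = 0) ?addr0.
  by rewrite exchange_big; apply: eq_bigr => l _; rewrite mulr_sumr.
rewrite exchange_big -big_split big1 //= => j _; rewrite -big_split big1 //= => l _.
by rewrite !mxE; ring.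
Qed.

Lemma trace_row_act s phi X : phi \in g0 ->
  trace_row s (act phi X) = trace_row s X *m (gl_sign s phi)^T.
Proof.
move=> hphi; apply/rowP => i; rewrite !mxE mixed_act // tr23_rho.
by apply: eq_bigr => l _; rewrite !mxE mulrC.
Qed.

Lemma g0_so phi : phi \in g0 -> phi \in so.
Proof. by move/(mem_g0 g_metric E_dual) => []. Qed.

Lemma g0_p phi : phi \in g0 -> phi \in p_alg g gam xi.
Proof. by move/(mem_g0 g_metric E_dual) => [h1 _ h2]; apply/(mem_p_alg g_metric E_dual). Qed.

End Actions.

(** * Transport of irreducibility, dimension and isomorphism from models *)

Section Realizations.
Variables (F : numFieldType) (n sp sm m : nat).
Variable g : 'M[F]_n.
Variables (gam : 'I_n -> 'M[F]_(sp, sm)) (gam' : 'I_n -> 'M[F]_(sm, sp)).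
Variables (xi : 'rV[F]_sp) (Vm : {vspace 'rV[F]_n}).
Hypothesis g_metric : nondegenerate_symmetric g.
Variable E : bool -> 'I_m -> 'rV[F]_n.
Hypothesis E_dual : dual_basis g gam xi Vm E.
Local Notation tensor := {ffun 'I_n -> 'M[F]_n}.
Local Notation g0 := (g_0 g gam xi Vm).
Local Notation act := (tact g).
Variables (N : vectType F) (rho : 'M[F]_m -> N -> N) (s : bool).
Implicit Types (phi : 'M[F]_n) (X Y : tensor) (U W : {vspace tensor}) (K : {vspace N}).
Implicit Types (f h : 'Hom(tensor, N)).

Definition irreducible_model K : Prop := K <> 0%VS /\
  forall S : {vspace N}, (S <= K)%VS -> (forall M B, B \in S -> rho M B \in S) ->
    S = 0%VS \/ S = K.

Definition equivariant_on U f : Prop :=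
  forall phi X, phi \in g0 -> X \in U -> f (act phi X) = rho (gl_part E s phi) (f X).

(* f identifies the g_0-module U / W with the model K, on which gl_m acts by rho. *)
Definition realizes U W K f : Prop :=
  [/\ stable g g0 U, stable g g0 W, (W <= U)%VS, (f @: U)%VS = K
    & (forall X, X \in U -> f X = 0 <-> X \in W) /\ equivariant_on U f].

Lemma stable_image U f : stable g g0 U -> equivariant_on U f ->
  forall M B, B \in (f @: U)%VS -> rho M B \in (f @: U)%VS.
Proof.
move=> stU eqf M _ /memv_imgP[X XU ->].
have [phi hphi <-] := gl_sign_exists g_metric E_dual s M.
by rewrite -eqf //; apply: memv_img; exact: stU.
Qed.

(** A submodule between [W] and [U] is recovered from its image in [K], since the kernel of [f] on
    [U] is [W]. *)
Lemma realizes_irreducible U W K f : irreducible_model K -> realizes U W K f ->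
  irreducible_quot g g0 U W.
Proof.
move=> [K0 irrK] [stU stW WU fU [fW eqf]]; split=> // [e|X stX WX XU].
  apply: K0; apply/eqP; rewrite -subv0 -fU; apply/subvP => _ /memv_imgP[X XU ->].
  by rewrite memv0; apply/eqP/fW; rewrite -?e.
have eqX : equivariant_on X f by move=> phi Y hphi YX; apply: eqf => //; exact: (subvP XU).
have fXK : (f @: X <= K)%VS by rewrite -fU limgS.
have [fX|fX] := irrK _ fXK (stable_image stX eqX).
  left; apply/eqP; rewrite eqEsubv WX andbT; apply/subvP => Y YX.
  apply/fW; first exact: (subvP XU).
  by apply/eqP; rewrite -memv0 -fX memv_img.
right; apply/eqP; rewrite eqEsubv XU; apply/subvP => Y YU.
have /memv_imgP[Z ZX e] : f Y \in (f @: X)%VS by rewrite fX -fU memv_img.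
have ZU := subvP XU _ ZX.
rewrite -[Y](subrK Z) memvD //; apply: (subvP WX); apply/fW; first by rewrite memvB.
by rewrite linearB /= e subrr.
Qed.

Lemma realizes_dim U W K f : realizes U W K f -> (\dim U - \dim W)%N = \dim K.
Proof.
move=> [_ _ WU fU [fW _]]; rewrite -(limg_ker_dim f U) fU.
suff -> : (U :&: lker f)%VS = W by rewrite addKn.
apply/eqP; rewrite eqEsubv; apply/andP; split; apply/subvP => X.
  by rewrite memv_cap memv_ker => /andP[XU /eqP fX]; apply/fW.
by move=> XW; have XU := subvP WU _ XW; rewrite memv_cap memv_ker XU; apply/eqP/fW.
Qed.

(** Both modules are identified with [K], so the isomorphism is [f] followed by the inverse of
    [h]. *)
Lemma realizes_iso U W K f T h : realizes U W K f -> realizes T 0%VS K h ->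
  isomorphic_quot g g0 U W T.
Proof.
move=> [stU stW WU fU [fW eqf]] [stT st0 _ hT [hW eqh]]; split=> //.
have hinj Y Z : Y \in T -> Z \in T -> h Y = h Z -> Y = Z.
  move=> YT ZT e; apply/eqP; rewrite -subr_eq0 -memv0; apply/hW; rewrite ?memvB //.
  by rewrite linearB /= e subrr.
(* [h] is injective only on [T]; projecting to [T] before and after the pseudo-inverse makes it a
   true inverse there. *)
pose h1 := (h \o projv T)%VF.
pose k := (projv T \o (h1^-1 \o f))%VF.
have kT X : k X \in T by rewrite lfunE memv_proj.
have hk X : X \in U -> h (k X) = f X.
  move=> XU; have /memv_imgP[Z ZT e] : f X \in (h @: T)%VS by rewrite hT -fU memv_img.
  rewrite !comp_lfunE -[h _]comp_lfunE -/h1 limg_lfunVK // e.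
  suff -> : h Z = h1 Z by rewrite memv_img // memvf.
  by rewrite comp_lfunE projv_id.
exists k; split.
- apply/eqP; rewrite eqEsubv; apply/andP; split; apply/subvP => Y.
    by case/memv_imgP => X _ ->.
  move=> YT; have : h Y \in (h @: T)%VS by rewrite memv_img.
  rewrite hT -fU => /memv_imgP[X XU e].
  suff <- : k X = Y by rewrite memv_img.
  by apply: hinj => //; rewrite hk.
- move=> X XU; rewrite -fW // -hk //; split=> [->|e]; first by rewrite linear0.
  by apply/eqP; rewrite -memv0; apply/hW.
move=> phi X hphi XU; apply: hinj => //; first exact: stT.
by rewrite hk ?eqf ?eqh ?hk //; exact: stU.
Qed.

(* The complement of K in the tensor product has smaller dimension than K, so no
   other irreducible submodule can compete with K. *)
Lemma realizes_cartan (U : {vspace 'rV[F]_n}) (V : {vspace 'M[F]_n}) T K h :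
  irreducible_model K -> realizes T 0%VS K h -> (T <= tensor_Vg g U V)%VS ->
  (\dim (tensor_Vg g U V) < 2 * \dim K)%N -> cartan_product g gam xi Vm U V T.
Proof.
move=> irrK hT TV dimV; have irrT := realizes_irreducible irrK hT.
have dimT : \dim T = \dim K by rewrite -(realizes_dim hT) dimv0 subn0.
split=> // K' [stK' _ _ K'0 irrK'] K'V K'T.
have [stT _ _ T0 irrT'] := irrT.
have stcap : stable g g0 (K' :&: T)%VS.
  by move=> phi X hphi; rewrite !memv_cap => /andP[X1 X2]; rewrite stK' ?stT.
have cap0 : (K' :&: T)%VS = 0%VS.
  have [//|e] := irrK' _ stcap (sub0v _) (capvSl _ _).
  by have [/K'0|//] := irrT' _ stK' (sub0v _) (introT capv_idPl e).
have : (\dim (K' + T) <= \dim (tensor_Vg g U V))%N by rewrite dimvS // subv_add K'V.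
by rewrite dimv_disjoint_sum // dimT; lia.
Qed.

Lemma dim_injective (P : vectType F) (T : {vspace tensor}) (K : {vspace P}) (f : 'Hom(tensor, P)) :
  {in T, forall X, f X = 0 -> X = 0} -> {in T, forall X, f X \in K} ->
  (\dim T <= \dim K)%N.
Proof.
move=> injf fT; rewrite -(limg_ker_dim f T).
have -> : (T :&: lker f)%VS = 0%VS.
  apply/eqP; rewrite -subv0; apply/subvP => X; rewrite memv_cap memv_ker => /andP[XT /eqP e].
  by rewrite memv0 (injf X).
rewrite dimv0 add0n dimvS //; apply/subvP => _ /memv_imgP[X XT ->]; exact: fT.
Qed.

Lemma stable0 : stable g g0 (0%VS : {vspace tensor}).
Proof.
move=> phi X _; rewrite !memv0 => /eqP ->; apply/eqP/(cf_inj g_metric E_dual).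
move=> s1 s2 s3 i j k; rewrite (cf_tact g_metric E_dual) cf0 !big1 ?addr0 // => u _;
  by rewrite big1 // => l _; rewrite cf0 mulr0.
Qed.

Lemma realizes_preimage (V : {vspace tensor}) K h : stable g g0 V -> equivariant_on V h ->
  {in V, forall X, h X = 0 -> X = 0} ->
  (forall M B, B \in K -> rho M B \in K) ->
  (forall B, B \in K -> exists2 X, X \in V & h X = B) ->
  realizes (V :&: h @^-1: K)%VS 0%VS K h.
Proof.
move=> stV eqV injV stK sur; split.
- move=> phi X hphi; rewrite !memv_cap -!memv_preim => /andP[XV hX].
  by rewrite stV // eqV // stK.
- exact: stable0.
- exact: sub0v.
- apply/eqP; rewrite eqEsubv; apply/andP; split; apply/subvP => B.
    by case/memv_imgP => X; rewrite memv_cap -memv_preim => /andP[_ hX] ->.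
  move=> BK; have [X XV e] := sur B BK; rewrite -e memv_img //.
  by rewrite memv_cap XV -memv_preim e.
split=> [X|phi X hphi]; rewrite memv_cap => /andP[XV _]; last exact: eqV.
rewrite memv0; split=> [|/eqP ->]; last by rewrite linear0.
by move/(injV X XV) ->.
Qed.

End Realizations.

(** * Irreducibility and stability of the four models *)

Section Models.
Variables (F : numFieldType) (m : nat).
Hypothesis m_gt2 : (2 < m)%N.
Local Notation tensor := {ffun 'I_m -> 'M[F]_m}.
Implicit Types (M : 'M[F]_m) (B : tensor) (S : {vspace tensor}).

Lemma lspan_neq0 (T : vectType F) (P : T -> Prop) x : P x -> x != 0 -> lspan P <> 0%VS.
Proof. by move=> Px x0 e; move: ((lspanP P).1 x Px); rewrite e memv0 (negPf x0). Qed.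

Lemma dim_lspan_neq0 (T : vectType F) (K : {vspace T}) : (0 < \dim K)%N -> K <> 0%VS.
Proof. by move=> h e; rewrite e dimv0 in h. Qed.

Lemma irreducible_model_intro (T : vectType F) (rho : 'M[F]_m -> T -> T) (K : {vspace T}) :
  (0 < \dim K)%N -> (forall S : {vspace T}, (S <= K)%VS ->
    (forall M x, x \in S -> rho M x \in S) ->
    {in K, forall x, x \in S} \/ {in S, forall x, x = 0}) ->
  irreducible_model rho K.
Proof.
move=> K0 h; split=> [|S SK stS]; first exact: dim_lspan_neq0.
have [KS|S0] := h S SK stS; [right|left].
  by apply/eqP; rewrite eqEsubv SK; apply/subvP => x /KS.
by apply/eqP; rewrite -subv0; apply/subvP => x /S0 ->; rewrite mem0v.
Qed.

Lemma irreducible_hook : irreducible_model (@rho_cov F m) (lspan (@hook F m)).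
Proof.
apply: irreducible_model_intro => [|S SK stS].
  have := dim_hook F m_gt2; case: (\dim _) => // /esym/eqP.
  by rewrite muln0 !muln_eq0; move: m_gt2; case: m => [|[|k]] //= _; rewrite subn_eq0 => /=; lia.
have [S0|S0] := pselect (S = 0%VS).
  by right=> x; rewrite S0 memv0 => /eqP.
left=> B /mem_hook hB; apply: hook_irreducible hB => //.
by move=> B' /(subvP SK)/mem_hook.
Qed.

Lemma irreducible_vector :
  irreducible_model (fun M (v : 'rV[F]_m) => v *m M^T) fullv.
Proof.
apply: irreducible_model_intro => [|S SK stS].
  by rewrite dimvf /dim /= mul1n; lia.
have [S0|S0] := pselect (S = 0%VS).
  by right=> x; rewrite S0 memv0 => /eqP.
by left=> v; rewrite (vector_irreducible stS S0).
Qed.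

(** The dichotomy leaves only pure traces as an alternative, and a traceless pure trace is zero
    because [m - 1] is invertible; the symmetric case uses [m + 1] in the same way. *)
Lemma irreducible_skew_traceless :
  irreducible_model (@rho_mixed F m) (lspan (@skew_traceless F m)).
Proof.
apply: irreducible_model_intro => [|S SK stS].
  have := dim_skew_traceless F m_gt2; case: (\dim _) => // /esym/eqP.
  by rewrite muln0 !muln_eq0; lia.
have [KS|S0] := skew_traceless_irreducible m_gt2 stS; [left|right] => B BS.
  by apply: KS; apply/mem_skew_traceless.
have [as_B tB] := (mem_skew_traceless B).1 (subvP SK _ BS).
have [l hl] := S0 B BS.
have e i j k : 2 * B i j k = (j == k)%:R * l i - (i == k)%:R * l j.
  by rewrite -hl -(as_B i j k); ring.
have l0 i : l i = 0.
  have : \sum_j 2 * B i j j = 0 by rewrite -mulr_sumr tB mulr0.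
  under eq_bigr do rewrite e eqxx mul1r.
  rewrite sumrB sum_const sum_delta_sym -[X in _ - X]mulr1 -mulrBr => /eqP.
  by rewrite mulf_eq0 (negPf (m_sub1_neq0 F m_gt2)) orbF => /eqP.
apply: tensorP => i j k; rewrite tensor0; apply/eqP.
by have /eqP := e i j k; rewrite !l0 !mulr0 subrr mulf_eq0 pnatr_eq0.
Qed.

Lemma irreducible_sym_traceless :
  irreducible_model (@rho_mixed F m) (lspan (@sym_traceless F m)).
Proof.
apply: irreducible_model_intro => [|S SK stS].
  have := dim_sym_traceless F m_gt2; case: (\dim _) => // /esym/eqP.
  by rewrite muln0 !muln_eq0; lia.
have [KS|S0] := sym_traceless_irreducible m_gt2 stS; [left|right] => B BS.
  by apply: KS; apply/mem_sym_traceless.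
have [s_B tB] := (mem_sym_traceless B).1 (subvP SK _ BS).
have e i j k : 2 * B i j k = (j == k)%:R * B i i i + (i == k)%:R * B j j j.
  by rewrite -S0 // -(s_B i j k); ring.
have l0 i : B i i i = 0.
  have : \sum_j 2 * B i j j = 0 by rewrite -mulr_sumr tB mulr0.
  under eq_bigr do rewrite e eqxx mul1r.
  rewrite big_split /= sum_const sum_delta_sym -[X in _ + X]mulr1 -mulrDr => /eqP.
  by rewrite mulf_eq0 (negPf (m_add1_neq0 F m)) orbF => /eqP.
apply: tensorP => i j k; rewrite tensor0; apply/eqP.
by have /eqP := e i j k; rewrite !l0 !mulr0 addr0 mulf_eq0 pnatr_eq0.
Qed.

Lemma hook_stable M B : hook B -> hook (rho_cov M B).
Proof.
move=> [h1 h2]; split=> i j k; rewrite !rhoE.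
  rewrite !opprD -addrA [X in _ + X]addrC addrA -!sumrN.
  by congr (_ + _ + _); apply: eq_bigr => l _; rewrite -mulrN -h1.
transitivity (\sum_l M i l * (B l j k + B j k l + B k l j) +
   \sum_l M j l * (B i l k + B l k i + B k i l) +
   \sum_l M k l * (B i j l + B j l i + B l i j)); last first.
  by rewrite !big1 ?addr0 // => l _; rewrite h2 mulr0.
have dist (a x y z : 'I_m -> F) : \sum_l a l * (x l + y l + z l) =
    \sum_l a l * x l + \sum_l a l * y l + \sum_l a l * z l.
  by rewrite -!big_split; apply: eq_bigr => l _; rewrite /= !mulrDr.
by rewrite !dist; ring.
Qed.

Lemma tr23_rho_mixed M B i : (forall i, tr23 B i = 0) -> tr23 (rho_mixed M B) i = 0.
Proof. by move=> tB; rewrite tr23_rho big1 // => l _; rewrite tB mulr0. Qed.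

Lemma skew_traceless_stable M B : skew_traceless B -> skew_traceless (rho_mixed M B).
Proof.
move=> [h1 h2]; split=> [i j k|]; last by move=> i; exact: tr23_rho_mixed.
rewrite !rhoE !opprD [X in X + _]addrC -!sumrN.
by congr (_ + _ + _); apply: eq_bigr => l _; rewrite -mulrN -h1.
Qed.

Lemma sym_traceless_stable M B : sym_traceless B -> sym_traceless (rho_mixed M B).
Proof.
move=> [h1 h2]; split=> [i j k|]; last by move=> i; exact: tr23_rho_mixed.
rewrite !rhoE [X in X + _]addrC.
by congr (_ + _ + _); apply: eq_bigr => l _; rewrite -h1.
Qed.

End Models.

(** Here and in the two following lemmas, a model fills more than half of the surrounding tensor
    product as soon as [m > 2]; this is the numerical input of [realizes_cartan]. *)
Lemma dim_hook_lt m d v : (2 < m)%N -> (3 * d = m * (m ^ 2 - 1))%N ->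
  (2 * v <= m * (m * (m - 1)))%N -> (v < 2 * d)%N.
Proof.
move=> hm; have : (3 * (m * (m * (m - 1))) < 4 * (m * (m ^ 2 - 1)))%N.
  by case: m hm => [|[|[|k]]] // _; rewrite expnS expn1 subn1 /= mulnS addSn subn1 /=; nia.
move: (m * (m * (m - 1)))%N (m * (m ^ 2 - 1))%N => a b; lia.
Qed.
Lemma dim_skew_lt m d v : (2 < m)%N -> (2 * d = m * (m - 2) * (m + 1))%N ->
  (2 * v <= m * (m * (m - 1)))%N -> (v < 2 * d)%N.
Proof.
move=> hm; have : (m * (m * (m - 1)) < 2 * (m * (m - 2) * (m + 1)))%N.
  by case: m hm => [|[|[|k]]] // _; rewrite subn1 subn2 /=; nia.
move: (m * (m * (m - 1)))%N (m * (m - 2) * (m + 1))%N => a b; lia.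
Qed.
Lemma dim_sym_lt m d v : (2 < m)%N -> (2 * d = m * (m + 2) * (m - 1))%N ->
  v = (m * (m * m - 1))%N -> (v < 2 * d)%N.
Proof.
move=> hm -> ->.
by case: m hm => [|[|[|k]]] // _; rewrite subn1 mulnS addSn subn1 /=; nia.
Qed.

(** * The Cartan products as explicit spaces of tensors *)

Section CartanProducts.
Variables (F : numFieldType) (n sp sm m : nat).
Variable g : 'M[F]_n.
Variables (gam : 'I_n -> 'M[F]_(sp, sm)) (xi : 'rV[F]_sp) (Vm : {vspace 'rV[F]_n}).
Hypothesis g_metric : nondegenerate_symmetric g.
Variable E : bool -> 'I_m -> 'rV[F]_n.
Hypothesis E_dual : dual_basis g gam xi Vm E.
Hypothesis m_gt2 : (2 < m)%N.
Local Notation tensor := {ffun 'I_n -> 'M[F]_n}.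
Local Notation cf := (coord3 E).
Local Notation mixed := (mixed E).
Local Notation gl_sign := (gl_part E).
Local Notation g0 := (g_0 g gam xi Vm).
Local Notation V_ := (Vhalf gam xi Vm).
Local Notation act := (tact g).
Implicit Types (phi : 'M[F]_n) (X Y : tensor) (U : {vspace tensor}).

Lemma mem_Vg_wedge u s X : X \in tensor_Vg g (V_ u) (g_pm1 g gam xi Vm s) <->
  (forall s1 s2 s3 i j k, (s1, s2, s3) != (u, s, s) -> cf X s1 s2 s3 i j k = 0) /\
  forall i j k, cf X u s s i j k = - cf X u s s i k j.
Proof.
rewrite (mem_Vg g_metric E_dual); split=> [[h1 h2]|[h1 h2]].
  have z s1 s2 s3 i j k : s1 != u -> cf X s1 s2 s3 i j k = 0.
    by move=> su; rewrite cf_slice (negb_of_neq su) h1 cP0.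
  split=> [s1 s2 s3 i j k|i j k].
    have [->|/z -> //] := eqVneq s1 u; rewrite !xpair_eqE eqxx /= => ss.
    by have /(mem_g1 g_metric E_dual)[_ h] := h2 i; rewrite cf_slice h.
  by have /(mem_g1 g_metric E_dual)[/(mem_so g_metric E_dual) h _] := h2 i; rewrite !cf_slice h.
split=> i.
  apply: (cP_inj g_metric E_dual) => s2 s3 j k; rewrite cP0.
  have := h1 (~~ u) s2 s3 i j k; rewrite cf_slice negbK; apply.
  by rewrite !xpair_eqE; case: (u).
apply/(mem_g1 g_metric E_dual); split=> [|s2 s3 j k ss]; last first.
  by rewrite -cf_slice h1 // !xpair_eqE eqxx.
apply/(mem_so g_metric E_dual) => s2 s3 j k; rewrite -!cf_slice.
have [/andP[/eqP -> /eqP ->]|ss] := boolP ((s2 == s) && (s3 == s)); first exact: h2.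
by rewrite !h1 ?oppr0 // !xpair_eqE eqxx // andbC.
Qed.

(** Coordinate form of $V_s\otimes g_0$: the two slots of the $g_0$ factor carry opposite labels. *)
Definition g0_valued s X : Prop :=
  (forall s1 s2 s3 i j k, (s1 != s) || (s2 == s3) -> cf X s1 s2 s3 i j k = 0) /\
  forall t i j k, cf X s t (~~ t) i j k = - cf X s (~~ t) t i k j.

Lemma mem_Vg_g0 s (W : {vspace 'M[F]_n}) (Q : 'M[F]_n -> Prop) X : (forall phi, phi \in W <-> phi \in g0 /\ Q phi) ->
  X \in tensor_Vg g (V_ s) W <-> g0_valued s X /\ forall i, Q (slice (E (~~ s) i) X).
Proof.
move=> WQ; rewrite (mem_Vg g_metric E_dual).
split=> [[h1 h2]|[[h1 h2] h3]].
  split=> [|i]; last by have /WQ[] := h2 i.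
  split=> [s1 s2 s3 i j k|t i j k]; last first.
    by have /WQ[/(g0_so g_metric E_dual)/(mem_so g_metric E_dual) h _] := h2 i; rewrite !cf_slice h.
  have [->|su] := eqVneq s1 s => /= [/eqP ->|_]; last first.
    by rewrite cf_slice (negb_of_neq su) h1 cP0.
  have /WQ[h _] := h2 i; rewrite cf_slice (cP_g0 g_metric E_dual) //.
  by case: (s3).
split=> i.
  apply: (cP_inj g_metric E_dual) => s2 s3 j k; rewrite cP0.
  by have := h1 (~~ s) s2 s3 i j k; rewrite cf_slice negbK; apply; case: (s).
apply/WQ; split=> //; apply/(mem_g0 g_metric E_dual); split=> [|j k|j k].
- apply/(mem_so g_metric E_dual) => s2 s3 j k; rewrite -!cf_slice.
  have [->|ss] := eqVneq s2 s3; first by rewrite !h1 ?eqxx ?orbT // oppr0.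
  by rewrite -(negb_of_neq ss) h2.
- by rewrite -cf_slice h1 // orbT.
by rewrite -cf_slice h1 // orbT.
Qed.

Lemma gl_signE s phi i j : phi \in g0 -> gl_sign s phi i j = coord2 E phi s (~~ s) i j.
Proof.
move=> /(g0_so g_metric E_dual)/(mem_so g_metric E_dual) h.
by case: s; rewrite /gl_part /gl_mx !mxE //= h opprK.
Qed.

(** Injectivity of [f] is asked only on the tensor product [V]; the Cartan product is the preimage
    of [K] inside [V]. *)
Lemma cartan_intro (N : vectType F) (rho : 'M[F]_m -> N -> N) s (f : tensor -> N)
    (K : {vspace N}) (U : {vspace 'rV[F]_n}) (W : {vspace 'M[F]_n}) (V := tensor_Vg g U W) :
  irreducible_model rho K -> (forall a X Y, f (a *: X + Y) = a *: f X + f Y) ->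
  (forall phi X, phi \in g0 -> f (act phi X) = rho (gl_sign s phi) (f X)) ->
  stable g g0 V -> {in V, forall X, f X = 0 -> X = 0} ->
  (forall M B, B \in K -> rho M B \in K) ->
  (forall B, B \in K -> exists2 X, X \in V & f X = B) ->
  (\dim V < 2 * \dim K)%N ->
  exists T, cartan_product g gam xi Vm U W T /\
    exists h, realizes g gam xi Vm E rho s T 0%VS K h.
Proof.
move=> irrK lin_f eqf stV injf stK surf dimV; have [h hf] := exists_hom lin_f.
have hT : realizes g gam xi Vm E rho s (V :&: h @^-1: K)%VS 0%VS K h.
  apply: realizes_preimage => // [phi X hphi _|X XV|B /surf[X XV e]].
  - by rewrite !hf eqf.
  - by rewrite hf; exact: injf.
  by exists X; rewrite ?hf.
exists (V :&: h @^-1: K)%VS; split; last by exists h.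
by apply: (realizes_cartan g_metric E_dual irrK hT) => //; exact: capvSl.
Qed.

Lemma stable_wedge u s : stable g g0 (tensor_Vg g (V_ u) (g_pm1 g gam xi Vm s)).
Proof.
move=> phi X hphi /mem_Vg_wedge[h1 h2]; apply/mem_Vg_wedge; split=> [s1 s2 s3 i j k ss|i j k].
  by rewrite (cf_act0 g_metric E_dual) // !big1 ?addr0 // => l _; rewrite h1 // mulr0.
rewrite !(cf_act0 g_metric E_dual) // !opprD -addrA [X in _ + X]addrC addrA -!sumrN.
by congr (_ + _ + _); apply: eq_bigr => l _; rewrite -mulrN -h2.
Qed.

Lemma g0_valued_act s phi X : phi \in g0 -> g0_valued s X -> g0_valued s (act phi X).
Proof.
move=> hphi [h1 h2]; split=> [s1 s2 s3 i j k ss|t i j k].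
  by rewrite (cf_act0 g_metric E_dual) // !big1 ?addr0 // => l _; rewrite h1 // mulr0.
rewrite !(cf_act0 g_metric E_dual) // !opprD -addrA [X in _ + X]addrC addrA -!sumrN.
by congr (_ + _ + _); apply: eq_bigr => l _; rewrite -mulrN -h2.
Qed.

Lemma g0_valued_slice s X i : g0_valued s X -> slice (E (~~ s) i) X \in g0.
Proof.
move=> [h1 h2]; apply/(mem_g0 g_metric E_dual); split=> [|j k|j k]; rewrite -?cf_slice ?h1 ?orbT //.
apply/(mem_so g_metric E_dual) => s2 s3 j k; rewrite -!cf_slice.
have [->|ss] := eqVneq s2 s3; first by rewrite !h1 ?eqxx ?orbT // oppr0.
by rewrite -(negb_of_neq ss) h2.
Qed.

Lemma mixed_slice s X i j k : g0_valued s X ->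
  mixed s X i j k = gl_sign s (slice (E (~~ s) i) X) j k.
Proof. by move=> h; rewrite gl_signE ?mixedE //; exact: g0_valued_slice. Qed.

Lemma gl_sign_trace s phi : \tr (gl_sign s phi) = (if s then 1 else -1) * \tr (gl_mx E phi).
Proof. by case: s; rewrite /gl_part ?mul1r // linearN /= mxtrace_tr mulN1r. Qed.

Lemma mem_Vg_z0 s X : X \in tensor_Vg g (V_ s) (z_0 g gam xi Vm) <->
  g0_valued s X /\ exists c : 'I_m -> F, forall i j k, mixed s X i j k = (j == k)%:R * c i.
Proof.
rewrite (mem_Vg_g0 _ _ (fun phi => mem_z0 g_metric E_dual phi (ltnW (ltnW m_gt2)))).
split=> -[h1 h2]; split=> //.
  exists (fun i => (if s then 1 else -1) * sval (cid (h2 i))) => i j k.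
  rewrite mixed_slice //; case: (cid (h2 i)) => c /= e; rewrite /gl_part e.
  by case: (s); rewrite !mxE ?mul1r ?mulN1r mulr_natl // mulNrn eq_sym.
have [c hc] := h2 => i; exists ((if s then 1 else -1) * c i); apply/matrixP => j k.
have := hc i j k; have := hc i k j; rewrite !mixed_slice // /gl_part; case: (s) => h3 h4.
  by rewrite h4 mxE mul1r mulr_natl.
move: h3; rewrite !mxE => /eqP; rewrite eqr_oppLR => /eqP ->.
by rewrite eq_sym mulN1r mulNrn mulr_natl.
Qed.

Lemma mem_Vg_sl0 s X : X \in tensor_Vg g (V_ s) (sl_0 g gam xi Vm) <->
  g0_valued s X /\ forall i, tr23 (mixed s X) i = 0.
Proof.
rewrite (mem_Vg_g0 _ _ (fun phi => mem_sl0 g_metric E_dual phi (ltnW (ltnW m_gt2)))).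
have e i : g0_valued s X -> tr23 (mixed s X) i =
    (if s then 1 else -1) * \tr (gl_mx E (slice (E (~~ s) i) X)).
  by move=> h; rewrite -gl_sign_trace; apply: eq_bigr => j _; rewrite mixed_slice.
split=> -[h1 h2]; split=> // i; first by rewrite e // h2 mulr0.
by have /eqP := h2 i; rewrite e //; case: (s); rewrite ?mul1r ?mulN1r ?oppr_eq0 => /eqP.
Qed.

Lemma cf0_wedge u s X : X \in tensor_Vg g (V_ u) (g_pm1 g gam xi Vm s) ->
  (forall i j k, cf X u s s i j k = 0) -> X = 0.
Proof.
move=> /mem_Vg_wedge[h1 _] h; apply: (cf_inj g_metric E_dual) => s1 s2 s3 i j k; rewrite cf0.
by have [[-> -> ->]|/h1 ->] := eqVneq (s1, s2, s3) (u, s, s).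
Qed.

Lemma dim_wedge u s :
  (2 * \dim (tensor_Vg g (V_ u) (g_pm1 g gam xi Vm s)) <= m * (m * (m - 1)))%N.
Proof.
pose f X : {ffun 'I_m -> 'M[F]_m} := [ffun i => \matrix_(j, k) cf X u s s i j k].
have fE X i j k : f X i j k = cf X u s s i j k by rewrite ffunE mxE.
have [|h hf] := exists_hom (f := f).
  by move=> a X Y; apply: tensorP => i j k; rewrite !(tensorE, fE) cf_lin.
rewrite -(dim_skew23 F m_gt2) leq_pmul2l //; apply: (dim_injective (f := h)) => X XV.
  by rewrite hf => e; apply: (cf0_wedge XV) => i j k; rewrite -fE e tensor0.
by rewrite hf; apply/mem_skew23 => i j k; rewrite !fE; case/mem_Vg_wedge: XV.
Qed.

Lemma cartan_hook s :
  exists T, cartan_product g gam xi Vm (V_ s) (g_pm1 g gam xi Vm s) T /\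
    exists h, realizes g gam xi Vm E (@rho_cov F m) s T 0%VS (lspan (@hook F m)) h.
Proof.
apply: (@cartan_intro _ _ s (extremal E s)) => //.
- exact: irreducible_hook.
- exact: extremal_lin.
- by move=> phi X hphi; exact: (extremal_act g_metric E_dual).
- exact: stable_wedge.
- by move=> X XV e; apply: (cf0_wedge XV) => i j k; rewrite -extremalE e tensor0.
- by move=> M B /mem_hook hB; apply/mem_hook/hook_stable.
- move=> B /mem_hook[hB _]; have [X hX] := exists_tensor E_dual
    (fun s1 s2 s3 i j k => if (s1, s2, s3) == (s, s, s) then B i j k else 0).
  exists X; last by apply: tensorP => i j k; rewrite extremalE hX eqxx.
  apply/mem_Vg_wedge; split=> [s1 s2 s3 i j k ss|i j k]; first by rewrite hX (negPf ss).
  by rewrite !hX eqxx.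
exact: (dim_hook_lt m_gt2 (dim_hook F m_gt2) (dim_wedge s s)).
Qed.

Lemma cartan_skew_traceless s :
  exists T, cartan_product g gam xi Vm (V_ (~~ s)) (g_pm1 g gam xi Vm s) T /\
    exists h, realizes g gam xi Vm E (@rho_mixed F m) s T 0%VS (lspan (@skew_traceless F m)) h.
Proof.
apply: (@cartan_intro _ _ s (cyclic_mixed E s)) => //.
- exact: irreducible_skew_traceless.
- exact: cyclic_mixed_lin.
- by move=> phi X hphi; exact: (cyclic_mixed_act g_metric E_dual).
- exact: stable_wedge.
- by move=> X XV e; apply: (cf0_wedge XV) => i j k; rewrite -cyclic_mixedE e tensor0.
- by move=> M B /mem_skew_traceless hB; apply/mem_skew_traceless/skew_traceless_stable.
- move=> B /mem_skew_traceless[hB _]; have [X hX] := exists_tensor E_dual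
    (fun s1 s2 s3 i j k => if (s1, s2, s3) == (~~ s, s, s) then B j k i else 0).
  exists X; last by apply: tensorP => i j k; rewrite cyclic_mixedE hX eqxx.
  apply/mem_Vg_wedge; split=> [s1 s2 s3 i j k ss|i j k]; first by rewrite hX (negPf ss).
  by rewrite !hX eqxx.
exact: (dim_skew_lt m_gt2 (dim_skew_traceless F m_gt2) (dim_wedge (~~ s) s)).
Qed.

Lemma cf0_g0_valued s X : g0_valued s X -> mixed s X = 0 -> X = 0.
Proof.
move=> [h1 h2] e; apply: (cf_inj g_metric E_dual) => s1 s2 s3 i j k; rewrite cf0.
have z i' j' k' : cf X s s (~~ s) i' j' k' = 0 by rewrite -mixedE e tensor0.
have [ss|] := boolP ((s1 != s) || (s2 == s3)); first exact: h1.
rewrite negb_or negbK => /andP[/eqP -> ss]; rewrite -(negb_of_neq ss).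
have [->|/negb_of_neq e2] := eqVneq s2 s; first exact: z.
by rewrite h2 e2 -[s2]negbK e2 z oppr0.
Qed.

Lemma g0_valued_exists s (B : {ffun 'I_m -> 'M[F]_m}) :
  exists2 X, g0_valued s X & mixed s X = B.
Proof.
have [X hX] := exists_tensor E_dual (fun s1 s2 s3 i j k =>
  if (s1 == s) && (s2 != s3) then if s2 == s then B i j k else - B i k j else 0).
exists X; last by apply: tensorP => i j k; rewrite mixedE hX eqxx; case: (s).
split=> [s1 s2 s3 i j k|t i j k]; rewrite !hX ?eqxx /=.
  by move=> h; rewrite -[X in if X then _ else _]negbK negb_and negbK h.
by case: t; case: (s); rewrite //= opprK.
Qed.

Lemma cartan_sym_traceless s :
  exists T, cartan_product g gam xi Vm (V_ s) (sl_0 g gam xi Vm) T /\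
    exists h, realizes g gam xi Vm E (@rho_mixed F m) s T 0%VS (lspan (@sym_traceless F m)) h.
Proof.
apply: (@cartan_intro _ _ s (mixed s)) => //.
- exact: irreducible_sym_traceless.
- exact: mixed_lin.
- by move=> phi X hphi; exact: (mixed_act g_metric E_dual).
- move=> phi X hphi /mem_Vg_sl0[h1 h2]; apply/mem_Vg_sl0; split; first exact: g0_valued_act.
  by move=> i; rewrite (mixed_act g_metric E_dual) // tr23_rho_mixed.
- by move=> X /mem_Vg_sl0[h _]; exact: cf0_g0_valued.
- by move=> M B /mem_sym_traceless hB; apply/mem_sym_traceless/sym_traceless_stable.
- move=> B /mem_sym_traceless[_ tB]; have [X h e] := g0_valued_exists s B.
  by exists X => //; apply/mem_Vg_sl0; rewrite e.
have [h hf] := exists_hom (@mixed_lin F n m E s).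
apply: leq_ltn_trans (_ : \dim (lspan (@traceless23 F m)) < _)%N.
  apply: (dim_injective (f := h)) => X /mem_Vg_sl0[h1 h2]; rewrite hf.
    exact: cf0_g0_valued.
  exact/mem_traceless23.
exact: (dim_sym_lt m_gt2 (dim_sym_traceless F m_gt2) (dim_traceless23 F m_gt2)).
Qed.

Lemma mixed_of_trace s X (c : 'I_m -> F) : (forall i j k, mixed s X i j k = (j == k)%:R * c i) ->
  forall i, c i = m%:R^-1 * trace_row E s X 0 i.
Proof.
move=> h i; rewrite mxE /tr23; under eq_bigr do rewrite h eqxx mul1r.
by rewrite sum_const; have := m_neq0 F m_gt2 => m0; field.
Qed.

(** As $\mathfrak z_0$ is one-dimensional, the whole tensor product is already the irreducible
    vector module, identified through its trace. *)
Lemma cartan_vector s :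
  exists T, cartan_product g gam xi Vm (V_ s) (z_0 g gam xi Vm) T /\
    exists h, realizes g gam xi Vm E (fun M (v : 'rV[F]_m) => v *m M^T) s T 0%VS fullv h.
Proof.
have inj X : X \in tensor_Vg g (V_ s) (z_0 g gam xi Vm) -> trace_row E s X = 0 -> X = 0.
  move=> /mem_Vg_z0[h1 [c hc]] e; apply: (cf0_g0_valued h1); apply: tensorP => i j k.
  by rewrite hc (mixed_of_trace hc) e mxE tensor0 !mulr0.
apply: (@cartan_intro _ _ s (trace_row E s)) => //.
- exact: irreducible_vector.
- exact: trace_row_lin.
- by move=> phi X hphi; exact: (trace_row_act g_metric E_dual).
- move=> phi X hphi /mem_Vg_z0[h1 [c hc]]; apply/mem_Vg_z0; split; first exact: g0_valued_act.
  exists (fun i => \sum_l gl_sign s phi i l * c l) => i j k.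
  rewrite (mixed_act g_metric E_dual) // rhoE; under eq_bigr do rewrite hc mulrCA.
  under [X in _ + X + _]eq_bigr do rewrite hc mulrCA.
  under [X in _ + X]eq_bigr do rewrite hc mulrCA.
  by rewrite -mulr_sumr sum_delta sum_delta_sym !mxE mulNr addrK.
- by move=> M B _; exact: memvf.
- move=> v _; have [X h e] := g0_valued_exists s
    [ffun i => \matrix_(j, k) ((j == k)%:R * (m%:R^-1 * v 0 i))].
  exists X; first by apply/mem_Vg_z0; split=> //; exists (fun i => m%:R^-1 * v 0 i) => i j k;
    rewrite e ffunE mxE.
  apply/rowP => i; rewrite mxE e /tr23; under eq_bigr do rewrite ffunE mxE eqxx mul1r.
  by rewrite sum_const; have := m_neq0 F m_gt2 => m0; field.
have [h hf] := exists_hom (@trace_row_lin F n m E s).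
apply: leq_ltn_trans (_ : \dim (fullv : {vspace 'rV[F]_m}) < _)%N.
  by apply: (dim_injective (f := h)) => X XV; rewrite ?memvf // hf; exact: inj.
by rewrite dimvf /dim /= mul1n; lia.
Qed.

End CartanProducts.

(** * The graded pieces: liftings, dimensions and direct sums *)

Section Components.
Variables (F : numFieldType) (n sp sm m : nat).
Variable g : 'M[F]_n.
Variables (gam : 'I_n -> 'M[F]_(sp, sm)) (gam' : 'I_n -> 'M[F]_(sm, sp)).
Variables (xi : 'rV[F]_sp) (Vm : {vspace 'rV[F]_n}).
Hypothesis g_metric : nondegenerate_symmetric g.
Hypothesis gam_clifford : clifford_relations g gam gam'.
Hypothesis xi_neq0 : xi != 0.
Variable E : bool -> 'I_m -> 'rV[F]_n.
Hypothesis E_dual : dual_basis g gam xi Vm E.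
Hypothesis m_gt2 : (2 < m)%N.
Hypothesis n_def : n = m.*2.
Local Notation tensor := {ffun 'I_n -> 'M[F]_n}.
Local Notation model := {ffun 'I_m -> 'M[F]_m}.
Local Notation cf := (coord3 E).
Local Notation mixed := (mixed E).
Local Notation gl_sign := (gl_part E).
Local Notation A_ := (filtr g gam gam' xi).
Local Notation Aj_ := (CYcomp g gam gam' xi).
Local Notation g0 := (g_0 g gam xi Vm).
Local Notation p_ := (p_alg g gam xi).
Local Notation V_ := (Vhalf gam xi Vm).
Local Notation act := (tact g).
Implicit Types (phi : 'M[F]_n) (X Y : tensor) (U : {vspace tensor}) (B : model).

Definition on_level (p : nat) X := forall (s t r : bool) i j k,
  (s + t + r)%N != p -> cf X s t r i j k = 0.

Lemma mem_CY_level p X :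
  X \in CY_level g gam xi Vm p <-> cotton_york E X /\ on_level p X.
Proof.
rewrite memv_cap; split=> [/andP[/(mem_CY g_metric E_dual) h /(mem_level g_metric E_dual)]|[h1 h2]].
  by split.
apply/andP; split; [exact/(mem_CY g_metric E_dual) | exact/(mem_level g_metric E_dual)].
Qed.

Lemma on_level_high p X : on_level p X -> high E p X.
Proof. by move=> h s t r i j k lp; rewrite h // neq_ltn lp. Qed.

(** The metric trace pairs opposite labels, so a tensor with all labels equal satisfies it
    automatically; hook symmetry is the rest of the Cotton-York condition. *)
Lemma lift_extremal (s : bool) B : hook B ->
  exists X, [/\ cotton_york E X, on_level (s + s + s) X & extremal E s X = B].
Proof.
move=> [h1 h2]; have [X hX] := exists_tensor E_dual (fun s1 s2 s3 i j k =>
  if [&& s1 == s, s2 == s & s3 == s] then B i j k else 0).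
exists X; split; last by apply: tensorP => i j k; rewrite extremalE hX eqxx.
  split=> [s1 s2 s3 i j k|s1 s2 s3 i j k|r k].
  - rewrite !hX [(s3 == s) && _]andbC; case: ifP => _; last by rewrite oppr0.
    exact: h1.
  - rewrite !hX; case: (s1 == s); case: (s2 == s); case: (s3 == s); rewrite //= ?addr0 //.
  rewrite big1 // => s1 _; rewrite big1 // => i _; rewrite hX.
  by case: (s1); case: (s).
move=> s1 s2 s3 i j k; rewrite hX.
by case: s1; case: s2; case: s3; case: (s).
Qed.

(** The formulas of [cf_mid] and [cf_first], read as definitions, give the other coordinates; the
    hypothesis on traces is then exactly the metric trace condition. *)
Lemma lift_mixed (s : bool) B : (forall i, tr13 B i = tr23 B i / 2) ->
  exists X, [/\ cotton_york E X, on_level s.+1 X & mixed s X = B].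
Proof.
move=> trB; have [X hX] := exists_tensor E_dual (fun s1 s2 s3 i j k =>
  match s1 == s, s2 == s, s3 == s with
  | true, true, false => B i j k
  | true, false, true => - B i k j
  | false, true, true => B k j i - B j k i
  | _, _, _ => 0
  end).
exists X; split; last by apply: tensorP => i j k; rewrite mixedE hX eqxx; case: (s).
  split=> [s1 s2 s3 i j k|s1 s2 s3 i j k|r k].
  - rewrite !hX; case: (s1 == s); case: (s2 == s); case: (s3 == s);
      rewrite ?oppr0 ?opprK ?opprB //.
  - by rewrite !hX; case: (s1 == s); case: (s2 == s); case: (s3 == s); ring.
  rewrite (bigD1 s) //= (bigD1 (~~ s)) /=; last by case: (s).
  rewrite [X in _ + (_ + X)]big1 ?addr0; last by case: (s) => [] [].
  under eq_bigr do rewrite hX eqxx; under [X in _ + X]eq_bigr do rewrite hX negbK eqxx.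
  have -> : (~~ s == s) = false by case: (s).
  case: (r == s); last by rewrite !big1 ?addr0.
  rewrite sumrN sumrB -/(tr13 B k) -/(tr23 B k) trB.
  by field.
move=> s1 s2 s3 i j k; rewrite hX.
by case: s1; case: s2; case: s3; case: (s).
Qed.

Lemma filtr_high p X : (p <= 4)%N -> X \in A_ p <-> cotton_york E X /\ high E p X.
Proof.
move=> p4; rewrite (mem_filtr g_metric gam_clifford xi_neq0 E_dual m_gt2 n_def X p4).
by split=> -[/(mem_CY g_metric E_dual) h1 h2].
Qed.

Lemma CYcomp_mixed (s : bool) j X : X \in Aj_ s.+1 j <-> cotton_york E X /\
  (high E s.+1 X /\ forall k, k <> j -> comp_zero k (mixed s X)).
Proof.
rewrite (mem_CYcomp g_metric gam_clifford xi_neq0 E_dual m_gt2 n_def).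
by split=> -[/(mem_CY g_metric E_dual) h1 h2].
Qed.

Lemma stable_filtr p : (p <= 4)%N -> stable g p_ (A_ p).
Proof.
move=> p4 phi X hphi /(filtr_high _ p4)[h1 h2]; apply/(filtr_high _ p4); split.
  apply: (cotton_york_tact g_metric E_dual) => //.
  by have [] := (mem_p_alg g_metric E_dual phi).1 hphi.
exact: (high_tact g_metric E_dual).
Qed.

Lemma filtrS p : (p < 4)%N -> (A_ p.+1 <= A_ p)%VS.
Proof.
move=> p4; apply/subvP => X /(filtr_high _ p4)[h1 h2]; apply/(filtr_high _ (ltnW p4)).
by split=> // s t r i j k l; apply: h2; rewrite ltnS ltnW.
Qed.

(** The part of [phi] in $g_1$ would have to act on coordinates of lower weight, and these vanish;
    only the $g_0$ part acts on the leading block. *)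
Lemma mixed_act_p (s : bool) phi X : phi \in p_ -> high E s.+1 X ->
  mixed s (act phi X) = rho_mixed (gl_sign s phi) (mixed s X).
Proof.
move=> /(mem_p_alg g_metric E_dual)[/(mem_so g_metric E_dual) as_phi phi0] hX.
have glE t i l : coord2 E phi t (~~ t) i l = gl_sign t phi i l.
  by case: t; rewrite /gl_part /gl_mx !mxE //= as_phi.
have sum2 t (f : bool -> 'I_m -> F) i : (forall l, coord2 E phi t t i l * f (~~ t) l = 0) ->
    \sum_u \sum_l coord2 E phi t (~~ u) i l * f u l = \sum_l gl_sign t phi i l * f t l.
  move=> h; rewrite (bigD1 t) //= [X in _ + X]big1 ?addr0 => [|u ut].
    by apply: eq_bigr => l _; rewrite glE.
  by rewrite big1 // => l _; rewrite (negb_of_neq ut) -[u]negbK (negb_of_neq ut) h.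
apply: tensorP => i j k; rewrite mixedE (cf_tact g_metric E_dual) rhoE -gl_signN.
rewrite !sum2 => [|l|l|l].
- by congr (_ + _ + _); apply: eq_bigr => l _; rewrite mixedE.
- by case: (s) hX => hX; rewrite ?phi0 ?mul0r // hX ?mulr0.
- by case: (s) hX => hX; rewrite ?phi0 ?mul0r // hX ?mulr0.
by case: (s) hX => hX; rewrite ?phi0 ?mul0r // hX ?mulr0.
Qed.

(** [e = -1] and [e = 1] give the stability of the skew and of the symmetric condition in
    [comp_zero], with [c] the respective constant. *)
Lemma trace_part_rho (M : 'M[F]_m) B (c e : F) :
  (forall i j l, B i j l + e * B j i l =
     c * ((j == l)%:R * tr23 B i + e * ((i == l)%:R * tr23 B j))) ->
  forall i j l, rho_mixed M B i j l + e * rho_mixed M B j i l =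
    c * ((j == l)%:R * tr23 (rho_mixed M B) i + e * ((i == l)%:R * tr23 (rho_mixed M B) j)).
Proof.
move=> h i j l; rewrite !rhoE !tr23_rho.
transitivity (\sum_p M i p * (B p j l + e * B j p l) + \sum_p M j p * (B i p l + e * B p i l)
    + \sum_p (- M^T) l p * (B i j p + e * B j i p)).
  have dist (a x y : 'I_m -> F) : \sum_p a p * (x p + e * y p) =
      \sum_p a p * x p + e * \sum_p a p * y p.
    by rewrite mulr_sumr -big_split; apply: eq_bigr => q _ /=; ring.
  by rewrite !dist; ring.
under eq_bigr do rewrite h; under [X in _ + X + _]eq_bigr do rewrite h.
under [X in _ + X]eq_bigr do rewrite h.
have dist (a x y : 'I_m -> F) b d : \sum_p a p * (c * (b * x p + e * (y p * d))) =
    c * (b * \sum_p a p * x p + e * (d * \sum_p y p * a p)).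
  by rewrite !mulr_sumr -big_split mulr_sumr; apply: eq_bigr => q _ /=; ring.
have dist' (a x y : 'I_m -> F) b d : \sum_p a p * (c * (x p * d + e * (b * y p))) =
    c * (d * \sum_p x p * a p + e * (b * \sum_p a p * y p)).
  by rewrite !mulr_sumr -big_split mulr_sumr; apply: eq_bigr => q _ /=; ring.
rewrite dist dist' !sum_delta.
have -> : \sum_p (- M^T) l p * (c * ((j == p)%:R * tr23 B i + e * ((i == p)%:R * tr23 B j))) =
    - c * (M j l * tr23 B i + e * (M i l * tr23 B j)).
  transitivity (c * (tr23 B i * (\sum_p (j == p)%:R * (- M^T) l p)
      + e * (tr23 B j * \sum_p (i == p)%:R * (- M^T) l p))).
    by rewrite !mulr_sumr -big_split mulr_sumr; apply: eq_bigr => q _ /=; ring.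
  by rewrite !sum_delta_sym !mxE; ring.
by ring.
Qed.

Lemma comp_zero_rho k (M : 'M[F]_m) B : comp_zero k B -> comp_zero k (rho_mixed M B).
Proof.
case: k => [|[|[|k]]] //= h; first by move=> i; exact: tr23_rho_mixed.
  move=> i j l; have := @trace_part_rho M B (2 * (m%:R - 1))^-1 (-1) _ i j l.
  by rewrite !mulN1r; apply=> i' j' l'; rewrite !mulN1r.
move=> i j l; have := @trace_part_rho M B (3 / (2 * (m%:R + 1))) 1 _ i j l.
by rewrite !mul1r; apply=> i' j' l'; rewrite !mul1r.
Qed.

Lemma stable_CYcomp (s : bool) j : stable g p_ (Aj_ s.+1 j).
Proof.
move=> phi X hphi /CYcomp_mixed[h1 [h2 h3]]; apply/CYcomp_mixed.
split; last split.
- apply: (cotton_york_tact g_metric E_dual) => //.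
  by have [] := (mem_p_alg g_metric E_dual phi).1 hphi.
- exact: (high_tact g_metric E_dual).
by move=> k kj; rewrite mixed_act_p //; apply/comp_zero_rho/h3.
Qed.

Lemma stable_p_g0 U : stable g p_ U -> stable g g0 U.
Proof. by move=> h phi X hphi; apply: h; exact: (g0_p g_metric E_dual). Qed.

(** Irreducibility over $g_0$ implies irreducibility over the larger $\mathfrak p$, once the spaces
    are known to be stable under $\mathfrak p$. *)
Lemma comp_is_intro (N : vectType F) (rho : 'M[F]_m -> N -> N) s (K : {vspace N}) p j
    (U : {vspace 'rV[F]_n}) (W : {vspace 'M[F]_n}) h :
  irreducible_model rho K -> stable g p_ (Aj_ p j) -> (p < 4)%N ->
  realizes g gam xi Vm E rho s (Aj_ p j) (A_ p.+1) K h ->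
  (exists T, cartan_product g gam xi Vm U W T /\
    exists k, realizes g gam xi Vm E rho s T 0%VS K k) ->
  comp_is g gam gam' xi Vm p j U W /\ dim_comp g gam gam' xi p j = \dim K.
Proof.
move=> irrK stA p4 hA [T [cT [k hT]]].
split; last exact: (realizes_dim hA).
have [_ _ WU UW irr] := realizes_irreducible g_metric E_dual irrK hA.
split; last by exists T; split=> //; exact: (realizes_iso hA hT).
by split=> // [|X stX]; [exact: stable_filtr | apply: irr; exact: stable_p_g0].
Qed.

Lemma CYcomp_extremal (s : bool) (p : nat := if s then 3%N else 0%N) :
  exists h : 'Hom(tensor, model), (forall X, h X = extremal E s X) /\
    realizes g gam xi Vm E (@rho_cov F m) s (Aj_ p 0) (A_ p.+1) (lspan (@hook F m)) h.
Proof.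
have [h hf] := exists_hom (@extremal_lin F n m E s); exists h; split=> //.
have -> : Aj_ p 0%N = A_ p by rewrite /p; case: (s).
have p4 : (p < 4)%N by rewrite /p; case: (s).
split.
- exact/stable_p_g0/stable_filtr/ltnW.
- exact/stable_p_g0/stable_filtr.
- exact: filtrS.
- apply/eqP; rewrite eqEsubv; apply/andP; split; apply/subvP => B.
    by case/memv_imgP => X /(filtr_high _ (ltnW p4))[hX _] ->; rewrite hf; apply/mem_hook/cf_hook.
  move=> /mem_hook/(lift_extremal s)[X [h1 h2 <-]]; rewrite -hf memv_img //.
  apply/(filtr_high _ (ltnW p4)); split=> //; apply: on_level_high.
  by move: h2; rewrite /p; case: (s).
split=> [X /(filtr_high _ (ltnW p4))[h1 h2]|phi X hphi _]; last first.
  by rewrite !hf (extremal_act g_metric E_dual).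
rewrite (filtr_high _ p4) hf; split=> [e|[_ h3]].
  split=> // s1 s2 s3 i j k; rewrite ltnS leq_eqVlt => /orP[/eqP e'|]; last exact: h2.
  have [-> -> ->] : [/\ s1 = s, s2 = s & s3 = s].
    by move: e'; rewrite /p; case: (s); case: s1; case: s2; case: s3.
  by rewrite -extremalE e tensor0.
by apply: tensorP => i j k; rewrite extremalE tensor0 h3 // /p; case: (s).
Qed.

Lemma filtr_mixed (s : bool) X : X \in A_ s.+2 <->
  cotton_york E X /\ (high E s.+1 X /\ mixed s X = 0).
Proof.
have s4 : (s.+2 <= 4)%N by case: (s).
rewrite filtr_high //; split=> [[h1 h2]|[h1 h2]]; split=> //.
  exact/(high_step s h1).
exact/(high_step s h1).
Qed.

Lemma CYcomp_realizes (N : vectType F) (rho : 'M[F]_m -> N -> N) (s : bool) j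
    (K : {vspace N}) (f : tensor -> N) :
  (forall a X Y, f (a *: X + Y) = a *: f X + f Y) ->
  (forall phi X, phi \in g0 -> f (act phi X) = rho (gl_sign s phi) (f X)) ->
  (forall X, X \in Aj_ s.+1 j -> f X = 0 <-> mixed s X = 0) ->
  (forall X, X \in Aj_ s.+1 j -> f X \in K) ->
  (forall x, x \in K -> exists2 X, X \in Aj_ s.+1 j & f X = x) ->
  exists h : 'Hom(tensor, N), (forall X, h X = f X) /\
    realizes g gam xi Vm E rho s (Aj_ s.+1 j) (A_ s.+2) K h.
Proof.
move=> lin_f eqf f0 fK surf; have [h hf] := exists_hom lin_f; exists h; split=> //.
have s4 : (s.+2 <= 4)%N by case: (s).
split.
- exact/stable_p_g0/stable_CYcomp.
- exact/stable_p_g0/stable_filtr.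
- apply/subvP => X /filtr_mixed[h1 [h2 h3]]; apply/CYcomp_mixed; split=> //; split=> // k _.
  by rewrite h3; exact: comp_zero0.
- apply/eqP; rewrite eqEsubv; apply/andP; split; apply/subvP => x.
    by case/memv_imgP => X XA ->; rewrite hf; exact: fK.
  by move=> /surf[X XA <-]; rewrite -hf memv_img.
split=> [X XA|phi X hphi _]; last by rewrite !hf eqf.
rewrite hf f0 // filtr_mixed; have /CYcomp_mixed[h1 [h2 _]] := XA.
by split=> [|[_ []]].
Qed.

Lemma comp_zero_skew B : comp_zero 0 B -> comp_zero 2 B -> skew_traceless B.
Proof.
move=> h0 h2; split=> [i j k|]; last exact: h0.
by apply/eqP; rewrite -addr_eq0 h2 !h0 !mulr0 addr0 mulr0.
Qed.

Lemma comp_zero_sym B : comp_zero 0 B -> comp_zero 1 B -> sym_traceless B.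
Proof.
move=> h0 h2; split=> [i j k|]; last exact: h0.
by apply/eqP; rewrite -subr_eq0 h2 !h0 !mulr0 subr0 mulr0.
Qed.

Lemma skew_comp_zero B k : skew_traceless B -> k <> 1%N -> comp_zero k B.
Proof.
move=> [h1 h2]; have t i : tr23 B i = 0 by exact: h2.
case: k => [|[|[|k]]] //= _ i j l; rewrite !t !mulr0 addr0 mulr0.
by rewrite h1 addNr.
Qed.

Lemma sym_comp_zero B k : sym_traceless B -> k <> 2%N -> comp_zero k B.
Proof.
move=> [h1 h2]; have t i : tr23 B i = 0 by exact: h2.
case: k => [|[|[|k]]] //= _ i j l; rewrite !t !mulr0 subr0 mulr0.
by rewrite h1 subrr.
Qed.

Lemma CYcomp_skew (s : bool) : exists h : 'Hom(tensor, model), (forall X, h X = mixed s X) /\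
  realizes g gam xi Vm E (@rho_mixed F m) s (Aj_ s.+1 1) (A_ s.+2)
    (lspan (@skew_traceless F m)) h.
Proof.
apply: CYcomp_realizes.
- exact: mixed_lin.
- by move=> phi X hphi; exact: (mixed_act g_metric E_dual).
- by [].
- move=> X /CYcomp_mixed[h1 [h2 h3]]; apply/mem_skew_traceless.
  by apply: comp_zero_skew; exact: h3.
move=> B /mem_skew_traceless hB; have [|X [h1 h2 h3]] := lift_mixed s (B := B).
  by move=> i; rewrite !(skew_traceless_tr _ hB) mul0r.
exists X => //; apply/CYcomp_mixed; split=> //; split; first exact: on_level_high.
by move=> k k1; rewrite h3; exact: skew_comp_zero.
Qed.

Lemma CYcomp_sym (s : bool) : exists h : 'Hom(tensor, model), (forall X, h X = mixed s X) /\
  realizes g gam xi Vm E (@rho_mixed F m) s (Aj_ s.+1 2) (A_ s.+2)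
    (lspan (@sym_traceless F m)) h.
Proof.
apply: CYcomp_realizes.
- exact: mixed_lin.
- by move=> phi X hphi; exact: (mixed_act g_metric E_dual).
- by [].
- move=> X /CYcomp_mixed[h1 [h2 h3]]; apply/mem_sym_traceless.
  by apply: comp_zero_sym; exact: h3.
move=> B /mem_sym_traceless hB; have [|X [h1 h2 h3]] := lift_mixed s (B := B).
  by move=> i; rewrite !(sym_traceless_tr _ hB) mul0r.
exists X => //; apply/CYcomp_mixed; split=> //; split; first exact: on_level_high.
by move=> k k1; rewrite h3; exact: sym_comp_zero.
Qed.

(** Combinations of deltas with one trace half the other: with weights [m - 2] and [2m - 1] the
    traces are $m^2-1$ and $2(m^2-1)$ times [t]. *)
Definition pure_trace (t : 'I_m -> F) : model := [ffun i => \matrix_(j, k)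
  ((m%:R - 2) * ((i == k)%:R * t j) + (2 * m%:R - 1) * ((j == k)%:R * t i))].

Lemma pure_traceE t i j k : pure_trace t i j k =
  (m%:R - 2) * ((i == k)%:R * t j) + (2 * m%:R - 1) * ((j == k)%:R * t i).
Proof. by rewrite ffunE mxE. Qed.

Lemma tr23_pure t i : tr23 (pure_trace t) i = 2 * (m%:R - 1) * (m%:R + 1) * t i.
Proof.
rewrite /tr23; under eq_bigr do rewrite pure_traceE eqxx mul1r.
by rewrite big_split /= -mulr_sumr sum_delta_sym sum_const; ring.
Qed.

Lemma tr13_pure t i : tr13 (pure_trace t) i = tr23 (pure_trace t) i / 2.
Proof.
rewrite tr23_pure /tr13; under eq_bigr do rewrite pure_traceE eqxx mul1r.
by rewrite big_split /= -!mulr_sumr sum_delta_sym sum_const; field.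
Qed.

Lemma pure_comp_zero t k : k <> 0%N -> comp_zero k (pure_trace t).
Proof.
have h1 := m_sub1_neq0 F m_gt2; have h2 := m_add1_neq0 F m.
case: k => [|[|[|k]]] //= _ i j l; rewrite !tr23_pure !pure_traceE; field.
  by rewrite h1 // pnatr_eq0.
by rewrite h2 // pnatr_eq0.
Qed.

Lemma comp_zero_pure B : comp_zero 1 B -> comp_zero 2 B ->
  B = pure_trace (fun i => (2 * (m%:R - 1) * (m%:R + 1))^-1 * tr23 B i).
Proof.
have n1 := m_sub1_neq0 F m_gt2; have n2 := m_add1_neq0 F m.
move=> h1 h2; apply: tensorP => i j l; rewrite pure_traceE.
transitivity (2^-1 * ((B i j l - B j i l) + (B i j l + B j i l))); first by field.
by rewrite h1 h2; field; rewrite n1 n2.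
Qed.

Lemma CYcomp_vector (s : bool) : exists h : 'Hom(tensor, 'rV[F]_m), (forall X, h X = trace_row E s X) /\
  realizes g gam xi Vm E (fun M (v : 'rV[F]_m) => v *m M^T) s (Aj_ s.+1 0) (A_ s.+2) fullv h.
Proof.
apply: CYcomp_realizes.
- exact: trace_row_lin.
- by move=> phi X hphi; exact: (trace_row_act g_metric E_dual).
- move=> X /CYcomp_mixed[h1 [h2 h3]]; split=> [e|e].
    apply: comp_zero_all => -[|k]; last exact: h3.
    by move=> i; move/rowP/(_ i): e; rewrite !mxE.
  by apply/rowP => i; rewrite !mxE e /tr23 big1 // => j _; rewrite tensor0.
- by move=> X _; exact: memvf.
move=> v _; have [X [h1 h2 h3]] := lift_mixed s
  (tr13_pure (fun i => (2 * (m%:R - 1) * (m%:R + 1))^-1 * v 0 i)).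
exists X.
  apply/CYcomp_mixed; split=> //; split; first exact: on_level_high.
  by move=> k k0; rewrite h3; exact: pure_comp_zero.
apply/rowP => i; rewrite mxE h3 tr23_pure.
by have n1 := m_sub1_neq0 F m_gt2; have n2 := m_add1_neq0 F m; field; rewrite n1 n2.
Qed.

Lemma components_hold (s : bool) (p32 : nat := if s then 3%N else 0%N)
    (p12 : nat := if s then 2%N else 1%N) (is_ := comp_is g gam gam' xi Vm)
    (dim_ := dim_comp g gam gam' xi) (g1_ := g_pm1 g gam xi Vm) :
  [/\ is_ p32 0%N (V_ s) (g1_ s) /\ (3 * dim_ p32 0 = m * (m ^ 2 - 1))%N,
      is_ p12 0%N (V_ s) (z_0 g gam xi Vm) /\ dim_ p12 0%N = m,
      is_ p12 1%N (V_ (~~ s)) (g1_ s) /\ (2 * dim_ p12 1 = m * (m - 2) * (m + 1))%N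
    & is_ p12 2%N (V_ s) (sl_0 g gam xi Vm) /\
        (2 * dim_ p12 2 = m * (m + 2) * (m - 1))%N].
Proof.
have -> : p12 = s.+1 by rewrite /p12; case: (s).
have s4 : (s.+1 < 4)%N by case: (s).
have stA j : stable g p_ (Aj_ s.+1 j) := @stable_CYcomp s j.
split.
- have [h [_ hA]] := CYcomp_extremal s.
  have p4 : (p32 < 4)%N by rewrite /p32; case: (s).
  have st : stable g p_ (Aj_ p32 0%N).
    have -> : Aj_ p32 0%N = A_ p32 by rewrite /p32; case: (s).
    exact/stable_filtr/ltnW.
  have [h1 h2] := comp_is_intro (irreducible_hook F m_gt2) st p4 hA
    (cartan_hook g_metric E_dual m_gt2 s).
  by split=> //; rewrite /dim_ h2 dim_hook.
- have [h [_ hA]] := CYcomp_vector s.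
  have [h1 h2] := comp_is_intro (irreducible_vector F m_gt2) (stA 0%N) s4 hA
    (cartan_vector g_metric E_dual m_gt2 s).
  by split=> //; rewrite /dim_ h2 dimvf /dim /= mul1n.
- have [h [_ hA]] := CYcomp_skew s.
  have [h1 h2] := comp_is_intro (irreducible_skew_traceless F m_gt2) (stA 1%N) s4 hA
    (cartan_skew_traceless g_metric E_dual m_gt2 s).
  by split=> //; rewrite /dim_ h2 dim_skew_traceless.
have [h [_ hA]] := CYcomp_sym s.
have [h1 h2] := comp_is_intro (irreducible_sym_traceless F m_gt2) (stA 2%N) s4 hA
  (cartan_sym_traceless g_metric E_dual m_gt2 s).
by split=> //; rewrite /dim_ h2 dim_sym_traceless.
Qed.

Lemma CYcomp_zero_mem (s : bool) j X :
  X \in lspan (fun X => X \in CY g /\ (high E s.+1 X /\ comp_zero j (mixed s X))) <->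
  cotton_york E X /\ (high E s.+1 X /\ comp_zero j (mixed s X)).
Proof.
rewrite (@lspan_CY _ _ g _ (fun X => high E s.+1 X /\ comp_zero j (mixed s X))) //.
- by split=> -[/(mem_CY g_metric E_dual) h1 h2].
- by split=> [s1 s2 s3 i j' k _|]; [exact: cf0 | rewrite mixed0; exact: comp_zero0].
move=> a Y Z [h1 h2] [h3 h4]; split; first exact: high_lin.
by rewrite mixed_lin; exact: comp_zero_lin.
Qed.

(** The sum is the splitting of B into pure trace, skew traceless and symmetric traceless parts,
    lifted back to tensors; the intersection has all three parts zero. *)
Lemma direct_sum_components (s : bool) :
  direct_sum_quot (A_ s.+1) (A_ s.+2) (fun j : 'I_3 => Aj_ s.+1 j).
Proof.
have s4 : (s.+1 <= 4)%N by case: (s).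
have AW j : (A_ s.+2 <= Aj_ s.+1 j)%VS.
  apply/subvP => X /filtr_mixed[h1 [h2 h3]]; apply/CYcomp_mixed; split=> //; split=> // k _.
  by rewrite h3; exact: comp_zero0.
split.
  apply/eqP; rewrite eqEsubv; apply/andP; split.
    by apply/subv_sumP => j _; apply/subvP => X /CYcomp_mixed[h1 [h2 _]]; apply/filtr_high.
  apply/subvP => X /(filtr_high _ s4)[hX highX].
  have n1 := m_sub1_neq0 F m_gt2; have n2 := m_add1_neq0 F m.
  set B := mixed s X; have t13 i : tr13 B i = tr23 B i / 2 by exact: tr13_mixed.
  have skB := skew_proj_traceless m_gt2 B; have syB := sym_proj_traceless B.
  (* Traceless parts satisfy the trace condition trivially, so they lift; [X] minus both lifts has
     pure trace leading block and represents component 0. *)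
  have [|X1 [a1 b1 c1]] := lift_mixed s (B := skew_proj B).
    by move=> i; rewrite !(skew_traceless_tr _ skB) mul0r.
  have [|X2 [a2 b2 c2]] := lift_mixed s (B := sym_proj B).
    by move=> i; rewrite !(sym_traceless_tr _ syB) mul0r.
  rewrite big_ord_recl big_ord_recl big_ord_recl big_ord0 addv0 /=.
  rewrite -[X](subrK (X1 + X2)); apply: memv_add; last apply: memv_add.
  - have e : X - (X1 + X2) = (-1) *: (1 *: X1 + X2) + X by rewrite scale1r scaleN1r addrC.
    apply/CYcomp_mixed; split; last split=> [|k k0].
    + apply/(mem_CY g_metric E_dual); rewrite memvB ?memvD //;
        exact/(mem_CY g_metric E_dual).
    + by rewrite e; do 2!(apply: high_lin => //); exact: on_level_high.
    have -> : mixed s (X - (X1 + X2)) = B - (skew_proj B + sym_proj B).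
      by rewrite e !mixed_lin c1 c2 -/B scale1r scaleN1r addrC.
    have tr0 i : tr23 (B - (skew_proj B + sym_proj B)) i = tr23 B i.
      have -> : B - (skew_proj B + sym_proj B) = (-1) *: (1 *: skew_proj B + sym_proj B) + B.
        by rewrite scale1r scaleN1r addrC.
      by rewrite !tr23_lin !(skew_traceless_tr _ skB) !(sym_traceless_tr _ syB); ring.
    case: k k0 => [|[|[|k]]] //= _ i j l; rewrite !tr0 !tensorE !skew_projE !sym_projE !t13;
      field; rewrite n1 n2 //.
  - apply/CYcomp_mixed; split=> //; split; first exact: on_level_high.
    by move=> k k1; rewrite c1; exact: skew_comp_zero.
  apply/CYcomp_mixed; split=> //; split; first exact: on_level_high.
  by move=> k k1; rewrite c2; exact: sym_comp_zero.
move=> j; apply/eqP; rewrite eqEsubv; apply/andP; split; last first.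
  rewrite subv_cap AW /=; have [k kj] : exists k : 'I_3, k != j.
    by have [->|?] := eqVneq j ord0; [exists ord_max | exists ord0; rewrite eq_sym].
  by rewrite (bigD1 k) //=; apply: subv_trans (addvSl _ _).
apply/subvP => X; rewrite memv_cap => /andP[/CYcomp_mixed[h1 [h2 h3]] XS].
(* All other components lie in the subspace where part [j] vanishes, hence so does their sum. *)
suff h : comp_zero j (mixed s X).
  apply/filtr_mixed; split=> //; split=> //; apply: comp_zero_all => k.
  by have [->|/eqP kj] := eqVneq k j; [|exact: h3].
suff /subvP/(_ _ XS)/CYcomp_zero_mem[_ [] //] : (\sum_(k < 3 | k != j) Aj_ s.+1 k <=
    lspan (fun X => X \in CY g /\ (high E s.+1 X /\ comp_zero j (mixed s X))))%VS.
apply/subv_sumP => k kj; apply/subvP => Y /CYcomp_mixed[y1 [y2 y3]].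
apply/CYcomp_zero_mem; split=> //; split=> //; apply: y3.
by move=> e; move: kj; rewrite -val_eqE /= e eqxx.
Qed.

End Components.

(** * Copies of components in a weight space and the action of $g_1$ *)

Section Generation.
Variables (F : numFieldType) (n sp sm m : nat).
Variable g : 'M[F]_n.
Variables (gam : 'I_n -> 'M[F]_(sp, sm)) (gam' : 'I_n -> 'M[F]_(sm, sp)).
Variables (xi : 'rV[F]_sp) (Vm : {vspace 'rV[F]_n}).
Hypothesis g_metric : nondegenerate_symmetric g.
Hypothesis gam_clifford : clifford_relations g gam gam'.
Hypothesis xi_neq0 : xi != 0.
Variable E : bool -> 'I_m -> 'rV[F]_n.
Hypothesis E_dual : dual_basis g gam xi Vm E.
Hypothesis m_gt2 : (2 < m)%N.
Hypothesis n_def : n = m.*2.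
Local Notation tensor := {ffun 'I_n -> 'M[F]_n}.
Local Notation model := {ffun 'I_m -> 'M[F]_m}.
Local Notation cf := (coord3 E).
Local Notation mixed := (mixed E).
Local Notation gl_sign := (gl_part E).
Local Notation A_ := (filtr g gam gam' xi).
Local Notation Aj_ := (CYcomp g gam gam' xi).
Local Notation g0 := (g_0 g gam xi Vm).
Local Notation g1 := (g_pm1 g gam xi Vm true).
Local Notation level := (CY_level g gam xi Vm).
Local Notation act := (tact g).
Implicit Types (phi psi : 'M[F]_n) (X Y Z : tensor) (S T U : {vspace tensor}) (B : model).

Lemma tact_slots phi X (phi' := phi *m ginv g) : act phi X = [ffun a =>
  \sum_d phi' a d *: X d + phi' *m X a + X a *m phi'^T].
Proof.
rewrite /tact -/phi'; move: phi' => P.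
apply/ffunP => a; apply/matrixP => b c; rewrite !ffunE !mxE summxE.
rewrite !big_split /=; congr (_ + _ + _).
  by apply: eq_bigr => d _; rewrite mxE.
by apply: eq_bigr => d _; rewrite mxE mulrC.
Qed.

(** [tact] is a representation; applied with one factor in $g_0$ and the other in $g_1$ it shows
    that [g1_span] is a $g_0$-module. *)
Lemma tact_lie phi psi X :
  act phi (act psi X) = act (lie g phi psi) X + act psi (act phi X).
Proof.
have e : lie g phi psi *m ginv g =
    phi *m ginv g *m (psi *m ginv g) - psi *m ginv g *m (phi *m ginv g).
  by rewrite /lie mulmxBl !mulmxA.
rewrite !tact_slots e; move: (phi *m ginv g) (psi *m ginv g) => P Q.
apply/ffunP => a; rewrite !ffunE.
have slot (P1 Q1 : 'M[F]_n) : \sum_d P1 a d *: (\sum_d' Q1 d d' *: X d' + Q1 *m X d + X d *m Q1^T) =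
    \sum_d (P1 *m Q1) a d *: X d + Q1 *m (\sum_d P1 a d *: X d) + (\sum_d P1 a d *: X d) *m Q1^T.
  under eq_bigr do rewrite !scalerDr.
  rewrite !big_split /= mulmx_sumr mulmx_suml; congr (_ + _ + _).
  - under [RHS]eq_bigr do rewrite mxE scaler_suml.
    rewrite [RHS]exchange_big; apply: eq_bigr => d _; rewrite scaler_sumr.
    by apply: eq_bigr => d' _; rewrite scalerA.
  - by apply: eq_bigr => d _; rewrite scalemxAr.
  by apply: eq_bigr => d _; rewrite scalemxAl.
under eq_bigr do rewrite ffunE; under [X in _ = _ + (X + _ + _)]eq_bigr do rewrite ffunE.
rewrite !slot.
have -> : \sum_d (P *m Q - Q *m P) a d *: X d =
    \sum_d (P *m Q) a d *: X d - \sum_d (Q *m P) a d *: X d.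
  by rewrite -sumrB; apply: eq_bigr => d _; rewrite !mxE scalerBl.
rewrite linearB /= !trmx_mul !mulmxDr !mulmxDl !mulmxN !mulNmx !mulmxA.

have shuffle (s1 q1 q2 p1 pqx pxq p2 qxp xqp s2 qpx xpq : 'M[F]_n) :
    s1 + q1 + q2 + (p1 + pqx + pxq) + (p2 + qxp + xqp) =
    s1 - s2 + (pqx - qpx) + (xqp - xpq) + (s2 + p1 + p2 + (q1 + qpx + qxp) + (q2 + pxq + xpq)).
  by apply/matrixP => b c; rewrite !mxE; ring.
exact: shuffle.
Qed.

Lemma lie_g1 phi psi : phi \in g0 -> psi \in g1 -> lie g phi psi \in g1.
Proof.
move=> hphi /(mem_g1 g_metric E_dual)[as_psi psi0]; have as_phi := g0_so g_metric E_dual hphi.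
apply/(mem_g1 g_metric E_dual); split.
  have [e1 e2] := ((mem_so_tr phi).1 as_phi, (mem_so_tr psi).1 as_psi).
  apply/mem_so_tr; rewrite /lie /ginv linearB /= !trmx_mul !trmx_inv g_metric.1 e1 e2.
  by rewrite !mulNmx !mulmxN !opprK opprB !mulmxA.
move=> s t i j st; rewrite (cP_lie g_metric E_dual).
rewrite !big1 ?subrr // => u _; rewrite big1 // => l _.
  have [ut|ut] := eqVneq u t; last first.
    by rewrite (psi0 s (~~ u)) ?mul0r // (negb_of_neq ut).
  by rewrite (cP_g0 g_metric E_dual u) // ut eqxx mulr0.
have [us|us] := eqVneq u s; first by rewrite (psi0 u t) ?mulr0 // us.
by rewrite (cP_g0 g_metric E_dual s) // (negb_of_neq us) eqxx mul0r.
Qed.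

Lemma tact_raises p phi Z : phi \in g1 -> on_level E p Z -> on_level E p.+1 (act phi Z).
Proof.
move=> /(mem_g1 g_metric E_dual)[_ phi0] hZ s t r i j k l; rewrite (cf_tact g_metric E_dual).
have key s' u i' q (x : F) : (s' && ~~ u -> x = 0) -> coord2 E phi s' (~~ u) i' q * x = 0.
  have [_ -> //|h _] := boolP (s' && ~~ u); first by rewrite mulr0.
  by rewrite phi0 ?mul0r // !eqb_id.
by rewrite !big1 ?addr0 // => u _; rewrite big1 // => q _; apply: key => /andP[e1 e2];
  rewrite hZ //; move: l; rewrite e1 (negPf e2) ?add0n ?addn0 ?addn1 ?add1n ?addnS ?addSn eqSS.
Qed.

Local Notation mem_lev := (mem_CY_level g_metric E_dual).
Local Notation mem_filtr_high := (filtr_high g_metric gam_clifford xi_neq0 E_dual m_gt2 n_def).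
Local Notation mem_comp := (CYcomp_mixed g_metric gam_clifford xi_neq0 E_dual m_gt2 n_def).

Lemma level_high0 p X : on_level E p X -> high E p.+1 X -> X = 0.
Proof.
move=> h1 h2; apply: (cf_inj g_metric E_dual) => s t r i j k; rewrite cf0.
by have [e|] := eqVneq (s + t + r)%N p; [rewrite h2 // e | exact: h1].
Qed.

(** The Cotton-York conditions relate only coordinates of equal weight, so truncating to weight [p]
    preserves them. *)
Lemma level_part p X : cotton_york E X -> high E p X ->
  exists Y, [/\ cotton_york E Y, on_level E p Y & high E p.+1 (X - Y)].
Proof.
move=> [h1 h2 h3] hX; have [Y hY] := exists_tensor E_dual (fun s t r i j k =>
  if (s + t + r == p)%N then cf X s t r i j k else 0).
exists Y; split.
- split=> [s t r i j k|s t r i j k|r k].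
  + rewrite !hY addnAC; case: ifP => _; [exact: h1 | by rewrite oppr0].
  + rewrite !hY (_ : (t + r + s = s + t + r)%N) 1?(_ : (r + s + t = s + t + r)%N); try lia.
    by case: ifP => _; [exact: h2 | rewrite !addr0].
  under eq_bigr do under eq_bigr do rewrite hY.
  have [e|/negPf e] := boolP (1 + r == p)%N.
    rewrite -[RHS](h3 r k); apply: eq_bigr => s _; apply: eq_bigr => i _.
    by rewrite (_ : s + ~~ s = 1)%N ?e //; case: s.
  rewrite big1 // => s _; rewrite big1 // => i _.
  by rewrite (_ : s + ~~ s = 1)%N ?e //; case: s.
- by move=> s t r i j k /negPf e; rewrite hY e.
move=> s t r i j k; rewrite ltnS cfB hY => l.
by case: eqP => [_|/eqP e]; [rewrite subrr | rewrite hX ?subr0 // ltn_neqAle e l].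
Qed.

Lemma stable_level p : stable g g0 (level p).
Proof.
move=> phi X hphi /mem_lev[h1 h2]; apply/mem_lev; split.
  by apply: (cotton_york_tact g_metric E_dual) => //; exact: (g0_so g_metric E_dual).
move=> s t r i j k l; rewrite (cf_act0 g_metric E_dual) // !big1 ?addr0 // => q _;
  by rewrite h2 ?mulr0.
Qed.

Lemma CYcomp_sub p j : (p < 4)%N -> (Aj_ p j <= A_ p)%VS.
Proof.
have mid (s : bool) : (Aj_ s.+1 j <= A_ s.+1)%VS.
  apply/subvP => X /mem_comp[h1 [h2 _]]; apply/mem_filtr_high => //.
  by case: (s).
by case: p => [|[|[|p]]] // _; [exact: (mid false) | exact: (mid true)].
Qed.

(** The representative of the component inside a single weight space; by [copy_unique] it is the
    only one, so the quantifier over all copies in [g1_generates] becomes harmless. *)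
Definition copy p j : {vspace tensor} := (Aj_ p j :&: level p)%VS.

Lemma copy_realizes (N : vectType F) (rho : 'M[F]_m -> N -> N) s (K : {vspace N}) p j h :
  (p < 4)%N -> realizes g gam xi Vm E rho s (Aj_ p j) (A_ p.+1) K h ->
  realizes g gam xi Vm E rho s (copy p j) 0%VS K h.
Proof.
move=> p4 [stA stW WA hA [hW eqh]]; split.
- move=> phi X hphi; rewrite memv_cap => /andP[X1 X2].
  by rewrite memv_cap; apply/andP; split; [exact: stA | exact: stable_level].
- exact: (stable0 g_metric E_dual).
- exact: sub0v.
- apply/eqP; rewrite eqEsubv; apply/andP; split; apply/subvP => x.
    case/memv_imgP => X; rewrite memv_cap => /andP[XA _] ->.
    by rewrite -hA memv_img.
  rewrite -hA => /memv_imgP[X XA ->].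
  have /(mem_filtr_high _ (ltnW p4))[X1 X2] := subvP (CYcomp_sub j p4) _ XA.
  have [Y [Y1 Y2 Y3]] := level_part X1 X2.
  have YX : X - Y \in A_ p.+1.
    apply/mem_filtr_high => //; split=> //; apply/(mem_CY g_metric E_dual).
    by apply: memvB; exact/(mem_CY g_metric E_dual).
  have YX' := subvP WA _ YX.
  have YA : Y \in Aj_ p j by rewrite -[Y](subKr X) memvB.
  have : h (X - Y) = 0 by apply/hW.
  rewrite linearB /= => /eqP; rewrite subr_eq0 => /eqP ->; rewrite memv_img //.
  by rewrite memv_cap YA; apply/mem_lev.
split=> [X|phi X hphi]; rewrite memv_cap => /andP[XA /mem_lev[X1 X2]]; last exact: eqh.
rewrite hW // memv0; split=> [/mem_filtr_high[] // _ X3|/eqP ->]; last exact: mem0v.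
by rewrite (level_high0 X2 X3).
Qed.

Definition is_component p j : Prop :=
  (exists s : bool, p = s.+1 /\ (j < 3)%N) \/
  (exists s : bool, p = (if s then 3%N else 0%N) /\ j = 0%N).

Lemma is_component_lt p j : is_component p j -> (p < 4)%N.
Proof. by case=> -[[] [-> _]]. Qed.

Lemma copy_spec p j : is_component p j -> irreducible_quot g g0 (copy p j) 0%VS /\
  isomorphic_quot g g0 (Aj_ p j) (A_ p.+1) (copy p j).
Proof.
move=> pj; have p4 := is_component_lt pj.
have key (N : vectType F) (rho : 'M[F]_m -> N -> N) s (K : {vspace N}) h :
    irreducible_model rho K -> realizes g gam xi Vm E rho s (Aj_ p j) (A_ p.+1) K h ->
    irreducible_quot g g0 (copy p j) 0%VS /\
    isomorphic_quot g g0 (Aj_ p j) (A_ p.+1) (copy p j).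
  move=> irrK hA; have hC := copy_realizes p4 hA; split.
    exact: (realizes_irreducible g_metric E_dual irrK hC).
  exact: (realizes_iso hA hC).
case: pj key p4 => -[s [-> jj]] key p4; last first.
  rewrite jj in key *.
  have [h [_ hA]] := CYcomp_extremal g_metric gam_clifford xi_neq0 E_dual m_gt2 n_def s.
  exact: key (irreducible_hook F m_gt2) hA.
case: j jj key => [|[|[|j]]] // _ key.
- have [h [_ hA]] := CYcomp_vector g_metric gam_clifford xi_neq0 E_dual m_gt2 n_def s.
  exact: key (irreducible_vector F m_gt2) hA.
- have [h [_ hA]] := CYcomp_skew g_metric gam_clifford xi_neq0 E_dual m_gt2 n_def s.
  exact: key (irreducible_skew_traceless F m_gt2) hA.
have [h [_ hA]] := CYcomp_sym g_metric gam_clifford xi_neq0 E_dual m_gt2 n_def s.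
exact: key (irreducible_sym_traceless F m_gt2) hA.
Qed.

Lemma iso_dim U W T : isomorphic_quot g g0 U W T -> \dim T = (\dim U - \dim W)%N.
Proof.
move=> [_ _ _ WU [f [fU fW _]]]; rewrite -(limg_ker_dim f U) fU.
suff -> : (U :&: lker f)%VS = W by rewrite addKn.
apply/eqP; rewrite eqEsubv; apply/andP; split; apply/subvP => X.
  by rewrite memv_cap memv_ker => /andP[XU /eqP fX]; apply/fW.
by move=> XW; have XU := subvP WU _ XW; rewrite memv_cap memv_ker XU; apply/eqP/fW.
Qed.

(** At the extreme weights there is only one component, and its vanishing is that of the tensor. *)
Definition comp_vanish p j X : Prop :=
  match p with
  | 1%N => comp_zero j (mixed false X)
  | 2%N => comp_zero j (mixed true X)
  | _ => X = 0
  end.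

Lemma comp_vanish_mixed (s : bool) j X : comp_vanish s.+1 j X = comp_zero j (mixed s X).
Proof. by case: s. Qed.

Lemma comp_vanish_lin p j a X Y :
  comp_vanish p j X -> comp_vanish p j Y -> comp_vanish p j (a *: X + Y).
Proof.
case: p => [|[|[|p]]] /=; rewrite ?mixed_lin; try exact: comp_zero_lin.
  by move=> -> ->; rewrite scaler0 addr0.
by move=> -> ->; rewrite scaler0 addr0.
Qed.

Lemma level_mixed0 (s : bool) X : X \in level s.+1 -> mixed s X = 0 -> X = 0.
Proof.
move=> /mem_lev[h1 h2] e; apply: (level_high0 h2); apply/(high_step s h1).
by split=> //; exact: on_level_high.
Qed.

Lemma exists_comp_nonzero p X : (p < 4)%N -> X \in level p -> X <> 0 ->
  exists2 j, is_component p j & ~ comp_vanish p j X.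
Proof.
have ext (s : bool) : is_component (if s then 3%N else 0%N) 0 by right; exists s.
have mid (s : bool) : X \in level s.+1 -> X <> 0 ->
    exists2 j, is_component s.+1 j & ~ comp_vanish s.+1 j X.
  move=> hX X0; apply: contrapT => none; apply/X0/(level_mixed0 hX)/comp_zero_all => j.
  case: (ltnP j 3) => j3; last by case: j j3 => [|[|[|j]]].
  rewrite -comp_vanish_mixed; apply: contrapT => h; apply: none; exists j => //.
  by left; exists s.
case: p => [|[|[|[|p]]]] // _ hX X0; try by exists 0%N => //; first [exact: (ext true) | exact: (ext false)].
  exact: (mid false).
exact: (mid true).
Qed.

Lemma skew_form_of (M : {vspace model}) B : stable_mixed M -> B \in M ->
  (forall B', skew_traceless B' -> B' \in M) \/
  forall i j k, B i j k - B j i k = (m%:R - 1)^-1 *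
    ((j == k)%:R * (tr23 B i - tr13 B i) - (i == k)%:R * (tr23 B j - tr13 B j)).
Proof.
move=> stM BM; have [|form] := skew_traceless_irreducible m_gt2 stM; [by left | right].
have [l hl] := form B BM; have n1 := m_sub1_neq0 F m_gt2.
have e i : tr23 B i - tr13 B i = (m%:R - 1) * l i.
  rewrite /tr23 /tr13 -sumrB; under eq_bigr do rewrite hl eqxx mul1r.
  by rewrite sumrB sum_const sum_delta_sym; ring.
by move=> i j k; rewrite hl !e; field.
Qed.

Lemma sym_form_of (M : {vspace model}) B : stable_mixed M -> B \in M ->
  (forall B', sym_traceless B' -> B' \in M) \/
  forall i j k, B i j k + B j i k = (m%:R + 1)^-1 *
    ((j == k)%:R * (tr23 B i + tr13 B i) + (i == k)%:R * (tr23 B j + tr13 B j)).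
Proof.
move=> stM BM; have [|form] := sym_traceless_irreducible m_gt2 stM; [by left | right].
have hl := form B BM; have n1 := m_add1_neq0 F m.
have e i : tr23 B i + tr13 B i = (m%:R + 1) * B i i i.
  rewrite /tr23 /tr13 -big_split /=; under eq_bigr do rewrite hl eqxx mul1r.
  by rewrite big_split /= sum_const sum_delta_sym; ring.
by move=> i j k; rewrite hl !e; field.
Qed.

(** Either the stable subspace contains the whole traceless model, and with it the projection, or
    the corresponding part of [B] is a pure trace and the projection is zero. *)
Lemma stable_projections (M : {vspace model}) B : stable_mixed M -> B \in M ->
  skew_proj B \in M /\ sym_proj B \in M.
Proof.
move=> stM BM; split.
  have [h|h] := skew_form_of stM BM; first exact/h/skew_proj_traceless.
  rewrite (_ : skew_proj B = 0) ?mem0v //; apply: tensorP => i j k.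
  by rewrite skew_projE h subrr mulr0 tensor0.
have [h|h] := sym_form_of stM BM; first exact/h/sym_proj_traceless.
rewrite (_ : sym_proj B = 0) ?mem0v //; apply: tensorP => i j k.
by rewrite sym_projE h subrr mulr0 tensor0.
Qed.

(** For the traceless types this is the dichotomy on stable subspaces. For the trace type, the
    traces of [S] form a nonzero stable space of vectors, hence all of them. *)
Lemma sub_generates_mid (s : bool) j S X : (j < 3)%N -> stable g g0 S ->
  (S <= level s.+1)%VS -> X \in S -> ~ comp_zero j (mixed s X) -> (copy s.+1 j <= S)%VS.
Proof.
move=> j3 stS SL XS nz; have [h hf] := exists_hom (@mixed_lin F n m E s).
have eqh : equivariant_on g gam xi Vm E (@rho_mixed F m) s S h.
  by move=> phi Y hphi _; rewrite !hf (mixed_act g_metric E_dual).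
have stM := stable_image g_metric E_dual stS eqh.
have n1 := m_sub1_neq0 F m_gt2; have n2 := m_add1_neq0 F m.
have trS Y : Y \in S -> forall i, tr13 (mixed s Y) i = tr23 (mixed s Y) i / 2.
  by move=> /(subvP SL)/mem_lev[hY _] i; exact: tr13_mixed.
suff key Y : Y \in copy s.+1 j -> mixed s Y \in (h @: S)%VS.
  apply/subvP => Y YC; have /memv_imgP[Z ZS e] := key Y YC.
  suff -> : Y = Z by [].
  apply/eqP; rewrite -subr_eq0; apply/eqP; apply: (level_mixed0 (s := s)).
    by apply: memvB; [move: YC; rewrite memv_cap => /andP[] | exact: (subvP SL)].
  by rewrite -hf linearB /= [h Y]hf e subrr.
have XM : mixed s X \in (h @: S)%VS by rewrite -hf memv_img.
rewrite memv_cap => /andP[/mem_comp[Y1 [Y2 Y3]] _].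
case: j j3 nz Y3 => [|[|[|j]]] // _ nz Y3.
- have [ht htf] := exists_hom (@trace_row_lin F n m E s).
  have stT M v : v \in (ht @: S)%VS -> v *m M^T \in (ht @: S)%VS.
    move=> /memv_imgP[Z ZS ->]; have [phi hphi <-] := gl_sign_exists g_metric E_dual s M.
    by rewrite htf -(trace_row_act g_metric E_dual) // -htf memv_img // stS.
  have T0 : (ht @: S)%VS <> 0%VS.
    move=> e; apply: nz => i; have : ht X \in (ht @: S)%VS by rewrite memv_img.
    by rewrite e memv0 htf => /eqP/rowP/(_ i); rewrite !mxE.
  have : trace_row E s Y \in (ht @: S)%VS by rewrite (vector_irreducible stT T0) memvf.
  case/memv_imgP => Z ZS; rewrite htf => e.
  (* [Z] has the trace of [Y]; removing its two traceless projections, which stay in the image of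
     [S], leaves the pure trace of [Y]. *)
  have ZM : mixed s Z \in (h @: S)%VS by rewrite -hf memv_img.
  have [p1 p2] := stable_projections stM ZM.
  suff -> : mixed s Y = mixed s Z - skew_proj (mixed s Z) - sym_proj (mixed s Z).
    by rewrite !memvB.
  have tYZ i : tr23 (mixed s Y) i = tr23 (mixed s Z) i by move/rowP/(_ i): e; rewrite !mxE.
  rewrite (comp_zero_pure m_gt2 (Y3 1%N _) (Y3 2%N _)) //.
  apply: tensorP => i k l; rewrite !tensorE skew_projE sym_projE pure_traceE !tYZ !trS //.
  by field; rewrite n1 n2.
- have [hM|form] := skew_form_of stM XM.
    by apply: hM; apply: comp_zero_skew; exact: Y3.
  by case: nz => i k l; rewrite form !trS //; field.
have [hM|form] := sym_form_of stM XM.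
  by apply: hM; apply: comp_zero_sym; exact: Y3.
by case: nz => i k l; rewrite form !trS //; field.
Qed.

Lemma sub_generates p j S X : is_component p j -> stable g g0 S ->
  (S <= level p)%VS -> X \in S -> ~ comp_vanish p j X -> (copy p j <= S)%VS.
Proof.
move=> pj stS SL XS; case: (pj) => -[s [e jj]].
  by rewrite e in SL *; rewrite comp_vanish_mixed; exact: sub_generates_mid.
rewrite jj in pj *; move=> nz.
have [_ _ _ _ irr] := (copy_spec pj).1.
have SC : (S <= copy p 0)%VS.
  apply/subvP => Y YS; rewrite memv_cap; apply/andP; split; last exact: (subvP SL).
  have /mem_lev[Y1 Y2] := subvP SL _ YS.
  have -> : Aj_ p 0%N = A_ p by rewrite e; case: (s).
  by apply/mem_filtr_high; [rewrite e; case: (s) | split=> //; exact: on_level_high].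
have [S0|-> //] := irr S stS (sub0v _) SC.
by case: nz; move: XS; rewrite S0 memv0 e => /eqP ->; case: (s).
Qed.

(** For [m > 2] the dimensions $m$, $m(m-2)(m+1)/2$ and $m(m+2)(m-1)/2$ are strictly increasing, so
    the dimension identifies a component of given weight. *)
Lemma dim_copy_inj p j k : is_component p j -> is_component p k ->
  \dim (copy p j) = \dim (copy p k) -> j = k.
Proof.
move=> pj pk; rewrite (iso_dim (copy_spec pj).2) (iso_dim (copy_spec pk).2).
case: (pj) (pk) => -[s [e jj]] [] [s' [e' kk]]; try by [rewrite jj kk | move: e'; rewrite e; case: (s); case: (s')].
have {e}-> : p = if s then 2%N else 1%N by rewrite e; case: (s).
have [_ [_ d0] [_ d1] [_ d2]] :=
  components_hold g_metric gam_clifford xi_neq0 E_dual m_gt2 n_def s.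
have l1 : (2 * m < m * (m - 2) * (m + 1))%N.
  by move: m_gt2; case: m => [|[|[|q]]] // _; rewrite subn2 /=; nia.
have l2 : (m * (m - 2) * (m + 1) < m * (m + 2) * (m - 1))%N.
  by move: m_gt2; case: m => [|[|[|q]]] // _; rewrite subn2 subn1 /=; nia.
move: d0 d1 d2; rewrite /dim_comp /dim_quot.
pose d i := (\dim (Aj_ (if s then 2%N else 1%N) i) - \dim (A_ (if s then 2%N else 1%N).+1))%N.
rewrite -/(d 0%N) -/(d 1%N) -/(d 2%N) -/(d j) -/(d k).
move: d l1 l2; move: (m * (m - 2) * (m + 1))%N (m * (m + 2) * (m - 1))%N => x y d l1 l2.
case: j jj {pj} => [|[|[|j]]] // _; case: k kk {pk} => [|[|[|k]]] // _;
  move: (d 0%N) (d 1%N) (d 2%N) => *; lia.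
Qed.

(** A nonzero element of [S] has some nonzero part [k], so [S] contains the copy of component [k]
    and equals it by irreducibility; comparing dimensions gives [k = j]. *)
Lemma copy_unique p j S : is_component p j -> (S <= level p)%VS ->
  irreducible_quot g g0 S 0%VS -> isomorphic_quot g g0 (Aj_ p j) (A_ p.+1) S -> S = copy p j.
Proof.
move=> pj SL [stS _ _ S0 irrS] isoS.
have [X XS X0] : exists2 X, X \in S & X <> 0.
  apply: contrapT => none; apply: S0; apply/eqP; rewrite -subv0; apply/subvP => X XS.
  by rewrite memv0; apply/eqP; apply: contrapT => X0; apply: none; exists X.
have [k pk nz] := exists_comp_nonzero (is_component_lt pj) (subvP SL _ XS) X0.
have CS := sub_generates pk stS SL XS nz.
have [stC _ _ C0 _] := (copy_spec pk).1.
have [/esym //|e] := irrS _ stC (sub0v _) CS.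
suff -> : j = k by [].
by apply: (dim_copy_inj pj pk); rewrite e (iso_dim isoS) (iso_dim (copy_spec pj).2).
Qed.

Lemma mem_g1_span (U S : {vspace tensor}) :
  (forall phi Z, phi \in g1 -> Z \in U -> act phi Z \in S) -> (g1_span g gam xi Vm U <= S)%VS.
Proof. by move=> h; apply: (lspanP _).2 => _ [phi [Z [h1 h2 ->]]]; exact: h. Qed.

Lemma g1_span_in U phi Z : phi \in g1 -> Z \in U -> act phi Z \in g1_span g gam xi Vm U.
Proof. by move=> h1 h2; apply: (lspanP _).1; exists phi, Z. Qed.

Lemma tact_linr phi a X Y : act phi (a *: X + Y) = a *: act phi X + act phi Y.
Proof.
rewrite !tact_slots; apply/ffunP => b; rewrite !ffunE.
have -> : \sum_d (phi *m ginv g) b d *: (a *: X + Y) d =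
    a *: (\sum_d (phi *m ginv g) b d *: X d) + \sum_d (phi *m ginv g) b d *: Y d.
  rewrite scaler_sumr -big_split; apply: eq_bigr => d _.
  by rewrite !ffunE scalerDr !scalerA mulrC.
rewrite mulmxDr mulmxDl -!scalemxAl -!scalemxAr !scalerDr !addrA.
have shuffle (x1 y1 x2 y2 x3 y3 : 'M[F]_n) :
    x1 + y1 + x2 + y2 + x3 + y3 = x1 + x2 + x3 + y1 + y2 + y3.
  by apply/matrixP => i j; rewrite !mxE; ring.
exact: shuffle.
Qed.

Lemma stable_g1_span U : stable g g0 U -> stable g g0 (g1_span g gam xi Vm U).
Proof.
move=> stU psi X hpsi; have [h hf] := exists_hom (tact_linr psi).
suff /subvP sub : (g1_span g gam xi Vm U <= h @^-1: g1_span g gam xi Vm U)%VS.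
  by move=> /sub; rewrite -memv_preim hf.
apply: mem_g1_span => phi Z hphi ZU; rewrite -memv_preim hf tact_lie.
by rewrite memvD ?g1_span_in ?lie_g1 ?stU.
Qed.

Lemma g1_span_level p U : (U <= level p)%VS -> (g1_span g gam xi Vm U <= level p.+1)%VS.
Proof.
move=> UL; apply: mem_g1_span => phi Z hphi /(subvP UL)/mem_lev[Z1 Z2]; apply/mem_lev.
split; last exact: tact_raises.
by apply: (cotton_york_tact g_metric E_dual) => //; have [] := (mem_g1 g_metric E_dual _ _).1 hphi.
Qed.

(** A nonzero part [j] in the span of $g_1\cdot Z$ forces the whole copy of component [j] into it,
    since that span is $g_0$-stable. Conversely, if part [j] of every product vanished, it would
    vanish on the copy of component [j] itself. *)
Lemma generatesP p j k : is_component p.+1 j -> is_component p k ->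
  g1_generates g gam gam' xi Vm p.+1 j k <-> exists phi Z,
    [/\ phi \in g1, Z \in copy p k & ~ comp_vanish p.+1 j (act phi Z)].
Proof.
move=> pj pk; have [irrj isoj] := copy_spec pj; have [irrk isok] := copy_spec pk.
have copyL q i : (copy q i <= level q)%VS by exact: capvSr.
split=> [gen|[phi [Z [hphi ZC nz]]] S T SL TL irrS irrT isoS isoT].
  apply: contrapT => none; have [_ _ _ C0 _] := irrj; apply: C0.
  have sub := gen _ _ (copyL _ _) (copyL _ _) irrj irrk isoj isok.
  have vP X : X \in lspan (comp_vanish p.+1 j) <-> comp_vanish p.+1 j X.
    apply: mem_lspan; last exact: comp_vanish_lin.
    by case: (p) => [|[|q]] //=; rewrite mixed0; exact: comp_zero0.
  have subv : (g1_span g gam xi Vm (copy p k) <= lspan (comp_vanish p.+1 j))%VS.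
    apply: mem_g1_span => phi Z hphi ZC; apply/vP; apply: contrapT => nz.
    by apply: none; exists phi, Z.
  apply/eqP; rewrite -subv0; apply/subvP => X XC; rewrite memv0; apply/eqP.
  apply: contrapT => X0.
  (* A nonzero element of the copy of component [j] has a nonzero part [i]; it cannot be [j], by
     assumption, nor another index, by definition of the component. *)
  have [i pi nz] := exists_comp_nonzero (is_component_lt pj) (subvP (copyL _ _) _ XC) X0.
  have /vP vj := subvP subv _ (subvP sub _ XC).
  have ij : i <> j by move=> ij; apply: nz; rewrite ij.
  case: pj pi => -[s [e jj]] [] [s' [e' ii]]; last by apply: ij; rewrite ii jj.
  - move: XC nz; rewrite memv_cap => /andP[+ _]; rewrite e => /mem_comp[_ [_ h]].
    by rewrite comp_vanish_mixed => nz; apply/nz/h.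
  - by move: e'; rewrite e; case: (s); case: (s').
  by move: e'; rewrite e; case: (s); case: (s').
rewrite (copy_unique pj SL irrS isoS) (copy_unique pk TL irrT isoT).
have [stC _ _ _ _] := irrk.
apply: (sub_generates pj (X := act phi Z) _ _ _ nz).
- exact: stable_g1_span.
- exact/g1_span_level/copyL.
exact: g1_span_in.
Qed.

End Generation.

(** * The exceptional case [m = 3] and test tensors with few entries *)

Lemma ord3_cases (i : 'I_3) : [\/ i = ord0, i = lift ord0 ord0 | i = ord_max].
Proof.
by case: i => -[|[|[|i]]] // h; [constructor 1 | constructor 2 | constructor 3]; exact: val_inj.
Qed.

(** Conceptually a Schur argument: for sl(3) the lower component is $S^2W$ and $g_1\cong W^*$, and
    the 18-dimensional $W^*\otimes S^2W$ splits as 3 + 15 and so does not contain the 6-dimensional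
    $S^2W^*$. The proof verifies it entry by entry. *)
Lemma raised_dim3 (F : numFieldType) m (B C : {ffun 'I_m -> 'M[F]_m}) (phi : 'I_m -> 'I_m -> F) :
  m = 3%N -> (forall i l, phi i l = - phi l i) -> skew_traceless B ->
  (forall i l q, C i l q = - (\sum_p phi i p * B p q l) + \sum_p phi l p * (B q p i - B p q i)) ->
  comp_zero 1 C.
Proof.
move=> m3; subst m => as_phi [sk tB] hC.
set o1 : 'I_3 := lift ord0 ord0.
have sum3 (f : 'I_3 -> F) : \sum_p f p = f ord0 + f o1 + f ord_max.
  rewrite !big_ord_recl big_ord0 addr0 addrA; congr (_ + _ + f _).
  exact: val_inj.
have diag_phi i : phi i i = 0 by exact/self_oppr0/as_phi.
have diagB i k : B i i k = 0 by exact/self_oppr0/sk.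
have t0 := tB ord0; have t1 := tB o1; have t2 := tB ord_max.
rewrite !sum3 !diagB in t0 t1 t2.
have e0 : B ord0 ord_max ord_max = - B ord0 o1 o1.
  by apply/eqP; rewrite -addr_eq0 addrC -[X in _ == X]t0 add0r.
have e1 : B o1 ord_max ord_max = B ord0 o1 ord0.
  by apply/eqP; rewrite -subr_eq0 -[X in _ == X]t1 addr0 (sk o1 ord0) addrC.
have e2 : B o1 ord_max o1 = - B ord0 ord_max ord0.
  apply/eqP; rewrite -addr_eq0 -oppr_eq0 opprD -!sk addrC -[X in _ == X]t2 addr0.
  by [].
(* Rules that express the entries of [phi] and [B] through independent ones; each of the 27 choices
   of indices then becomes a field identity. *)
have N := (diag_phi, as_phi o1 ord0, as_phi ord_max ord0, as_phi ord_max o1,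
  (diagB, sk o1 ord0, sk ord_max ord0, sk ord_max o1, e0, e1, e2)).
have m2 : (3%:R : F) - 1 != 0 by rewrite subr_eq0 pnatr_eq1.
move=> i j l; rewrite /tr23 !sum3 !hC !sum3.
by case: (ord3_cases i) => ->; case: (ord3_cases j) => ->; case: (ord3_cases l) => ->;
  rewrite !N /=; field.
Qed.

Section Witnesses.
Variables (F : numFieldType) (m : nat).
Hypothesis m_gt2 : (2 < m)%N.
Local Notation model := {ffun 'I_m -> 'M[F]_m}.
Implicit Types B : model.

(** At indices where all deltas vanish the pure trace side is zero, so a single entry can refute
    [comp_zero]; the companion lemma does the same for the symmetric part. *)
Lemma comp_zero1_distinct p q r B : comp_zero 1 B -> r != q -> p != q -> B p r q = B r p q.
Proof.
by move=> h rq pq; apply/eqP; rewrite -subr_eq0 h (negPf rq) (negPf pq) !mul0r subrr mulr0.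
Qed.

Lemma comp_zero2_distinct p q B : comp_zero 2 B -> p != q -> B p p q = 0.
Proof.
move=> h pq; have /eqP := h p p q; rewrite (negPf pq) !mul0r addr0 mulr0 -mulr2n.
by rewrite mulrn_eq0 => /eqP.
Qed.

Lemma skew_unit a b c : a != c -> b != c -> skew_traceless (unit3 a b c - unit3 b a c : model).
Proof.
move=> /negPf ac /negPf bc; split=> [i j k|i]; first by rewrite !tensorE; ring.
rewrite -[LHS]/(tr23 _ i) addrC -scaleN1r tr23_lin !tr23_unit ac bc /=; ring.
Qed.

Lemma sym_unit a b c : a != c -> b != c -> sym_traceless (unit3 a b c + unit3 b a c : model).
Proof.
move=> /negPf ac /negPf bc; split=> [i j k|i]; first by rewrite !tensorE; ring.
rewrite -[LHS]/(tr23 _ i) -[unit3 a b c]scale1r tr23_lin !tr23_unit ac bc /=; ring.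
Qed.

Lemma skew_tr13 B : skew_traceless B -> forall i, tr13 B i = tr23 B i / 2.
Proof. by move=> h i; rewrite !(skew_traceless_tr _ h) mul0r. Qed.

Lemma sym_tr13 B : sym_traceless B -> forall i, tr13 B i = tr23 B i / 2.
Proof. by move=> h i; rewrite !(sym_traceless_tr _ h) mul0r. Qed.

Lemma three_distinct : exists a b c : 'I_m, [/\ a != b, a != c & b != c].
Proof.
have [h0 h1] : (0 < m)%N /\ (1 < m)%N by split; lia.
by exists (Ordinal h0), (Ordinal h1), (Ordinal m_gt2).
Qed.

Lemma four_distinct : m <> 3%N -> exists a b c d : 'I_m,
  [/\ a != b, a != c & b != c] /\ [/\ a != d, b != d & c != d].
Proof.
move=> m3; have [h0 h1] : (0 < m)%N /\ (1 < m)%N by split; lia.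
have h3 : (3 < m)%N by lia.
by exists (Ordinal h0), (Ordinal h1), (Ordinal m_gt2), (Ordinal h3).
Qed.

Lemma absurd_eq (c x : F) : x = 0 -> x = c -> c != 0 -> False.
Proof. by move=> -> <-; rewrite eqxx. Qed.

Lemma absurd_eq2 (c x y : F) : x = y -> x - y = c -> c != 0 -> False.
Proof. by move=> -> <-; rewrite subrr eqxx. Qed.

End Witnesses.

(** * The action of $g_1$ from one weight to the next: witnesses and obstructions *)

Section Raising.
Variables (F : numFieldType) (n sp sm m : nat).
Variable g : 'M[F]_n.
Variables (gam : 'I_n -> 'M[F]_(sp, sm)) (gam' : 'I_n -> 'M[F]_(sm, sp)).
Variables (xi : 'rV[F]_sp) (Vm : {vspace 'rV[F]_n}).
Hypothesis g_metric : nondegenerate_symmetric g.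
Hypothesis gam_clifford : clifford_relations g gam gam'.
Hypothesis xi_neq0 : xi != 0.
Variable E : bool -> 'I_m -> 'rV[F]_n.
Hypothesis E_dual : dual_basis g gam xi Vm E.
Hypothesis m_gt2 : (2 < m)%N.
Hypothesis n_def : n = m.*2.
Local Notation tensor := {ffun 'I_n -> 'M[F]_n}.
Local Notation model := {ffun 'I_m -> 'M[F]_m}.
Local Notation cf := (coord3 E).
Local Notation mixed := (mixed E).
Local Notation gl_sign := (gl_part E).
Local Notation A_ := (filtr g gam gam' xi).
Local Notation Aj_ := (CYcomp g gam gam' xi).
Local Notation g0 := (g_0 g gam xi Vm).
Local Notation g1 := (g_pm1 g gam xi Vm true).
Local Notation level := (CY_level g gam xi Vm).
Local Notation act := (tact g).
Implicit Types (phi psi : 'M[F]_n) (X Y Z : tensor) (S T U : {vspace tensor}) (B : model).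
Local Notation mem_lev := (mem_CY_level g_metric E_dual).
Local Notation mem_filtr_high := (filtr_high g_metric gam_clifford xi_neq0 E_dual m_gt2 n_def).
Local Notation mem_comp := (CYcomp_mixed g_metric gam_clifford xi_neq0 E_dual m_gt2 n_def).
Local Notation copy := (copy g gam gam' xi Vm).
Local Notation generates := (g1_generates g gam gam' xi Vm).
Local Notation cP := (coord2 E).

Lemma g1_row phi i (f : bool -> 'I_m -> F) : phi \in g1 ->
  (\sum_u \sum_l cP phi true (~~ u) i l * f u l = \sum_l cP phi true true i l * f false l) *
  (\sum_u \sum_l cP phi false (~~ u) i l * f u l = 0).
Proof.
move=> /(mem_g1 g_metric E_dual)[_ phi0]; split.
  rewrite (bigD1 false) //= [X in _ + X]big1 ?addr0 // => -[] // _.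
  by rewrite big1 // => l _; rewrite phi0 ?mul0r.
by rewrite big1 // => u _; rewrite big1 // => l _; rewrite phi0 ?mul0r.
Qed.

Lemma raise0 phi Z i j k : phi \in g1 -> mixed false (act phi Z) i j k =
  \sum_l cP phi true true k l * extremal E false Z i j l.
Proof.
move=> hphi; rewrite mixedE (cf_tact g_metric E_dual) !(g1_row _ _ hphi) !add0r.
by apply: eq_bigr => l _; rewrite extremalE.
Qed.

Lemma raise1 phi Z i j k (B := mixed false Z) : phi \in g1 -> cotton_york E Z ->
  mixed true (act phi Z) i j k = - (\sum_l cP phi true true i l * B l k j)
    + \sum_l cP phi true true j l * (B k l i - B l k i).
Proof.
move=> hphi hZ; rewrite mixedE (cf_tact g_metric E_dual) !(g1_row _ _ hphi) addr0 -sumrN.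
congr (_ + _); apply: eq_bigr => l _; last by rewrite (cf_first hZ false).
by rewrite (cf_mid hZ false) mulrN.
Qed.

Lemma raise2 phi Z i j k (C := mixed true Z) : phi \in g1 -> cotton_york E Z ->
  extremal E true (act phi Z) i j k = \sum_l cP phi true true i l * (C k j l - C j k l)
    - (\sum_l cP phi true true j l * C i k l) + \sum_l cP phi true true k l * C i j l.
Proof.
move=> hphi hZ; rewrite extremalE (cf_tact g_metric E_dual) !(g1_row _ _ hphi) -sumrN.
congr (_ + _ + _); apply: eq_bigr => l _; last by rewrite mixedE.
  by rewrite (cf_first hZ true).
by rewrite (cf_mid hZ true) mulrN.
Qed.

(** [phi] is the wedge product of [E true x] and [E true y]; all witnesses below use elements of
    this form. *)
Lemma g1_exists x y : exists2 phi, phi \in g1 & forall i (f : 'I_m -> F),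
  \sum_l cP phi true true i l * f l = (i == x)%:R * f y - (i == y)%:R * f x.
Proof.
have [phi hphi] := exists_mx E_dual (fun s t i j => if s && t then
  (i == x)%:R * (j == y)%:R - (i == y)%:R * (j == x)%:R else 0).
exists phi => [|i f].
  apply/(mem_g1 g_metric E_dual); split=> [|s t i j]; last first.
    by rewrite hphi; case: s; case: t.
  apply/(mem_so g_metric E_dual) => s t i j; rewrite !hphi [t && s]andbC.
  by case: ifP => _; [ring | rewrite oppr0].
under eq_bigr do rewrite hphi /= mulrBl -!mulrA.
by rewrite sumrB -!mulr_sumr !sum_delta.
Qed.

Lemma copy_mid (s : bool) k B : (forall i, tr13 B i = tr23 B i / 2) ->
  (forall k', k' <> k -> comp_zero k' B) -> exists2 Z, Z \in copy s.+1 k & mixed s Z = B.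
Proof.
move=> trB hB; have [Z [h1 h2 h3]] := lift_mixed E_dual s trB; exists Z => //.
rewrite memv_cap; apply/andP; split; last exact/mem_lev.
apply/mem_comp; split=> //; split; first exact: on_level_high.
by rewrite h3.
Qed.

Lemma copy_low B : hook B -> exists2 Z, Z \in copy 0 0 & extremal E false Z = B.
Proof.
move=> hB; have [Z [h1 h2 h3]] := lift_extremal E_dual false hB; exists Z => //.
rewrite memv_cap; apply/andP; split; [exact/(mem_CY g_metric E_dual) | exact/mem_lev].
Qed.

Lemma mem_copy_CY p k Z : Z \in copy p k -> cotton_york E Z.
Proof. by rewrite memv_cap => /andP[_ /mem_lev[]]. Qed.

Lemma mem_copy_mid (s : bool) k Z : Z \in copy s.+1 k ->
  forall k', k' <> k -> comp_zero k' (mixed s Z).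
Proof. by rewrite memv_cap => /andP[/mem_comp[_ []]]. Qed.

Lemma is_component_mid (s : bool) j : (j < 3)%N -> is_component s.+1 j.
Proof. by left; exists s. Qed.

Lemma is_component_ext (s : bool) : is_component (if s then 3%N else 0%N) 0.
Proof. by right; exists s. Qed.

Lemma generates1 j x y H : (j < 3)%N -> hook H ->
  (forall B, (forall i l k, B i l k = (k == x)%:R * H i l y - (k == y)%:R * H i l x) ->
    ~ comp_zero j B) -> generates 1 j 0.
Proof.
move=> j3 hH test; have [phi hphi rphi] := g1_exists x y; have [Z ZC hZ] := copy_low hH.
apply/(generatesP g_metric gam_clifford xi_neq0 E_dual m_gt2 n_def (is_component_mid false j3)
  (is_component_ext false)); exists phi, Z; split=> //.
by apply: test => i l k; rewrite raise0 // rphi hZ.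
Qed.

(** The formula of [raise1] specialised to the element of [g1_exists x y]. *)
Definition raised (B : model) x y i j k : F :=
  - ((i == x)%:R * B y k j - (i == y)%:R * B x k j)
  + ((j == x)%:R * (B k y i - B y k i) - (j == y)%:R * (B k x i - B x k i)).

Lemma generates2 j k x y B : (j < 3)%N -> (k < 3)%N -> (forall i, tr13 B i = tr23 B i / 2) ->
  (forall k', k' <> k -> comp_zero k' B) ->
  (forall C : model, (forall i l q, C i l q = raised B x y i l q) -> ~ comp_zero j C) ->
  generates 2 j k.
Proof.
move=> j3 k3 trB hB test; have [phi hphi rphi] := g1_exists x y.
have [Z ZC hZ] := copy_mid false trB hB.
apply/(generatesP g_metric gam_clifford xi_neq0 E_dual m_gt2 n_def (is_component_mid true j3)
  (is_component_mid false k3)); exists phi, Z; split=> //.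
by apply: test => i l q; rewrite raise1 ?rphi ?hZ //; exact: mem_copy_CY ZC.
Qed.

Lemma generates3 k x y p q r (C : model) : (k < 3)%N -> (forall i, tr13 C i = tr23 C i / 2) ->
  (forall k', k' <> k -> comp_zero k' C) ->
  (p == x)%:R * (C r q y - C q r y) - (p == y)%:R * (C r q x - C q r x)
    - ((q == x)%:R * C p r y - (q == y)%:R * C p r x)
    + ((r == x)%:R * C p q y - (r == y)%:R * C p q x) <> 0 ->
  generates 3 0 k.
Proof.
move=> k3 trC hC test; have [phi hphi rphi] := g1_exists x y.
have [Z ZC hZ] := copy_mid true trC hC.
apply/(generatesP g_metric gam_clifford xi_neq0 E_dual m_gt2 n_def (is_component_ext true)
  (is_component_mid true k3)); exists phi, Z; split=> //= z.
apply: test; have := raise2 p q r hphi (mem_copy_CY ZC).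
rewrite !rphi hZ z extremalE cf0 => ->; ring.
Qed.

Lemma tr23_raised (B C : model) x y i : (forall i j k, C i j k = raised B x y i j k) ->
  tr23 C i = - ((i == x)%:R * tr23 B y - (i == y)%:R * tr23 B x) + 2 * (B x y i - B y x i).
Proof.
move=> hC; rewrite {1}/tr23; under eq_bigr do rewrite hC.
rewrite big_split /= sumrN !sumrB -!mulr_sumr -!/(tr23 _ _) !sum_delta.
by ring.
Qed.

Lemma arrows1 j : (j < 3)%N -> generates 1 j 0.
Proof.
have [a [b [c [ab ac bc]]]] := three_distinct m_gt2.
have [ba ca cb] : [/\ b != a, c != a & c != b] by split; rewrite eq_sym.
have N := (negPf ab, negPf ac, negPf bc, negPf ba, negPf ca, negPf cb).
(* One hook tensor serves for all three targets; only the element of $g_1$ changes. *)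
have hH : hook (unit3 a a b - unit3 a b a : model).
  by split=> i l k; rewrite !tensorE; ring.
case: j => [|[|[|j]]] // _.
- apply: (generates1 (x := a) (y := b) _ hH) => // B hB /(_ a).
  rewrite /tr23; under eq_bigr do rewrite hB.
  rewrite sumrB !sum_delta !tensorE ?eqxx ?N => /absurd_eq; apply; last exact: (natr_neq0 F 1).
  by rewrite /=; ring.
- apply: (generates1 (x := c) (y := a) _ hH) => // B hB h1.
  have := comp_zero1_distinct h1 bc ac; rewrite !hB !tensorE ?eqxx ?N.
  move=> /absurd_eq2-/(_ (-1)); apply; last by rewrite oppr_eq0 oner_neq0.
  by rewrite /=; ring.
apply: (generates1 (x := c) (y := b) _ hH) => // B hB h1.
have := comp_zero2_distinct h1 ac; rewrite !hB !tensorE ?eqxx ?N.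
move/absurd_eq; apply; last exact: (oner_neq0 F).
by rewrite /=; ring.
Qed.

Lemma arrow200 : generates 2 0 0.
Proof.
have [a [b [c [ab ac bc]]]] := three_distinct m_gt2.
have N := (negPf ab, eq_sym b a).
pose t i : F := (i == b)%:R.
apply: (generates2 (x := a) (y := b) _ _ (tr13_pure t) (@pure_comp_zero F m m_gt2 t)) => //.
move=> C hC /(_ a); rewrite (tr23_raised _ hC) !tr23_pure !pure_traceE /t ?N ?eqxx ?N.
(* The trace at [a] collects $-2(m^2-1)$ from the trace of [B] and $-2(m+1)$ from the two remaining
   entries. *)
move=> /absurd_eq-/(_ (- 2 * m%:R * (m%:R + 1))); apply; first by rewrite /=; ring.
by rewrite !mulf_eq0 oppr_eq0 pnatr_eq0 (negPf (m_neq0 F m_gt2)) (negPf (m_add1_neq0 F m)).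
Qed.

Lemma arrow210 : generates 2 1 0.
Proof.
have [a [b [c [ab ac bc]]]] := three_distinct m_gt2.
have [ba ca cb] : [/\ b != a, c != a & c != b] by split; rewrite eq_sym.
have N := (negPf ab, negPf ac, negPf bc, negPf ba, negPf ca, negPf cb).
pose t i : F := (i == b)%:R.
apply: (generates2 (x := a) (y := c) _ _ (tr13_pure t) (@pure_comp_zero F m m_gt2 t)) => //.
move=> C hC h1; have := comp_zero1_distinct h1 cb ab.
rewrite !hC /raised !pure_traceE /t ?eqxx ?N.
move=> /absurd_eq2-/(_ (- 2 * (2 * m%:R - 1))); apply; first by rewrite /=; ring.
rewrite mulf_eq0 oppr_eq0 pnatr_eq0 /= subr_eq0 -natrM pnatr_eq1.
by move: m_gt2; case: m => [|[|q]].
Qed.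

(** The test needs four distinct indices, two for the element of $g_1$ and two more in play; for
    three the statement is false, see [no_arrow211]. *)
Lemma arrow211 : m <> 3%N -> generates 2 1 1.
Proof.
move=> m3; have [p [q [y [r [[pq py qy] [pr qr yr]]]]]] := four_distinct m_gt2 m3.
have [qp yp yq] : [/\ q != p, y != p & y != q] by split; rewrite eq_sym.
have [rp rq ry] : [/\ r != p, r != q & r != y] by split; rewrite eq_sym.
have N := (negPf pq, negPf py, negPf qy, negPf pr, negPf qr, negPf yr,
  (negPf qp, negPf yp, negPf yq, negPf rp, negPf rq, negPf ry)).
have hB := skew_unit F qr yr.
apply: (generates2 (x := p) (y := y) _ _ (skew_tr13 hB) (fun k => skew_comp_zero hB (k := k))) => //.
move=> C hC h1; have := comp_zero1_distinct h1 rq pq.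
rewrite !hC /raised !tensorE ?eqxx ?N.
move=> /absurd_eq2-/(_ (-1)); apply; last by rewrite oppr_eq0 oner_neq0.
by rewrite /=; ring.
Qed.

Lemma arrow201 : generates 2 0 1.
Proof.
have [a [b [c [ab ac bc]]]] := three_distinct m_gt2.
have [ba ca cb] : [/\ b != a, c != a & c != b] by split; rewrite eq_sym.
have N := (negPf ab, negPf ac, negPf bc, negPf ba, negPf ca, negPf cb).
have hB := skew_unit F ac bc.
apply: (generates2 (x := a) (y := b) _ _ (skew_tr13 hB) (fun k => skew_comp_zero hB (k := k))) => //.
move=> C hC /(_ c); rewrite (tr23_raised _ hC) !(skew_traceless_tr _ hB) !tensorE ?eqxx ?N.
by move=> /absurd_eq; apply; last exact: (natr_neq0 F 3); rewrite /=; ring.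
Qed.

Lemma arrow221 : generates 2 2 1.
Proof.
have [a [b [c [ab ac bc]]]] := three_distinct m_gt2.
have [ba ca cb] : [/\ b != a, c != a & c != b] by split; rewrite eq_sym.
have N := (negPf ab, negPf ac, negPf bc, negPf ba, negPf ca, negPf cb).
have hB := skew_unit F ba ca.
apply: (generates2 (x := a) (y := b) _ _ (skew_tr13 hB) (fun k => skew_comp_zero hB (k := k))) => //.
move=> C hC h2; have := comp_zero2_distinct h2 ac.
rewrite !hC /raised !tensorE ?eqxx ?N => /absurd_eq-/(_ (-3)); apply.
  by rewrite /=; ring.
by rewrite oppr_eq0 (natr_neq0 F 2).
Qed.

Lemma arrow212 : generates 2 1 2.
Proof.
have [a [b [c [ab ac bc]]]] := three_distinct m_gt2.
have [ba ca cb] : [/\ b != a, c != a & c != b] by split; rewrite eq_sym.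
have N := (negPf ab, negPf ac, negPf bc, negPf ba, negPf ca, negPf cb).
have hB := sym_unit F bc bc.
apply: (generates2 (x := a) (y := b) _ _ (sym_tr13 hB) (fun k => sym_comp_zero hB (k := k))) => //.
move=> C hC h1; have := comp_zero1_distinct h1 cb ab.
rewrite !hC /raised !tensorE ?eqxx ?N => /absurd_eq2-/(_ (-2)); apply.
  by rewrite /=; ring.
by rewrite oppr_eq0 (natr_neq0 F 1).
Qed.

Lemma arrow222 : generates 2 2 2.
Proof.
have [a [b [c [ab ac bc]]]] := three_distinct m_gt2.
have [ba ca cb] : [/\ b != a, c != a & c != b] by split; rewrite eq_sym.
have N := (negPf ab, negPf ac, negPf bc, negPf ba, negPf ca, negPf cb).
have hB := sym_unit F ba ba.
apply: (generates2 (x := a) (y := b) _ _ (sym_tr13 hB) (fun k => sym_comp_zero hB (k := k))) => //.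
move=> C hC h2; have := comp_zero2_distinct h2 ab.
rewrite !hC /raised !tensorE ?eqxx ?N => /absurd_eq-/(_ (-2)); apply.
  by rewrite /=; ring.
by rewrite oppr_eq0 (natr_neq0 F 1).
Qed.

Lemma arrows3 k : (k < 3)%N -> generates 3 0 k.
Proof.
have [a [b [c [ab ac bc]]]] := three_distinct m_gt2.
have [ba ca cb] : [/\ b != a, c != a & c != b] by split; rewrite eq_sym.
have N := (negPf ab, negPf ac, negPf bc, negPf ba, negPf ca, negPf cb).
case: k => [|[|[|k]]] // _.
- pose t i : F := (i == a)%:R.
  apply: (generates3 (x := a) (y := b) (p := a) (q := b) (r := a) _ (tr13_pure t)
    (@pure_comp_zero F m m_gt2 t)) => //.
  rewrite !pure_traceE /t ?eqxx ?N => /absurd_eq-/(_ (3 * (2 * m%:R - 1))); apply.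
    by rewrite /=; ring.
  rewrite mulf_eq0 pnatr_eq0 /= subr_eq0 -natrM pnatr_eq1.
  by move: m_gt2; case: m => [|[|q]].
- have hB := skew_unit F ac bc.
  apply: (generates3 (x := a) (y := c) (p := a) (q := b) (r := a) _ (skew_tr13 hB)
    (fun k => skew_comp_zero hB (k := k))) => //.
  rewrite !tensorE ?eqxx ?N => /absurd_eq-/(_ 3); apply; last exact: (natr_neq0 F 2).
  by rewrite /=; ring.
have hB := sym_unit F ac bc.
apply: (generates3 (x := a) (y := c) (p := a) (q := b) (r := a) _ (sym_tr13 hB)
  (fun k => sym_comp_zero hB (k := k))) => //.
rewrite !tensorE ?eqxx ?N => /absurd_eq-/(_ 1); apply; last exact: (oner_neq0 F).
by rewrite /=; ring.
Qed.

Lemma not_generates2 j k : (j < 3)%N -> (k < 3)%N ->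
  (forall (C B : model) (phi : 'I_m -> 'I_m -> F), (forall i l, phi i l = - phi l i) ->
     (forall i, tr13 B i = tr23 B i / 2) -> (forall k', k' <> k -> comp_zero k' B) ->
     (forall i l q, C i l q = - (\sum_p phi i p * B p q l)
        + \sum_p phi l p * (B q p i - B p q i)) -> comp_zero j C) ->
  ~ generates 2 j k.
Proof.
move=> j3 k3 h /(generatesP g_metric gam_clifford xi_neq0 E_dual m_gt2 n_def
  (is_component_mid true j3) (is_component_mid false k3))[phi [Z [hphi ZC nz]]].
have hZ := mem_copy_CY ZC; apply: nz; apply: (h _ (mixed false Z) (cP phi true true)).
- by move=> i l; have [/(mem_so g_metric E_dual) as_phi _] := (mem_g1 g_metric E_dual true phi).1 hphi.
- by move=> i; exact: tr13_mixed.
- exact: (mem_copy_mid (s := false)) ZC.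
by move=> i l q; rewrite raise1.
Qed.

(** For symmetric B the second sum of the raising formula vanishes, and the trace of the first one
    is a trace of B, which is zero. *)
Lemma no_arrow202 : ~ generates 2 0 2.
Proof.
apply: not_generates2 => // C B phi as_phi _ hB hC i.
have [b0 b1] : comp_zero 0 B /\ comp_zero 1 B by split; exact: hB.
have [s_B t0] := comp_zero_sym b0 b1.
rewrite /tr23; under eq_bigr do rewrite hC.
rewrite big_split /= sumrN [X in - X + _](_ : _ = 0) ?oppr0 ?add0r; last first.
  by rewrite exchange_big big1 // => p _; rewrite -mulr_sumr t0 mulr0.
by rewrite big1 // => j _; rewrite big1 // => p _; rewrite s_B subrr mulr0.
Qed.

Lemma no_arrow220 : ~ generates 2 2 0.
Proof.
apply: not_generates2 => // C B phi as_phi _ hB hC.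
have [b1 b2] : comp_zero 1 B /\ comp_zero 2 B by split; exact: hB.
have [t Bt] : exists t, B = pure_trace t by eexists; exact: (comp_zero_pure m_gt2 b1 b2).
have n2 := m_add1_neq0 F m.
pose u i := \sum_p phi i p * t p.
have s1 i q : \sum_p phi i p * (q == p)%:R = phi i q.
  by under eq_bigr do rewrite mulrC; rewrite sum_delta_sym.
have s1' i q : \sum_p phi i p * (p == q)%:R = phi i q.
  by under eq_bigr do rewrite mulrC; rewrite sum_delta.
(* Symmetrising in [i] and [j] removes the term with [phi i j] and leaves deltas with coefficient
   [-3m], which is exactly the pure trace prescribed by [tr]. *)
have CE i j k : C i j k = - (2 * m%:R - 1) * (phi i j * t k)
    - (2 * m%:R - 1) * ((j == k)%:R * u i) - (m%:R + 1) * ((i == k)%:R * u j).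
  transitivity (- \sum_p ((m%:R - 2) * t k * (phi i p * (p == j)%:R)
      + (2 * m%:R - 1) * (j == k)%:R * (phi i p * t p))
    + \sum_p ((2 * m%:R - 1 - (m%:R - 2)) * t k * (phi j p * (p == i)%:R)
      - (m%:R + 1) * (i == k)%:R * (phi j p * t p))).
    rewrite hC Bt; congr (- _ + _); apply: eq_bigr => p _; rewrite !pure_traceE.
      by rewrite (eq_sym k j); ring.
    by rewrite (eq_sym k i); ring.
  rewrite big_split sumrB -!mulr_sumr !s1' (as_phi j i) /u /=; ring.
have tr i : tr23 C i = - 2 * m%:R * (m%:R + 1) * u i.
  rewrite /tr23; under eq_bigr do rewrite CE eqxx mul1r.
  by rewrite !sumrB -!mulr_sumr -/(u i) sum_delta_sym sum_const; ring.
by move=> i j k; rewrite !CE !tr (as_phi j i); field.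
Qed.

Lemma no_arrow211 : m = 3%N -> ~ generates 2 1 1.
Proof.
move=> m3; apply: not_generates2 => // C B phi as_phi _ hB hC.
have [b0 b2] : comp_zero 0 B /\ comp_zero 2 B by split; exact: hB.
exact: raised_dim3 m3 as_phi (comp_zero_skew b0 b2) hC.
Qed.

End Raising.

(** * Kernel inclusions and their agreement with the arrows *)

Section Graph.
Variables (F : numFieldType) (n sp sm m : nat).
Variable g : 'M[F]_n.
Variables (gam : 'I_n -> 'M[F]_(sp, sm)) (gam' : 'I_n -> 'M[F]_(sm, sp)).
Variables (xi : 'rV[F]_sp) (Vm : {vspace 'rV[F]_n}).
Hypothesis g_metric : nondegenerate_symmetric g.
Hypothesis gam_clifford : clifford_relations g gam gam'.
Hypothesis xi_neq0 : xi != 0.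
Variable E : bool -> 'I_m -> 'rV[F]_n.
Hypothesis E_dual : dual_basis g gam xi Vm E.
Hypothesis m_gt2 : (2 < m)%N.
Hypothesis n_def : n = m.*2.
Local Notation tensor := {ffun 'I_n -> 'M[F]_n}.
Local Notation model := {ffun 'I_m -> 'M[F]_m}.
Local Notation cf := (coord3 E).
Local Notation mixed := (mixed E).
Local Notation gl_sign := (gl_part E).
Local Notation A_ := (filtr g gam gam' xi).
Local Notation Aj_ := (CYcomp g gam gam' xi).
Local Notation g0 := (g_0 g gam xi Vm).
Local Notation g1 := (g_pm1 g gam xi Vm true).
Local Notation level := (CY_level g gam xi Vm).
Local Notation act := (tact g).
Implicit Types (phi psi : 'M[F]_n) (X Y Z : tensor) (S T U : {vspace tensor}) (B : model).
Local Notation mem_lev := (mem_CY_level g_metric E_dual).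
Local Notation mem_filtr_high := (filtr_high g_metric gam_clifford xi_neq0 E_dual m_gt2 n_def).
Local Notation mem_comp := (CYcomp_mixed g_metric gam_clifford xi_neq0 E_dual m_gt2 n_def).
Local Notation copy := (copy g gam gam' xi Vm).
Local Notation generates := (g1_generates g gam gam' xi Vm).
Local Notation vanishes := (Pi_vanishes g gam gam' xi).
Local Notation ker_ := (kerPi g gam gam' xi).

Lemma kerS p j q k : (forall X, cotton_york E X -> vanishes p j X -> vanishes q k X) ->
  (ker_ p j <= ker_ q k)%VS.
Proof.
move=> h; apply: (lspanP _).2 => X [XCY v]; apply: (lspanP _).1; split=> //.
by apply: h => //; exact/(mem_CY g_metric E_dual).
Qed.

Lemma vanishes1 k X : (k < 3)%N -> cotton_york E X -> vanishes 1 k X <->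
  (forall i j l, cf X false false false i j l = 0) /\ comp_zero k (mixed false X).
Proof.
case: k => [|[|[|k]]] // _ hX.
- exact: (vanishes10 g_metric gam_clifford xi_neq0 E_dual hX).
- exact: (vanishes11 g_metric gam_clifford E_dual m_gt2 n_def hX).
exact: (vanishes12 g_metric gam_clifford E_dual m_gt2 n_def hX).
Qed.

Lemma ker1P k X : (k < 3)%N -> X \in ker_ 1 k -> comp_zero k (mixed false X).
Proof.
move=> k3; pose Q X := (forall i j l, cf X false false false i j l = 0) /\
  comp_zero k (mixed false X).
suff -> : X \in ker_ 1 k <-> X \in CY g /\ Q X by case=> _ [].
apply: lspan_CY => [Y||a Y Z [y1 y2] [z1 z2]].
- by split=> -[h1 h2]; split=> //; apply/(vanishes1 k3) => //; exact/(mem_CY g_metric E_dual).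
- by split=> [i j l|]; [exact: cf0 | rewrite mixed0; exact: comp_zero0].
split=> [i j l|]; first by rewrite cf_lin y1 z1 mulr0 addr0.
by rewrite mixed_lin; exact: comp_zero_lin.
Qed.

(** Non-inclusion is witnessed by a tensor concentrated in weight -1/2 with leading block [B]:
    killed by the upper map but not by the lower one. *)
Lemma ker_not_sub j k B : (k < 3)%N -> (forall i, tr13 B i = tr23 B i / 2) ->
  (forall X, cotton_york E X -> (forall i j l, cf X false false false i j l = 0) ->
     mixed true X = 0 -> mixed false X = B -> vanishes 2 j X) ->
  ~ comp_zero k B -> ~ (ker_ 2 j <= ker_ 1 k)%VS.
Proof.
move=> k3 trB v nz /subvP sub; have [X [h1 h2 h3]] := lift_mixed E_dual false trB.
apply: nz; rewrite -h3; apply: (ker1P k3); apply: sub; apply: (lspanP _).1.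
split; first exact/(mem_CY g_metric E_dual).
apply: v => // [i l q|]; first exact: h2.
by apply: tensorP => i l q; rewrite mixedE tensor0 h2.
Qed.

Lemma ker_20_sub k : (k < 2)%N -> (ker_ 2 0 <= ker_ 1 k)%VS.
Proof.
move=> k2; apply: kerS => X hX /(vanishes20 g_metric gam_clifford xi_neq0 E_dual hX)[z c0 sB _].
apply/(vanishes1 (ltnW k2 : k < 3)%N hX); split=> //.
case: k k2 => [|[|k]] // _ i j l.
by rewrite sB subrr !c0 !mulr0 subrr mulr0.
Qed.

Lemma ker_21_sub k : (k < 3)%N -> (k = 1%N -> m <> 3%N) -> (ker_ 2 1 <= ker_ 1 k)%VS.
Proof.
move=> k3 m3; apply: kerS => X hX.
move=> /(vanishes21_level1 g_metric gam_clifford E_dual m_gt2 n_def hX)[z c0 c2 c1].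
by apply/(vanishes1 k3 hX); split=> //; case: k k3 m3 => [|[|[|k]]] // _ m3; exact/c1/m3.
Qed.

Lemma ker_22_sub k : (0 < k < 3)%N -> (ker_ 2 2 <= ker_ 1 k)%VS.
Proof.
move=> /andP[k0 k3]; apply: kerS => X hX.
move=> /(vanishes22_level1 g_metric gam_clifford E_dual m_gt2 n_def hX)[z c1 c2].
by apply/(vanishes1 k3 hX); split=> //; case: k k0 k3 => [|[|[|k]]].
Qed.

Lemma ker_20_nsub : ~ (ker_ 2 0 <= ker_ 1 2)%VS.
Proof.
have [a [b [c [ab ac bc]]]] := three_distinct m_gt2.
have hB := sym_unit F ab ab.
apply: (ker_not_sub (B := unit3 a a b + unit3 a a b)) => // [|X hX z z1 hXB|h].
- exact: sym_tr13.
- apply/(vanishes20 g_metric gam_clifford xi_neq0 E_dual hX); rewrite z1 hXB; split=> //.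
  + exact: (sym_comp_zero hB).
  + exact: hB.1.
  exact: comp_zero0.
have := comp_zero2_distinct h ab; rewrite !tensorE !eqxx => /absurd_eq; apply.
  2: exact: (natr_neq0 F 1).
by rewrite /=; ring.
Qed.

Lemma ker_22_nsub : ~ (ker_ 2 2 <= ker_ 1 0)%VS.
Proof.
have [a [b [c [ab ac bc]]]] := three_distinct m_gt2.
pose t i : F := (i == a)%:R.
apply: (ker_not_sub (B := pure_trace t)) => // [|X hX z z1 hXB|/(_ a)].
- exact: tr13_pure.
- apply: (vanishes22_trace g_metric gam_clifford E_dual n_def hX (t := t)) => // i j k.
  by rewrite hXB pure_traceE.
rewrite tr23_pure /t eqxx => /eqP; rewrite !mulf_eq0 pnatr_eq0 (negPf (m_sub1_neq0 F m_gt2)).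
by rewrite (negPf (m_add1_neq0 F m)) oner_eq0.
Qed.

Lemma ker_21_nsub : m = 3%N -> ~ (ker_ 2 1 <= ker_ 1 1)%VS.
Proof.
move=> m3; have [a [b [c [ab ac bc]]]] := three_distinct m_gt2.
have hB := skew_unit F ac bc.
apply: (ker_not_sub (B := unit3 a b c - unit3 b a c)) => // [|X hX z z1 hXB|h].
- exact: skew_tr13.
- exact: (vanishes21_dim3 g_metric gam_clifford E_dual m_gt2 n_def hX m3 ab ac bc).
have := h a b c; rewrite !(skew_traceless_tr _ hB) !tensorE !eqxx (negPf ab) eq_sym (negPf ab).
move=> /absurd_eq2-/(_ 2); apply; last exact: (natr_neq0 F 1).
by rewrite /=; ring.
Qed.

Local Notation a1 := (arrows1 g_metric gam_clifford xi_neq0 E_dual m_gt2 n_def).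
Local Notation a3 := (arrows3 g_metric gam_clifford xi_neq0 E_dual m_gt2 n_def).
Local Notation a200 := (arrow200 g_metric gam_clifford xi_neq0 E_dual m_gt2 n_def).
Local Notation a201 := (arrow201 g_metric gam_clifford xi_neq0 E_dual m_gt2 n_def).
Local Notation a210 := (arrow210 g_metric gam_clifford xi_neq0 E_dual m_gt2 n_def).
Local Notation a211 := (arrow211 g_metric gam_clifford xi_neq0 E_dual m_gt2 n_def).
Local Notation a212 := (arrow212 g_metric gam_clifford xi_neq0 E_dual m_gt2 n_def).
Local Notation a221 := (arrow221 g_metric gam_clifford xi_neq0 E_dual m_gt2 n_def).
Local Notation a222 := (arrow222 g_metric gam_clifford xi_neq0 E_dual m_gt2 n_def).
Local Notation n202 := (no_arrow202 g_metric gam_clifford xi_neq0 E_dual m_gt2 n_def).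
Local Notation n211 := (no_arrow211 g_metric gam_clifford xi_neq0 E_dual m_gt2 n_def).
Local Notation n220 := (no_arrow220 g_metric gam_clifford xi_neq0 E_dual m_gt2 n_def).

Lemma arrows_hold p j k : (p, j, k) \in arrows -> generates p j k.
Proof.
rewrite !inE !xpair_eqE.
do 11!(case/orP; first by move=> /andP[/andP[/eqP-> /eqP->] /eqP->];
  first [exact: a3 | exact: a222 | exact: a221 | exact: a212 | exact: a210 | exact: a200
        | exact: a201 | exact: a1]).
by move=> /andP[/andP[/eqP-> /eqP->] /eqP->]; exact: a1.
Qed.

(** Both sides are settled separately for each pair of maps and found to agree; from weight -1/2 to
    -3/2 both always hold. *)
Lemma kernels_generate p j k : (p.+1, j) \in Pi_index -> (p, k) \in Pi_index ->
  generates p.+1 j k <-> (ker_ p.+1 j <= ker_ p k)%VS.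
Proof.
have low j' : (j' < 3)%N -> (ker_ 1 j' <= ker_ 0 0)%VS.
  move=> j3; apply: kerS => X hX /(vanishes1 j3 hX)[z _].
  exact/(vanishes00 gam' g_metric E_dual).
have both (P Q : Prop) : P -> Q -> (P <-> Q) by [].
have none (P Q : Prop) : ~ P -> ~ Q -> (P <-> Q) by [].
case: p => [|[|p]]; last by rewrite !inE /= !xpair_eqE.
  rewrite !inE !xpair_eqE /= ?orbF => hj /eqP ->.
  have j3 : (j < 3)%N by case: j hj => [|[|[|j]]].
  by apply: both; [exact: a1 | exact: low].
rewrite !inE !xpair_eqE /= => hj hk.
have : (k < 3)%N by case: k hk => [|[|[|k]]].
have : (j < 3)%N by case: j hj => [|[|[|j]]].
case: j {hj} => [|[|[|j]]] // _; case: k {hk} => [|[|[|k]]] // _.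
- by apply: both; [exact: a200 | exact: ker_20_sub].
- by apply: both; [exact: a201 | exact: ker_20_sub].
- by apply: none; [exact: n202 | exact: ker_20_nsub].
- by apply: both; [exact: a210 | exact: ker_21_sub].
(* The pair (1, 1), which is not in [arrows]: generation and inclusion fail together for [m = 3] and
   hold together otherwise. *)
- have [m3|m3] := pselect (m = 3%N).
    by apply: none; [exact: n211 | exact: ker_21_nsub].
  by apply: both; [exact: a211 | exact: ker_21_sub].
- by apply: both; [exact: a212 | exact: ker_21_sub].
- by apply: none; [exact: n220 | exact: ker_22_nsub].
- by apply: both; [exact: a221 | exact: ker_22_sub].
by apply: both; [exact: a222 | exact: ker_22_sub].
Qed.

End Graph.

(** * The complex case, by choosing a frame adapted to [xi] and [Vm] *)

Theorem proposition4p2 (R : realType) (m : nat) (m_gt2 : (2 < m)%N)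
    (g : 'M[R[i]]_(m.*2)) (g_metric : nondegenerate_symmetric g)
    (gam : 'I_(m.*2) -> 'M[R[i]]_(2 ^ m.-1, 2 ^ m.-1))
    (gam' : 'I_(m.*2) -> 'M[R[i]]_(2 ^ m.-1, 2 ^ m.-1))
    (gam_clifford : clifford_relations g gam gam')
    (xi : 'rV[R[i]]_(2 ^ m.-1)) (xi_pure : pure_spinor gam xi m)
    (Vm : {vspace 'rV[R[i]]_(m.*2)}) (Vm_compl : null_complement g gam xi Vm) :
  let A_ := filtr g gam gam' xi in
  let A_j := CYcomp g gam gam' xi in
  let V_ := Vhalf gam xi Vm in
  let g1_ := g_pm1 g gam xi Vm in
  let is_ := comp_is g gam gam' xi Vm in
  let dim_ := dim_comp g gam gam' xi in
  let generates := g1_generates g gam gam' xi Vm in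
  let ker_ := kerPi g gam gam' xi in
  (* filtration by p-modules *)
  [/\ A_ 0%N = CY g /\ A_ 4%N = 0%VS,
      forall p, (p < 4)%N -> (A_ p.+1 <= A_ p)%VS
    & forall p, (p <= 4)%N -> stable g (p_alg g gam xi) (A_ p)] /\
  (* splitting of gr_{-1/2} and gr_{1/2} *)
  (forall p, p = 1%N \/ p = 2%N ->
     direct_sum_quot (A_ p) (A_ p.+1) (fun j : 'I_3 => A_j p j)) /\
  (* irreducible components: upper signs for s = true, lower for s = false *)
  (forall s : bool,
     let p32 := if s then 3%N else 0%N in
     let p12 := if s then 2%N else 1%N in
     [/\ is_ p32 0%N (V_ s) (g1_ s)
           /\ (3 * dim_ p32 0 = m * (m ^ 2 - 1))%N,
         is_ p12 0%N (V_ s) (z_0 g gam xi Vm)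
           /\ dim_ p12 0%N = m,
         is_ p12 1%N (V_ (~~ s)) (g1_ s)
           /\ (2 * dim_ p12 1 = m * (m - 2) * (m + 1))%N
       & is_ p12 2%N (V_ s) (sl_0 g gam xi Vm)
           /\ (2 * dim_ p12 2 = m * (m + 2) * (m - 1))%N]) /\
  (* the directed graph *)
  (forall p j k, (p, j, k) \in arrows -> generates p j k) /\
  (forall p j k, (p.+1, j) \in Pi_index -> (p, k) \in Pi_index ->
     (generates p.+1 j k <-> (ker_ p.+1 j <= ker_ p k)%VS)).
Proof.
have m0 : (0 < m)%N by apply: ltn_trans m_gt2.
have [xi0 _] := xi_pure.
have [E E_dual] := dual_basis_exists g_metric gam_clifford (erefl (m.*2)) xi_pure Vm_compl.
split; [split|split; [|split; [|split]]].
- by [].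
- by move=> p; exact: (filtrS g_metric gam_clifford xi0 E_dual m_gt2 (erefl _)).
- by move=> p; exact: (stable_filtr g_metric gam_clifford xi0 E_dual m_gt2 (erefl _)).
- move=> p [->|->].
    exact: (direct_sum_components g_metric gam_clifford xi0 E_dual m_gt2 (erefl _) false).
  exact: (direct_sum_components g_metric gam_clifford xi0 E_dual m_gt2 (erefl _) true).
- move=> s; exact: (components_hold g_metric gam_clifford xi0 E_dual m_gt2 (erefl _) s).
- by move=> p j k; exact: (arrows_hold g_metric gam_clifford xi0 E_dual m_gt2 (erefl _)).
by move=> p j k; exact: (kernels_generate g_metric gam_clifford xi0 E_dual m_gt2 (erefl _)).
Qed.
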